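(* Let $\tfrac12\le\theta<1$. (Products) Let $\Gamma_1,\Gamma_2\subset T^*\mathbb{R}^d\setminus\{0\}$ be closed cones and $$\Gamma_3=\{(x,\xi+\eta)\,:\,(x,\xi)\in\Gamma_1\text{ and }(x,\eta)\in\Gamma_2\}\cup\Gamma_1\cup\Gamma_2.$$ Assume $0\notin\Gamma_3$, i.e. $(0,\xi)\in\Gamma_1\Rightarrow(0,-\xi)\notin\Gamma_2$. Then the product $u\cdot v$ of any $u\in\mathcal{S}'_{\theta,\Gamma_1}(\mathbb{R}^d)$ and $v\in\mathcal{S}'_{\theta,\Gamma_2}(\mathbb{R}^d)$ is well-defined, $\mathrm{WF}^\theta_{\mathrm{gl}}(u\cdot v)\subset\Gamma_3$, and the product is a continuous mapping $\mathcal{S}'_{\theta,\Gamma_1}(\mathbb{R}^d)\times\mathcal{S}'_{\theta,\Gamma_2}(\mathbb{R}^d)\to\mathcal{S}'_{\theta,\Gamma_3}(\mathbb{R}^d)$. (Convolutions) Let $u,v\in\mathcal{S}'_\theta(\mathbb{R}^d)$ satisfy $(\xi,0)\in\mathrm{WF}^\theta_{\mathrm{gl}}(u)\Rightarrow(-\xi,0)\notin\mathrm{WF}^\theta_{\mathrm{gl}}(v)$. Then the convolution $u*v$ is well-defined and $$\mathrm{WF}^\theta_{\mathrm{gl}}(u*v)\subset\{(x+y,\xi)\,:\,(x,\xi)\in\mathrm{WF}^\theta_{\mathrm{gl}}(u)\cup\{0\},\ (y,\xi)\in\mathrm{WF}^\theta_{\mathrm{gl}}(v)\cup\{0\}\}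.$$
   Context: $\mathcal{S}_\theta(\mathbb{R}^d)$ is the union over $C>0$ of the Banach spaces of all $f\in C^\infty(\mathbb{R}^d)$ with $\sup_{\alpha,\beta\in\mathbb{N}^d}\sup_{x} C^{-|\alpha|-|\beta|}(\alpha!\,\beta!)^{-\theta}|x^\alpha\partial^\beta f(x)|<\infty$, with the inductive limit topology. $\mathcal{S}_\theta'(\mathbb{R}^d)$ is its topological dual with the weak topology; $\langle\cdot,\cdot\rangle$ is the bilinear duality pairing. $T^*\mathbb{R}^d$ is identified with $\mathbb{R}^{2d}$; a subset of $\mathbb{R}^{2d}\setminus\{0\}$ is conic (a cone) if it is invariant under multiplication of all $2d$ coordinates by positive reals; closed means closed in $\mathbb{R}^{2d}\setminus\{0\}$. Global wave front set: for $u\in\mathcal{S}_\theta'(\mathbb{R}^d)$, a point $(x_0,\xi_0)\in\mathbb{R}^{2d}\setminus\{0\}$ is not in $\mathrm{WF}^\theta_{\mathrm{gl}}(u)$ iff there are an open conic neighbourhood $\Gamma'$ of $(x_0,\xi_0)$ and $C,\varepsilon>0$ with $|\langle u_y, e^{-i\langle y,\xi\rangle-\frac12|y-x|^2}\rangle|\le C e^{-\varepsilon(|x|^{1/\theta}+|\xi|^{1/\theta})}$ for all $(x,\xi)\in\Gamma'$. For a closed cone $\Gamma\subset\mathbb{R}^{2d}\setminus\{0\}$, $\mathcal{S}'_{\theta,\Gamma}(\mathbb{R}^d)=\{u\in\mathcal{S}'_\theta(\mathbb{R}^d):\mathrm{WF}^\theta_{\mathrm{gl}}(u)\subset\Gamma\}$,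 with the following notion of convergence: $u_n\to0$ in $\mathcal{S}'_{\theta,\Gamma}$ if (1) $u_n\to 0$ in $\mathcal{S}'_\theta$, and (2) every $z\in(\mathbb{R}^{2d}\setminus\{0\})\setminus\Gamma$ has a conic neighbourhood $L$ and constants $C,\varepsilon>0$ such that $|\langle (u_n)_y,e^{-i\langle y,\xi\rangle-\frac12|y-x|^2}\rangle|\le Ce^{-\varepsilon(|x|^{1/\theta}+|\xi|^{1/\theta})}$ for all $n$ and all $(x,\xi)\in L$; $u_n\to u$ means $u_n-u\to0$. Continuity is with respect to this convergence. The product is defined by $u\cdot v=\delta^*(u\otimes v)$, where $\delta:\mathbb{R}^d\to\mathbb{R}^{2d}$, $\delta(x)=(x,x)$, and $\delta^*$ is the unique continuous extension of the pull-back $f\mapsto f\circ\delta$, $\mathcal{S}_\theta(\mathbb{R}^{2d})\to\mathcal{S}_\theta(\mathbb{R}^d)$, to the spaces $\mathcal{S}'_{\theta,\Gamma}(\mathbb{R}^{2d})$ for closed cones $\Gamma\subset\mathbb{R}^{4d}\setminus\{0\}$ containing no point of the form $(0,0,\xi,-\xi)$; it extends the pointwise product of functions in $\mathcal{S}_\theta(\mathbb{R}^d)$. The convolution is defined from the product by Fourier transformation: $\widehat{u*v}$ is the product of $\hat u$ and $\hat v$ (with $\hat f(\xi)=\int e^{-i\langle x,\xi\rangle}f(x)\,dx$ on test functions), extending the convolution of functions in $\mathcal{S}_\theta(\mathbb{R}^d)$. *)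

(* Defs.v *)
From HB Require Import structures.
From mathcomp Require Import all_boot all_order all_algebra.
From mathcomp Require Import all_classical all_reals all_analysis.
From mathcomp Require Import complex.

Set Implicit Arguments.
Unset Strict Implicit.
Unset Printing Implicit Defensive.

Import Order.TTheory GRing.Theory Num.Theory.
Import numFieldNormedType.Exports.

Local Open Scope classical_set_scope.
Local Open Scope ring_scope.
Local Open Scope complex_scope.

Section Defs.
Context {R : realType}.

Definition cabs (z : R[i]) : R := complex.Re `|z|.

Definition cis (t : R) : R[i] := cos t +i* sin t.

Definition dotp d (x y : 'rV[R]_d) : R := \sum_(j < d) x 0 j * y 0 j.

(* The Euclidean norm; the library norm `|x| on 'rV[R]_d is the sup norm. *)
Definition enorm d (x : 'rV[R]_d) : R := Num.sqrt (dotp x x).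

(* The library differentiates between normed modules over the same field, and
   R[i] is not one over R: real and imaginary parts are differentiated
   separately. *)
Definition pderivable d (j : 'I_d) (f : 'rV[R]_d -> R[i]) (x : 'rV[R]_d) :=
  derivable (fun y => complex.Re (f y)) x (delta_mx 0 j) /\
  derivable (fun y => complex.Im (f y)) x (delta_mx 0 j).

Definition pderiv d (j : 'I_d) (f : 'rV[R]_d -> R[i]) : 'rV[R]_d -> R[i] :=
  fun x => 'D_(delta_mx 0 j) (fun y => complex.Re (f y)) x +i*
           'D_(delta_mx 0 j) (fun y => complex.Im (f y)) x.

Definition smooth d (f : 'rV[R]_d -> R[i]) :=
  forall s : seq 'I_d, let g := foldr (@pderiv d) f s in
    [/\ continuous (fun x => complex.Re (g x)),
        continuous (fun x => complex.Im (g x)) &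
        forall (j : 'I_d) (x : 'rV[R]_d), pderivable j g x].

Definition mdeg d (a : {ffun 'I_d -> nat}) : nat := (\sum_(j < d) a j)%N.

Definition mfact d (a : {ffun 'I_d -> nat}) : nat := (\prod_(j < d) (a j)`!)%N.

Definition mpow d (x : 'rV[R]_d) (a : {ffun 'I_d -> nat}) : R :=
  \prod_(j < d) x 0 j ^+ a j.

Definition mderiv d (b : {ffun 'I_d -> nat}) (f : 'rV[R]_d -> R[i]) :
    'rV[R]_d -> R[i] :=
  foldr (fun j g => iter (b j) (pderiv j) g) f (enum 'I_d).

Definition gs_norm d (theta C : R) (f : 'rV[R]_d -> R[i]) : \bar R :=
  ereal_sup [set r | exists (a b : {ffun 'I_d -> nat}) (x : 'rV[R]_d),
    r = (C ^- (mdeg a + mdeg b) * (mfact a * mfact b)%:R `^ (- theta)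
         * cabs ((mpow x a)%:C * mderiv b f x))%:E].

Definition gs_step d (theta C : R) : set ('rV[R]_d -> R[i]) :=
  [set f | smooth f /\ (gs_norm theta C f < +oo)%E].

Definition gs d (theta : R) : set ('rV[R]_d -> R[i]) :=
  \bigcup_(C in [set C : R | 0 < C]) gs_step theta C.

Definition abs_convex d (V : set ('rV[R]_d -> R[i])) :=
  forall f g (a b : R[i]), V f -> V g -> cabs a + cabs b <= 1 ->
    V (fun x => a * f x + b * g x).

(* Neighbourhoods of 0 for the (locally convex) inductive limit topology: the
   absolutely convex sets meeting every step in a neighbourhood of 0 of that
   step form a basis. *)
Definition ilim_nbhs0 d (theta : R) (U : set ('rV[R]_d -> R[i])) :=
  exists V : set ('rV[R]_d -> R[i]),
    [/\ V `<=` U, V `<=` gs theta, abs_convex V &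
        forall C : R, 0 < C -> exists2 r : R, 0 < r &
          forall f, gs_step theta C f -> (gs_norm theta C f < r%:E)%E -> V f].

(* An element of S_theta'(R^d) is represented by a map defined on all functions
   R^d -> C, of which only the values on S_theta(R^d) are meaningful; two of
   them denote the same element of the dual when they agree there. *)
Definition functional (d : nat) : Type := ('rV[R]_d -> R[i]) -> R[i].

Definition agree d (theta : R) (u v : functional d) :=
  forall f, gs theta f -> u f = v f.

Definition ultradist d (theta : R) : set (functional d) :=
  [set u | (forall (a : R[i]) f g, gs theta f -> gs theta g ->
              u (fun x => a * f x + g x) = a * u f + u g) /\
           (forall f, gs theta f -> forall e : R, 0 < e ->
              ilim_nbhs0 theta
                [set g | cabs (u (fun x => f x + g x) - u f) < e])].

Definition weak_cvg d (theta : R) (u_ : nat -> functional d)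
    (u : functional d) :=
  forall f, gs theta f -> cabs (u_ n f - u f) @[n --> \oo] --> (0 : R).

Definition phase (d : nat) : Type := ('rV[R]_d * 'rV[R]_d)%type.

Definition conic d (A : set (phase d)) :=
  ~ A 0 /\ forall (t : R) z, 0 < t -> A z -> A (t *: z).

Definition closed_cone d (A : set (phase d)) :=
  conic A /\ exists2 F : set (phase d), closed F & A = F `\ 0.

Definition wave_packet d (z : phase d) : 'rV[R]_d -> R[i] :=
  fun y => cis (- dotp y z.2) * (expR (- (enorm (y - z.1) ^+ 2 / 2)))%:C.

Definition decays d (theta : R) (u : functional d) (L : set (phase d))
    (C e : R) :=
  forall z, L z -> cabs (u (wave_packet z)) <=
    C * expR (- (e * (enorm z.1 `^ theta^-1 + enorm z.2 `^ theta^-1))).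

Definition WF d (theta : R) (u : functional d) : set (phase d) :=
  [set z | z <> 0 /\
     ~ exists (L : set (phase d)) (C e : R),
         [/\ open L, conic L, L z, 0 < C & 0 < e /\ decays theta u L C e]].

Definition ultradist_in d (theta : R) (G : set (phase d)) :
    set (functional d) :=
  [set u | ultradist theta u /\ WF theta u `<=` G].

Definition cvg0_in d (theta : R) (G : set (phase d))
    (u_ : nat -> functional d) :=
  weak_cvg theta u_ (fun _ => 0) /\
  forall z, z <> 0 -> ~ G z ->
    exists (L : set (phase d)) (C e : R),
      [/\ conic L, nbhs z L, 0 < C, 0 < e &
          forall n, decays theta (u_ n) L C e].

Definition cvg_in d (theta : R) (G : set (phase d))
    (u_ : nat -> functional d) (u : functional d) :=
  cvg0_in theta G (fun n f => u_ n f - u f).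

(* The d-dimensional Lebesgue integral as an iterated one-dimensional Lebesgue
   integral (Fubini); it is only ever applied to elements of S_theta multiplied
   by bounded smooth functions. *)
Fixpoint rint (d : nat) : ('rV[R]_d -> R) -> R :=
  match d return ('rV[R]_d -> R) -> R with
  | 0 => fun f => f 0
  | n.+1 => fun f =>
      \int[@lebesgue_measure R]_t
        @rint n (fun y => f (row_mx (const_mx t : 'rV[R]_1) y))
  end.

Definition cint d (f : 'rV[R]_d -> R[i]) : R[i] :=
  rint (fun x => complex.Re (f x)) +i* rint (fun x => complex.Im (f x)).

Definition of_fun d (f : 'rV[R]_d -> R[i]) : functional d :=
  fun phi => cint (fun x => f x * phi x).

Definition fourier_fun d (f : 'rV[R]_d -> R[i]) : 'rV[R]_d -> R[i] :=
  fun xi => cint (fun x => cis (- dotp x xi) * f x).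

Definition fourier d (u : functional d) : functional d :=
  fun phi => u (fourier_fun phi).

(* <u (x) v, phi> = <u_x, <v_y, phi(x,y)>> ; on phi = f (x) g this is
   <u, f> <v, g>, which determines u (x) v. *)
Definition tensor d (u v : functional d) : functional (d + d) :=
  fun phi => u (fun x => v (fun y => phi (row_mx x y))).

Definition diag_pull d (f : 'rV[R]_(d + d) -> R[i]) : 'rV[R]_d -> R[i] :=
  fun x => f (row_mx x x).

Definition diag_admissible d (G : set (phase (d + d))) :=
  closed_cone G /\ forall xi : 'rV[R]_d, ~ G (0, row_mx xi (- xi)).

Definition diag_extension d (theta : R) (G : set (phase (d + d)))
    (D : functional (d + d) -> functional d) :=
  [/\ forall t, ultradist_in theta G t -> ultradist theta (D t),
      forall (t_ : nat -> functional (d + d)) t,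
        (forall n, ultradist_in theta G (t_ n)) -> ultradist_in theta G t ->
        cvg_in theta G t_ t -> weak_cvg theta (fun n => D (t_ n)) (D t) &
      forall f, gs theta f ->
        agree theta (D (of_fun f)) (of_fun (diag_pull f))].

Definition is_delta_star d (theta : R) (G : set (phase (d + d)))
    (D : functional (d + d) -> functional d) :=
  diag_extension theta G D /\
  forall D', diag_extension theta G D' ->
    forall t, ultradist_in theta G t -> agree theta (D t) (D' t).

Definition is_product d (theta : R) (u v w : functional d) :=
  ultradist theta w /\
  exists (G : set (phase (d + d))) (D : functional (d + d) -> functional d),
    [/\ diag_admissible G, ultradist_in theta G (tensor u v),
        is_delta_star theta G D & agree theta w (D (tensor u v))].

Definition is_convolution d (theta : R) (u v w : functional d) :=
  ultradist theta w /\
  is_product theta (fourier u) (fourier v) (fourier w).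

Definition well_defined d (theta : R) (P : functional d -> Prop) :=
  (exists w, P w) /\ forall w w', P w -> P w' -> agree theta w w'.

Definition prod_cone d (G1 G2 : set (phase d)) : set (phase d) :=
  [set z | exists x xi eta, [/\ G1 (x, xi), G2 (x, eta) & z = (x, xi + eta)]]
  `|` G1 `|` G2.

Definition conv_cone d (W1 W2 : set (phase d)) : set (phase d) :=
  [set z | exists x y xi, [/\ (W1 `|` [set 0]) (x, xi),
     (W2 `|` [set 0]) (y, xi) & z = (x + y, xi)]].

End Defs.

Arguments functional : clear implicits.
Arguments phase : clear implicits.

(* Main.v *)
(** Everything is tested on the wave packets g_X, X in phase space. Riemann sums
    for the integral over phase space give a reproducing formula
    f = lim_n sum_(X in grid_n) w_n <f, g_(flip X)> g_X, with partial sums bounded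
    in one step of S_theta, hence (normal families) convergent against every
    ultradistribution. So u is determined by the numbers u(g_X), which grow more
    slowly than every exp(c |X|^(1/theta)), c > 0.

    For t on R^(d+d) with WF(t) in G put
    <delta^* t, f> = lim sum_X w_n t(g_X) <diag_pull g_(flip X), f>. The second
    factor is a Gaussian integral; it decays away from the X = (0, 0, xi, - xi)
    for a fixed f, and away from the X = (x, x, xi, eta) with (x, xi + eta) = Y for
    f = g_Y. A compactness argument on rays shows that one of the two factors
    decays along every ray if G contains no (0, 0, xi, - xi), and that the sum for
    f = g_Y decays in Y away from the image of G. The same estimates, uniform in a
    convergent sequence, give continuity, and the reproducing formula gives
    density of the test functions, hence uniqueness. Finally (u (x) v)(g_X) is the
    product of values of u and v on wave packets, and the Fourier transformation
    maps g_(x, xi) to a multiple of g_(- xi, x). *)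

(* An ultradistribution is never applied to an integral, only to finite sums of wave packets and to
   sequences converging pointwise inside one step; this is why Riemann sums replace the phase space
   integral. Their kernel would oscillate, but with each frequency taken as a difference of two grid
   points it becomes a product of nonnegative kernels of one variable. Nonnegativity reduces
   convergence to two numbers, the mass and the first absolute moment, and both come from explicit
   Gaussian sums.

   The condition on theta acts through p = 1/theta. That p <= 2 lets a Gaussian absorb exp(c |y|^p)
   for small c and lets factorial powers absorb the coefficients of Hermite polynomials; that p >= 1
   is used to sum moments and grid weights.

   Estimates are made for indexed families with constants independent of the index, so that one
   statement serves a single functional (index type [unit]) and a convergent sequence. For sequences
   the uniform constants come from a gliding hump argument on one step of S_theta. *)
From HB Require Import structures.
From mathcomp Require Import all_boot all_order all_algebra.
From mathcomp Require Import all_classical all_reals all_analysis.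
From mathcomp Require Import measurable_realfun complex ring lra.
Require Import Defs.

Set Implicit Arguments.
Unset Strict Implicit.
Unset Printing Implicit Defensive.

Import Order.TTheory GRing.Theory Num.Theory.
Import numFieldNormedType.Exports.

Local Open Scope classical_set_scope.
Local Open Scope ring_scope.
Local Open Scope complex_scope.

(** * Iterated integrals of rapidly decreasing functions *)

Section RealLine.
Context {R : realType}.
Implicit Types (f g : R -> R) (K : R).
Notation mu := (@lebesgue_measure R).

(** The universal integrable majorant. Algebraic decay is chosen because a translate of [bump] is
    bounded by a multiple of [bump], see [bump_shift]. *)
Definition bump (t : R) : R := (1 + t ^+ 2)^-1.

Lemma bump_gt0 t : 0 < bump t.
Proof. by rewrite invr_gt0 ltr_wpDr ?sqr_ge0. Qed.

Lemma bump_ge0 t : 0 <= bump t. Proof. exact/ltW/bump_gt0. Qed.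

Lemma continuous_bump : continuous bump.
Proof. exact: (@continuous_oneDsqrV R). Qed.

Lemma measurable_EFin_continuous f : continuous f ->
  measurable_fun setT (EFin \o f).
Proof.
by move=> cf; apply/measurable_EFinP; apply: continuous_measurable_fun.
Qed.

Lemma integrable_bump : mu.-integrable setT (EFin \o bump).
Proof.
apply/integrableP; split.
  exact: (measurable_EFin_continuous continuous_bump).
under eq_integral => x _ do rewrite /= ger0_norm ?bump_ge0//.
rewrite ge0_symfun_integralT.
- rewrite -set_itvcy.
  rewrite [X in (_ * X)%E](_ : _ = (pi / 2)%:E) ?lte_mul_pinfty ?lee_fin// ?ltry//.
  exact: integral0y_oneDsqr.
- exact: bump_ge0.
- exact: continuous_bump.
- by move=> x; rewrite /= /bump sqrrN.
Qed.

Lemma integrable_dom f K : continuous f -> (forall t, `|f t| <= K * bump t) ->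
  mu.-integrable setT (EFin \o f).
Proof.
move=> cf fK; have h : mu.-integrable setT (fun t => (K%:E * (EFin \o bump) t)%E).
  by apply: integrableZl => //; exact: integrable_bump.
apply: (le_integrable _ _ _ h) => //.
- exact: measurable_EFin_continuous.
- by move=> t _; rewrite /= lee_fin (le_trans (fK t))// ler_norm.
Qed.

Definition rI f : R := (\int[mu]_t f t)%R.

Lemma rI_cvg (f_ : nat -> R -> R) f K :
  (forall n, continuous (f_ n)) -> continuous f ->
  (forall n t, `|f_ n t| <= K * bump t) ->
  (forall t, f_ n t @[n --> \oo] --> f t) ->
  rI (f_ n) @[n --> \oo] --> rI f.
Proof.
move=> cf_ cf fK f_f.
have fK' t : `|f t| <= K * bump t.
  have h : `|f_ n t| @[n --> \oo] --> `|f t| by apply: cvg_norm; exact: f_f.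
  rewrite -(cvg_lim _ h)//; apply: limr_le; [exact/cvgP/h|exact: nearW].
have [|||||_ _] := @dominated_convergence _ _ R mu setT measurableT
  (fun n => EFin \o f_ n) (EFin \o f) (fun t => (K%:E * (EFin \o bump) t)%E).
- by move=> n; exact: measurable_EFin_continuous.
- exact: measurable_EFin_continuous.
- by apply: aeW => t _; apply/cvg_EFin; [exact: nearW|exact: f_f].
- by apply: integrableZl => //; exact: integrable_bump.
- by apply: aeW => t n _; rewrite /= lee_fin.
move=> h; rewrite /rI /Rintegral.
have ff n : (\int[mu]_t (f_ n t)%:E)%E \is a fin_num.
  apply: integrable_fin_num => //; exact: integrable_dom (fK n).
have ff' : (\int[mu]_t (f t)%:E)%E \is a fin_num.
  by apply: integrable_fin_num => //; exact: integrable_dom fK'.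
apply: fine_cvg; rewrite fineK//.
Qed.

Lemma rID f g K L : continuous f -> continuous g ->
  (forall t, `|f t| <= K * bump t) -> (forall t, `|g t| <= L * bump t) ->
  rI (fun t => f t + g t) = rI f + rI g.
Proof. by move=> cf cg fK gL; apply: RintegralD => //; exact: integrable_dom. Qed.

Lemma rIZ a f K : continuous f -> (forall t, `|f t| <= K * bump t) ->
  rI (fun t => a * f t) = a * rI f.
Proof. by move=> cf fK; apply: RintegralZl => //; exact: integrable_dom. Qed.

Lemma rI_le f g K L : continuous f -> continuous g ->
  (forall t, `|f t| <= K * bump t) -> (forall t, `|g t| <= L * bump t) ->
  (forall t, f t <= g t) -> rI f <= rI g.
Proof. by move=> cf cg fK gL fg; apply: le_Rintegral => //; exact: integrable_dom. Qed.

Lemma rI0 : rI (fun=> 0) = 0.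
Proof. by rewrite /rI /Rintegral integral0. Qed.

Lemma bump_shift c t : bump (t + c) <= 2 * (1 + c ^+ 2) * bump t.
Proof.
rewrite /bump ler_pdivlMr ?ltr_wpDr ?sqr_ge0// mulrC ler_pdivrMr ?ltr_wpDr ?sqr_ge0//.
have : 0 <= (t + 2 * c) ^+ 2 by exact: sqr_ge0.
have : 0 <= (c * (t + c))^+2 by exact: sqr_ge0.
nra.
Qed.

Lemma derive1_addc c : (fun t : R => t + c)^`()%classic = cst 1.
Proof.
apply/funext => t; rewrite derive1E; apply: derive_val.
by apply: is_derive_eq; rewrite addr0.
Qed.

Lemma rI_shift_ge0 f c : continuous f -> (forall t, 0 <= f t) ->
  rI (fun t => f (t + c)) = rI f.
Proof.
move=> cf f0; rewrite /rI /Rintegral; congr fine.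
rewrite [in RHS](@increasing_ge0_integration_by_substitutionT R (fun t => t + c) f)//.
- apply: eq_integral => t _ /=; congr EFin.
  by rewrite derive1_addc mulr1.
- by move=> x y xy; rewrite ltrD2r.
- by rewrite derive1_addc; exact: cst_continuous.
- by rewrite derive1_addc; exact: is_cvg_cst.
- by rewrite derive1_addc; exact: is_cvg_cst.
- apply/cvgrNyPle => A; near=> x.
  rewrite -lerBrDr; near: x; apply: nbhs_ninfty_le; exact: num_real.
- apply/cvgryPge => A; near=> x.
  rewrite -lerBlDr; near: x; apply: nbhs_pinfty_ge; exact: num_real.
Unshelve. all: by end_near. Qed.

Lemma rI_shift f c K : continuous f -> (forall t, `|f t| <= K * bump t) ->
  rI (fun t => f (t + c)) = rI f.
Proof.
move=> cf fK.
have K0 : 0 <= K.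
  by have := le_trans (normr_ge0 _) (fK 0); rewrite pmulr_lge0 ?bump_gt0.
have cb : continuous (fun t => K * bump t).
  by move=> t; apply: cvgM; [exact: cvg_cst|exact: continuous_bump].
have csh (h : R -> R) : continuous h -> continuous (fun t => h (t + c)).
  move=> ch t; apply: (@continuous_comp _ _ _ (fun t => t + c) h); last exact: ch.
  by apply: cvgD; [exact: cvg_id|exact: cvg_cst].
have bb t : `|K * bump t| <= K * bump t.
  by rewrite ger0_norm ?mulr_ge0 ?bump_ge0.
have bbs t : `|K * bump (t + c)| <= K * (2 * (1 + c ^+ 2)) * bump t.
  rewrite ger0_norm ?mulr_ge0 ?bump_ge0// -mulrA ler_wpM2l//.
  exact: bump_shift.
have fs t : `|f (t + c)| <= K * (2 * (1 + c ^+ 2)) * bump t.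
  by apply: le_trans (bbs t); rewrite (le_trans (fK _)) ?ler_norm.
(* Adding the majorant makes the integrand nonnegative; its own integral, also translation
   invariant, is then cancelled. *)
have := @rI_shift_ge0 (fun t => f t + K * bump t) c.
rewrite (rID cf cb fK bb) (rID (csh _ cf) (csh _ cb) fs bbs).
rewrite (rI_shift_ge0 c cb) => [h|t]; last by rewrite mulr_ge0 ?bump_ge0.
apply: (addIr (rI (fun t => K * bump t))); apply: h.
  by move=> t; apply: cvgD; [exact: cf|exact: cb].
by move=> t; rewrite -lerBlDr sub0r; have := fK t; rewrite ler_norml => /andP[].
Qed.

(** If the integral were zero, [f] would vanish almost everywhere, so the whole line, and with it
    [0, 1], would be a null set. *)
Lemma rI_gt0 f K : continuous f -> (forall t, `|f t| <= K * bump t) ->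
  (forall t, 0 < f t) -> 0 < rI f.
Proof.
move=> cf fK f0.
have ge0 : 0 <= rI f by apply: Rintegral_ge0 => t _; exact: ltW.
rewrite lt_neqAle ge0 andbT eq_sym; apply/eqP => If0.
have : (\int[mu]_t (f t)%:E = 0)%E.
  move: If0; rewrite /rI /Rintegral => If0.
  by rewrite -[LHS]fineK ?If0//; apply: integrable_fin_num => //; exact: integrable_dom fK.
have mf : measurable_fun setT (EFin \o f).
  exact: measurable_EFin_continuous.
have eq1 : (\int[mu]_t `|(EFin \o f) t| = \int[mu]_t (f t)%:E)%E.
  by apply: eq_integral => t _ /=; rewrite ger0_norm ?ltW.
have [h _] := ae_eq_integral_abs mu measurableT mf.
rewrite -eq1 => /h [N [mN N0 sN]].
have NT : N = setT.
  apply/seteqP; split => // t _; apply: sN => /= /(_ Logic.I) [] ft0.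
  by have := f0 t; rewrite ft0 ltxx.
have := @lebesgue_measure_itv R `[0, 1].
have : (mu `[0%R, 1%R] <= mu N)%E by apply: le_measure; rewrite ?inE// NT.
by rewrite N0 => + h'; rewrite h' /= lte_fin ltr01 oppr0 adde0 lee_fin ler10.
Qed.

End RealLine.

(** * Iterated integrals in several variables *)

Section Rint.
Context {R : realType}.

Definition cwcvg N (u : nat -> 'rV[R]_N) (x : 'rV[R]_N) :=
  forall j, u n 0 j @[n --> \oo] --> x 0 j.

(* Sequential continuity, because dominated convergence is about sequences. *)
Definition scont N (f : 'rV[R]_N -> R) :=
  forall u x, cwcvg u x -> f (u n) @[n --> \oo] --> f x.

Definition wgt N (x : 'rV[R]_N) : R := \prod_(j < N) bump (x 0 j).

Lemma bump_le1 (t : R) : bump t <= 1.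
Proof. by rewrite invf_le1 ?ltr_wpDr ?sqr_ge0// lerDl sqr_ge0. Qed.

Lemma wgt_ge0 N (x : 'rV[R]_N) : 0 <= wgt x.
Proof. by apply: prodr_ge0 => j _; exact: bump_ge0. Qed.

Definition slice N (f : 'rV[R]_(1 + N) -> R) t : 'rV[R]_N -> R :=
  fun y => f (row_mx (const_mx t : 'rV[R]_1) y).

Lemma wgt_slice N t (y : 'rV[R]_N) :
  wgt (row_mx (const_mx t : 'rV[R]_1) y) = bump t * wgt y.
Proof.
rewrite /wgt big_split_ord /= big_ord1 row_mxEl mxE; congr (_ * _).
by apply: eq_bigr => j _; rewrite row_mxEr.
Qed.

Lemma cwcvg_slice N (t_ : nat -> R) t (u : nat -> 'rV[R]_N) x :
  t_ n @[n --> \oo] --> t -> cwcvg u x ->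
  cwcvg (fun n => row_mx (const_mx (t_ n) : 'rV[R]_1) (u n))
    (row_mx (const_mx t : 'rV[R]_1) x).
Proof.
move=> tt ux j; case: (split_ordP j) => k ->.
  by rewrite row_mxEl mxE; under eq_fun do rewrite row_mxEl mxE.
by rewrite row_mxEr; under eq_fun do rewrite row_mxEr; exact: ux.
Qed.

Lemma scont_slice N (f : 'rV[R]_(1 + N) -> R) t : scont f -> scont (slice f t).
Proof.
by move=> cf u x ux; apply: cf; apply: cwcvg_slice => //; exact: cvg_cst.
Qed.

Lemma rintS N (f : 'rV[R]_(1 + N) -> R) :
  @rint R N.+1 f = rI (fun t => rint (slice f t)).
Proof. by []. Qed.

Let I1 : R := rI bump.

Lemma rI_bound (g : R -> R) K : continuous g ->
  (forall t, `|g t| <= K * bump t) -> `|rI g| <= K * I1.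
Proof.
move=> cg gK.
have bb t : `|bump t| <= 1 * bump t :> R by rewrite ger0_norm ?bump_ge0 ?mul1r.
have cb := @continuous_bump R.
have cKb : continuous (fun t => K * bump t : R).
  by move=> t; apply: cvgM; [exact: cvg_cst|exact: cb].
have Kb t : `|K * bump t| <= `|K| * bump t by rewrite normrM (ger0_norm (bump_ge0 _)).
rewrite /I1 -(rIZ K cb bb) ler_norml; apply/andP; split.
  rewrite -mulN1r -(rIZ _ cKb Kb); apply: (rI_le (K := `|K|) (L := K)) => //.
  - by move=> t; apply: cvgM; [exact: cvg_cst|exact: cKb].
  - by move=> t; rewrite normrM normrN1 mul1r; exact: Kb.
  - by move=> t; have := gK t; rewrite ler_norml mulN1r => /andP[].
apply: (rI_le (K := K) (L := `|K|)) => //.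
by move=> t; have := gK t; rewrite ler_norml => /andP[].
Qed.

Lemma wgt0E N : wgt (0 : 'rV[R]_N) = 1.
Proof. by rewrite /wgt big1// => j _; rewrite mxE /bump expr0n addr0 invr1. Qed.

Lemma dom_ge0 N (f : 'rV[R]_N -> R) K : (forall x, `|f x| <= K * wgt x) -> 0 <= K.
Proof. by move=> /(_ 0); rewrite wgt0E mulr1; exact/le_trans. Qed.

Lemma slice_dom N (f : 'rV[R]_(1 + N) -> R) K t :
  (forall x, `|f x| <= K * wgt x) ->
  forall y, `|slice f t y| <= K * bump t * wgt y.
Proof. by move=> fK y; rewrite (le_trans (fK _))// wgt_slice mulrA. Qed.

(** Both claims go through one induction: convergence in dimension N makes the partially integrated
    function continuous in the remaining variable, the bound makes it dominated by [bump], and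
    together they allow the one-dimensional theorem to be applied. *)
Let rint_cvg_bound N :
  (forall (f_ : nat -> 'rV[R]_N -> R) f K, (forall n, scont (f_ n)) -> scont f ->
    (forall n x, `|f_ n x| <= K * wgt x) ->
    (forall x, f_ n x @[n --> \oo] --> f x) ->
    rint (f_ n) @[n --> \oo] --> rint f) /\
  (forall (f : 'rV[R]_N -> R) K, scont f ->
    (forall x, `|f x| <= K * wgt x) -> `|rint f| <= K * I1 ^+ N).
Proof.
elim: N => [|N [IHc IHb]].
  split=> [f_ f K _ _ _|f K _ /(_ 0)]; first exact.
  by rewrite wgt0E expr0 mulr1.
have cslice (f : 'rV[R]_(1 + N) -> R) K : scont f ->
    (forall x, `|f x| <= K * wgt x) -> continuous (fun t => rint (slice f t)).
  move=> cf fK t; apply/(@cvg_nbhsP _ R^o) => u ut.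
  apply: (IHc (fun n => slice f (u n)) _ K).
  - by move=> n; exact: scont_slice.
  - exact: scont_slice.
  - move=> n y; apply: le_trans (slice_dom _ fK _) _.
    rewrite -mulrA ler_wpM2l ?(dom_ge0 fK)// ler_piMl ?wgt_ge0 ?bump_le1//.
  - by move=> y; apply: cf; apply: cwcvg_slice => //; move=> j; exact: cvg_cst.
have bslice (f : 'rV[R]_(1 + N) -> R) K t : scont f ->
    (forall x, `|f x| <= K * wgt x) ->
    `|rint (slice f t)| <= (K * I1 ^+ N) * bump t.
  move=> cf fK; rewrite mulrAC; apply: IHb; first exact: scont_slice.
  exact: slice_dom.
split=> [f_ f K cf_ cf fK f_f|f K cf fK].
  have fK' x : `|f x| <= K * wgt x.
    have h : `|f_ n x| @[n --> \oo] --> `|f x| by apply: cvg_norm; exact: f_f.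
    by rewrite -(cvg_lim _ h)//; apply: limr_le; [exact/cvgP/h|exact: nearW].
  apply: (rI_cvg (K := K * I1 ^+ N)).
  - by move=> n; exact: (cslice (f_ n) K).
  - exact: (cslice f K).
  - by move=> n t; apply: bslice => //; exact: fK.
  - move=> t; apply: (IHc (fun n => slice (f_ n) t) _ (K * bump t)).
    + by move=> n; exact: scont_slice.
    + exact: scont_slice.
    + by move=> n; apply: slice_dom; exact: fK.
    + by move=> y; exact: f_f.
rewrite exprSr mulrA; apply: rI_bound; first exact: (cslice f K).
by move=> t; exact: bslice.
Qed.

Lemma rint_cvg N (f_ : nat -> 'rV[R]_N -> R) f K :
  (forall n, scont (f_ n)) -> scont f ->
  (forall n x, `|f_ n x| <= K * wgt x) ->
  (forall x, f_ n x @[n --> \oo] --> f x) ->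
  rint (f_ n) @[n --> \oo] --> rint f.
Proof. exact: (rint_cvg_bound N).1. Qed.

Lemma rint_bound N (f : 'rV[R]_N -> R) K : scont f ->
  (forall x, `|f x| <= K * wgt x) -> `|rint f| <= K * I1 ^+ N.
Proof. exact: (rint_cvg_bound N).2. Qed.

Lemma continuous_slice N (f : 'rV[R]_(1 + N) -> R) K : scont f ->
  (forall x, `|f x| <= K * wgt x) -> continuous (fun t => rint (slice f t)).
Proof.
move=> cf fK t; apply/(@cvg_nbhsP _ R^o) => u ut.
apply: (rint_cvg (f_ := fun n => slice f (u n)) (K := K)).
- by move=> n; exact: scont_slice.
- exact: scont_slice.
- move=> n y; apply: le_trans (slice_dom _ fK _) _.
  by rewrite -mulrA ler_wpM2l ?(dom_ge0 fK)// ler_piMl ?wgt_ge0 ?bump_le1.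
- by move=> y; apply: cf; apply: cwcvg_slice => //; move=> j; exact: cvg_cst.
Qed.

Lemma bound_slice N (f : 'rV[R]_(1 + N) -> R) K t : scont f ->
  (forall x, `|f x| <= K * wgt x) ->
  `|rint (slice f t)| <= (K * I1 ^+ N) * bump t.
Proof.
move=> cf fK; rewrite mulrAC; apply: rint_bound; first exact: scont_slice.
exact: slice_dom.
Qed.

Lemma scontD N (f g : 'rV[R]_N -> R) : scont f -> scont g ->
  scont (fun x => f x + g x).
Proof. by move=> cf cg u x ux; apply: cvgD; [exact: cf|exact: cg]. Qed.

Lemma scontM N (f g : 'rV[R]_N -> R) : scont f -> scont g ->
  scont (fun x => f x * g x).
Proof. by move=> cf cg u x ux; apply: cvgM; [exact: cf|exact: cg]. Qed.

Lemma scont_cst N (c : R) : scont (fun _ : 'rV[R]_N => c).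
Proof. by move=> u x ux; exact: cvg_cst. Qed.

Lemma scont_coord N (j : 'I_N) : scont (fun x : 'rV[R]_N => x 0 j).
Proof. by move=> u x ux; exact: ux. Qed.

Lemma scont_comp N (f : 'rV[R]_N -> R) (h : R -> R) : continuous h -> scont f ->
  scont (fun x => h (f x)).
Proof. by move=> ch cf u x ux; apply: continuous_cvg; [exact: ch|exact: cf]. Qed.

Lemma scont_sum N I (r : seq I) (f : I -> 'rV[R]_N -> R) :
  (forall i, scont (f i)) -> scont (fun x => \sum_(i <- r) f i x).
Proof.
move=> cf; elim: r => [|i r IH].
  by under eq_fun do rewrite big_nil; exact: scont_cst.
by under eq_fun do rewrite big_cons; exact: scontD.
Qed.

Lemma scont_prod N I (r : seq I) (f : I -> 'rV[R]_N -> R) :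
  (forall i, scont (f i)) -> scont (fun x => \prod_(i <- r) f i x).
Proof.
move=> cf; elim: r => [|i r IH].
  by under eq_fun do rewrite big_nil; exact: scont_cst.
by under eq_fun do rewrite big_cons; exact: scontM.
Qed.

Lemma rintD N (f g : 'rV[R]_N -> R) K L : scont f -> scont g ->
  (forall x, `|f x| <= K * wgt x) -> (forall x, `|g x| <= L * wgt x) ->
  rint (fun x => f x + g x) = rint f + rint g.
Proof.
elim: N f g K L => [|N IH] f g K L cf cg fK gL //.
rewrite [LHS]rintS [rint f]rintS [rint g]rintS.
rewrite -(rID (continuous_slice cf fK) (continuous_slice cg gL)
  (fun t => bound_slice t cf fK) (fun t => bound_slice t cg gL)).
congr rI; apply/funext => t.
by apply: (IH _ _ (K * bump t) (L * bump t)); [exact: scont_slice|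
  exact: scont_slice|exact: slice_dom|exact: slice_dom].
Qed.

Lemma rintZ N (f : 'rV[R]_N -> R) a K : scont f ->
  (forall x, `|f x| <= K * wgt x) ->
  rint (fun x => a * f x) = a * rint f.
Proof.
elim: N f K => [|N IH] f K cf fK //.
rewrite [LHS]rintS [rint f]rintS.
rewrite -(rIZ _ (continuous_slice cf fK) (fun t => bound_slice t cf fK)).
congr rI; apply/funext => t.
by apply: (IH _ (K * bump t)); [exact: scont_slice|exact: slice_dom].
Qed.

Lemma le_rint N (f g : 'rV[R]_N -> R) K L : scont f -> scont g ->
  (forall x, `|f x| <= K * wgt x) -> (forall x, `|g x| <= L * wgt x) ->
  (forall x, f x <= g x) -> rint f <= rint g.
Proof.
elim: N f g K L => [|N IH] f g K L cf cg fK gL fg; first exact: fg.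
rewrite [rint f]rintS [rint g]rintS.
apply: (rI_le (continuous_slice cf fK) (continuous_slice cg gL)
  (fun t => bound_slice t cf fK) (fun t => bound_slice t cg gL)) => t.
apply: (IH _ _ (K * bump t) (L * bump t)); [exact: scont_slice|
  exact: scont_slice|exact: slice_dom|exact: slice_dom|by move=> y; exact: fg].
Qed.

Lemma rint0 N : rint (fun _ : 'rV[R]_N => 0) = 0 :> R.
Proof.
elim: N => [//|N IH]; rewrite [LHS]rintS.
by rewrite (_ : (fun t => _) = fun=> 0) ?rI0//; apply/funext => t; exact: IH.
Qed.

Lemma row_mx_ord0 N (a : 'rV[R]_1) (y : 'rV[R]_N) :
  row_mx a y 0 (ord0 : 'I_N.+1) = a 0 0.
Proof.
have -> : (ord0 : 'I_N.+1) = lshift N (ord0 : 'I_1) by apply/val_inj.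
by rewrite row_mxEl.
Qed.

Lemma row_mx_lift0 N (a : 'rV[R]_1) (y : 'rV[R]_N) j :
  row_mx a y 0 (lift ord0 j : 'I_N.+1) = y 0 j.
Proof.
have -> : (lift ord0 j : 'I_N.+1) = rshift 1 j by apply/val_inj.
by rewrite row_mxEr.
Qed.

Lemma rint_prod N (b : 'I_N -> R -> R) (K : 'I_N -> R) :
  (forall j, continuous (b j)) -> (forall j t, `|b j t| <= K j * bump t) ->
  rint (fun x : 'rV[R]_N => \prod_(j < N) b j (x 0 j)) = \prod_(j < N) rI (b j).
Proof.
elim: N b K => [|N IH] b K cb bK; first by rewrite /= !big_ord0.
rewrite rintS big_ord_recl /=.
have c' := fun j => cb (lift ord0 j); have K' := fun j => bK (lift ord0 j).
rewrite -(IH _ _ c' K') mulrC -(rIZ _ (cb ord0) (bK ord0)).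
congr rI; apply/funext => t; rewrite mulrC.
transitivity (rint (fun y : 'rV[R]_N => b ord0 t * \prod_(j < N) b (lift ord0 j) (y 0 j))).
  congr rint; apply/funext => y; rewrite /slice big_ord_recl; congr (_ * _).
    by rewrite row_mx_ord0 mxE.
  apply: eq_bigr => j _.
  by rewrite row_mx_lift0.
apply: (@rintZ _ _ _ (\prod_j K (lift ord0 j))).
  by apply: scont_prod => j; apply: scont_comp => //; exact: scont_coord.
move=> y; rewrite normr_prod /wgt -big_split /=.
by apply: ler_prod => j _; rewrite normr_ge0 K'.
Qed.

Definition shiftj N (j : 'I_N) (e : R) (x : 'rV[R]_N) := x + e *: delta_mx 0 j.

Lemma shiftjE N (j : 'I_N) e x k :
  shiftj j e x 0 k = x 0 k + (if k == j then e else 0).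
Proof.
by rewrite !mxE eqxx /=; case: eqP => _; rewrite ?mulr1 ?mulr0.
Qed.

Lemma scont_shift N (f : 'rV[R]_N -> R) j e : scont f -> scont (fun x => f (shiftj j e x)).
Proof.
move=> cf u x ux; apply: cf => k; rewrite shiftjE.
under eq_fun do rewrite shiftjE.
by apply: cvgD; [exact: ux|exact: cvg_cst].
Qed.

Lemma wgt_shift N (j : 'I_N) e (x : 'rV[R]_N) :
  wgt (shiftj j e x) <= 2 * (1 + e ^+ 2) * wgt x.
Proof.
rewrite /wgt (bigD1 j)//= [in leRHS](bigD1 j)//= shiftjE eqxx mulrA.
apply: ler_pM; [exact: bump_ge0|by apply: prodr_ge0 => k _; exact: bump_ge0|
  exact: bump_shift|].
by apply: ler_prod => k kj; rewrite bump_ge0 shiftjE (negbTE kj) addr0 lexx.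
Qed.

Lemma rint_shift N (f : 'rV[R]_N -> R) j e K : scont f ->
  (forall x, `|f x| <= K * wgt x) ->
  rint (fun x => f (shiftj j e x)) = rint f.
Proof.
elim: N f j K => [|N IH] f j K cf fK; first by case: j.
rewrite [LHS]rintS [RHS]rintS.
case: (unliftP ord0 j) => [k ->|->].
- congr rI; apply/funext => t.
  have ct := @scont_slice _ f t cf.
  rewrite -(IH (slice f t) k (K * bump t) ct (slice_dom _ fK)).
  congr rint; apply/funext => y; congr f.
  apply/rowP => l; rewrite shiftjE.
  case: (unliftP ord0 l) => [m ->|->]; last by rewrite !row_mx_ord0 addr0.
  by rewrite !row_mx_lift0 shiftjE (inj_eq (@lift_inj _ _)).
- rewrite -(rI_shift e (continuous_slice cf fK) (fun t => bound_slice t cf fK)).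
  congr rI; apply/funext => t; congr rint; apply/funext => y; congr f.
  apply/rowP => l; rewrite shiftjE.
  case: (unliftP ord0 l) => [m ->|->]; last by rewrite !row_mx_ord0 !mxE eqxx.
  by rewrite !row_mx_lift0 addr0.
Qed.

End Rint.

(** * Directional derivatives, Taylor remainders, integrals of derivatives *)

Section Calculus.
Context {R : realType}.

Lemma is_derive_line (V : normedModType R) (f : V -> R) (x v : V) (t l : R) :
  is_derive (x + t *: v) v f l <-> is_derive t 1 (fun s => f (x + s *: v)) l.
Proof.
have E : (fun h : R => h^-1 *: ((f \o shift (x + t *: v)) (h *: v) - f (x + t *: v)))
  = (fun h : R => h^-1 *: (((fun s : R => f (x + s *: v)) \o shift t) (h *: (1 : R))
       - f (x + t *: v))).
  apply/funext => h /=; congr (_ *: (f _ - _)).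
  by rewrite scalerDl scaler1 addrCA addrA.
split=> -[h1 h2]; split.
- by move: h1; rewrite /derivable E.
- by move: h2; rewrite /derive E.
- by rewrite /derivable E.
- by rewrite /derive E.
Qed.

Lemma is_derive_cvg (V : normedModType R) (f : V -> R) (x v : V) (l : R) :
  is_derive x v f l ->
  (fun h : R => h^-1 * (f (x + h *: v) - f x)) h @[h --> 0^'] --> l.
Proof.
move=> [h1 h2]; rewrite -h2.
have -> : (fun h : R => h^-1 * (f (x + h *: v) - f x)) =
   (fun h : R => h^-1 *: ((f \o shift x) (h *: v) - f x)).
  by apply/funext => h /=; rewrite (addrC x).
exact: h1.
Qed.

Lemma cvg_is_derive (V : normedModType R) (f : V -> R) (x v : V) (l : R) :
  (fun h : R => h^-1 * (f (x + h *: v) - f x)) h @[h --> 0^'] --> l ->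
  is_derive x v f l.
Proof.
have -> : (fun h : R => h^-1 * (f (x + h *: v) - f x)) =
   (fun h : R => h^-1 *: ((f \o shift x) (h *: v) - f x)).
  by apply/funext => h /=; rewrite (addrC x).
by move=> h; split; [apply/cvg_ex; exists l|exact: cvg_lim].
Qed.

Lemma mvt_dir (V : normedModType R) (f f' : V -> R) (x v : V) (t : R) :
  (forall y, is_derive y v f (f' y)) -> 0 <= t ->
  exists2 c, 0 <= c <= t & f (x + t *: v) - f x = t * f' (x + c *: v).
Proof.
move=> df; rewrite le_eqVlt => /predU1P[<-|t0].
  by exists 0; rewrite ?lexx// scale0r addr0 subrr mul0r.
have d1 (s : R) : is_derive s 1 (fun s : R => f (x + s *: v)) (f' (x + s *: v)).
  by apply: (iffLR (is_derive_line f x v s _)); exact: df.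
have [|c] := @MVT R (fun s : R => f (x + s *: v)) (fun s : R => f' (x + s *: v)) 0 t t0
  (fun s _ => d1 s).
  apply: derivable_within_continuous => s _; by case: (d1 s).
rewrite in_itv /= => /andP[c0 ct] h; exists c; first by rewrite !ltW.
by move: h; rewrite scale0r addr0 subr0 mulrC.
Qed.

Lemma mvt_dirN (V : normedModType R) (f f' : V -> R) (x v : V) (t : R) :
  (forall y, is_derive y v f (f' y)) ->
  exists2 c, `|c| <= `|t| & f (x + t *: v) - f x = t * f' (x + c *: v).
Proof.
move=> df; case: (leP 0 t) => [t0|t0].
  have [c /andP[c0 ct] h] := mvt_dir x df t0.
  by exists c => //; rewrite !ger0_norm.
have t0' : 0 <= - t by rewrite oppr_ge0 ltW.
have [c /andP[c0 ct] h] := mvt_dir (x + t *: v) df t0'.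
exists (c + t).
  by rewrite (ltr0_norm t0) ler_norml opprK; apply/andP; split; lra.
move: h; rewrite -!addrA -!scalerDl subrr scale0r addr0 (addrC t c) => h.
by rewrite -opprB h mulNr opprK.
Qed.

(** The mean value theorem is applied twice, which loses the factor 1/2 of the sharp remainder. *)
Lemma taylor1 (V : normedModType R) (f f' f'' : V -> R) (x v : V) (B t : R) :
  (forall y, is_derive y v f (f' y)) -> (forall y, is_derive y v f' (f'' y)) ->
  (forall y, `|f'' y| <= B) ->
  `|f (x + t *: v) - f x - t * f' x| <= B * t ^+ 2.
Proof.
move=> df df' fB; have [c ct ->] := mvt_dirN x t df.
rewrite -mulrBr; have [c' _ ->] := mvt_dirN x c df'.
rewrite !normrM mulrA mulrC -(real_normK (num_real t)) expr2.
by apply: ler_pM => //; rewrite ?mulr_ge0// ler_wpM2l.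
Qed.

(** By translation invariance every difference quotient of [F] has integral zero; dominated
    convergence carries this to the derivative. *)
Lemma rint_derive0 N (F F' : 'rV[R]_N -> R) j K : scont F -> scont F' ->
  (forall x, `|F x| <= K * wgt x) -> (forall x, `|F' x| <= K * wgt x) ->
  (forall x, is_derive x (delta_mx 0 j) F (F' x)) ->
  rint F' = 0.
Proof.
move=> cF cF' FK F'K dF.
pose e_ (n : nat) : R := n.+1%:R^-1.
have e0 n : 0 < e_ n by rewrite invr_gt0.
have e1 n : e_ n <= 1 by rewrite invf_le1 ?ler1n.
pose q n x := (e_ n)^-1 * (F (shiftj j (e_ n) x) + (-1) * F x).
have cs n : scont (fun x => F (shiftj j (e_ n) x)) by exact: scont_shift.
have cN : scont (fun x => -1 * F x) by apply: scontM => //; exact: scont_cst.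
have bs n x : `|F (shiftj j (e_ n) x)| <= (K * (2 * (1 + e_ n ^+ 2))) * wgt x.
  rewrite (le_trans (FK _))// -mulrA ler_wpM2l ?(dom_ge0 FK)//; exact: wgt_shift.
have bN x : `|-1 * F x| <= K * wgt x by rewrite mulN1r normrN.
(* The quotient is a value of [F'] at a point shifted by at most 1, and such a shift costs at most 2
   (1 + 1) in the weight. *)
have bq n x : `|q n x| <= (K * 4) * wgt x.
  rewrite /q mulN1r; have [c ce ->] := mvt_dirN x (e_ n) dF.
  rewrite mulrA mulVf ?gt_eqF// mul1r (le_trans (F'K _))// -mulrA.
  rewrite ler_wpM2l ?(dom_ge0 FK)// (le_trans (wgt_shift _ _ _))//.
  rewrite ler_wpM2r ?wgt_ge0//.
  have : c ^+ 2 <= 1.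
    rewrite -(real_normK (num_real c)) expr_le1// (le_trans ce)//.
    by rewrite (ger0_norm (ltW (e0 n))).
  lra.
have cq n : scont (q n).
  by apply: scontM; [exact: scont_cst|exact: scontD].
have q0 n : rint (q n) = 0.
  rewrite (@rintZ _ _ _ _ (K * (2 * (1 + e_ n ^+ 2)) + K)).
  - rewrite (@rintD _ _ _ _ (K * (2 * (1 + e_ n ^+ 2))) K)//.
    by rewrite (rint_shift _ _ cF FK) (rintZ _ cF FK) mulN1r subrr mulr0.
  - exact: scontD.
  - by move=> x; rewrite mulrDl (le_trans (ler_normD _ _))// lerD.
have : rint (q n) @[n --> \oo] --> rint F'.
  apply: (rint_cvg cq cF' bq) => x.
  have /cvgrPdist_lt h := is_derive_cvg (dF x).
  apply/cvgrPdist_lt => e ee; have {h} := h e ee.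
  rewrite /= => -[d /= d0 h].
  have : e_ n @[n --> \oo] --> (0 : R).
    have := @cvg_harmonic R; exact.
  move/cvgrPdist_lt => /(_ d d0); apply: filterS => n; rewrite /= => hn.
  rewrite /q mulN1r; apply: h => //=; exact: lt0r_neq0.
under eq_fun do rewrite q0.
by move=> h; rewrite -(cvg_lim _ h)// lim_cst.
Qed.

End Calculus.

(** * Complex absolute value and complex limits *)

Section ComplexAbs.
Context {R : realType}.
Implicit Types z w : R[i].

Lemma cabsE z : cabs z = Num.sqrt (complex.Re z ^+ 2 + complex.Im z ^+ 2).
Proof. by rewrite /cabs normc_def. Qed.

Lemma cabs_normC z : `|z| = (cabs z)%:C.
Proof. by rewrite cabsE normc_def. Qed.

Lemma cabs_ge0 z : 0 <= cabs z. Proof. by rewrite cabsE sqrtr_ge0. Qed.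

Lemma cabsM z w : cabs (z * w) = cabs z * cabs w.
Proof. by apply/(@complexI R); rewrite rmorphM -!cabs_normC normrM. Qed.

Lemma cabsD z w : cabs (z + w) <= cabs z + cabs w.
Proof. by rewrite -lecR rmorphD -!cabs_normC ler_normD. Qed.

Lemma cabsN z : cabs (- z) = cabs z.
Proof. by rewrite /cabs normrN. Qed.

Lemma cabsBC z w : cabs (z - w) = cabs (w - z).
Proof. by rewrite /cabs distrC. Qed.

Lemma cabs0 : cabs (0 : R[i]) = 0. Proof. by rewrite /cabs normr0. Qed.

Lemma cabs1 : cabs (1 : R[i]) = 1. Proof. by rewrite /cabs normr1. Qed.

Lemma cabs_eq0 z : cabs z = 0 -> z = 0.
Proof. by move=> z0; apply/eqP; rewrite -normr_eq0 cabs_normC z0. Qed.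

Lemma cabsR (r : R) : cabs r%:C = `|r|.
Proof. by rewrite cabsE /= expr0n addr0 sqrtr_sqr. Qed.

Lemma Re_le_cabs z : `|complex.Re z| <= cabs z.
Proof. by rewrite cabsE -sqrtr_sqr ler_wsqrtr// lerDl sqr_ge0. Qed.

Lemma Im_le_cabs z : `|complex.Im z| <= cabs z.
Proof. by rewrite cabsE -sqrtr_sqr ler_wsqrtr// lerDr sqr_ge0. Qed.

Lemma cabs_leReIm z : cabs z <= `|complex.Re z| + `|complex.Im z|.
Proof.
rewrite cabsE -[leRHS]ger0_norm ?addr_ge0// -sqrtr_sqr ler_wsqrtr//.
rewrite sqrrD !real_normK ?num_real//.
by rewrite lerD2r lerDl mulrn_wge0// mulr_ge0.
Qed.

Lemma cabs_cis t : cabs (cis t : R[i]) = 1.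
Proof. by rewrite cabsE /= cos2Dsin2 sqrtr1. Qed.

Lemma cisD (s t : R) : cis (s + t) = cis s * cis t.
Proof. by rewrite /cis cosD sinD; simpc; congr (_ +i* _); rewrite addrC. Qed.

Lemma cis0 : cis (0 : R) = 1.
Proof. by rewrite /cis cos0 sin0. Qed.

Lemma cabs_sum I (r : seq I) (P : pred I) (F : I -> R[i]) :
  cabs (\sum_(i <- r | P i) F i) <= \sum_(i <- r | P i) cabs (F i).
Proof.
elim/big_ind2 : _ => [|x a y b xa yb|//]; first by rewrite cabs0.
by rewrite (le_trans (cabsD _ _))// lerD.
Qed.

Lemma cabs_prod I (r : seq I) (P : pred I) (F : I -> R[i]) :
  cabs (\prod_(i <- r | P i) F i) = \prod_(i <- r | P i) cabs (F i).
Proof. by apply: big_morph; [exact: cabsM|exact: cabs1]. Qed.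

Lemma ReD z w : complex.Re (z + w) = complex.Re z + complex.Re w.
Proof. by case: z; case: w. Qed.

Lemma ImD z w : complex.Im (z + w) = complex.Im z + complex.Im w.
Proof. by case: z; case: w. Qed.

Lemma ReN z : complex.Re (- z) = - complex.Re z. Proof. by case: z. Qed.

Lemma ImN z : complex.Im (- z) = - complex.Im z. Proof. by case: z. Qed.

Lemma ReM z w : complex.Re (z * w) =
  complex.Re z * complex.Re w - complex.Im z * complex.Im w.
Proof. by case: z; case: w. Qed.

Lemma ImM z w : complex.Im (z * w) =
  complex.Re z * complex.Im w + complex.Im z * complex.Re w.
Proof. by case: z => a b; case: w => c d /=; rewrite addrC. Qed.

Lemma complex_eqP z w : complex.Re z = complex.Re w -> complex.Im z = complex.Im w ->
  z = w.
Proof. by case: z => a b; case: w => c d /= -> ->. Qed.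

Section Ccvg.
Context {I : Type} (F : set_system I) {FF : Filter F}.
Implicit Types u v : I -> R[i].

Definition ccvg u z := cabs (u i - z) @[i --> F] --> (0 : R).

Lemma ccvgP u z :
  ccvg u z <-> forall e, 0 < e -> \forall i \near F, cabs (u i - z) < e.
Proof.
split=> [/cvgrPdist_lt h e e0|h].
  by apply: filterS (h e e0) => i; rewrite sub0r normrN ger0_norm ?cabs_ge0.
apply/cvgrPdist_lt => e e0; apply: filterS (h e e0) => i.
by rewrite sub0r normrN ger0_norm ?cabs_ge0.
Qed.

Lemma ccvg_cst z : ccvg (fun=> z) z.
Proof. by apply/ccvgP => e e0; apply: nearW => i; rewrite subrr cabs0. Qed.

Lemma ccvg_squeeze u z (b : I -> R) : (forall i, cabs (u i - z) <= b i) ->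
  b i @[i --> F] --> 0 -> ccvg u z.
Proof.
move=> ub /cvgrPdist_lt h; apply/ccvgP => e e0; apply: filterS (h e e0) => i.
rewrite sub0r normrN; apply: le_lt_trans; apply: le_trans (ub i) _; exact: ler_norm.
Qed.

Lemma ccvg_ext u v z : (forall i, u i = v i) -> ccvg u z -> ccvg v z.
Proof. by move=> /funext ->. Qed.

Lemma ccvgD u v z w : ccvg u z -> ccvg v w -> ccvg (fun i => u i + v i) (z + w).
Proof.
move=> uz vw; apply: (ccvg_squeeze (b := fun i => cabs (u i - z) + cabs (v i - w))).
  by move=> i; rewrite opprD addrACA cabsD.
by rewrite -[X in _ --> X](addr0 (0 : R)); exact: cvgD.
Qed.

Lemma ccvgZ a u z : ccvg u z -> ccvg (fun i => a * u i) (a * z).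
Proof.
move=> uz; apply: (ccvg_squeeze (b := fun i => cabs a * cabs (u i - z))).
  by move=> i; rewrite -mulrBr cabsM.
by rewrite -[X in _ --> X](mulr0 (cabs a)); apply: cvgM => //; exact: cvg_cst.
Qed.

Lemma ccvgB u v z w : ccvg u z -> ccvg v w -> ccvg (fun i => u i - v i) (z - w).
Proof.
move=> uz vw; have := ccvgD uz (ccvgZ (-1) vw).
by rewrite mulN1r; apply: ccvg_ext => i; rewrite mulN1r.
Qed.

Lemma ccvgM u v z w : ccvg u z -> ccvg v w -> ccvg (fun i => u i * v i) (z * w).
Proof.
move=> uz vw.
apply: (ccvg_squeeze (b := fun i => cabs (u i - z) * cabs (v i - w) +
    cabs w * cabs (u i - z) + cabs z * cabs (v i - w))).
  move=> i; rewrite (_ : u i * v i - z * w =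
    (u i - z) * (v i - w) + w * (u i - z) + z * (v i - w)); last by ring.
  by rewrite !(le_trans (cabsD _ _))// !cabsM lerD2r (le_trans (cabsD _ _))// !cabsM.
have h : cabs (u i - z) * cabs (v i - w) +
    cabs w * cabs (u i - z) + cabs z * cabs (v i - w) @[i --> F] -->
    0 * 0 + cabs w * 0 + cabs z * (0 : R).
  by apply: cvgD; [apply: cvgD|]; apply: cvgM => //; exact: cvg_cst.
by move: h; rewrite !mulr0 !addr0.
Qed.

Lemma ccvg_sum J (r : seq J) (u : J -> I -> R[i]) (z : J -> R[i]) :
  (forall j, ccvg (u j) (z j)) ->
  ccvg (fun i => \sum_(j <- r) u j i) (\sum_(j <- r) z j).
Proof.
move=> uz; elim: r => [|j r IH].
  by rewrite big_nil; apply: ccvg_ext (ccvg_cst 0) => i; rewrite big_nil.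
rewrite big_cons; apply: ccvg_ext (ccvgD (uz j) IH) => i.
by rewrite big_cons.
Qed.

Lemma ccvgReIm u z : ccvg u z <->
  (complex.Re (u i) @[i --> F] --> complex.Re z) /\
  (complex.Im (u i) @[i --> F] --> complex.Im z).
Proof.
split=> [/ccvgP h|[h1 h2]].
  split; apply/cvgrPdist_lt => e e0; apply: filterS (h e e0) => i; apply: le_lt_trans.
    by rewrite cabsBC -ReN -ReD Re_le_cabs.
  by rewrite cabsBC -ImN -ImD Im_le_cabs.
apply: (ccvg_squeeze (b := fun i => `|complex.Re (u i) - complex.Re z| +
   `|complex.Im (u i) - complex.Im z|)).
  by move=> i; rewrite -ReN -ImN -ReD -ImD cabs_leReIm.
rewrite -[X in _ --> X](addr0 (0 : R)); apply: cvgD.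
  have : `|complex.Re (u i) - complex.Re z| @[i --> F] --> `|complex.Re z - complex.Re z|.
    by apply: cvg_norm; apply: cvgB => //; exact: cvg_cst.
  by rewrite subrr normr0.
have : `|complex.Im (u i) - complex.Im z| @[i --> F] --> `|complex.Im z - complex.Im z|.
  by apply: cvg_norm; apply: cvgB => //; exact: cvg_cst.
by rewrite subrr normr0.
Qed.

End Ccvg.

Section CcvgProper.
Context {I : Type} (F : set_system I) {FF : ProperFilter F}.
Implicit Types u v : I -> R[i].

Lemma ccvg_le u z (b : R) : (\forall i \near F, cabs (u i) <= b) -> ccvg F u z -> cabs z <= b.
Proof.
move=> ub /ccvgP uz; apply/ler_addgt0Pr => e e0.
have : \forall i \near F, cabs z <= b + e.
  near=> i; rewrite (_ : z = u i + (z - u i)); last by rewrite addrC subrK.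
  rewrite (le_trans (cabsD _ _))// lerD//; first by near: i.
  by rewrite cabsBC ltW//; near: i; exact: uz.
by move=> /filter_ex[].
Unshelve. all: by end_near. Qed.

Lemma ccvg_unique u z w : ccvg F u z -> ccvg F u w -> z = w.
Proof.
move=> uz uw; apply/eqP; rewrite -subr_eq0; apply/eqP/cabs_eq0/eqP.
rewrite eq_le cabs_ge0 andbT.
have h : ccvg F (fun i => u i - u i) (z - w) by exact: ccvgB.
have : \forall i \near F, cabs (u i - u i) <= 0; last by move/ccvg_le; apply.
by apply: nearW => i; rewrite subrr cabs0.
Qed.

End CcvgProper.

End ComplexAbs.

(** * Normal families of smooth functions *)

Section RowNorm.
Context {R : realType}.

Lemma coord_le_norm N (x : 'rV[R]_N) j : `|x 0 j| <= `|x|.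
Proof.
have -> : `|x| = mx_norm x by [].
by rewrite mx_normrE; apply/bigmax_geP; right => /=; exists (0, j).
Qed.

Lemma norm_le_coord N (x : 'rV[R]_N) r : 0 <= r -> (forall j, `|x 0 j| <= r) -> `|x| <= r.
Proof.
have -> : `|x| = mx_norm x by [].
move=> r0 h; rewrite mx_normrE; apply/bigmax_leP; split => //= -[i j] _ /=.
by rewrite ord1.
Qed.

Lemma cwcvg_norm N (u : nat -> 'rV[R]_N) x : cwcvg u x -> u n @[n --> \oo] --> x.
Proof.
move=> ux; apply/cvgrPdist_le => e e0.
have : \forall n \near \oo, forall j, `|x 0 j - u n 0 j| <= e.
  apply: filter_forall => j.
  by have /cvgrPdist_le := ux j; exact.
apply: filterS => n h; apply: norm_le_coord; first exact: ltW.
by move=> j; rewrite !mxE.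
Qed.

Lemma continuous_scont N (f : 'rV[R]_N -> R) : continuous f -> scont f.
Proof. by move=> cf u x /cwcvg_norm ux; apply: continuous_cvg => //; exact: cf. Qed.

Lemma lip_dir N (a : 'rV[R]_N -> R) (a' : 'I_N -> 'rV[R]_N -> R) (B : R) :
  (forall j x, is_derive x (delta_mx 0 j) a (a' j x)) ->
  (forall j x, `|a' j x| <= B) ->
  forall x y, `|a x - a y| <= B *+ N * `|x - y|.
Proof.
move=> da aB x y.
(* The path from y to x changes one coordinate at a time, so each step is controlled by a single
   partial derivative. *)
pose z k : 'rV[R]_N := \row_j (if (j < k)%N then x 0 j else y 0 j).
suff H k : (k <= N)%N -> `|a (z k) - a y| <= B *+ k * `|x - y|.
  have := H N (leqnn _); congr (`|a _ - _| <= _).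
  by apply/rowP => j; rewrite mxE ltn_ord.
elim: k => [_|k IH kN].
  rewrite (_ : z 0%N = y) ?subrr ?normr0 ?mul0r//.
  by apply/rowP => j; rewrite mxE.
rewrite (_ : _ - _ = (a (z k.+1) - a (z k)) + (a (z k) - a y)); last by rewrite addrA subrK.
rewrite (le_trans (ler_normD _ _))// mulrSr mulrDl addrC lerD ?IH ?(ltnW kN)//.
pose j := Ordinal kN.
have -> : z k.+1 = z k + (x 0 j - y 0 j) *: delta_mx 0 j.
  apply/rowP => i; rewrite !mxE eqxx /=.
  have [->|ij] := eqVneq i j; first by rewrite ltnSn ltnn /= mulr1 addrC subrK.
  by rewrite mulr0 addr0 ltnS leq_eqVlt (negbTE (ij : (i != k :> nat))).
have [c _ ->] := mvt_dirN (z k) (x 0 j - y 0 j) (da j).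
rewrite normrM mulrC ler_pM//.
by have := coord_le_norm (x - y) j; rewrite !mxE.
Qed.

End RowNorm.

Section PartialDerivatives.
Context {R : realType} {N : nat}.
Implicit Types (f g : 'rV[R]_N -> R[i]) (x : 'rV[R]_N).

Definition is_pd j f x (l : R[i]) :=
  is_derive x (delta_mx 0 j) (fun y => complex.Re (f y)) (complex.Re l) /\
  is_derive x (delta_mx 0 j) (fun y => complex.Im (f y)) (complex.Im l).

Lemma is_pd_pderivable j f x l : is_pd j f x l -> pderivable j f x.
Proof. by move=> [[h1 _] [h2 _]]; split. Qed.

Lemma is_pd_pderiv j f x l : is_pd j f x l -> pderiv j f x = l.
Proof. by move=> [[_ h1] [_ h2]]; rewrite /pderiv h1 h2; case: l {h1 h2}. Qed.

Lemma pderivable_is_pd j f x : pderivable j f x -> is_pd j f x (pderiv j f x).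
Proof. by move=> [h1 h2]; split; rewrite /pderiv /=; exact: derivableP. Qed.

Lemma is_pd_cst j c x : is_pd j (fun=> c) x 0.
Proof. by split; exact: is_derive_cst. Qed.

Lemma is_pdD j f g x l m : is_pd j f x l -> is_pd j g x m ->
  is_pd j (fun y => f y + g y) x (l + m).
Proof.
move=> [f1 f2] [g1 g2]; split.
  under eq_fun do rewrite ReD; rewrite ReD; exact: is_deriveD.
under eq_fun do rewrite ImD; rewrite ImD; exact: is_deriveD.
Qed.

Lemma is_pdM j f g x l m : is_pd j f x l -> is_pd j g x m ->
  is_pd j (fun y => f y * g y) x (l * g x + f x * m).
Proof.
move=> [f1 f2] [g1 g2]; split.
  under eq_fun do rewrite ReM.
  apply: is_derive_eq; rewrite ReD !ReM /GRing.scale /=; ring.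
under eq_fun do rewrite ImM.
by apply: is_derive_eq; rewrite ImD !ImM /GRing.scale /=; ring.
Qed.

Lemma is_pdZ j a f x l : is_pd j f x l -> is_pd j (fun y => a * f y) x (a * l).
Proof. by move=> fl; have := is_pdM (is_pd_cst j a x) fl; rewrite mul0r add0r. Qed.

(** Smoothness is proved by supplying all iterated derivatives at once, indexed by the word of
    differentiations. *)
Lemma smooth_family f (h : seq 'I_N -> 'rV[R]_N -> R[i]) : h [::] = f ->
  (forall s, continuous (fun x => complex.Re (h s x))) ->
  (forall s, continuous (fun x => complex.Im (h s x))) ->
  (forall j s x, is_pd j (h s) x (h (j :: s) x)) ->
  smooth f /\ forall s, foldr (@pderiv R N) f s = h s.
Proof.
move=> h0 cr ci hd.
have E s : foldr (@pderiv R N) f s = h s.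
  elim: s => [//|j s IH] /=; rewrite IH; apply/funext => x; exact: is_pd_pderiv.
split=> // s; rewrite E; split => //.
by move=> j x; apply: is_pd_pderivable; exact: hd.
Qed.

Lemma smooth_pd f j s x : smooth f ->
  is_pd j (foldr (@pderiv R N) f s) x (foldr (@pderiv R N) f (j :: s) x).
Proof. by move=> sf; have [_ _ h] := sf s; exact/pderivable_is_pd. Qed.

Lemma continuous_lin3 (T : topologicalType) (u v w : T -> R) (a b : R) :
  continuous u -> continuous v -> continuous w ->
  continuous (fun p : T => a * u p + b * v p + w p).
Proof.
move=> cu cv cw p; apply: cvgD; last exact: cw.
by apply: cvgD; apply: cvgM; [exact: cvg_cst|exact: cu|exact: cvg_cst|exact: cv].
Qed.

Lemma smooth_lin a f g : smooth f -> smooth g ->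
  smooth (fun x => a * f x + g x) /\
  forall s, foldr (@pderiv R N) (fun x => a * f x + g x) s =
    (fun x => a * foldr (@pderiv R N) f s x + foldr (@pderiv R N) g s x).
Proof.
move=> sf sg; apply: smooth_family => //.
- move=> s; have [f1 f2 _] := sf s; have [g1 _ _] := sg s.
  under eq_fun do rewrite ReD ReM -mulNr.
  exact: continuous_lin3.
- move=> s; have [f1 f2 _] := sf s; have [_ g2 _] := sg s.
  under eq_fun do rewrite ImD ImM.
  exact: continuous_lin3.
- by move=> j s x; apply: is_pdD; [apply: is_pdZ|]; exact: smooth_pd.
Qed.

End PartialDerivatives.

(** * Derivatives of pointwise limits *)

Section LimitDerivative.
Context {R : realType} (V : normedModType R).
Implicit Types (x v y : V).

Lemma is_derive_sq (a : V -> R) x v (b B : R) :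
  (forall t : R, `|a (x + t *: v) - a x - t * b| <= B * t ^+ 2) -> is_derive x v a b.
Proof.
move=> h; apply: cvg_is_derive; apply/cvgrPdist_lt => e e0.
have B0 : 0 <= B.
  by have := h 1; rewrite expr1n mulr1; exact: le_trans.
have d0 : 0 < e / (B + 1) by rewrite divr_gt0// ltr_wpDl.
exists (e / (B + 1)) => //= t /=; rewrite sub0r normrN => td t0.
have tn : 0 < `|t| by rewrite normr_gt0.
rewrite distrC (_ : _ - b = t^-1 * (a (x + t *: v) - a x - t * b)); last first.
  by rewrite [RHS]mulrBr mulKf.
rewrite normrM normfV mulrC ltr_pdivrMr// (le_lt_trans (h t))//.
rewrite -(real_normK (num_real t)) expr2 mulrA ltr_pM2r//.
rewrite ltr_pdivlMr in td; last by rewrite ltr_wpDl.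
by apply: le_lt_trans td; rewrite mulrC ler_wpM2l// lerDl.
Qed.

(** Interpolation between a function and its second derivative: a' differs from a difference
    quotient of step t by at most B t, and for fixed t the quotient tends to zero. An arbitrary
    filter is allowed so that pairs of indices can be used in [deriv_cauchy]. *)
Lemma deriv_small I (F : set_system I) {FF : Filter F} (a a' a'' : I -> V -> R) x v (B : R) :
  (forall i y, is_derive y v (a i) (a' i y)) ->
  (forall i y, is_derive y v (a' i) (a'' i y)) ->
  (forall i y, `|a'' i y| <= B) ->
  (forall y, a i y @[i --> F] --> 0) -> a' i x @[i --> F] --> 0.
Proof.
move=> da da' aB a0; apply/cvgrPdist_lt => e e0.
pose t : R := e / (2 * (`|B| + 1)).
have t0 : 0 < t by rewrite divr_gt0// mulr_gt0// ltr_wpDl.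
have tB : `|B| * t < e / 2.
  rewrite /t invfM !mulrA ltr_pdivrMr ?ltr_wpDl//.
  have := normr_ge0 B; nra.
have et : 0 < e * t / 4 by rewrite divr_gt0// mulr_gt0.
have /cvgrPdist_lt /(_ _ et) h1 := a0 (x + t *: v).
have /cvgrPdist_lt /(_ _ et) h2 := a0 x.
near=> i.
have := taylor1 x t (da i) (da' i) (aB i).
have : `|a i (x + t *: v)| < e * t / 4.
  by rewrite -normrN -sub0r; near: i.
have : `|a i x| < e * t / 4 by rewrite -normrN -sub0r; near: i.
rewrite sub0r normrN => H1 H2 H3.
have H4 : t * `|a' i x| < t * e.
  rewrite -{1}(gtr0_norm t0) -normrM.
  rewrite (_ : t * a' i x = - (a i (x + t *: v) - a i x - t * a' i x)
     + (a i (x + t *: v) - a i x)); last by ring.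
  rewrite (le_lt_trans (ler_normD _ _))// normrN.
  rewrite (_ : t * e = e / 2 * t + (e * t / 4 + e * t / 4)); last by field.
  apply: ltrD; last by rewrite (le_lt_trans (ler_normB _ _))// ltrD.
  apply: le_lt_trans H3 _; rewrite expr2 mulrA ltr_pM2r//.
  by apply: le_lt_trans tB; rewrite (ler_wpM2r (ltW t0))// ler_norm.
by rewrite ltr_pM2l in H4.
Unshelve. all: by end_near. Qed.

Lemma deriv_cauchy (a a' a'' : nat -> V -> R) (al : V -> R) x v (B : R) :
  (forall i y, is_derive y v (a i) (a' i y)) ->
  (forall i y, is_derive y v (a' i) (a'' i y)) ->
  (forall i y, `|a'' i y| <= B) ->
  (forall y, a i y @[i --> \oo] --> al y) -> cvg (a' i x @[i --> \oo]).
Proof.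
move=> da da' aB a0.
have h : (fun ij : nat * nat => a' ij.1 x - a' ij.2 x) ij @[ij --> (\oo, \oo)] --> 0.
  apply: (@deriv_small _ _ _ (fun ij y => a ij.1 y - a ij.2 y)
    (fun ij y => a' ij.1 y - a' ij.2 y) (fun ij y => a'' ij.1 y - a'' ij.2 y) x v (B + B)).
  - by move=> ij y; rewrite (le_trans (ler_normB _ _))// lerD.
  - move=> y; rewrite -(subrr (al y)); apply: cvgB.
      by apply: (cvg_comp _ (fun n => a n y) cvg_fst); exact: a0.
    by apply: (cvg_comp _ (fun n => a n y) cvg_snd); exact: a0.
apply: cauchy_cvg; apply/cauchy_ballP => e e0.
move/cvgrPdist_lt : h => /(_ e e0); rewrite /= !near_simpl.
case=> -[P Q] [PP QQ] PQ; exists (P, Q) => // -[i j] ij.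
by have := PQ (i, j) ij; rewrite /= sub0r normrN.
Qed.

Lemma lip_continuous (u : V -> R) (L : R) :
  (forall x y : V, `|u x - u y| <= L * `|x - y|) -> continuous u.
Proof.
move=> uL x; apply/cvgrPdist_lt => e e0.
have L1 : 0 < `|L| + 1 by rewrite ltr_wpDl.
have d0 : 0 < e / (`|L| + 1) by rewrite divr_gt0.
near=> y; apply: le_lt_trans (uL x y) _.
apply: (@le_lt_trans _ _ ((`|L| + 1) * `|x - y|)).
  by rewrite ler_wpM2r// (le_trans (ler_norm _))// lerDl.
rewrite mulrC -ltr_pdivlMr//; near: y.
Unshelve. all: by end_near. Qed.

End LimitDerivative.

Section Montel.
Context {R : realType} {N : nat}.
Implicit Types (f g : 'rV[R]_N -> R[i]) (x : 'rV[R]_N) (theta C M : R).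

Notation dd f s := (foldr (@pderiv R N) f s).

Definition gbd theta (k : nat) : R := k`!%:R `^ theta.

Lemma gbd_gt0 theta k : 0 < gbd theta k.
Proof. by rewrite powR_gt0// ltr0n fact_gt0. Qed.

Lemma gbd_ge1 theta k : 0 <= theta -> 1 <= gbd theta k.
Proof.
move=> t0; have <- : 1 `^ theta = 1 :> R by rewrite powR1.
by rewrite ge0_ler_powR// ?nnegrE ?ler0n// ler1n fact_gt0.
Qed.

(* Total degrees, and derivatives in any order: this is equivalent to
   finiteness of [gs_norm] up to changing the constants, and closed under
   pointwise limits. *)
Definition gsb theta C M f := smooth f /\ forall m (s : seq 'I_N) x,
  `|x| ^+ m * cabs (dd f s x) <= M * (C ^+ (m + size s) * gbd theta (m + size s)).

Lemma gsb_ge0 theta C M f : 0 < C -> gsb theta C M f -> 0 <= M.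
Proof.
move=> C0 [_ /(_ 0%N [::] 0)]; rewrite expr0 mul1r => h.
have := le_trans (cabs_ge0 _) h; by rewrite pmulr_lge0// mulr_gt0 ?gbd_gt0// exprn_gt0.
Qed.

Lemma gsb_lin theta C M M' a f g : gsb theta C M f -> gsb theta C M' g ->
  gsb theta C (cabs a * M + M') (fun x => a * f x + g x).
Proof.
move=> [sf fM] [sg gM']; have [sl E] := smooth_lin a sf sg; split=> // m s x.
rewrite E (le_trans (ler_wpM2l _ (cabsD _ _))) ?exprn_ge0//.
rewrite mulrDr mulrDl lerD// cabsM mulrCA -!mulrA ler_wpM2l ?cabs_ge0//; exact: fM.
Qed.

Lemma smooth0 : smooth (fun _ : 'rV[R]_N => 0 : R[i]) /\
  forall s, dd (fun=> 0) s = fun=> 0.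
Proof.
apply: (@smooth_family R N (fun=> 0) (fun _ _ => 0)) => //.
- by move=> s; exact: cst_continuous.
- by move=> s; exact: cst_continuous.
- by move=> j s x; exact: is_pd_cst.
Qed.

Lemma gsb0 theta C : 0 <= C -> gsb theta C 0 (fun=> 0).
Proof.
move=> C0; have [s0 E] := smooth0; split=> // m s x.
by rewrite E cabs0 mulr0 mul0r.
Qed.

Lemma gsb_le theta C M M' f : 0 <= C -> M <= M' -> gsb theta C M f -> gsb theta C M' f.
Proof.
move=> C0 MM' [sf h]; split=> // m s x; apply: le_trans (h m s x) _.
by rewrite ler_wpM2r// mulr_ge0 ?exprn_ge0// ltW ?gbd_gt0.
Qed.

Lemma gsb_leC theta C C' M f : 0 <= C -> C <= C' -> 0 <= M ->
  gsb theta C M f -> gsb theta C' M f.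
Proof.
move=> C0 CC' M0 [sf h]; split=> // m s x; apply: le_trans (h m s x) _.
rewrite ler_wpM2l// ler_wpM2r ?(ltW (gbd_gt0 _ _))// lerXn2r ?nnegrE//.
exact: le_trans CC'.
Qed.

Lemma gsb_dd theta C M f s x : gsb theta C M f ->
  cabs (dd f s x) <= M * (C ^+ (size s) * gbd theta (size s)).
Proof. by move=> [_ /(_ 0%N s x)]; rewrite expr0 mul1r. Qed.

Lemma gsb_lip theta C M f s x y : gsb theta C M f ->
  cabs (dd f s x - dd f s y) <=
  2 * ((M * (C ^+ (size s).+1 * gbd theta (size s).+1)) *+ N * `|x - y|).
Proof.
move=> Gf; have [sf _] := Gf.
rewrite (le_trans (cabs_leReIm _))// mulr_natl mulr2n lerD//.
- rewrite ReD ReN; apply: (@lip_dir R N (fun x => complex.Re (dd f s x))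
    (fun j x => complex.Re (dd f (j :: s) x))).
    by move=> j z; have [] := smooth_pd j s z sf.
  by move=> j z; rewrite (le_trans (Re_le_cabs _))// (gsb_dd (j :: s) z Gf).
- rewrite ImD ImN; apply: (@lip_dir R N (fun x => complex.Im (dd f s x))
    (fun j x => complex.Im (dd f (j :: s) x))).
    by move=> j z; have [] := smooth_pd j s z sf.
  by move=> j z; rewrite (le_trans (Im_le_cabs _))// (gsb_dd (j :: s) z Gf).
Qed.

(** Bounds on two further derivatives make each derivative converge pointwise ([deriv_cauchy]). The
    limits are Lipschitz, hence continuous, and the quadratic Taylor remainders survive in the
    limit, which identifies the limits as derivatives of each other. *)
Lemma gsb_limit theta C M (f_ : nat -> 'rV[R]_N -> R[i]) f :
  (forall n, gsb theta C M (f_ n)) ->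
  (forall x, ccvg \oo (f_ ^~ x) (f x)) -> gsb theta C M f.
Proof.
move=> Gf ff.
have H s : (forall x, cvg (complex.Re (dd (f_ n) s x) @[n --> \oo])) /\
           (forall x, cvg (complex.Im (dd (f_ n) s x) @[n --> \oo])).
  elim: s => [|j s [IH1 IH2]].
    by split=> x; apply/cvg_ex; have /ccvgReIm [h1 h2] := ff x; eexists; [exact: h1|exact: h2].
  have B n y := gsb_dd (j :: j :: s) y (Gf n).
  split=> x.
  - apply: (@deriv_cauchy R _ (fun n y => complex.Re (dd (f_ n) s y))
      (fun n y => complex.Re (dd (f_ n) (j :: s) y))
      (fun n y => complex.Re (dd (f_ n) (j :: j :: s) y))
      (fun y => lim (complex.Re (dd (f_ n) s y) @[n --> \oo])) x
      (delta_mx 0 j) (M * (C ^+ (size s).+2 * gbd theta (size s).+2))).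
    + by move=> n y; exact: (smooth_pd j s y (Gf n).1).1.
    + by move=> n y; exact: (smooth_pd j (j :: s) y (Gf n).1).1.
    + by move=> n y; exact: le_trans (Re_le_cabs _) (B n y).
    + exact: IH1.
  - apply: (@deriv_cauchy R _ (fun n y => complex.Im (dd (f_ n) s y))
      (fun n y => complex.Im (dd (f_ n) (j :: s) y))
      (fun n y => complex.Im (dd (f_ n) (j :: j :: s) y))
      (fun y => lim (complex.Im (dd (f_ n) s y) @[n --> \oo])) x
      (delta_mx 0 j) (M * (C ^+ (size s).+2 * gbd theta (size s).+2))).
    + by move=> n y; exact: (smooth_pd j s y (Gf n).1).2.
    + by move=> n y; exact: (smooth_pd j (j :: s) y (Gf n).1).2.
    + by move=> n y; exact: le_trans (Im_le_cabs _) (B n y).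
    + exact: IH2.
pose h s x : R[i] := lim (complex.Re (dd (f_ n) s x) @[n --> \oo]) +i*
   lim (complex.Im (dd (f_ n) s x) @[n --> \oo]).
have hc s x : ccvg \oo (fun n => dd (f_ n) s x) (h s x).
  by apply/ccvgReIm; split; [exact: (H s).1|exact: (H s).2].
have h0 : h [::] = f.
  by apply/funext => x; exact: ccvg_unique (hc [::] x) (ff x).
have hlip s x y : cabs (h s x - h s y) <=
    (2 * (M * (C ^+ (size s).+1 * gbd theta (size s).+1) *+ N)) * `|x - y|.
  have hxy : ccvg \oo (fun n => dd (f_ n) s x - dd (f_ n) s y) (h s x - h s y).
    exact: ccvgB.
  apply: (ccvg_le _ hxy); apply: nearW => n.
  by rewrite -mulrA; apply: gsb_lip.
have [sf E] : smooth f /\ forall s, dd f s = h s.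
  apply: smooth_family => //.
  - move=> s; apply: lip_continuous => x y.
    by apply: le_trans (hlip s x y); rewrite -ReN -ReD Re_le_cabs.
  - move=> s; apply: lip_continuous => x y.
    by apply: le_trans (hlip s x y); rewrite -ImN -ImD Im_le_cabs.
  - move=> j s x; pose B := M * (C ^+ (size s).+2 * gbd theta (size s).+2).
    have hB n y : cabs (dd (f_ n) (j :: j :: s) y) <= B by exact: gsb_dd.
    split; apply: (@is_derive_sq _ _ _ _ _ _ B) => t.
    + have hl : `|complex.Re (dd (f_ n) s (x + t *: delta_mx 0 j)) -
         complex.Re (dd (f_ n) s x) - t * complex.Re (dd (f_ n) (j :: s) x)| @[n --> \oo] -->
         `|complex.Re (h s (x + t *: delta_mx 0 j)) -
         complex.Re (h s x) - t * complex.Re (h (j :: s) x)|.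
        apply: cvg_norm; apply: cvgB; last by apply: cvgM; [exact: cvg_cst|exact: (H _).1].
        by apply: cvgB; exact: (H _).1.
      rewrite -(cvg_lim _ hl)//; apply: limr_le; first exact/cvgP/hl.
      apply: nearW => n; apply: (@taylor1 _ _ (fun y => complex.Re (dd (f_ n) s y))
       (fun y => complex.Re (dd (f_ n) (j :: s) y))
       (fun y => complex.Re (dd (f_ n) (j :: j :: s) y))).
      * by move=> y; exact: (smooth_pd j s y (Gf n).1).1.
      * by move=> y; exact: (smooth_pd j (j :: s) y (Gf n).1).1.
      * by move=> y; exact: le_trans (Re_le_cabs _) (hB n y).
    + have hl : `|complex.Im (dd (f_ n) s (x + t *: delta_mx 0 j)) -
         complex.Im (dd (f_ n) s x) - t * complex.Im (dd (f_ n) (j :: s) x)| @[n --> \oo] -->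
         `|complex.Im (h s (x + t *: delta_mx 0 j)) -
         complex.Im (h s x) - t * complex.Im (h (j :: s) x)|.
        apply: cvg_norm; apply: cvgB; last by apply: cvgM; [exact: cvg_cst|exact: (H _).2].
        by apply: cvgB; exact: (H _).2.
      rewrite -(cvg_lim _ hl)//; apply: limr_le; first exact/cvgP/hl.
      apply: nearW => n; apply: (@taylor1 _ _ (fun y => complex.Im (dd (f_ n) s y))
       (fun y => complex.Im (dd (f_ n) (j :: s) y))
       (fun y => complex.Im (dd (f_ n) (j :: j :: s) y))).
      * by move=> y; exact: (smooth_pd j s y (Gf n).1).2.
      * by move=> y; exact: (smooth_pd j (j :: s) y (Gf n).1).2.
      * by move=> y; exact: le_trans (Im_le_cabs _) (hB n y).
split=> // m s x; rewrite E.
have hz : ccvg \oo (fun n => (`|x| ^+ m)%:C * dd (f_ n) s x)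
    ((`|x| ^+ m)%:C * h s x) by exact: ccvgZ.
have := ccvg_le _ hz; rewrite cabsM cabsR ger0_norm ?exprn_ge0//; apply.
by apply: nearW => n; rewrite cabsM cabsR ger0_norm ?exprn_ge0//; apply: (Gf n).2.
Qed.

Lemma gsb_small_dd theta C M I (F : set_system I) {FF : Filter F}
  (e_ : I -> 'rV[R]_N -> R[i]) :
  (forall i, gsb theta C M (e_ i)) -> (forall x, ccvg F (e_ ^~ x) 0) ->
  forall s x, ccvg F (fun i => dd (e_ i) s x) 0.
Proof.
move=> Ge e0; elim=> [|j s IH] x; first exact: e0.
have B i y := gsb_dd (j :: j :: s) y (Ge i).
apply/ccvgReIm; split.
- apply: (@deriv_small R _ _ _ _ (fun n y => complex.Re (dd (e_ n) s y))
    (fun n y => complex.Re (dd (e_ n) (j :: s) y))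
    (fun n y => complex.Re (dd (e_ n) (j :: j :: s) y)) x
    (delta_mx 0 j) (M * (C ^+ (size s).+2 * gbd theta (size s).+2))).
  + by move=> n y; exact: (smooth_pd j s y (Ge n).1).1.
  + by move=> n y; exact: (smooth_pd j (j :: s) y (Ge n).1).1.
  + by move=> n y; exact: le_trans (Re_le_cabs _) (B n y).
  + by move=> y; have /ccvgReIm[] := IH y. 
- apply: (@deriv_small R _ _ _ _ (fun n y => complex.Im (dd (e_ n) s y))
    (fun n y => complex.Im (dd (e_ n) (j :: s) y))
    (fun n y => complex.Im (dd (e_ n) (j :: j :: s) y)) x
    (delta_mx 0 j) (M * (C ^+ (size s).+2 * gbd theta (size s).+2))).
  + by move=> n y; exact: (smooth_pd j s y (Ge n).1).2.
  + by move=> n y; exact: (smooth_pd j (j :: s) y (Ge n).1).2.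
  + by move=> n y; exact: le_trans (Im_le_cabs _) (B n y).
  + by move=> y; have /ccvgReIm[] := IH y. 
Qed.

Lemma ball_compact (r : R) : compact [set x : 'rV[R]_N | `|x| <= r].
Proof.
apply: bounded_closed_compact.
  exists r; split; first exact: num_real.
  by move=> M rM x /= xr; rewrite (le_trans xr)// ltW.
apply: (@preimage_closed _ _ (fun x : 'rV[R]_N => `|x|) [set t | t <= r]).
  by move=> x _; exact: norm_continuous.
exact: closed_le.
Qed.

(** Doubling C gains a factor 2 per order, so all high orders are small at once. The finitely many
    low orders are treated one by one: by compactness on a ball, by one more power of |x| outside
    it. *)
Lemma gsb_small theta C M I (F : set_system I) {FF : Filter F}
  (e_ : I -> 'rV[R]_N -> R[i]) : 0 <= theta -> 0 < C ->
  (forall i, gsb theta C M (e_ i)) -> (forall x, ccvg F (e_ ^~ x) 0) ->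
  forall eta, 0 < eta -> \forall i \near F, gsb theta (2 * C) eta (e_ i).
Proof.
move=> t0 C0 Ge e0 eta eta0.
have ds := gsb_small_dd (FF := FF) Ge e0.
have unif s r eps : 0 < eps ->
    \forall i \near F, forall x, `|x| <= r -> cabs (dd (e_ i) s x) < eps.
  move=> eps0.
  pose L := 2 * (M * (C ^+ (size s).+1 * gbd theta (size s).+1) *+ N).
  have L1 : 0 < `|L| + 1 by rewrite ltr_wpDl.
  have := iffLR (compact_near_coveringP _) (@ball_compact r).
  move=> /(_ I F (fun i x => cabs (dd (e_ i) s x) < eps) FF); apply => x _.
  near=> x' i.
  rewrite (_ : dd (e_ i) s x' = (dd (e_ i) s x' - dd (e_ i) s x) + dd (e_ i) s x);
    last by rewrite subrK.
  rewrite (le_lt_trans (cabsD _ _))// (splitr eps) ltrD//.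
    apply: le_lt_trans (gsb_lip s x' x (Ge i)) _; rewrite mulrA -/L.
    apply: (@le_lt_trans _ _ ((`|L| + 1) * `|x' - x|)).
      by rewrite ler_wpM2r// (le_trans (ler_norm _))// lerDl.
    rewrite mulrC -ltr_pdivlMr//; near: x'.
    apply: (@cvgr_distC_lt _ _ _ _ _ id x); first exact: cvg_id.
    by rewrite !divr_gt0.
  rewrite -[dd _ _ _]subr0; near: i.
  by move/ccvgP: (ds s x); apply; rewrite divr_gt0.
have one (m : nat) s eps : 0 < eps ->
    \forall i \near F, forall x, `|x| ^+ m * cabs (dd (e_ i) s x) <= eps.
  move=> eps0.
  pose B := M * (C ^+ (m.+1 + size s) * gbd theta (m.+1 + size s)).
  (* For |x| > r the moment of order m + 1, bounded by B <= r eps, already yields the claim. *)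
  pose r := 1 + `|B| / eps.
  have r1 : 1 <= r by rewrite lerDl divr_ge0// ltW.
  have r0 : 0 < r by exact: lt_le_trans r1.
  have e' : 0 < eps / r ^+ m by rewrite divr_gt0// exprn_gt0.
  apply: filterS (unif s r _ e') => i hi x.
  case: (leP `|x| r) => xr.
    have := hi x xr; rewrite ltr_pdivlMr ?exprn_gt0// => h.
    rewrite (le_trans _ (ltW h))// mulrC ler_wpM2l ?cabs_ge0//.
    by rewrite lerXn2r ?nnegrE// ltW.
  have := (Ge i).2 m.+1 s x; rewrite -/B exprS -mulrA => h.
  rewrite -(ler_pM2l (lt_trans r0 xr)) (le_trans h)//.
  rewrite (le_trans (ler_norm _))//.
  apply: (@le_trans _ _ (r * eps)); last by rewrite ler_wpM2r// ltW.
  by rewrite /r mulrDl mul1r divfK ?gt_eqF// lerDr ltW.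
(* From total order k on, the factor 2^k gained by doubling C outweighs M / eta. *)
pose k := (Num.truncn (M / eta)).+1.
have Mk : M <= eta * 2 ^+ k.
  rewrite mulrC -ler_pdivrMr// (le_trans (ltW (truncnS_gt _)))//.
  by rewrite -natrX ler_nat ltnW// ltn_expl.
(* A common lower bound for the powers (2 C)^q with q < k, whether 2 C is below or above 1. *)
pose c : R := Num.min 1 (2 * C) ^+ k.
have mn0 : 0 < Num.min 1 (2 * C) by rewrite lt_min ltr01 mulr_gt0.
have mn1 : Num.min 1 (2 * C) <= 1 by rewrite ge_min lexx.
have c0 : 0 < c by rewrite exprn_gt0.
have : \forall i \near F, forall (m l : 'I_k) (s : l.-tuple 'I_N) x,
    `|x| ^+ m * cabs (dd (e_ i) s x) <= eta * c.
  apply: filter_forall => m; apply: filter_forall => l; apply: filter_forall => s.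
  by apply: one; rewrite mulr_gt0.
apply: filterS => i hi; split; first exact: (Ge i).1.
move=> m s x; set q := (m + size s)%N.
case: (ltnP q k) => qk.
  have mk : (m < k)%N by rewrite (leq_ltn_trans _ qk)// leq_addr.
  have lk : (size s < k)%N by rewrite (leq_ltn_trans _ qk)// leq_addl.
  have := hi (Ordinal mk) (Ordinal lk) (in_tuple s) x => /= /le_trans; apply.
  rewrite ler_wpM2l ?(ltW eta0)//.
  rewrite -[leLHS]mulr1 ler_pM// ?gbd_ge1// ?(ltW c0)//.
  apply: (@le_trans _ _ (Num.min 1 (2 * C) ^+ q)).
    by apply: ler_wiXn2l; [exact: ltW|exact: mn1|exact: ltnW].
  by rewrite lerXn2r ?nnegrE ?mulr_ge0 ?(ltW C0) ?(ltW mn0)// ge_min lexx orbT.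
apply: le_trans ((Ge i).2 m s x) _; rewrite -/q exprMn !mulrA ler_pM2r ?gbd_gt0//.
rewrite ler_pM2r ?exprn_gt0// (le_trans Mk)// ler_pM2l//.
by rewrite ler_weXn2l// ler1n.
Unshelve. all: by end_near. Qed.

End Montel.

(** * Wave packets and their derivatives *)

Section PowerBounds.
Context {R : realType}.
Implicit Types (theta r K M t : R).

Lemma exp_coeff_le_expR (x : R) n : 0 <= x -> x ^+ n / n`!%:R <= expR x.
Proof.
move=> x0; case: n => [|n]; first by rewrite expr0 divr1 (le_trans _ (expR_ge1Dx x))// lerDl.
rewrite (le_trans _ (expR_ge1Dxn n x0))// lerDr ler01//.
Qed.

Lemma gbdS theta k : gbd theta k.+1 = k.+1%:R `^ theta * gbd theta k.
Proof. by rewrite /gbd factS natrM powRM. Qed.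

(** The place where theta >= 1/2 enters: two steps of the factorial, raised to the power theta, give
    at least sqrt((q + 2) (q + 1)) >= l, and so pay for one integer factor. *)
Lemma gbd_mulS2 theta l q : 2^-1 <= theta -> (l <= q.+1)%N ->
  l%:R * gbd theta q <= gbd theta q.+2.
Proof.
move=> t0 lq; rewrite !gbdS mulrA ler_pM2r ?gbd_gt0// -powRM//.
apply: (@le_trans _ _ ((q.+2%:R * q.+1%:R) `^ 2^-1 : R)); last first.
  by rewrite ler_powR// -natrM ler1n.
rewrite powR12_sqrt ?mulr_ge0// -[leLHS]ger0_norm// -sqrtr_sqr ler_wsqrtr// expr2.
by rewrite -!natrM ler_nat leq_mul// (leq_trans lq).
Qed.

Lemma bin_le_exp n m : ('C(n, m) <= 2 ^ n)%N.
Proof.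
case: (leqP m n) => mn; last by rewrite bin_small.
rewrite -[X in (X ^ _)%N]/(1 + 1)%N expnDn (bigD1 (Ordinal (mn : (m < n.+1)%N)))//=.
by rewrite !exp1n !muln1 leq_addr.
Qed.

Lemma factD_le m n : ((m + n)`! <= 2 ^ (m + n) * (m`! * n`!))%N.
Proof.
have h : (m <= m + n)%N by rewrite leq_addr.
by rewrite -(bin_fact h) addKn leq_mul2r bin_le_exp orbT.
Qed.

Lemma powR_gbd_root theta k : 0 < theta -> gbd theta k `^ theta^-1 = k`!%:R.
Proof. by move=> t0; rewrite /gbd -powRrM divff ?gt_eqF// powRr1. Qed.

(** This is x^n / n! <= exp x for x = (r / K)^(1/theta), raised to the power theta. *)
Lemma expn_le_gbd theta K r n : 0 < theta -> 0 < K -> 0 <= r ->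
  r ^+ n <= expR (theta * (r / K) `^ theta^-1) * (K ^+ n * gbd theta n).
Proof.
move=> t0 K0 r0; set x := (r / K) `^ theta^-1.
have x0 : 0 <= x by exact: powR_ge0.
have h := exp_coeff_le_expR n x0.
have fn : 0 < n`!%:R :> R by rewrite ltr0n fact_gt0.
rewrite ler_pdivrMr// in h.
have : (x ^+ n) `^ theta <= (expR x * n`!%:R) `^ theta.
  by rewrite ge0_ler_powR ?(ltW t0)// nnegrE ?exprn_ge0// mulr_ge0 ?expR_ge0.
rewrite powRM ?expR_ge0// -expRM -/(gbd theta n) -powR_mulrn//.
rewrite /x -!powRrM (mulrC theta^-1) mulfK ?gt_eqF// powR_mulrn ?divr_ge0 ?(ltW K0)//.
rewrite expr_div_n ler_pdivrMr ?exprn_gt0// => /le_trans; apply.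
by rewrite mulrC (mulrC theta) mulrCA.
Qed.

(** Raising the moment bounds to the power 1/theta turns gbd into n!. Summing them against the
    exponential series of x / 2 gives a geometric series, hence a exp(x / 2) <= 2; finally one
    returns to the power theta, where theta <= 1 bounds 2^theta by 2. *)
Lemma decay_of_moments theta K r M t : 0 < theta <= 1 -> 0 < K -> 0 <= r -> 0 <= M ->
  0 <= t -> (forall n, r ^+ n * t <= M * (K ^+ n * gbd theta n)) ->
  t <= 2 * M * expR (- (theta / 2 * (r / K) `^ theta^-1)).
Proof.
move=> /andP[th0 th1] K0 r0 M0 t0 h.
move: M0; rewrite le_eqVlt => /predU1P[M0|M0].
  by have := h 0%N; rewrite -M0 mul0r expr0 mul1r mulr0 mul0r.
set x := (r / K) `^ theta^-1.
have x0 : 0 <= x by exact: powR_ge0.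
set a := (t / M) `^ theta^-1.
have a0 : 0 <= a by exact: powR_ge0.
have ha n : x ^+ n * a <= n`!%:R.
  have : ((r / K) ^+ n * (t / M)) `^ theta^-1 <= gbd theta n `^ theta^-1.
    have g0 := ltW (gbd_gt0 theta n); have iM : 0 <= M^-1 by rewrite invr_ge0 ltW.
    have iK : 0 <= K^-1 by rewrite invr_ge0 ltW.
    rewrite ge0_ler_powR ?invr_ge0 ?(ltW th0)// ?nnegrE ?mulr_ge0 ?exprn_ge0 ?mulr_ge0//.
    rewrite mulrA ler_pdivrMr// expr_div_n mulrAC ler_pdivrMr ?exprn_gt0//.
    by rewrite (le_trans (h n))// mulrC (mulrC _ (gbd _ _)) mulrAC.
  rewrite powR_gbd_root// powRM ?exprn_ge0 ?divr_ge0 ?(ltW K0) ?(ltW M0)//.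
  rewrite -(powR_mulrn n (divr_ge0 r0 (ltW K0))) -powRrM (mulrC n%:R) powRrM.
  by rewrite (powR_mulrn n x0).
have S k : a * series (exp_coeff (x / 2)) k <= 2.
  apply: (@le_trans _ _ (2 - 2 / 2 ^+ k)); last by rewrite gerBl divr_ge0// exprn_ge0.
  elim: k => [|k IH]; first by rewrite /series /= big_geq// mulr0 expr0 divr1 subrr.
  rewrite /series /= big_nat_recr//= mulrDr.
  apply: le_trans (lerD IH (_ : _ <= 2^-1 ^+ k)) _; last first.
    by rewrite exprS exprVn invfM; lra.
  have fk : 0 < k`!%:R :> R by rewrite ltr0n fact_gt0.
  rewrite /exp_coeff /= expr_div_n exprVn.
  rewrite (_ : a * _ = (x ^+ k * a / k`!%:R) * (2 ^+ k)^-1); last by ring.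
  by rewrite ler_piMl ?invr_ge0 ?exprn_ge0// ler_pdivrMr// mul1r.
have E : a * expR (x / 2) <= 2.
  have hc := @is_cvg_series_exp_coeff R (x / 2).
  have : a * series (exp_coeff (x / 2)) k @[k --> \oo] --> a * expR (x / 2).
    by apply: cvgM; [exact: cvg_cst|exact: hc].
  by move=> hl; rewrite -(cvg_lim _ hl)//; apply: limr_le; [exact/cvgP/hl|exact: nearW].
have : (a * expR (x / 2)) `^ theta <= 2 `^ theta.
  by rewrite ge0_ler_powR ?(ltW th0)// nnegrE ?mulr_ge0 ?expR_ge0.
rewrite powRM ?expR_ge0// /a -powRrM mulVf ?gt_eqF// powRr1 ?divr_ge0 ?(ltW M0)//.
rewrite -expRM => H.
have {}H : t / M * expR (x / 2 * theta) <= 2.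
  apply: le_trans H _; rewrite -[leRHS]powRr1//; apply: ler_powR => //.
  by rewrite ler1n.
move: H; rewrite -ler_pdivlMr ?expR_gt0// ler_pdivrMr// => /le_trans; apply.
have e u v : u / 2 * v = v / 2 * u :> R by ring.
by rewrite expRN (e theta) mulrAC.
Qed.

Lemma powR_triangle3 (q a b c : R) : 1 <= q -> 0 <= a -> 0 <= b -> 0 <= c ->
  (a + b + c) `^ q <= 3 `^ q * (a `^ q + b `^ q + c `^ q).
Proof.
move=> q1 a0 b0 c0.
have q0 : 0 <= q by exact: le_trans q1.
pose m := Num.max a (Num.max b c).
have am : a <= m by rewrite le_max lexx.
have bm : b <= m by rewrite !le_max lexx orbT.
have cm : c <= m by rewrite !le_max lexx !orbT.
have m0 : 0 <= m by exact: le_trans am.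
apply: (@le_trans _ _ ((3 * m) `^ q)).
  by rewrite ge0_ler_powR// ?nnegrE ?addr_ge0 ?mulr_ge0//; lra.
rewrite powRM// ler_wpM2l ?powR_ge0//.
have := powR_ge0 a q; have := powR_ge0 b q; have := powR_ge0 c q.
have : [\/ m = a, m = b | m = c].
  by rewrite /m; case: (leP a (Num.max b c)) => _; case: (leP b c) => _;
    [constructor 3|constructor 2|constructor 1|constructor 1].
by case=> ->; lra.
Qed.

Lemma powR_le_1Dsqr (q a : R) : 0 <= q <= 2 -> 0 <= a -> a `^ q <= 1 + a ^+ 2.
Proof.
move=> /andP[q0 q2] a0; case: (leP a 1) => a1.
  apply: (@le_trans _ _ 1); last by rewrite lerDl sqr_ge0.
  by have := @ge0_ler_powR R q q0 a 1; rewrite powR1; apply; rewrite ?nnegrE.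
apply: (@le_trans _ _ (a `^ 2%:R)); first by rewrite ler_powR// ltW.
by rewrite powR_mulrn// lerDr.
Qed.

End PowerBounds.

(** * Hermite polynomials and their growth *)

Section HermiteRecursion.
Context {R : realType}.

(* The j-fold derivative of [exp (- z^2 / 2)] is [hermite j (- z)] times it. *)
Fixpoint hermite (n : nat) (z : R[i]) : R[i] :=
  match n with
  | 0 => 1
  | n1.+1 => z * hermite n1 z -
      (if n1 is n2.+1 then n1%:R * hermite n2 z else 0)
  end.

Fixpoint hermite_bound (n : nat) (r : R) : R :=
  match n with
  | 0 => 1
  | n1.+1 => r * hermite_bound n1 r +
      (if n1 is n2.+1 then n1%:R * hermite_bound n2 r else 0)
  end.

Lemma hermiteSS n z :
  hermite n.+2 z = z * hermite n.+1 z - n.+1%:R * hermite n z.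
Proof. by []. Qed.

Lemma hermite_boundSS n r : hermite_bound n.+2 r =
  r * hermite_bound n.+1 r + n.+1%:R * hermite_bound n r.
Proof. by []. Qed.

Lemma nat_ind2 (P : nat -> Prop) : P 0%N -> P 1%N ->
  (forall n, P n -> P n.+1 -> P n.+2) -> forall n, P n.
Proof.
move=> P0 P1 PS n; suff: P n /\ P n.+1 by case.
by elim: n => [//|n [h1 h2]]; split=> //; exact: PS.
Qed.

Lemma hermite_bound_ge0 n r : 0 <= r -> 0 <= hermite_bound n r.
Proof.
move=> r0; elim/nat_ind2: n => [||n h1 h2] /=; rewrite ?addr0 ?mulr1//.
by rewrite addr_ge0// mulr_ge0.
Qed.

Lemma cabs_natr n : cabs (n%:R : R[i]) = n%:R.
Proof. by rewrite /cabs normr_nat -(rmorph_nat (@real_complex R)). Qed.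

Lemma hermite_le n z r : cabs z <= r -> cabs (hermite n z) <= hermite_bound n r.
Proof.
move=> zr; have r0 := le_trans (cabs_ge0 _) zr.
elim/nat_ind2: n => [||n h1 h2].
- by rewrite /= cabs1.
- by rewrite /= subr0 addr0 !mulr1.
rewrite [hermite _ _]/= [hermite_bound _ _]/=.
rewrite (le_trans (cabsD _ _))// cabsN !cabsM cabs_natr lerD//.
  by rewrite ler_pM ?cabs_ge0.
by rewrite ler_wpM2l.
Qed.

(** In the recursion the factor r raises the moment by one, and the integer factor is absorbed by
    [gbd_mulS2]; 2 K^2 + 1 <= 4 K^2 explains the rate 2 K per degree. The data [D] and [n0] stand
    for the coordinates already treated, so that the lemma can be iterated over a product. *)
Lemma hermite_bound_gbd (theta r E K D : R) n0 l : 2^-1 <= theta -> 0 <= r -> 1 <= K -> 0 <= E ->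
  0 <= D ->
  (forall m, r ^+ m * D <= E * (K ^+ m * gbd theta (m + n0))) ->
  forall m, r ^+ m * (D * hermite_bound l r) <=
    E * (2 * K) ^+ l * (K ^+ m * gbd theta (m + (n0 + l))).
Proof.
move=> th r0 K1 E0 D0 h.
have K0 : 0 < K by exact: lt_le_trans K1.
have g0 q : 0 <= gbd theta q by exact/ltW/gbd_gt0.
have B0 m : 0 <= K ^+ m by rewrite exprn_ge0// ltW.
elim/nat_ind2: l => [m|m|l h1 h2 m].
- by rewrite /= mulr1 expr0 mulr1 addn0.
- rewrite /= addr0 mulr1 (_ : r ^+ m * (D * r) = r ^+ m.+1 * D); last by rewrite exprS; ring.
  rewrite (le_trans (h _))//.
  rewrite addn1 addnS addSn exprS expr1 -!mulrA ler_wpM2l//.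
  by rewrite ler_peMl ?mulr_ge0 ?(ltW K0)// ler1n.
rewrite hermite_boundSS [D * (_ + _)]mulrDr [r ^+ m * (_ + _)]mulrDr.
have H2 := h2 m.+1; have H1 := h1 m.
have e1 : (m.+1 + (n0 + l.+1) = (m + (n0 + l)).+2)%N by rewrite !addnS addSn.
have e2 : (m + (n0 + l.+2) = (m + (n0 + l)).+2)%N by rewrite !addnS.
rewrite e1 !exprS in H2; rewrite e2.
have H3 : r ^+ m * (D * (l.+1%:R * hermite_bound l r)) <=
    E * (2 * K) ^+ l * (K ^+ m * gbd theta (m + (n0 + l)).+2).
  rewrite (_ : _ * _ = l.+1%:R * (r ^+ m * (D * hermite_bound l r))); last by ring.
  apply: le_trans (ler_wpM2l (ler0n _ _) H1) _.
  rewrite mulrCA ler_wpM2l ?mulr_ge0 ?exprn_ge0 ?mulr_ge0 ?(ltW K0)//.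
  rewrite mulrCA ler_wpM2l// gbd_mulS2//.
  by rewrite ltnS (leq_trans (leq_addl n0 l))// leq_addl.
have H4 : r ^+ m * (D * (r * hermite_bound l.+1 r)) <=
    E * (2 * K * (2 * K) ^+ l) * (K * K ^+ m * gbd theta (m + (n0 + l)).+2).
  by apply: le_trans H2; rewrite le_eqVlt; apply/orP; left; apply/eqP; ring.
apply: le_trans (lerD H4 H3) _; rewrite !exprS.
set G := gbd _ _; set A := (2 * K) ^+ l; set B := K ^+ m.
have A0 : 0 <= E * A * (B * G).
  have A1 : 0 <= A by rewrite exprn_ge0// mulr_ge0// ltW.
  exact: (mulr_ge0 (mulr_ge0 E0 A1) (mulr_ge0 (B0 m) (g0 _))).
rewrite (_ : _ + _ = (2 * K ^+ 2 + 1) * (E * A * (B * G))); last by ring.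
rewrite [leRHS](_ : _ = (4 * K ^+ 2) * (E * A * (B * G))); last by ring.
by rewrite ler_wpM2r//; nra.
Qed.

End HermiteRecursion.

Section WavePacketDerivatives.
Context {R : realType} {N : nat}.
Implicit Types (x xi y : 'rV[R]_N) (c : 'I_N -> nat).

Lemma enorm_sq y : enorm y ^+ 2 = \sum_(j < N) y 0 j ^+ 2.
Proof.
rewrite /enorm sqr_sqrtr; first by apply: eq_bigr => j _; rewrite expr2.
by apply: sumr_ge0 => j _; rewrite -expr2 sqr_ge0.
Qed.

(** The logarithmic derivative of the wave packet in direction j, and the argument of its Hermite
    polynomials. *)
Definition wroot x xi y j : R[i] := (x 0 j - y 0 j) +i* (- xi 0 j).

(** The derivative of the wave packet of multi-order [c], by [is_pd_herm]. *)
Definition herm c x xi y : R[i] :=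
  (\prod_(j < N) hermite (c j) (wroot x xi y j)) * wave_packet (x, xi) y.

Lemma is_pd_comp_line j (f : 'rV[R]_N -> R[i]) y l (fr fi : R -> R) :
  (forall t, complex.Re (f (y + t *: delta_mx 0 j)) = fr t) ->
  (forall t, complex.Im (f (y + t *: delta_mx 0 j)) = fi t) ->
  is_derive (0 : R) 1 fr (complex.Re l) -> is_derive (0 : R) 1 fi (complex.Im l) ->
  is_pd j f y l.
Proof.
move=> /funext hr /funext hi dr di.
have y0 : y = y + 0 *: delta_mx 0 j by rewrite scale0r addr0.
rewrite y0; split.
  by apply: (iffRL (is_derive_line (fun y => complex.Re (f y)) _ _ _ _)); rewrite hr.
by apply: (iffRL (is_derive_line (fun y => complex.Im (f y)) _ _ _ _)); rewrite hi.
Qed.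

Lemma dotp_line j y xi (t : R) : dotp (y + t *: delta_mx 0 j) xi = dotp y xi + t * xi 0 j.
Proof.
rewrite /dotp (bigD1 j)//= [in RHS](bigD1 j)//= !mxE !eqxx mulr1 mulrDl.
rewrite -!addrA; congr (_ + _); rewrite addrC; congr (_ + _).
by apply: eq_bigr => k kj; rewrite !mxE (negbTE kj) andbF mulr0 addr0.
Qed.

Lemma enorm_line j y x (t : R) : enorm (y + t *: delta_mx 0 j - x) ^+ 2 =
  enorm (y - x) ^+ 2 + (2 * t * (y 0 j - x 0 j) + t ^+ 2).
Proof.
rewrite !enorm_sq (bigD1 j)//= [in RHS](bigD1 j)//= !mxE !eqxx mulr1.
rewrite [in RHS]addrAC; congr (_ + _); first by ring.
by apply: eq_bigr => k kj; rewrite !mxE (negbTE kj) andbF mulr0 addr0.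
Qed.

Lemma is_pd_wave j x xi y :
  is_pd j (wave_packet (x, xi)) y (wroot x xi y j * wave_packet (x, xi) y).
Proof.
pose A := dotp y xi; pose E := enorm (y - x) ^+ 2.
apply: (@is_pd_comp_line _ _ _ _
  (fun t => cos (- (A + t * xi 0 j)) * expR (- ((E + (2 * t * (y 0 j - x 0 j) + t ^+ 2)) / 2)))
  (fun t => sin (- (A + t * xi 0 j)) * expR (- ((E + (2 * t * (y 0 j - x 0 j) + t ^+ 2)) / 2)))).
- by move=> t; rewrite /wave_packet ReM /= dotp_line enorm_line mulr0 subr0.
- by move=> t; rewrite /wave_packet ImM /= dotp_line enorm_line mulr0 add0r.
- have -> : complex.Re (wroot x xi y j * wave_packet (x, xi) y) =
     (x 0 j - y 0 j) * (cos (- A) * expR (- (E / 2))) + xi 0 j * (sin (- A) * expR (- (E / 2))).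
    by rewrite /wroot /wave_packet ReM ReM ImM /= !(mulr0, subr0, add0r) mulNr opprK.
  apply: is_derive_eq.
  rewrite /GRing.scale /= !(mul0r, mulr0, addr0, subr0, add0r, expr0n, mulr1) /=.
  rewrite ?(mul0r, mulr0, addr0, subr0, add0r) /=.
  by field.
- have -> : complex.Im (wroot x xi y j * wave_packet (x, xi) y) =
     (x 0 j - y 0 j) * (sin (- A) * expR (- (E / 2))) - xi 0 j * (cos (- A) * expR (- (E / 2))).
    by rewrite /wroot /wave_packet ImM ReM ImM /= !(mulr0, subr0, add0r) mulNr.
  apply: is_derive_eq.
  rewrite /GRing.scale /= !(mul0r, mulr0, addr0, subr0, add0r, expr0n, mulr1) /=.
  rewrite ?(mul0r, mulr0, addr0, subr0, add0r) /=.
  by field.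
Qed.

Lemma is_pd_wroot j k x xi y :
  is_pd j (fun y => wroot x xi y k) y (if k == j then -1 else 0).
Proof.
apply: (@is_pd_comp_line _ _ _ _
  (fun t => x 0 k - y 0 k - (if k == j then t else 0)) (fun t => - xi 0 k)).
- move=> t; rewrite /= !mxE eqxx /=.
  by case: (k == j); rewrite ?mulr1 ?mulr0 ?subr0 ?addr0// opprD addrA.
- by [].
- case: (k == j).
    have -> : complex.Re (-1 : R[i]) = -1 by [].
    have H := is_deriveB (is_derive_cst (x 0 k - y 0 k) (0 : R) (1 : R)) (is_derive_id (0 : R) (1 : R)).
    by rewrite sub0r in H.
  by apply: is_derive_eq; rewrite ?subr0 ?oppr0 ?addr0.
- have -> : complex.Im (if k == j then -1 else 0 : R[i]) = 0 by case: ifP => //= _; rewrite oppr0.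
  exact: is_derive_cst.
Qed.

Lemma is_pd_hermite j (f : 'rV[R]_N -> R[i]) y l n : is_pd j f y l ->
  is_pd j (fun y => hermite n (f y)) y
    (if n is n1.+1 then n%:R * hermite n1 (f y) * l else 0).
Proof.
move=> fl; elim/nat_ind2: n => [||n h1 h2].
- exact: is_pd_cst.
- rewrite /= mulr1n mulr1 mul1r.
  have -> : (fun y => f y * 1 - 0) = f by apply/funext => z; rewrite mulr1 subr0.
  exact: fl.
have H := is_pdD (is_pdM fl h2) (is_pdZ (- n.+1%:R) h1).
have -> : (fun y => hermite n.+2 (f y)) =
  (fun y => f y * hermite n.+1 (f y) + - n.+1%:R * hermite n (f y)).
  by apply/funext => z; rewrite [hermite n.+2 _]/= mulNr.
move: H; set a := (X in is_pd _ _ _ X -> _); set b := (X in _ -> is_pd _ _ _ X).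
suff -> : a = b by [].
rewrite /a /b; case: n {h1 h2 a b} => [|n].
  by rewrite /= mulr0 addr0 !mulr1 subr0; ring.
rewrite hermiteSS (_ : n.+3%:R = n.+2%:R + 1); last by rewrite -addn1 natrD.
ring.
Qed.

Lemma is_pd_prod j (r : seq 'I_N) (f : 'I_N -> 'rV[R]_N -> R[i]) y :
  (forall k, k \in r -> is_pd j (f k) y 0) ->
  is_pd j (fun y => \prod_(k <- r) f k y) y 0.
Proof.
elim: r => [_|k r IH h].
  under eq_fun do rewrite big_nil; exact: is_pd_cst.
under eq_fun do rewrite big_cons.
have := is_pdM (h k (mem_head _ _)) (IH (fun k kr => h k (mem_behead (kr : k \in behead (_ :: r))))).
by rewrite mul0r mulr0 addr0.
Qed.

Lemma herm_step n (z w : R[i]) :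
  (if n is n1.+1 then n%:R * hermite n1 z * -1 else 0) * w + hermite n z * (z * w) =
  hermite n.+1 z * w.
Proof.
by case: n => [|n]; [rewrite /=; ring|rewrite hermiteSS; ring].
Qed.

Lemma is_pd_herm j c x xi y :
  is_pd j (herm c x xi) y (herm (fun k => c k + (k == j))%N x xi y).
Proof.
have E (c' : 'I_N -> nat) : herm c' x xi = fun y => (\prod_(k <- [seq k <- index_enum 'I_N | k != j])
     hermite (c' k) (wroot x xi y k)) *
   (hermite (c' j) (wroot x xi y j) * wave_packet (x, xi) y).
  apply/funext => z; rewrite /herm (bigD1 j)//= big_filter; ring.
have P : is_pd j (fun y => \prod_(k <- [seq k <- index_enum 'I_N | k != j])
     hermite (c k) (wroot x xi y k)) y 0.
  apply: is_pd_prod => k; rewrite mem_filter => /andP[kj _].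
  have := is_pd_hermite (c k) (is_pd_wroot j k x xi y).
  by rewrite (negbTE kj); case: (c k) => [//|n]; rewrite mulr0.
have := is_pdM P (is_pdM (is_pd_hermite (c j) (is_pd_wroot j j x xi y)) (is_pd_wave j x xi y)).
rewrite -E; set a := (X in is_pd _ _ _ X -> _); set b := (X in _ -> is_pd _ _ _ X).
suff -> : a = b by [].
rewrite /a /b {a b} E mul0r add0r eqxx addn1; congr (_ * _).
  rewrite !big_filter; apply: eq_bigr => k kj; by rewrite (negbTE kj) addn0.
exact: herm_step.
Qed.

Lemma cabs_wave x xi y :
  cabs (wave_packet (x, xi) y) = expR (- (enorm (y - x) ^+ 2 / 2)).
Proof. by rewrite /wave_packet cabsM cabs_cis mul1r cabsR ger0_norm ?expR_ge0. Qed.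

Lemma norm_le_enorm y : `|y| <= enorm y.
Proof.
apply: norm_le_coord; first by rewrite sqrtr_ge0.
move=> j; rewrite -sqrtr_sqr ler_wsqrtr// /dotp (bigD1 j)//= -expr2 lerDl.
by apply: sumr_ge0 => k _; rewrite -expr2 sqr_ge0.
Qed.

Lemma enorm_ge0 y : 0 <= enorm y. Proof. exact: sqrtr_ge0. Qed.

Lemma cabs_wave_le x xi y :
  cabs (wave_packet (x, xi) y) <= expR (- (`|y - x| ^+ 2 / 2)).
Proof.
rewrite cabs_wave ler_expR lerN2 ler_pM2r ?invr_gt0//.
by rewrite lerXn2r ?nnegrE// ?enorm_ge0// norm_le_enorm.
Qed.

(* The weight [|x|^(1/theta) + |xi|^(1/theta)], in the sup norm. *)
Definition phw (theta : R) (X : phase R N) : R := `|X.1| `^ theta^-1 + `|X.2| `^ theta^-1.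

Lemma phw_ge0 theta X : 0 <= phw theta X.
Proof. by rewrite addr_ge0 ?powR_ge0. Qed.

Lemma wroot_le x xi y j : cabs (wroot x xi y j) <= `|x| + `|xi| + `|y - x|.
Proof.
rewrite (le_trans (cabs_leReIm _))//= normrN addrAC lerD ?coord_le_norm//.
rewrite distrC; have := coord_le_norm (y - x) j; rewrite !mxE => h.
by rewrite (le_trans h)// lerDr.
Qed.

(** The single radius [rho] dominates |y| and all the arguments of the Hermite polynomials. The
    bound then contains exp((rho / K)^(1/theta)), which splits into a factor exp(delta [phw]) and a
    factor in y - x absorbed by the Gaussian. Small delta is bought by a larger step. *)
Lemma herm_bound theta delta c x xi y m : 2^-1 <= theta < 1 -> 0 < delta <= 2^-1 ->
  `|y| ^+ m * cabs (herm c x xi y) <= expR 1 * expR (delta * phw theta (x, xi)) *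
     ((6 / delta) ^+ (m + \sum_j c j) * gbd theta (m + \sum_j c j)).
Proof.
move=> /andP[th2 th1] /andP[d0 d2].
have th0 : 0 < theta by rewrite (lt_le_trans _ th2)// invr_gt0.
have ith1 : 1 <= theta^-1 by rewrite invf_ge1// ltW.
have ith2 : theta^-1 <= 2 by rewrite invf_ple ?posrE.
(* The 3 compensates the constant of [powR_triangle3]; what remains is delta^(1/theta) <= delta. *)
pose K := 3 / delta; have K1 : 1 <= K by rewrite /K ler_pdivlMr// mul1r; lra.
have K0 : 0 < K by exact: lt_le_trans K1.
pose rho := `|x| + `|xi| + `|y - x|.
have rho0 : 0 <= rho by rewrite !addr_ge0.
pose E := expR (theta * (rho / K) `^ theta^-1).
have E0 : 0 <= E by exact: expR_ge0.
have H (r : seq 'I_N) : forall m, rho ^+ m * \prod_(j <- r) hermite_bound (c j) rho <=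
    (E * (2 * K) ^+ (\sum_(j <- r) c j)%N) *
      (K ^+ m * gbd theta (m + (\sum_(j <- r) c j))%N).
  elim: r => [k|j r IH k].
    by rewrite !big_nil mulr1 expr0 mulr1 addn0; exact: expn_le_gbd.
  rewrite !big_cons [X in _ * X <= _]mulrC.
  have := @hermite_bound_gbd _ theta rho _ K (\prod_(j <- r) hermite_bound (c j) rho)
    (\sum_(j <- r) c j)%N (c j) th2 rho0 K1 _ _ IH k.
  rewrite -(mulrA E) -exprD (addnC (\sum_(j <- r) c j)%N) => h.
  apply: h; first by rewrite mulr_ge0// exprn_ge0// mulr_ge0// ltW.
  by apply: prodr_ge0 => i _; exact: hermite_bound_ge0.
have {}H := H (index_enum 'I_N) m.
set n := (\sum_j c j)%N in H *.
have yr : `|y| <= rho.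
  have := ler_normD (y - x) x; rewrite subrK /rho => /le_trans; apply.
  by rewrite addrC lerD2r lerDl.
have P : cabs (\prod_(j < N) hermite (c j) (wroot x xi y j)) <=
    \prod_(j < N) hermite_bound (c j) rho.
  rewrite cabs_prod; apply: ler_prod => j _.
  by rewrite cabs_ge0 hermite_le// wroot_le.
rewrite /herm cabsM mulrA.
apply: (@le_trans _ _ (E * (2 * K) ^+ n * (K ^+ m * gbd theta (m + n)) *
    expR (- (`|y - x| ^+ 2 / 2)))).
  apply: ler_pM; rewrite ?mulr_ge0 ?exprn_ge0 ?cabs_ge0 ?cabs_wave_le//.
  by apply: le_trans H; rewrite ler_pM ?exprn_ge0 ?cabs_ge0// lerXn2r ?nnegrE.
(* Since 1/theta <= 2 and delta <= 1/2, the term delta |y - x|^(1/theta) is at most (1 + |y - x|^2)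
   / 2. *)
have HE : E * expR (- (`|y - x| ^+ 2 / 2)) <= expR 1 * expR (delta * phw theta (x, xi)).
  rewrite /E -!expRD ler_expR /phw /=.
  have h3 : (rho / K) `^ theta^-1 <= delta * (`|x| `^ theta^-1 + `|xi| `^ theta^-1 + `|y - x| `^ theta^-1).
    rewrite powRM ?invr_ge0 ?(ltW K0)//.
    apply: (@le_trans _ _ ((3 `^ theta^-1 * (`|x| `^ theta^-1 + `|xi| `^ theta^-1 + `|y - x| `^ theta^-1)) * K^-1 `^ theta^-1)).
      by rewrite ler_wpM2r ?powR_ge0// powR_triangle3.
    rewrite mulrAC ler_wpM2r ?addr_ge0 ?powR_ge0// -powRM ?invr_ge0 ?(ltW K0)//.
    rewrite /K invfM invrK mulrA divff// mul1r.
    by rewrite ge1r_powR// d0/=; lra.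
  have h4 : `|y - x| `^ theta^-1 <= 1 + `|y - x| ^+ 2.
    by apply: powR_le_1Dsqr => //; rewrite ith2 andbT; exact: le_trans ith1.
  have h5 : theta * (rho / K) `^ theta^-1 <= (rho / K) `^ theta^-1.
    by rewrite ler_piMl ?powR_ge0// ltW.
  have a0 := powR_ge0 `|x| theta^-1; have b0 := powR_ge0 `|xi| theta^-1.
  have c0 := powR_ge0 `|y - x| theta^-1.
  have s0 := sqr_ge0 `|y - x|.
  apply: (@le_trans _ _ (delta * (`|x| `^ theta^-1 + `|xi| `^ theta^-1 + `|y - x| `^ theta^-1) - `|y - x| ^+ 2 / 2)).
    by rewrite lerD2r; exact: le_trans h3.
  have : delta * `|y - x| `^ theta^-1 <= 2^-1 * (1 + `|y - x| ^+ 2) by apply: ler_pM => //; exact: ltW.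
  lra.
have g0 := ltW (gbd_gt0 theta (m + n)).
have id0 : 0 <= delta^-1 by rewrite invr_ge0 ltW.
have -> : 6 / delta = 2 * K by rewrite /K; field; rewrite gt_eqF.
rewrite [leLHS](_ : _ = (E * expR (- (`|y - x| ^+ 2 / 2))) *
   ((2 * K) ^+ n * K ^+ m * gbd theta (m + n))); last by ring.
apply: ler_pM => //; rewrite ?mulr_ge0 ?expR_ge0 ?exprn_ge0 ?mulr_ge0 ?(ltW K0)//.
rewrite ler_wpM2r// addnC exprD ler_wpM2l ?exprn_ge0 ?mulr_ge0 ?(ltW K0)//.
by rewrite lerXn2r ?nnegrE ?mulr_ge0 ?(ltW K0)// ler_peMl ?(ltW K0)// ler1n.
Qed.

Lemma sum_count_mem_size (s : seq 'I_N) : (\sum_(j < N) count_mem j s = size s)%N.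
Proof.
elim: s => [|i s IH] /=; first by rewrite big1.
by rewrite big_split /= IH (bigD1 i)//= eqxx big1 ?addn0 // => k ki; rewrite eq_sym (negbTE ki).
Qed.

Lemma herm_bounded c x xi : exists B, forall y, cabs (herm c x xi y) <= B.
Proof.
have th : 2^-1 <= (2^-1 : R) < 1 by lra.
have de : 0 < (2^-1 : R) <= 2^-1 by lra.
eexists => y; have := herm_bound c x xi y 0%N th de; rewrite expr0 mul1r; exact.
Qed.

Lemma smooth_wave x xi : smooth (wave_packet (x, xi)) /\
  forall s, foldr (@pderiv R N) (wave_packet (x, xi)) s = herm (fun j => count_mem j s) x xi.
Proof.
have lip c : exists L, forall y z, cabs (herm c x xi y - herm c x xi z) <= L * `|y - z|.
  have /choice[B_ HB] : forall j : 'I_N, exists B, forall y,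
      cabs (herm (fun k => c k + (k == j))%N x xi y) <= B.
    by move=> j; exact: herm_bounded.
  pose B := \sum_j `|B_ j|.
  have HB' j y : cabs (herm (fun k => c k + (k == j))%N x xi y) <= B.
    rewrite (le_trans (HB j y))// (le_trans (ler_norm _))// /B (bigD1 j)//= lerDl.
    by apply: sumr_ge0.
  exists (B *+ N + B *+ N) => y z; rewrite (le_trans (cabs_leReIm _))// mulrDl lerD//.
    rewrite ReD ReN; apply: (@lip_dir R N (fun y => complex.Re (herm c x xi y))
      (fun j y => complex.Re (herm (fun k => c k + (k == j))%N x xi y))).
      by move=> j w; exact: (is_pd_herm j c x xi w).1.
    by move=> j w; exact: le_trans (Re_le_cabs _) (HB' j w).
  rewrite ImD ImN; apply: (@lip_dir R N (fun y => complex.Im (herm c x xi y))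
      (fun j y => complex.Im (herm (fun k => c k + (k == j))%N x xi y))).
    by move=> j w; exact: (is_pd_herm j c x xi w).2.
  by move=> j w; exact: le_trans (Im_le_cabs _) (HB' j w).
apply: (@smooth_family R N (wave_packet (x, xi)) (fun s => herm (fun j => count_mem j s) x xi)).
- by apply/funext => y; rewrite /herm big1 ?mul1r.
- move=> s; have [L hL] := lip (fun j => count_mem j s).
  apply: (@lip_continuous _ _ _ L) => y z; rewrite -ReN -ReD.
  exact: le_trans (Re_le_cabs _) (hL y z).
- move=> s; have [L hL] := lip (fun j => count_mem j s).
  apply: (@lip_continuous _ _ _ L) => y z; rewrite -ImN -ImD.
  exact: le_trans (Im_le_cabs _) (hL y z).
- move=> j s y; have := is_pd_herm j (fun k => count_mem k s) x xi y.
  have -> // : (fun k => count_mem k s + (k == j))%N = (fun k => count_mem k (j :: s)).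
  by apply/funext => k /=; rewrite addnC eq_sym.
Qed.

Lemma gsb_wave theta delta (X : phase R N) : 2^-1 <= theta < 1 -> 0 < delta <= 2^-1 ->
  gsb theta (6 / delta) (expR 1 * expR (delta * phw theta X)) (wave_packet X).
Proof.
case: X => x xi th de; have [sw E] := smooth_wave x xi; split=> // m s y.
by rewrite E; have := herm_bound (fun j => count_mem j s) x xi y m th de; rewrite sum_count_mem_size.
Qed.

End WavePacketDerivatives.

(** * Decay of the wave packet transform *)

Section ComplexIntegral.
Context {R : realType} {N : nat}.
Implicit Types (f g : 'rV[R]_N -> R[i]) (K : R).

Definition cscont f := scont (fun x => complex.Re (f x)) /\ scont (fun x => complex.Im (f x)).

(** The integrands on which [cint] has been shown to be linear. *)
Definition cnice f := cscont f /\ exists K, forall x, cabs (f x) <= K * wgt x.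

Lemma cscont_cst (c : R[i]) : cscont (fun=> c).
Proof. by split; exact: scont_cst. Qed.

Lemma cscontM f g : cscont f -> cscont g -> cscont (fun x => f x * g x).
Proof.
move=> [f1 f2] [g1 g2]; split.
  under eq_fun do rewrite ReM -[X in _ + X]mulN1r.
  apply: scontD; first exact: scontM.
  by apply: scontM; [exact: scont_cst|exact: scontM].
by under eq_fun do rewrite ImM; apply: scontD; exact: scontM.
Qed.

Lemma cscontD f g : cscont f -> cscont g -> cscont (fun x => f x + g x).
Proof.
move=> [f1 f2] [g1 g2]; split.
  by under eq_fun do rewrite ReD; exact: scontD.
by under eq_fun do rewrite ImD; exact: scontD.
Qed.

Lemma cscontR (r : 'rV[R]_N -> R) : scont r -> cscont (fun x => (r x)%:C).
Proof. by move=> cr; split => //; exact: scont_cst. Qed.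

Lemma cscont_cis (r : 'rV[R]_N -> R) : scont r -> cscont (fun x => cis (r x)).
Proof.
by move=> cr; split; apply: scont_comp => //; [exact: continuous_cos|exact: continuous_sin].
Qed.

Lemma cnice_Re f : cnice f -> exists2 K, 0 <= K & forall x, `|complex.Re (f x)| <= K * wgt x.
Proof.
move=> [_ [K h]]; exists K => [|x]; last exact: le_trans (Re_le_cabs _) (h x).
by have := le_trans (cabs_ge0 _) (h 0); rewrite wgt0E mulr1.
Qed.

Lemma cnice_Im f : cnice f -> exists2 K, 0 <= K & forall x, `|complex.Im (f x)| <= K * wgt x.
Proof.
move=> [_ [K h]]; exists K => [|x]; last exact: le_trans (Im_le_cabs _) (h x).
by have := le_trans (cabs_ge0 _) (h 0); rewrite wgt0E mulr1.
Qed.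

Lemma cniceD f g : cnice f -> cnice g -> cnice (fun x => f x + g x).
Proof.
move=> [cf [K fK]] [cg [L gL]]; split; first exact: cscontD.
by exists (K + L) => x; rewrite mulrDl (le_trans (cabsD _ _))// lerD.
Qed.

Lemma cniceZ a f : cnice f -> cnice (fun x => a * f x).
Proof.
move=> [cf [K fK]]; split; first by apply: cscontM => //; exact: cscont_cst.
by exists (cabs a * K) => x; rewrite cabsM -mulrA ler_wpM2l ?cabs_ge0.
Qed.

Lemma cnice_bounded f g B : cscont f -> (forall x, cabs (f x) <= B) -> cnice g ->
  cnice (fun x => f x * g x).
Proof.
move=> cf fB [cg [K gK]]; split; first exact: cscontM.
exists (B * K) => x; rewrite cabsM -mulrA; apply: ler_pM; rewrite ?cabs_ge0//.
Qed.

Lemma cintD f g : cnice f -> cnice g -> cint (fun x => f x + g x) = cint f + cint g.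
Proof.
move=> nf ng; have [[cf1 cf2] _] := nf; have [[cg1 cg2] _] := ng.
have [K1 _ h1] := cnice_Re nf; have [K2 _ h2] := cnice_Im nf.
have [L1 _ k1] := cnice_Re ng; have [L2 _ k2] := cnice_Im ng.
rewrite /cint; simpc; congr (_ +i* _).
  by under eq_fun do rewrite ReD; exact: rintD h1 k1.
by under eq_fun do rewrite ImD; exact: rintD h2 k2.
Qed.

Lemma cintZ a f : cnice f -> cint (fun x => a * f x) = a * cint f.
Proof.
move=> nf; have [[cf1 cf2] _] := nf.
have [K1 _ h1] := cnice_Re nf; have [K2 _ h2] := cnice_Im nf.
have sZ (c : R) (u : 'rV[R]_N -> R) : scont u -> scont (fun x => c * u x).
  by move=> su; apply: scontM => //; exact: scont_cst.
have bZ (c : R) (u : 'rV[R]_N -> R) K : (forall x, `|u x| <= K * wgt x) ->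
    forall x, `|c * u x| <= (`|c| * K) * wgt x.
  by move=> uK x; rewrite normrM -mulrA ler_wpM2l.
case: a => a b; rewrite /cint; apply: complex_eqP.
- rewrite ReM /= -(rintZ a cf1 h1) -mulNr -(rintZ (- b) cf2 h2).
  rewrite -(rintD (sZ _ _ cf1) (sZ _ _ cf2) (bZ _ _ _ h1) (bZ _ _ _ h2)).
  by congr rint; apply/funext => x; rewrite ReM /= mulNr.
- rewrite ImM /= -(rintZ a cf2 h2) -(rintZ b cf1 h1).
  rewrite -(rintD (sZ _ _ cf2) (sZ _ _ cf1) (bZ _ _ _ h2) (bZ _ _ _ h1)).
  by congr rint; apply/funext => x; rewrite ImM /=.
Qed.

Lemma cint0 : cint (fun _ : 'rV[R]_N => 0) = 0 :> R[i].
Proof. by rewrite /cint /= rint0. Qed.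

Lemma cint_sum I (r : seq I) (F : I -> 'rV[R]_N -> R[i]) : (forall i, cnice (F i)) ->
  cnice (fun x => \sum_(i <- r) F i x) /\
  cint (fun x => \sum_(i <- r) F i x) = \sum_(i <- r) cint (F i).
Proof.
move=> nF; elim: r => [|i r [IH1 IH2]].
  rewrite big_nil; under eq_fun do rewrite big_nil; rewrite cint0; split=> //.
  split; first exact: cscont_cst.
  by exists 0 => x; rewrite cabs0 mul0r.
rewrite big_cons; under eq_fun do rewrite big_cons; split; first exact: cniceD.
by rewrite cintD// IH2.
Qed.

(** The factor 2 comes from estimating real and imaginary parts separately. *)
Lemma cint_le f (b : 'rV[R]_N -> R) K : cscont f -> scont b ->
  (forall x, b x <= K * wgt x) -> (forall x, cabs (f x) <= b x) ->
  cabs (cint f) <= 2 * rint b.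
Proof.
move=> [cf1 cf2] cb bK fb.
have b0 x : 0 <= b x by exact: le_trans (cabs_ge0 _) (fb x).
have hb x : `|b x| <= K * wgt x by rewrite ger0_norm.
have cN (u : 'rV[R]_N -> R) : scont u -> scont (fun x => -1 * u x).
  by move=> su; apply: scontM => //; exact: scont_cst.
have H (u : 'rV[R]_N -> R) : scont u -> (forall x, `|u x| <= b x) -> `|rint u| <= rint b.
  move=> su ub; have uK x : `|u x| <= K * wgt x by exact: le_trans (ub x) (bK x).
  rewrite ler_norml; apply/andP; split.
    rewrite -mulN1r -(rintZ _ cb hb); apply: (le_rint (K := K) (L := K)) => //.
    - exact: cN.
    - by move=> x; rewrite mulN1r normrN.
    - by move=> x; have := ub x; rewrite mulN1r ler_norml => /andP[].
  apply: (le_rint (K := K) (L := K)) => // x.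
  by have := ub x; rewrite ler_norml => /andP[].
rewrite (le_trans (cabs_leReIm _))//= mulr_natl mulr2n lerD//; apply: H => // x.
  exact: le_trans (Re_le_cabs _) (fb x).
exact: le_trans (Im_le_cabs _) (fb x).
Qed.

Lemma cint_ibp (F F' : 'rV[R]_N -> R[i]) j : cnice F -> cnice F' ->
  (forall x, is_pd j F x (F' x)) -> cint F' = 0.
Proof.
move=> nF nF' dF; have [[cf1 cf2] _] := nF; have [[cg1 cg2] _] := nF'.
have [K1 K10 h1] := cnice_Re nF; have [K2 K20 h2] := cnice_Im nF.
have [L1 L10 k1] := cnice_Re nF'; have [L2 L20 k2] := cnice_Im nF'.
have up (u : 'rV[R]_N -> R) K L : 0 <= K -> (forall x, `|u x| <= K * wgt x) -> 0 <= L ->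
    forall x, `|u x| <= (K + L) * wgt x.
  move=> K0 uK L0 x; rewrite (le_trans (uK x))// ler_wpM2r ?wgt_ge0//.
  by rewrite lerDl.
have -> : cint F' = 0 +i* 0; last by [].
congr (_ +i* _).
- apply: (@rint_derive0 _ _ (fun x => complex.Re (F x)) _ j (K1 + L1)) => //.
  + exact: up.
  + by rewrite addrC; exact: up.
  + by move=> x; exact: (dF x).1.
- apply: (@rint_derive0 _ _ (fun x => complex.Im (F x)) _ j (K2 + L2)) => //.
  + exact: up.
  + by rewrite addrC; exact: up.
  + by move=> x; exact: (dF x).2.
Qed.

End ComplexIntegral.

Section ComplexProduct.
Context {R : realType}.

Definition cI (b : R -> R[i]) : R[i] :=
  rI (fun t => complex.Re (b t)) +i* rI (fun t => complex.Im (b t)).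

Lemma cint_prod N (b : 'I_N -> R -> R[i]) (K : 'I_N -> R) :
  (forall j, continuous (fun t => complex.Re (b j t))) ->
  (forall j, continuous (fun t => complex.Im (b j t))) ->
  (forall j t, cabs (b j t) <= K j * bump t) ->
  cint (fun x : 'rV[R]_N => \prod_(j < N) b j (x 0 j)) = \prod_(j < N) cI (b j).
Proof.
elim: N b K => [|N IH] b K cr ci bK.
  by rewrite /cint /= !big_ord0.
have c1 := fun j => cr (lift ord0 j); have c2 := fun j => ci (lift ord0 j).
have K' := fun j => bK (lift ord0 j).
pose P (y : 'rV[R]_N) := \prod_(j < N) b (lift ord0 j) (y 0 j).
have sP : cscont P.
  rewrite /P; elim: (index_enum _) => [|j r IHr].
    by under eq_fun do rewrite big_nil; exact: cscont_cst.
  under eq_fun do rewrite big_cons; apply: cscontM => //.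
  by split; [apply: (scont_comp (h := fun t => complex.Re (b (lift ord0 j) t))) => //|
    apply: (scont_comp (h := fun t => complex.Im (b (lift ord0 j) t))) => //];
    exact: scont_coord.
have nP : cnice P.
  split=> //; exists (\prod_j K (lift ord0 j)) => y; rewrite /P cabs_prod /wgt -big_split /=.
  by apply: ler_prod => j _; rewrite cabs_ge0 K'.
have sl t (y : 'rV[R]_N) :
    \prod_(j < N.+1) b j (row_mx (const_mx t : 'rV[R]_1) y 0 j) = b ord0 t * P y.
  rewrite big_ord_recl; congr (_ * _); first by rewrite row_mx_ord0 mxE.
  by apply: eq_bigr => j _; rewrite row_mx_lift0.
have cb0 := bK ord0.
have bR t : `|complex.Re (b ord0 t)| <= K ord0 * bump t.
  exact: le_trans (Re_le_cabs _) (cb0 t).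
have bI t : `|complex.Im (b ord0 t)| <= K ord0 * bump t.
  exact: le_trans (Im_le_cabs _) (cb0 t).
have cZ (c : R) (u : R -> R) : continuous u -> continuous (fun t => c * u t).
  by move=> cu t; apply: cvgM; [exact: cvg_cst|exact: cu].
have bZ (c : R) (u : R -> R) L : (forall t, `|u t| <= L * bump t) ->
    forall t, `|c * u t| <= (`|c| * L) * bump t.
  by move=> uL t; rewrite normrM -mulrA ler_wpM2l.
rewrite big_ord_recl -(IH _ _ c1 c2 K') -/P.
have E t : cint (fun y : 'rV[R]_N => b ord0 t * P y) = b ord0 t * cint P by exact: cintZ.
apply: complex_eqP; rewrite [LHS]/=.
- rewrite ReM [complex.Re (cI _)]/= [complex.Im (cI _)]/=.
  rewrite mulrC -(rIZ _ (cr ord0) bR) [X in _ - X]mulrC -mulNr -(rIZ _ (ci ord0) bI).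
  rewrite -(rID (cZ _ _ (cr ord0)) (cZ _ _ (ci ord0)) (bZ _ _ _ bR) (bZ _ _ _ bI)).
  congr rI; apply/funext => t.
  transitivity (complex.Re (b ord0 t * cint P)); last by rewrite ReM; ring.
  by rewrite -E; congr rint; apply/funext => y; rewrite -sl.
- rewrite ImM [complex.Re (cI _)]/= [complex.Im (cI _)]/=.
  rewrite mulrC -(rIZ _ (cr ord0) bR) [X in _ + X]mulrC -(rIZ _ (ci ord0) bI).
  rewrite -(rID (cZ _ _ (cr ord0)) (cZ _ _ (ci ord0)) (bZ _ _ _ bR) (bZ _ _ _ bI)).
  congr rI; apply/funext => t.
  transitivity (complex.Im (b ord0 t * cint P)); last by rewrite ImM; ring.
  by rewrite -E; congr rint; apply/funext => y; rewrite -sl.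
Qed.

End ComplexProduct.

(** * Gaussian windows *)

Section Window.
Context {R : realType} {N : nat}.
Implicit Types (m xi y : 'rV[R]_N) (a : R).

(** For a = 1 this is a wave packet; a = 2 is needed because restricting a wave packet on R^(d+d) to
    the diagonal multiplies two packets. *)
Definition gwin a (m xi : 'rV[R]_N) : 'rV[R]_N -> R[i] := fun y =>
  cis (- dotp y xi) * (expR (- (a * enorm (y - m) ^+ 2 / 2)))%:C.

Lemma gwin1 m xi : gwin 1 m xi = wave_packet (m, xi).
Proof. by apply/funext => y; rewrite /gwin mul1r. Qed.

Definition gw1 a (c s t : R) : R[i] := cis (- (t * s)) * (expR (- (a * (t - c) ^+ 2 / 2)))%:C.

Lemma cis_sum I (r : seq I) (F : I -> R) :
  cis (\sum_(i <- r) F i) = \prod_(i <- r) cis (F i) :> R[i].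
Proof. by apply: big_morph; [exact: cisD|exact: cis0]. Qed.

Lemma gwin_prod a m xi y : gwin a m xi y = \prod_(j < N) gw1 a (m 0 j) (xi 0 j) (y 0 j).
Proof.
rewrite /gwin big_split /= -cis_sum /dotp; congr (cis _ * _).
  by rewrite -sumrN.
rewrite -(rmorph_prod (@real_complex R)); congr (_%:C).
rewrite -expR_sum; congr expR; rewrite enorm_sq mulr_sumr mulr_suml -sumrN.
by apply: eq_bigr => j _; rewrite !mxE.
Qed.

Lemma expR_sq_le_bump a (s : R) : 0 < a -> expR (- (a * s ^+ 2 / 2)) <= (1 + 2 / a) * bump s.
Proof.
move=> a0; rewrite expRN /bump ler_pdivlMr ?ltr_wpDr ?sqr_ge0//.
rewrite mulrC ler_pdivrMr ?expR_gt0//.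
have h := expR_ge1Dx (a * s ^+ 2 / 2).
have h2 : 0 < 2 / a by rewrite divr_gt0.
apply: le_trans (ler_wpM2l _ h); last by rewrite addr_ge0// ltW.
have -> : (1 + 2 / a) * (1 + a * s ^+ 2 / 2) = 1 + s ^+ 2 + (2 / a + a * s ^+ 2 / 2).
  by field; rewrite gt_eqF.
have := sqr_ge0 s; nra.
Qed.

Lemma cabs_gw1 a c s t : cabs (gw1 a c s t) = expR (- (a * (t - c) ^+ 2 / 2)).
Proof. by rewrite cabsM cabs_cis mul1r cabsR ger0_norm ?expR_ge0. Qed.

Lemma gw1_dom a c s t : 0 < a -> cabs (gw1 a c s t) <= ((1 + 2 / a) * (2 * (1 + c ^+ 2))) * bump t.
Proof.
move=> a0; rewrite cabs_gw1 (le_trans (expR_sq_le_bump _ a0))// -mulrA ler_wpM2l//.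
  by rewrite addr_ge0// divr_ge0// ltW.
by rewrite (le_trans (bump_shift _ _))// sqrrN.
Qed.

Lemma continuous_gauss1 a c : continuous (fun t : R => expR (- (a * (t - c) ^+ 2 / 2))).
Proof.
move=> t; apply: (continuous_comp (f := fun t : R => - (a * (t - c) ^+ 2 / 2))); last exact: continuous_expR.
apply: cvgN; apply: cvgM; last exact: cvg_cst.
apply: cvgM; first exact: cvg_cst.
under eq_fun do rewrite expr2.
by rewrite expr2; apply: cvgM; apply: cvgB; [exact: cvg_id|exact: cvg_cst|exact: cvg_id|exact: cvg_cst].
Qed.

Lemma continuous_gw1 a c s : continuous (fun t => complex.Re (gw1 a c s t)) /\
  continuous (fun t => complex.Im (gw1 a c s t)).
Proof.
have ct : continuous (fun t : R => - (t * s)).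
  by move=> t; apply: cvgN; apply: cvgM; [exact: cvg_id|exact: cvg_cst].
split.
  under eq_fun do rewrite ReM /= mulr0 subr0.
  move=> t; apply: cvgM; last exact: continuous_gauss1.
  by apply: (continuous_comp (f := fun t : R => - (t * s))); [exact: ct|exact: continuous_cos].
under eq_fun do rewrite ImM /= mulr0 add0r.
move=> t; apply: cvgM; last exact: continuous_gauss1.
by apply: (continuous_comp (f := fun t : R => - (t * s))); [exact: ct|exact: continuous_sin].
Qed.

Lemma scont_gauss a m : scont (fun y : 'rV[R]_N => expR (- (a * enorm (y - m) ^+ 2 / 2))).
Proof.
have -> : (fun y : 'rV[R]_N => expR (- (a * enorm (y - m) ^+ 2 / 2))) =
    fun y => \prod_(j < N) expR (- (a * (y 0 j - m 0 j) ^+ 2 / 2)).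
  apply/funext => y; rewrite -expR_sum; congr expR.
  rewrite enorm_sq mulr_sumr mulr_suml -sumrN.
  by apply: eq_bigr => j _; rewrite !mxE.
apply: scont_prod => j.
by apply: (scont_comp (h := fun t => expR (- (a * (t - m 0 j) ^+ 2 / 2))));
  [exact: continuous_gauss1|exact: scont_coord].
Qed.

Lemma scont_dotp xi : scont (fun y : 'rV[R]_N => dotp y xi).
Proof.
by apply: scont_sum => j; apply: scontM; [exact: scont_coord|exact: scont_cst].
Qed.

Lemma gwin_cnice a m xi : 0 < a -> cnice (gwin a m xi).
Proof.
move=> a0; split.
  apply: cscontM; last exact/cscontR/scont_gauss.
  apply: cscont_cis; under eq_fun do rewrite -mulN1r.
  by apply: scontM; [exact: scont_cst|exact: scont_dotp].
exists (\prod_(j < N) ((1 + 2 / a) * (2 * (1 + (m 0 j) ^+ 2)))) => y.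
rewrite gwin_prod cabs_prod /wgt -big_split /=; apply: ler_prod => j _.
by rewrite cabs_ge0 gw1_dom.
Qed.

(** The Gaussian integral sqrt(2 pi / a), kept as a symbol. *)
Definition gmass a : R := rI (fun t => expR (- (a * t ^+ 2 / 2))).

Lemma gauss1_dom a (t : R) : 0 < a -> `|expR (- (a * t ^+ 2 / 2))| <= (1 + 2 / a) * bump t.
Proof. by move=> a0; rewrite ger0_norm ?expR_ge0// expR_sq_le_bump. Qed.

Lemma gmass_gt0 a : 0 < a -> 0 < gmass a.
Proof.
move=> a0; apply: (rI_gt0 (K := 1 + 2 / a)).
- by have := @continuous_gauss1 a 0; under eq_fun do rewrite subr0.
- by move=> t; exact: gauss1_dom.
- by move=> t; exact: expR_gt0.
Qed.

Lemma cabs_gwin a m xi y : cabs (gwin a m xi y) = expR (- (a * enorm (y - m) ^+ 2 / 2)).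
Proof. by rewrite /gwin cabsM cabs_cis mul1r cabsR ger0_norm ?expR_ge0. Qed.

Lemma rint_gauss a m : 0 < a ->
  (exists K, forall y : 'rV[R]_N, expR (- (a * enorm (y - m) ^+ 2 / 2)) <= K * wgt y) /\
  rint (fun y : 'rV[R]_N => expR (- (a * enorm (y - m) ^+ 2 / 2))) = gmass a ^+ N.
Proof.
move=> a0; split.
  by have [_ [K h]] := gwin_cnice m 0 a0; exists K => y; rewrite -(cabs_gwin a m 0).
have -> : (fun y : 'rV[R]_N => expR (- (a * enorm (y - m) ^+ 2 / 2))) =
    fun y => \prod_(j < N) expR (- (a * (y 0 j - m 0 j) ^+ 2 / 2)).
  apply/funext => y; rewrite -expR_sum; congr expR.
  rewrite enorm_sq mulr_sumr mulr_suml -sumrN.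
  by apply: eq_bigr => j _; rewrite !mxE.
rewrite (@rint_prod _ _ (fun j t => expR (- (a * (t - m 0 j) ^+ 2 / 2)))
   (fun j => (1 + 2 / a) * (2 * (1 + (m 0 j) ^+ 2)))).
- rewrite -[RHS]/((gmass a) ^+ N) -[X in _ ^+ X](card_ord N) -prodr_const.
  apply: eq_bigr => j _; rewrite /gmass.
  rewrite -(rI_shift (f := fun t => expR (- (a * t ^+ 2 / 2))) (- m 0 j) (K := 1 + 2 / a))//.
    by have := @continuous_gauss1 a 0; under eq_fun do rewrite subr0.
  by move=> t; exact: gauss1_dom.
- by move=> j; exact: continuous_gauss1.
- move=> j t; rewrite ger0_norm ?expR_ge0// -(cabs_gw1 a (m 0 j) 0); exact: gw1_dom.
Qed.

Lemma cint_gwin_bound a m xi (f : 'rV[R]_N -> R[i]) B : 0 < a -> cscont f ->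
  (forall y, cabs (f y) <= B) ->
  cnice (fun y => f y * gwin a m xi y) /\
  cabs (cint (fun y => f y * gwin a m xi y)) <= 2 * gmass a ^+ N * B.
Proof.
move=> a0 cf fB; have ng := gwin_cnice m xi a0.
have nfg := cnice_bounded cf fB ng; split=> //.
have B0 : 0 <= B by exact: le_trans (cabs_ge0 _) (fB 0).
have [[K hK] E] := rint_gauss m a0.
have sg := @scont_gauss a m.
have gK y : `|expR (- (a * enorm (y - m) ^+ 2 / 2))| <= K * wgt y.
  by rewrite ger0_norm ?expR_ge0.
rewrite -mulrA (mulrC _ B) -E -(rintZ B sg gK).
apply: (cint_le (K := B * K)).
- by apply: cscontM => //; exact: ng.1.
- by apply: scontM => //; exact: scont_cst.
- by move=> y; rewrite -(mulrA B K); apply: ler_wpM2l.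
- by move=> y; rewrite cabsM cabs_gwin ler_wpM2r ?expR_ge0.
Qed.

Lemma is_pd_gwin a j m xi y :
  is_pd j (gwin a m xi) y (((a * m 0 j - a * y 0 j) +i* (- xi 0 j)) * gwin a m xi y).
Proof.
pose A := dotp y xi; pose E := enorm (y - m) ^+ 2.
apply: (@is_pd_comp_line _ _ _ _ _ _
  (fun t => cos (- (A + t * xi 0 j)) * expR (- (a * (E + (2 * t * (y 0 j - m 0 j) + t ^+ 2)) / 2)))
  (fun t => sin (- (A + t * xi 0 j)) * expR (- (a * (E + (2 * t * (y 0 j - m 0 j) + t ^+ 2)) / 2)))).
- by move=> t; rewrite /gwin ReM /= dotp_line enorm_line mulr0 subr0.
- by move=> t; rewrite /gwin ImM /= dotp_line enorm_line mulr0 add0r.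
- have -> : complex.Re (((a * m 0 j - a * y 0 j) +i* - xi 0 j) * gwin a m xi y) =
     (a * m 0 j - a * y 0 j) * (cos (- A) * expR (- (a * E / 2))) + xi 0 j * (sin (- A) * expR (- (a * E / 2))).
    by rewrite /gwin ReM ReM ImM /= !(mulr0, subr0, add0r) mulNr opprK.
  apply: is_derive_eq.
  rewrite /GRing.scale /= !(mul0r, mulr0, addr0, subr0, add0r, expr0n, mulr1) /=.
  rewrite ?(mul0r, mulr0, addr0, subr0, add0r) /=.
  by field.
- have -> : complex.Im (((a * m 0 j - a * y 0 j) +i* - xi 0 j) * gwin a m xi y) =
     (a * m 0 j - a * y 0 j) * (sin (- A) * expR (- (a * E / 2))) - xi 0 j * (cos (- A) * expR (- (a * E / 2))).
    by rewrite /gwin ImM ReM ImM /= !(mulr0, subr0, add0r) mulNr.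
  apply: is_derive_eq.
  rewrite /GRing.scale /= !(mul0r, mulr0, addr0, subr0, add0r, expr0n, mulr1) /=.
  rewrite ?(mul0r, mulr0, addr0, subr0, add0r) /=.
  by field.
Qed.

End Window.

Section MomentRecursion.
Context {R : realType}.

(* [tau k l] is the transform of [y^k] times the l-th derivative of [f]; the
   recursion is one integration by parts. *)
Lemma recursion_decay (theta a B C : R) (z : R[i]) (tau : nat -> nat -> R[i]) :
  2^-1 <= theta -> 0 <= a -> 1 <= C -> 0 <= B ->
  (forall k l, cabs (tau k l) <= B * (C ^+ (k + l) * gbd theta (k + l))) ->
  (forall k l, z * tau k l = a%:C * tau k.+1 l - tau k l.+1 -
     (if k is k1.+1 then k%:R * tau k1 l else 0)) ->
  forall n, cabs z ^+ n * cabs (tau 0%N 0%N) <= B * (((2 + a) * C) ^+ n * gbd theta n).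
Proof.
move=> th a0 C1 B0 tB rec.
have C0 : 0 < C by exact: lt_le_trans C1.
have g0 q : 0 <= gbd theta q by exact/ltW/gbd_gt0.
suff H n : forall k l, cabs z ^+ n * cabs (tau k l) <=
    B * (((2 + a) * C) ^+ n * (C ^+ (k + l) * gbd theta (k + l + n))).
  by move=> n; have := H n 0%N 0%N; rewrite add0n expr0 mul1r.
elim: n => [|n IH] k l; first by rewrite !expr0 !mul1r addn0.
rewrite exprSr -mulrA -cabsM rec.
have IH1 := IH k.+1 l; have IH2 := IH k l.+1.
set D := ((2 + a) * C) ^+ n in IH IH1 IH2 *.
have D0 : 0 <= D by rewrite exprn_ge0// mulr_ge0 ?(ltW C0)// addr_ge0.
set q := (k + l)%N in IH IH1 IH2 *.
have e1 : (k.+1 + l = q.+1)%N by rewrite addSn.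
have e2 : (k + l.+1 = q.+1)%N by rewrite addnS.
rewrite e1 exprS in IH1; rewrite e2 exprS in IH2.
have IH3 : cabs z ^+ n * cabs (if k is k1.+1 then k%:R * tau k1 l else 0) <=
    B * (D * (C * C ^+ q * gbd theta (q.+1 + n))).
  rewrite /q; case: (k) => [|k1].
    by rewrite cabs0 mulr0 !mulr_ge0// ?exprn_ge0 ?(ltW C0).
  rewrite cabsM cabs_natr mulrCA; apply: le_trans (ler_wpM2l (ler0n _ _) (IH k1 l)) _.
  rewrite mulrCA ler_wpM2l// mulrCA ler_wpM2l// mulrCA.
  rewrite addSn -exprS; apply: ler_pM.
  - by rewrite exprn_ge0// ltW.
  - by rewrite mulr_ge0.
  - by apply: ler_weXn2l => //; rewrite !leqW.
  - by rewrite !addSn gbd_mulS2// ltnS (leq_trans (leq_addr l k1))// leq_addr.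
have z0 : 0 <= cabs z ^+ n by rewrite exprn_ge0// cabs_ge0.
apply: (@le_trans _ _ (cabs z ^+ n * (a * cabs (tau k.+1 l) + cabs (tau k l.+1) +
    cabs (if k is k1.+1 then k%:R * tau k1 l else 0)))).
  rewrite ler_wpM2l// (le_trans (cabsD _ _))// cabsN lerD2r (le_trans (cabsD _ _))// cabsN lerD2r.
  by rewrite cabsM cabsR ger0_norm.
rewrite !mulrDr mulrCA.
have IH1' := ler_wpM2l a0 IH1.
apply: le_trans (lerD (lerD IH1' IH2) IH3) _.
rewrite exprS -/D addnS -addSn.
by rewrite le_eqVlt; apply/orP; left; apply/eqP; ring.
Qed.

End MomentRecursion.

(** * Exponential decay of the transform of a test function *)

Section TransformDecay.
Context {R : realType} {N : nat}.
Implicit Types (f : 'rV[R]_N -> R[i]) (m xi y : 'rV[R]_N) (theta a B C M : R).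

(** A short-time Fourier transform with Gaussian window, without complex conjugation since the
    pairing is bilinear. *)
Definition gwt a f (X : phase R N) : R[i] := cint (fun y => f y * gwin a X.1 X.2 y).

(* Weaker than [gsb]: only one coordinate at a time is involved, which is all
   that the integrations by parts need. *)
Definition coordb theta C M f := [/\ smooth f, forall y, cabs (f y) <= M & forall j k l y,
  `|y 0 j| ^+ k * cabs (iter l (pderiv j) f y) <= M * (C ^+ (k + l) * gbd theta (k + l))].

Lemma iter_foldr j l f : iter l (pderiv j) f = foldr (@pderiv R N) f (nseq l j).
Proof. by elim: l => //= l ->. Qed.

Lemma gsb_coordb theta C M f : gsb theta C M f -> coordb theta C M f.
Proof.
move=> [sf h]; split=> // [y|j k l y].
  by have := h 0%N [::] y; rewrite expr0 mul1r /= expr0 mul1r /gbd fact0 powR1 mulr1.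
rewrite iter_foldr.
have := h k (nseq l j) y; rewrite size_nseq; apply: le_trans.
by rewrite ler_wpM2r ?cabs_ge0// lerXn2r ?nnegrE// coord_le_norm.
Qed.

Lemma smooth_cscont f s : smooth f -> cscont (foldr (@pderiv R N) f s).
Proof. by move=> /(_ s) [h1 h2 _]; split; exact: continuous_scont. Qed.

Lemma is_pd_coordX j k y :
  is_pd j (fun y => (y 0 j ^+ k)%:C) y (if k is k1.+1 then k%:R * (y 0 j ^+ k1)%:C else 0).
Proof.
elim: k => [|k IH].
  by under eq_fun do rewrite expr0; exact: is_pd_cst.
under eq_fun do rewrite exprS rmorphM.
have h : is_pd j (fun y => (y 0 j)%:C) y 1.
  apply: (@is_pd_comp_line _ _ _ _ _ _ (fun t => y 0 j + t) (fun t => 0)).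
  - by move=> t; rewrite /= !mxE !eqxx mulr1.
  - by [].
  - have H := is_deriveD (is_derive_cst (y 0 j) (0 : R) (1 : R)) (is_derive_id (0 : R) (1 : R)).
    by rewrite add0r in H.
have := is_pdM h IH; set u := (X in is_pd _ _ _ X -> _).
suff -> : u = k.+1%:R * (y 0 j ^+ k)%:C by [].
rewrite /u; case: (k) => [|k1]; first by rewrite mulr0 addr0.
by rewrite exprS rmorphM -[in RHS]natr1 mulrDl mul1r addrC mulrCA.
Qed.

(** The derivative of y_j^k (d_j^l f) times the window has integral zero; the window contributes the
    factor a m_j - a y_j - i xi_j, which is exactly the recursion of [recursion_decay] with
    multiplier z = a m_j - i xi_j. *)
Lemma gwt_moments theta a C M f (X : phase R N) j n : 2^-1 <= theta -> 0 < a -> 1 <= C -> 0 <= M ->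
  coordb theta C M f ->
  cabs ((a * X.1 0 j) +i* (- X.2 0 j)) ^+ n * cabs (gwt a f X) <=
   (2 * gmass a ^+ N * M) * (((2 + a) * C) ^+ n * gbd theta n).
Proof.
case: X => m xi /= th a0 C1 M0 [sf _ hf].
have C0 : 0 < C by exact: lt_le_trans C1.
have K0 : 0 <= 2 * gmass a ^+ N by rewrite mulr_ge0// exprn_ge0// ltW// gmass_gt0.
pose F k l y := (y 0 j ^+ k)%:C * iter l (pderiv j) f y.
have cF k l : cscont (F k l).
  apply: cscontM; last by rewrite iter_foldr; exact: smooth_cscont.
  apply: cscontR; elim: k => [|k IH].
    by under eq_fun do rewrite expr0; exact: scont_cst.
  by under eq_fun do rewrite exprS; apply: scontM => //; exact: scont_coord.
have bF k l y : cabs (F k l y) <= M * (C ^+ (k + l) * gbd theta (k + l)).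
  by rewrite cabsM cabsR normrX.
have H k l := cint_gwin_bound m xi a0 (cF k l) (bF k l).
pose tau k l := cint (fun y => F k l y * gwin a m xi y).
have -> : gwt a f (m, xi) = tau 0%N 0%N.
  by congr cint; apply/funext => y; rewrite /F /= expr0 mul1r.
apply: (recursion_decay (tau := tau) th (ltW a0) C1); first by rewrite mulr_ge0.
  by move=> k l; rewrite -mulrA; exact: (H k l).2.
move=> k l; apply/eqP; rewrite -subr_eq0; apply/eqP.
pose P (y : 'rV[R]_N) := (if k is k1.+1 then k%:R * F k1 l y else 0) * gwin a m xi y.
have nP : cnice P.
  rewrite /P; case: (k) => [|k1].
    under eq_fun do rewrite mul0r; split; first exact: cscont_cst.
    by exists 0 => y; rewrite cabs0 mul0r.
  under eq_fun do rewrite -mulrA; apply: cniceZ; exact: (H _ _).1.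
have intP : cint P = if k is k1.+1 then k%:R * tau k1 l else 0.
  rewrite /P; case: (k) => [|k1].
    by under eq_fun do rewrite mul0r; exact: cint0.
  under eq_fun do rewrite -mulrA; apply: cintZ; exact: (H _ _).1.
pose z : R[i] := (a * m 0 j) +i* - xi 0 j.
have n1 : cnice (fun y => - a%:C * (F k.+1 l y * gwin a m xi y)) by apply: cniceZ; exact: (H _ _).1.
have n2 : cnice (fun y => z * (F k l y * gwin a m xi y)) by apply: cniceZ; exact: (H _ _).1.
have n3 := (H k l.+1).1.
have n12 := cniceD n1 n2; have n34 := cniceD n3 nP; have n1234 := cniceD n12 n34.
have I : cint (fun y => (- a%:C * (F k.+1 l y * gwin a m xi y) + z * (F k l y * gwin a m xi y)) +
    (F k l.+1 y * gwin a m xi y + P y)) = 0.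
  apply: (cint_ibp (j := j) (H k l).1 n1234) => y.
  have D1 := is_pd_coordX j k y.
  have D2 : is_pd j (iter l (pderiv j) f) y (iter l.+1 (pderiv j) f y).
    by rewrite /= iter_foldr; exact: smooth_pd.
  have := is_pdM (is_pdM D1 D2) (is_pd_gwin a j m xi y).
  set u := (X in is_pd _ _ _ X -> _); set v := (X in _ -> is_pd _ _ _ X).
  suff -> : u = v by [].
  have ez : ((a * m 0 j - a * y 0 j) +i* - xi 0 j) = z - a%:C * (y 0 j)%:C.
    by rewrite /z -rmorphM; apply: complex_eqP; rewrite ?ReD ?ImD ?ReN ?ImN /= ?subr0.
  rewrite /u /v /P ez /F exprS rmorphM /=.
  by case: (k) => [|k1]; ring.
rewrite (cintD n12 n34) (cintD n1 n2) (cintD n3 nP) intP in I.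
rewrite (cintZ _ (H _ _).1) (cintZ _ (H _ _).1) -/(tau _ _) -/(tau _ _) -/(tau _ _) in I.
have alg (A B T1 T2 T3 W : R[i]) : - A * T1 + B * T2 + (T3 + W) = 0 ->
    B * T2 - (A * T1 - T3 - W) = 0 by move=> <-; ring.
exact: alg I.
Qed.

Lemma exists_coord_norm (x : 'rV[R]_N) : x != 0 -> exists j, `|x| = `|x 0 j|.
Proof.
move=> x0; have -> : `|x| = mx_norm x by [].
have xn : mx_norm x != 0 by apply: contra x0 => /eqP/mx_norm_eq0 ->.
have [[i j] h] := mx_norm_neq0 xn.
by exists j; rewrite h ord1.
Qed.

Lemma half_weight_le (t k u v : R) : 0 <= t / 4 * k -> u <= v ->
  t / 4 * k * (u + v) <= t / 2 * (k * v).
Proof. by move=> k0 uv; have := ler_wpM2l k0 uv; lra. Qed.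

(** For the coordinate realizing the sup norm, the multiplier dominates |m| (as a >= 1), and
    likewise |xi|. The larger of the two weights is at least half their sum, whence theta / 4 in
    place of the theta / 2 of [decay_of_moments]. *)
Lemma gwt_decay theta a C M f (X : phase R N) : 2^-1 <= theta < 1 -> 1 <= a -> 1 <= C -> 0 <= M ->
  coordb theta C M f ->
  cabs (gwt a f X) <= 2 * (2 * gmass a ^+ N * M) *
     expR (- (theta / 4 * (((2 + a) * C)^-1 `^ theta^-1) * phw theta X)).
Proof.
case: X => m xi /andP[th2 th1] a1 C1 M0 hf.
have th0 : 0 < theta by rewrite (lt_le_trans _ th2)// invr_gt0.
have a0 : 0 < a by exact: lt_le_trans a1.
have C0 : 0 < C by exact: lt_le_trans C1.
have K0 : 0 <= 2 * gmass a ^+ N by rewrite mulr_ge0// exprn_ge0// ltW// gmass_gt0.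
set A := 2 * gmass a ^+ N * M; have A0 : 0 <= A by rewrite mulr_ge0.
set L := (2 + a) * C; have L0 : 0 < L by rewrite mulr_gt0// addr_gt0.
set c := L^-1 `^ theta^-1; have c0 : 0 <= c by exact: powR_ge0.
have T0 : cabs (gwt a f (m, xi)) <= 2 * A.
  have [sf bf _] := hf.
  have [_] := cint_gwin_bound m xi a0 (smooth_cscont [::] sf) bf.
  by move/le_trans; apply; rewrite -/A ler_peMl// ler1n.
have one (r : R) j : 0 <= r -> r <= cabs ((a * m 0 j) +i* (- xi 0 j)) ->
    cabs (gwt a f (m, xi)) <= 2 * A * expR (- (theta / 2 * (c * r `^ theta^-1))).
  move=> r0 rz; rewrite /c mulrC -powRM ?invr_ge0 ?(ltW L0)// mulrC.
  rewrite (mulrC L^-1); apply: decay_of_moments => //; rewrite ?th0 ?(ltW th1) ?cabs_ge0//.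
  move=> n; apply: le_trans (gwt_moments (m, xi) j n th2 a0 C1 M0 hf).
  by rewrite ler_wpM2r ?cabs_ge0// lerXn2r ?nnegrE ?cabs_ge0.
have p0 : theta^-1 != 0 by rewrite invr_neq0// gt_eqF.
have tm : cabs (gwt a f (m, xi)) <= 2 * A * expR (- (theta / 2 * (c * `|m| `^ theta^-1))).
  have [m0|m0] := eqVneq m 0.
    by rewrite [in leRHS]m0 normr0 powR0// !mulr0 oppr0 expR0 mulr1.
  have [j ->] := exists_coord_norm m0; apply: (one _ j) => //.
  apply: le_trans (Re_le_cabs _) => /=; rewrite normrM ler_peMl//.
  by rewrite ger0_norm // ltW.
have tx : cabs (gwt a f (m, xi)) <= 2 * A * expR (- (theta / 2 * (c * `|xi| `^ theta^-1))).
  have [xi0|x0] := eqVneq xi 0.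
    by rewrite [in leRHS]xi0 normr0 powR0// !mulr0 oppr0 expR0 mulr1.
  have [j ->] := exists_coord_norm x0; apply: (one _ j) => //.
  by apply: le_trans (Im_le_cabs _) => /=; rewrite normrN.
rewrite /phw /=; set u := `|m| `^ _ in tm *; set v := `|xi| `^ _ in tx *.
have th40 : 0 <= theta / 4 * c by rewrite mulr_ge0// divr_ge0// ltW.
have A20 : 0 <= 2 * A by rewrite mulr_ge0.
case: (leP u v) => uv.
  apply: (le_trans tx); apply: (ler_wpM2l A20); rewrite ler_expR lerN2.
  exact: half_weight_le.
apply: (le_trans tm); apply: (ler_wpM2l A20); rewrite ler_expR lerN2.
by rewrite addrC; apply: half_weight_le => //; exact: ltW.
Qed.

End TransformDecay.

(** * Fourier transforms of Gaussians on the line *)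

Section GaussianFourier1.
Context {R : realType}.
Implicit Types (a t u : R).

Lemma rI_derive0 (F F' : R -> R) K : continuous F -> continuous F' ->
  (forall t, `|F t| <= K * bump t) -> (forall t, `|F' t| <= K * bump t) ->
  (forall t, is_derive t 1 F (F' t)) -> rI F' = 0.
Proof.
move=> cF cF' FK F'K dF.
have E (G : R -> R) : rI G = rint (fun x : 'rV[R]_1 => G (x 0 0)).
  rewrite rintS; congr rI; apply/funext => t; rewrite /slice /=.
  by congr G; rewrite row_mx_ord0 mxE.
have w1 (x : 'rV[R]_1) : wgt x = bump (x 0 0) by rewrite /wgt big_ord1.
rewrite E; apply: (@rint_derive0 _ _ (fun x : 'rV[R]_1 => F (x 0 0)) _ 0 K).
- by apply: (scont_comp (h := F)) => //; exact: scont_coord.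
- by apply: (scont_comp (h := F')) => //; exact: scont_coord.
- by move=> x; rewrite w1.
- by move=> x; rewrite w1.
- move=> x; apply: cvg_is_derive.
  have := is_derive_cvg (dF (x 0 0)).
  apply: cvg_trans; apply: near_eq_cvg; near=> h.
  by rewrite /= !mxE eqxx mulr1 /GRing.scale /= mulr1.
Unshelve. all: by end_near. Qed.

Lemma cZ (c : R) (u : R -> R) : continuous u -> continuous (fun t => c * u t).
Proof. by move=> cu s; apply: cvgM; [exact: cvg_cst|exact: cu]. Qed.

Arguments cZ c {u} _.

Lemma bZ (c : R) (u : R -> R) L : (forall t, `|u t| <= L * bump t) ->
  forall t, `|c * u t| <= (`|c| * L) * bump t.
Proof. by move=> uL s; rewrite normrM -mulrA ler_wpM2l. Qed.

(** The bound on the second derivative in the parameter gives a quadratic Taylor remainder that can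
    be integrated, which is what [is_derive_sq] asks for. *)
Lemma rI_derive_param (F F1 F2 : R -> R -> R) K t :
  (forall t, continuous (F t)) -> (forall t, continuous (F1 t)) ->
  (forall t u, `|F t u| <= K * bump u) -> (forall t u, `|F1 t u| <= K * bump u) ->
  (forall t u, `|F2 t u| <= K * bump u) ->
  (forall t u, is_derive t 1 (F ^~ u) (F1 t u)) ->
  (forall t u, is_derive t 1 (F1 ^~ u) (F2 t u)) ->
  is_derive t 1 (fun t => rI (F t)) (rI (F1 t)).
Proof.
move=> cF cF1 FK F1K F2K dF dF1.
apply: (@is_derive_sq _ _ _ _ _ _ (K * rI bump)) => h.
have cD (u v : R -> R) : continuous u -> continuous v -> continuous (fun t => u t + v t).
  by move=> cu cv s; apply: cvgD; [exact: cu|exact: cv].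
have bD (u v : R -> R) L M : (forall t, `|u t| <= L * bump t) -> (forall t, `|v t| <= M * bump t) ->
    forall t, `|u t + v t| <= (L + M) * bump t.
  by move=> uL vM s; rewrite mulrDl (le_trans (ler_normD _ _))// lerD.
pose s : R := t + h *: 1.
have b1 := FK s; have b2 := bZ (-1) (FK t); have b3 := bZ (- h) (F1K t).
have c1 := cF s; have c2 := cZ (-1) (cF t); have c3 := cZ (- h) (cF1 t).
have -> : rI (F s) - rI (F t) - h * rI (F1 t) =
    rI (fun u => F s u + -1 * F t u + - h * F1 t u).
  rewrite (rID (cD _ _ c1 c2) c3 (bD _ _ _ _ b1 b2) b3) (rID c1 c2 b1 b2).
  by rewrite (rIZ _ (cF t) (FK t)) (rIZ _ (cF1 t) (F1K t)) mulN1r mulNr.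
rewrite mulrAC; apply: rI_bound; first by apply: (cD _ _ (cD _ _ c1 c2) c3).
move=> u; rewrite mulN1r mulNr mulrAC.
apply: (@taylor1 R _ (F ^~ u) (F1 ^~ u) (F2 ^~ u) t 1 (K * bump u) h).
by move=> y; exact: F2K.
Qed.

Definition gw a u : R := expR (- (a * u ^+ 2 / 2)).

Lemma continuous_gw a : continuous (gw a).
Proof.
have := @continuous_gauss1 R a 0.
by rewrite (_ : (fun t => _) = gw a)//; apply/funext => t; rewrite subr0.
Qed.

Lemma gw_ge0 a u : 0 <= gw a u. Proof. exact: expR_ge0. Qed.

Lemma gw_bump2 a u : 0 < a -> (1 + u ^+ 2) * gw a u <= 2 * (1 + 6 / a + 32 / a ^+ 2) * bump u.
Proof.
move=> a0; rewrite /bump ler_pdivlMr ?ltr_wpDr ?sqr_ge0// /gw expRN mulrAC.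
rewrite ler_pdivrMr ?expR_gt0//; set x := a * u ^+ 2 / 2.
have x0 : 0 <= x by rewrite /x divr_ge0// mulr_ge0 ?sqr_ge0// ltW.
have h1 := expR_ge1Dx x.
have h2 : x ^+ 2 / 2 <= expR x by have := exp_coeff_le_expR 2 x0.
(* In terms of x, the polynomial (1 + u^2)^2 is quadratic with each power of x bounded by a multiple
   of exp x. *)
have eu : u ^+ 2 = 2 / a * x by rewrite /x; field; rewrite gt_eqF.
rewrite eu.
have i0 : 0 < a^-1 by rewrite invr_gt0.
set i := a^-1 in i0 *.
have -> : 32 / a ^+ 2 = 32 * i ^+ 2 by rewrite -exprVn.
have h3 : (1 + 2 * i * x) * (1 + 2 * i * x) = 1 + 4 * i * x + 4 * i ^+ 2 * x ^+ 2 by ring.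
rewrite h3.
have e0 : 0 <= expR x by exact: expR_ge0.
have h4 : 4 * i * x <= 4 * i * expR x by rewrite ler_wpM2l ?mulr_ge0 ?(ltW i0)//; lra.
have h5 : 4 * i ^+ 2 * x ^+ 2 <= 8 * i ^+ 2 * expR x.
  rewrite (_ : 4 * i ^+ 2 * x ^+ 2 = 8 * i ^+ 2 * (x ^+ 2 / 2)); last by field.
  by rewrite ler_wpM2l// mulr_ge0// sqr_ge0.
have h6 : 0 <= i * expR x by rewrite mulr_ge0// ltW.
have h7 : 0 <= i ^+ 2 * expR x by rewrite mulr_ge0// sqr_ge0.
lra.
Qed.

Definition gwC a : R := 2 * (1 + 6 / a + 32 / a ^+ 2).

Lemma gw_trig_dom a (P tr : R -> R) : 0 < a -> (forall u, `|P u| <= 1 + u ^+ 2) ->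
  (forall u, `|tr u| <= 1) -> forall u, `|P u * gw a u * tr u| <= gwC a * bump u.
Proof.
move=> a0 P1 tr1 u; apply: le_trans (gw_bump2 u a0).
rewrite 2!normrM (ger0_norm (gw_ge0 _ _)) -[leRHS]mulr1.
by apply: ler_pM; rewrite ?mulr_ge0 ?gw_ge0//; apply: ler_pM; rewrite ?gw_ge0.
Qed.

Lemma continuous_gw_trig a (P tr : R -> R) : continuous P -> continuous tr ->
  continuous (fun u => P u * gw a u * tr u).
Proof.
move=> cP ct u; apply: cvgM; last exact: ct.
by apply: cvgM; [exact: cP|exact: continuous_gw].
Qed.

Let le1 u : `|(1 : R)| <= 1 + u ^+ 2. Proof. by rewrite normr1 lerDl sqr_ge0. Qed.
Let leu u : `|u| <= 1 + u ^+ 2.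
Proof.
rewrite -(real_normK (num_real u)); have := sqr_ge0 (`|u| - 1); have := normr_ge0 u; nra.
Qed.
Let leuu u : `|u * u| <= 1 + u ^+ 2.
Proof. by rewrite -expr2 ger0_norm ?sqr_ge0// lerDr. Qed.
Let c1 : continuous (fun _ : R => 1 : R). Proof. exact: cst_continuous. Qed.
Let cu : continuous (fun u : R => u). Proof. by move=> u; exact: cvg_id. Qed.
Let cuu : continuous (fun u : R => u * u). Proof. by move=> u; apply: cvgM; exact: cvg_id. Qed.
Let ccos t : continuous (fun u : R => cos (t * u)).
Proof.
move=> u; apply: (continuous_comp (f := fun u : R => t * u)); last exact: continuous_cos.
by apply: cvgM; [exact: cvg_cst|exact: cvg_id].
Qed.
Let csin t : continuous (fun u : R => sin (t * u)).
Proof.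
move=> u; apply: (continuous_comp (f := fun u : R => t * u)); last exact: continuous_sin.
by apply: cvgM; [exact: cvg_cst|exact: cvg_id].
Qed.

(** The explicit factor 1 gives all these integrals the shape P(u) gw(u) trig(u) of
    [gw_trig_dom]. *)
Definition Ecos a t := rI (fun u => 1 * gw a u * cos (t * u)).
Definition Esin a t := rI (fun u => 1 * gw a u * sin (t * u)).
Definition Eusin a t := rI (fun u => u * gw a u * sin (t * u)).
Definition Eucos a t := rI (fun u => u * gw a u * cos (t * u)).
Definition Euucos a t := rI (fun u => u * u * gw a u * cos (t * u)).

Lemma is_derive_gw a u : is_derive u 1 (gw a) (- (a * u * gw a u)).
Proof.
rewrite /gw; apply: is_derive_eq; rewrite /GRing.scale /= ?expr0n ?mulr1 ?mulr0 ?addr0.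
by field.
Qed.

(** With differentiation under the integral this becomes the linear equation for [Ecos] solved by
    [gauss_ode]; the two lemmas that follow play the same part for [Esin] and for the second
    moment. *)
Lemma Eusin_ibp a t : 0 < a -> a * Eusin a t = t * Ecos a t.
Proof.
move=> a0.
pose F u := 1 * gw a u * sin (t * u).
pose G u := (- a) * (u * gw a u * sin (t * u)) + t * (1 * gw a u * cos (t * u)).
have b1 := gw_trig_dom a0 le1 (fun u => sin_max (t * u)).
have b2 := gw_trig_dom a0 leu (fun u => sin_max (t * u)).
have b3 := gw_trig_dom a0 le1 (fun u => cos_max (t * u)).
have k1 := @continuous_gw_trig a _ _ c1 (@csin t).
have k2 := @continuous_gw_trig a _ _ cu (@csin t).
have k3 := @continuous_gw_trig a _ _ c1 (@ccos t).
have gC0 : 0 <= gwC a by have := le_trans (normr_ge0 _) (b1 0); rewrite pmulr_lge0 ?bump_gt0.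
have kG : continuous G by move=> u; apply: cvgD; [exact: (cZ _ k2)|exact: (cZ _ k3)].
have bG u : `|G u| <= ((`|- a| * gwC a) + (`|t| * gwC a)) * bump u.
  rewrite mulrDl (le_trans (ler_normD _ _))//.
  exact: (lerD (bZ _ b2 u) (bZ _ b3 u)).
have I : rI G = 0.
  apply: (@rI_derive0 F G (gwC a + ((`|- a| * gwC a) + (`|t| * gwC a)))) => //.
  - move=> u; apply: le_trans (b1 u) _; rewrite ler_wpM2r ?bump_ge0// lerDl.
    by rewrite addr_ge0// mulr_ge0.
  - by move=> u; apply: le_trans (bG u) _; rewrite ler_wpM2r ?bump_ge0// lerDr.
  - move=> u; have dg := is_derive_gw a u; rewrite /F.
    apply: is_derive_eq; rewrite /G /GRing.scale /= ?mulr1 ?mul1r ?mulr0 ?addr0 ?scaler0; ring.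
move: I; rewrite (rID (cZ _ k2) (cZ _ k3) (bZ _ b2) (bZ _ b3)).
rewrite (rIZ _ k2 b2) (rIZ _ k3 b3) -/(Eusin a t) -/(Ecos a t) => I.
by apply/eqP; rewrite -subr_eq0 -oppr_eq0 opprB -mulNr addrC I.
Qed.

Lemma Eucos_ibp a t : 0 < a -> a * Eucos a t = - (t * Esin a t).
Proof.
move=> a0.
pose F u := 1 * gw a u * cos (t * u).
pose G u := (- a) * (u * gw a u * cos (t * u)) + (- t) * (1 * gw a u * sin (t * u)).
have b1 := gw_trig_dom a0 le1 (fun u => cos_max (t * u)).
have b2 := gw_trig_dom a0 leu (fun u => cos_max (t * u)).
have b3 := gw_trig_dom a0 le1 (fun u => sin_max (t * u)).
have k1 := @continuous_gw_trig a _ _ c1 (@ccos t).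
have k2 := @continuous_gw_trig a _ _ cu (@ccos t).
have k3 := @continuous_gw_trig a _ _ c1 (@csin t).
have gC0 : 0 <= gwC a by have := le_trans (normr_ge0 _) (b1 0); rewrite pmulr_lge0 ?bump_gt0.
have kG : continuous G by move=> u; apply: cvgD; [exact: (cZ _ k2)|exact: (cZ _ k3)].
have bG u : `|G u| <= ((`|- a| * gwC a) + (`|- t| * gwC a)) * bump u.
  rewrite mulrDl (le_trans (ler_normD _ _))//.
  exact: (lerD (bZ _ b2 u) (bZ _ b3 u)).
have I : rI G = 0.
  apply: (@rI_derive0 F G (gwC a + ((`|- a| * gwC a) + (`|- t| * gwC a)))) => //.
  - move=> u; apply: le_trans (b1 u) _; rewrite ler_wpM2r ?bump_ge0// lerDl.
    by rewrite addr_ge0// mulr_ge0.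
  - by move=> u; apply: le_trans (bG u) _; rewrite ler_wpM2r ?bump_ge0// lerDr.
  - move=> u; have dg := is_derive_gw a u; rewrite /F.
    apply: is_derive_eq; rewrite /G /GRing.scale /= ?mulr1 ?mul1r ?mulr0 ?addr0 ?scaler0; ring.
move: I; rewrite (rID (cZ _ k2) (cZ _ k3) (bZ _ b2) (bZ _ b3)).
rewrite (rIZ _ k2 b2) (rIZ _ k3 b3) -/(Eucos a t) -/(Esin a t) => I.
apply/eqP; rewrite -subr_eq0 opprK -oppr_eq0 opprD -!mulNr; exact/eqP.
Qed.

Lemma Euucos_ibp a t : 0 < a -> a * Euucos a t = Ecos a t - t * Eusin a t.
Proof.
move=> a0.
pose F u := u * gw a u * cos (t * u).
pose G u := (1 * gw a u * cos (t * u) + (- a) * (u * u * gw a u * cos (t * u)))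
   + (- t) * (u * gw a u * sin (t * u)).
have b1 := gw_trig_dom a0 leu (fun u => cos_max (t * u)).
have b2 := gw_trig_dom a0 leuu (fun u => cos_max (t * u)).
have b3 := gw_trig_dom a0 leu (fun u => sin_max (t * u)).
have b4 := gw_trig_dom a0 le1 (fun u => cos_max (t * u)).
have k1 := @continuous_gw_trig a _ _ cu (@ccos t).
have k2 := @continuous_gw_trig a _ _ cuu (@ccos t).
have k3 := @continuous_gw_trig a _ _ cu (@csin t).
have k4 := @continuous_gw_trig a _ _ c1 (@ccos t).
have gC0 : 0 <= gwC a by have := le_trans (normr_ge0 _) (b1 0); rewrite pmulr_lge0 ?bump_gt0.
have k42 : continuous (fun u => 1 * gw a u * cos (t * u) + (- a) * (u * u * gw a u * cos (t * u))).
  by move=> u; apply: cvgD; [exact: k4|exact: (cZ _ k2)].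
have b42 u : `|1 * gw a u * cos (t * u) + (- a) * (u * u * gw a u * cos (t * u))| <=
    (gwC a + `|- a| * gwC a) * bump u.
  rewrite mulrDl (le_trans (ler_normD _ _))//.
  exact: (lerD (b4 u) (bZ _ b2 u)).
have kG : continuous G by move=> u; apply: cvgD; [exact: k42|exact: (cZ _ k3)].
have bG u : `|G u| <= ((gwC a + `|- a| * gwC a) + (`|- t| * gwC a)) * bump u.
  rewrite mulrDl (le_trans (ler_normD _ _))//.
  exact: (lerD (b42 u) (bZ _ b3 u)).
have I : rI G = 0.
  apply: (@rI_derive0 F G (gwC a + ((gwC a + `|- a| * gwC a) + (`|- t| * gwC a)))) => //.
  - move=> u; apply: le_trans (b1 u) _; rewrite ler_wpM2r ?bump_ge0// lerDl.
    by rewrite !addr_ge0// mulr_ge0.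
  - by move=> u; apply: le_trans (bG u) _; rewrite ler_wpM2r ?bump_ge0// lerDr.
  - move=> u; have dg := is_derive_gw a u; rewrite /F.
    apply: is_derive_eq; rewrite /G /GRing.scale /= ?mulr1 ?mul1r ?mulr0 ?addr0 ?scaler0; ring.
move: I; rewrite (rID k42 (cZ _ k3) b42 (bZ _ b3)) (rID k4 (cZ _ k2) b4 (bZ _ b2)).
rewrite (rIZ _ k2 b2) (rIZ _ k3 b3) -/(Eusin a t) -/(Ecos a t) -/(Euucos a t) => I.
by apply/eqP; rewrite eq_sym -subr_eq0 addrAC -!mulNr I.
Qed.

Lemma is_derive_Ecos a t : 0 < a -> is_derive t 1 (Ecos a) (- Eusin a t).
Proof.
move=> a0.
have -> : - Eusin a t = rI (fun u => (- u) * gw a u * sin (t * u)).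
  have b2 := gw_trig_dom a0 leu (fun u => sin_max (t * u)).
  have k2 := @continuous_gw_trig a _ _ cu (@csin t).
  by rewrite -mulN1r -(rIZ _ k2 b2); congr rI; apply/funext => u; ring.
apply: (@rI_derive_param (fun t u => 1 * gw a u * cos (t * u))
  (fun t u => (- u) * gw a u * sin (t * u)) (fun t u => - (u * u) * gw a u * cos (t * u)) (gwC a)).
- by move=> s; apply: continuous_gw_trig.
- by move=> s; apply: continuous_gw_trig => // u; apply: cvgN; exact: cvg_id.
- by move=> s u; apply: (gw_trig_dom a0 le1 (fun u => cos_max (s * u))).
- move=> s u; apply: (@gw_trig_dom a (fun u => - u) (fun u => sin (s * u)) a0) => v; first by rewrite normrN.
  exact: sin_max.
- move=> s u; apply: (@gw_trig_dom a (fun u => - (u * u)) (fun u => cos (s * u)) a0) => v; first by rewrite normrN.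
  exact: cos_max.
- by move=> s u; apply: is_derive_eq; rewrite /GRing.scale /= ?mulr1 ?mul1r ?mulr0 ?addr0 ?scaler0; ring.
- by move=> s u; apply: is_derive_eq; rewrite /GRing.scale /= ?mulr1 ?mul1r ?mulr0 ?addr0 ?scaler0; ring.
Qed.

Lemma is_derive_Esin a t : 0 < a -> is_derive t 1 (Esin a) (Eucos a t).
Proof.
move=> a0.
apply: (@rI_derive_param (fun t u => 1 * gw a u * sin (t * u))
  (fun t u => u * gw a u * cos (t * u)) (fun t u => - (u * u) * gw a u * sin (t * u)) (gwC a)).
- by move=> s; apply: continuous_gw_trig.
- by move=> s; apply: continuous_gw_trig.
- by move=> s u; apply: (gw_trig_dom a0 le1 (fun u => sin_max (s * u))).
- by move=> s u; apply: (gw_trig_dom a0 leu (fun u => cos_max (s * u))).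
- move=> s u; apply: (@gw_trig_dom a (fun u => - (u * u)) (fun u => sin (s * u)) a0) => v; first by rewrite normrN.
  exact: sin_max.
- by move=> s u; apply: is_derive_eq; rewrite /GRing.scale /= ?mulr1 ?mul1r ?mulr0 ?addr0 ?scaler0; ring.
- by move=> s u; apply: is_derive_eq; rewrite /GRing.scale /= ?mulr1 ?mul1r ?mulr0 ?addr0 ?scaler0; ring.
Qed.

(** Multiplying by the integrating factor exp(t^2 / (2 a)) gives a function with zero derivative. *)
Lemma gauss_ode a (f : R -> R) : 0 < a ->
  (forall t, is_derive t 1 f (- (t / a * f t))) -> forall t, f t = f 0 * expR (- (t ^+ 2 / (2 * a))).
Proof.
move=> a0 df t.
pose g s := f s * expR (s ^+ 2 / (2 * a)).
have dg (s : R) : is_derive s (1 : R) g 0.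
  have h := df s; rewrite /g; apply: is_derive_eq.
  by rewrite /GRing.scale /= ?mulr1 ?mul1r ?mulr0 ?addr0 ?scaler0; field; rewrite gt_eqF.
have := @is_derive_0_is_cst _ g t 0 dg; rewrite /g expr0n /= mul0r expR0 mulr1 => <-.
by rewrite -mulrA -expRD subrr expR0 mulr1.
Qed.

Lemma EcosE a t : 0 < a -> Ecos a t = gmass a * expR (- (t ^+ 2 / (2 * a))).
Proof.
move=> a0; have -> : gmass a = Ecos a 0.
  by congr rI; apply/funext => u; rewrite mul0r cos0 mulr1 mul1r.
apply: gauss_ode => // s; have := is_derive_Ecos s a0.
suff -> : Eusin a s = s / a * Ecos a s by [].
by apply: (mulfI (lt0r_neq0 a0)); rewrite Eusin_ibp//; field; rewrite gt_eqF.
Qed.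

Lemma EsinE a t : 0 < a -> Esin a t = 0.
Proof.
move=> a0; have H : forall t, is_derive t 1 (Esin a) (- (t / a * Esin a t)).
  move=> s; have := is_derive_Esin s a0.
  suff -> : Eucos a s = - (s / a * Esin a s) by [].
  by apply: (mulfI (lt0r_neq0 a0)); rewrite Eucos_ibp//; field; rewrite gt_eqF.
rewrite (gauss_ode a0 H) /Esin (_ : (fun u => _) = fun=> 0) ?rI0 ?mul0r//.
by apply/funext => u; rewrite mul0r sin0 mulr0.
Qed.

Lemma EuucosE a t : 0 < a ->
  Euucos a t = gmass a / a * ((1 - t ^+ 2 / a) * expR (- (t ^+ 2 / (2 * a)))).
Proof.
move=> a0; apply: (mulfI (lt0r_neq0 a0)); rewrite Euucos_ibp//.
have -> : Eusin a t = t / a * Ecos a t.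
  by apply: (mulfI (lt0r_neq0 a0)); rewrite Eusin_ibp//; field; rewrite gt_eqF.
by rewrite EcosE//; field; rewrite gt_eqF.
Qed.

Lemma cI_gw1 a (c s : R) : 0 < a ->
  cI (gw1 a c s) = cis (- (c * s)) * (gmass a * expR (- (s ^+ 2 / (2 * a))))%:C.
Proof.
move=> a0.
have b1 := gw_trig_dom a0 le1 (fun u => cos_max (- s * u)).
have b2 := gw_trig_dom a0 le1 (fun u => sin_max (- s * u)).
have k1 := @continuous_gw_trig a _ _ c1 (@ccos (- s)).
have k2 := @continuous_gw_trig a _ _ c1 (@csin (- s)).
have cw := continuous_gw1 a c s.
have dw t := gw1_dom c s t a0.
have E t : gw1 a c s (t + c) = cis (- (c * s)) *
    ((1 * gw a t * cos (- s * t)) +i* (1 * gw a t * sin (- s * t))).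
  rewrite /gw1 addrK (_ : - ((t + c) * s) = - (c * s) + (- s * t)); last by ring.
  rewrite cisD -mulrA; congr (_ * _); rewrite /gw /cis; apply: complex_eqP.
    by rewrite ReM /= mulr0 subr0 mul1r mulrC.
  by rewrite ImM /= mulr0 add0r mul1r mulrC.
have dR t : `|complex.Re (gw1 a c s t)| <= ((1 + 2 / a) * (2 * (1 + c ^+ 2))) * bump t.
  exact: le_trans (Re_le_cabs _) (dw t).
have dI t : `|complex.Im (gw1 a c s t)| <= ((1 + 2 / a) * (2 * (1 + c ^+ 2))) * bump t.
  exact: le_trans (Im_le_cabs _) (dw t).
have sqs : (- s) ^+ 2 = s ^+ 2 by rewrite sqrrN.
apply: complex_eqP.
- have -> : complex.Re (cI (gw1 a c s)) = rI (fun t => complex.Re (gw1 a c s t)) by [].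
  rewrite -(rI_shift c cw.1 dR).
  have -> : (fun t => complex.Re (gw1 a c s (t + c))) = fun t =>
     cos (- (c * s)) * (1 * gw a t * cos (- s * t)) + (- sin (- (c * s))) * (1 * gw a t * sin (- s * t)).
    by apply/funext => t; rewrite E ReM /cis; cbn [complex.Re complex.Im]; ring.
  rewrite (rID (cZ _ k1) (cZ _ k2) (bZ _ b1) (bZ _ b2)) (rIZ _ k1 b1) (rIZ _ k2 b2).
  by rewrite -/(Ecos a (- s)) -/(Esin a (- s)) EcosE// EsinE// ReM /= !mulr0 addr0 subr0 sqs.
- have -> : complex.Im (cI (gw1 a c s)) = rI (fun t => complex.Im (gw1 a c s t)) by [].
  rewrite -(rI_shift c cw.2 dI).
  have -> : (fun t => complex.Im (gw1 a c s (t + c))) = fun t =>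
     cos (- (c * s)) * (1 * gw a t * sin (- s * t)) + sin (- (c * s)) * (1 * gw a t * cos (- s * t)).
    by apply/funext => t; rewrite E ImM.
  rewrite (rID (cZ _ k2) (cZ _ k1) (bZ _ b2) (bZ _ b1)) (rIZ _ k1 b1) (rIZ _ k2 b2).
  by rewrite -/(Ecos a (- s)) -/(Esin a (- s)) EcosE// EsinE// ImM /= !mulr0 !add0r sqs.
Qed.

End GaussianFourier1.

Section GaussianFourier.
Context {R : realType} {N : nat}.

Lemma cint_gwin a (m xi : 'rV[R]_N) : 0 < a ->
  cint (gwin a m xi) =
    cis (- dotp m xi) * (gmass a ^+ N * expR (- (enorm xi ^+ 2 / (2 * a))))%:C.
Proof.
move=> a0.
have -> : gwin a m xi = fun y => \prod_(j < N) gw1 a (m 0 j) (xi 0 j) (y 0 j).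
  by apply/funext => y; rewrite gwin_prod.
rewrite (@cint_prod _ _ (fun j => gw1 a (m 0 j) (xi 0 j))
  (fun j => (1 + 2 / a) * (2 * (1 + (m 0 j) ^+ 2)))).
- under eq_bigr do rewrite cI_gw1//.
  rewrite big_split /= -cis_sum; congr (cis _ * _); first by rewrite /dotp -sumrN.
  rewrite -(rmorph_prod (@real_complex R)); congr (_%:C).
  rewrite big_split /= prodr_const card_ord -expR_sum; congr (_ * expR _).
  by rewrite enorm_sq mulr_suml -sumrN.
- by move=> j; exact: (continuous_gw1 a (m 0 j) (xi 0 j)).1.
- by move=> j; exact: (continuous_gw1 a (m 0 j) (xi 0 j)).2.
- by move=> j t; exact: gw1_dom.
Qed.

End GaussianFourier.

(** * Gabor sums over finite grids *)

Section RiemannSums.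
Context {R : realType}.
Implicit Types (f F : R -> R) (s h u : R).

Lemma antiderivative f K : continuous f -> (forall t, `|f t| <= K * bump t) ->
  exists F : R -> R, forall t : R, is_derive t (1 : R) F (f t).
Proof.
move=> cf fK.
exists (fun x => \int[@lebesgue_measure R]_(t in [set` Interval -oo%O (BRight x)]) f t)%R => t.
have intf : (@lebesgue_measure R).-integrable [set` Interval -oo%O (BRight (t + 1))] (EFin \o f).
  by apply: (integrableS measurableT) => //; exact: (integrable_dom cf fK).
have tt1 : t < t + 1 by rewrite ltrDl.
have [dF eF] := continuous_FTC1 tt1 intf (a := -oo%O) (x := t) (ltNyr t) (cf t).
apply: DeriveDef; first exact: dF.
by rewrite -derive1E; exact: eF.
Qed.

(** Each cell contributes one Taylor remainder c h^2 of the primitive, so the interval may grow with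
    m as long as m h^2 stays small. *)
Lemma riemann_sum (F f f' : R -> R) c s h m :
  (forall t : R, is_derive t (1 : R) F (f t)) -> (forall t : R, is_derive t (1 : R) f (f' t)) ->
  (forall t, `|f' t| <= c) ->
  `|\sum_(j < m) h * f (s + j%:R * h) - (F (s + m%:R * h) - F s)| <= m%:R * (c * h ^+ 2).
Proof.
move=> dF df fc; elim: m => [|m IH].
  by rewrite big_ord0 !mul0r addr0 subrr subr0 normr0.
rewrite big_ord_recr /=.
have tay := @taylor1 R R^o F f f' (s + m%:R * h) 1 c h dF df fc.
have e1 : s + m%:R * h + h *: 1 = s + m.+1%:R * h.
  by rewrite /GRing.scale /= mulr1 -natr1 mulrDl mul1r addrA.
rewrite e1 in tay; rewrite -[in leRHS]natr1 [leRHS]mulrDl mul1r.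
set A := \sum_(j < m) _ in IH *; set a := F (s + m.+1%:R * h) in tay *.
set b := F (s + m%:R * h) in IH tay *; set d := f _ in tay *.
have -> : A + h * d - (a - F s) = (A - (b - F s)) - (a - b - h * d) by ring.
by rewrite (le_trans (ler_normB _ _))// lerD.
Qed.

Lemma is_derive_cst_le (F f G g : R -> R) a b :
  (forall t : R, is_derive t (1 : R) F (f t)) -> (forall t : R, is_derive t (1 : R) G (g t)) ->
  a <= b -> (forall t, a <= t <= b -> f t <= g t) -> F b - F a <= G b - G a.
Proof.
move=> dF dG ab fg.
have dH (t : R) : is_derive t (1 : R) (fun t => G t - F t) (g t - f t).
  by have := dF t; have := dG t => ? ?; apply: is_deriveB.
have ba0 : 0 <= b - a by rewrite subr_ge0.
have [c /andP[c0 c1]] := @mvt_dir R R^o _ _ a 1 _ dH ba0.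
rewrite /GRing.scale /= !mulr1 (_ : a + (b - a) = b); last by ring.
move=> e.
rewrite -subr_ge0 (_ : _ - _ = G b - F b - (G a - F a)); last by ring.
rewrite e mulr_ge0// subr_ge0 fg// lerDl c0 /= -lerBrDl.
by rewrite (le_trans c1)// lerBlDr.
Qed.

Definition gsq t : R := expR (- t ^+ 2).

Lemma gsq_le_bump t : gsq t <= bump t.
Proof.
rewrite /gsq /bump expRN lef_pV2 ?posrE ?expR_gt0 ?ltr_wpDr ?sqr_ge0//.
exact: expR_ge1Dx.
Qed.

Lemma gsq_ge0 t : 0 <= gsq t. Proof. exact: expR_ge0. Qed.
Lemma gsq_gt0 t : 0 < gsq t. Proof. exact: expR_gt0. Qed.

Lemma gsq_gw t : gsq t = gw 2 t.
Proof. by rewrite /gsq /gw mulrC mulKr ?unitfE. Qed.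

Lemma is_derive_gsq (t : R) : is_derive t (1 : R) gsq (- (2 * t * gsq t)).
Proof.
have -> : gsq = gw 2 by apply/funext => x; rewrite gsq_gw.
by rewrite /=; exact: is_derive_gw.
Qed.

(** An odd primitive of the Gaussian together with the rate at which it reaches its limit; oddness
    comes from the vanishing derivative of E(s) + E(-s), and the limit is a supremum by
    monotonicity. *)
Lemma erf_exists : exists (E : R -> R) (L : R), [/\ 0 < L, forall t : R, is_derive t (1 : R) E (gsq t),
  forall t, E (- t) = - E t & forall t, 0 <= t -> `|E t - L| <= 4 * bump t].
Proof.
have cg : continuous gsq.
  by have -> : gsq = gw 2 by [apply/funext => x; rewrite gsq_gw]; exact: continuous_gw.
have [F dF] : exists F : R -> R, forall t : R, is_derive t (1 : R) F (gsq t).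
  apply: (antiderivative (K := 1) cg) => t; rewrite mul1r ger0_norm ?gsq_ge0//.
  exact: gsq_le_bump.
pose E t := F t - F 0.
have dE (t : R) : is_derive t (1 : R) E (gsq t).
  by have h := dF t; rewrite -[gsq t]subr0; apply: is_deriveB.
have EN t : E (- t) = - E t.
  have dS (s : R) : is_derive s (1 : R) (fun s => E s + E (- s)) 0.
    have h := dE s; have h2 : is_derive s (1 : R) (fun s => E (- s)) (- gsq s).
      have h1 := dE (- s); have hN := is_deriveNid s (1 : R).
      by have := @is_derive1_comp _ E -%R s _ _ h1 hN; rewrite /gsq sqrrN mulrN1.
    by rewrite -(subrr (gsq s)); apply: is_deriveD.
  have := @is_derive_0_is_cst _ (fun s => E s + E (- s)) t 0 dS.
  by rewrite /E oppr0 subrr addr0 => /eqP; rewrite addr_eq0 => /eqP ->; rewrite opprK.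
have Emono s t : s <= t -> E s <= E t.
  move=> st; have d0 (x : R) : is_derive x (1 : R) (fun _ : R => 0 : R) 0 by exact: is_derive_cst.
  have := is_derive_cst_le d0 dE st (fun _ _ => gsq_ge0 _).
  by rewrite subrr subr_ge0.
have Ebd s t : 0 <= s -> s <= t -> E t - E s <= 4 * bump s.
  (* Beyond u the Gaussian is at most (x / u) exp(- x^2), which has an elementary primitive. *)
  have big u w : 1 <= u -> u <= w -> E w - E u <= gsq u.
    move=> u1 uw; have u0 : 0 < u by exact: lt_le_trans u1.
    have dG (x : R) : is_derive x (1 : R) (fun x => - (gsq x / (2 * u))) (x * gsq x / u).
      have h := is_derive_gsq x; apply: is_derive_eq.
      by rewrite /GRing.scale /=; field; rewrite gt_eqF.
    have := is_derive_cst_le dE dG uw.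
    have -> : - (gsq w / (2 * u)) - - (gsq u / (2 * u)) = (gsq u - gsq w) / (2 * u).
      by field; rewrite gt_eqF.
    move=> h; apply: le_trans (h _) _ => [x /andP[ux _]|].
      by rewrite ler_pdivlMr// mulrC ler_wpM2r ?gsq_ge0.
    rewrite ler_pdivrMr ?mulr_gt0//; have := gsq_ge0 w; have := gsq_ge0 u; nra.
  have small u w : u <= w -> E w - E u <= w - u.
    move=> uw; apply: (is_derive_cst_le dE (fun x => is_derive_id x 1) uw) => x _.
    by apply: le_trans (gsq_le_bump x) (bump_le1 _).
  move=> s0 st; have [s1|s1] := leP 1 s.
    apply: le_trans (big _ _ s1 st) _; apply: le_trans (gsq_le_bump s) _.
    by rewrite ler_peMl ?bump_ge0// ler1n.
  have hb : 1 <= 2 * bump s.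
    rewrite /bump ler_pdivlMr ?ltr_wpDr ?sqr_ge0// mul1r; nra.
  have b2 : 2 <= 4 * bump s by lra.
  apply: le_trans b2; have [t1|t1] := leP t 1.
    by apply: le_trans (small _ _ st) _; lra.
  have h1 := small _ _ (ltW s1); have h2 := big _ _ (lexx 1) (ltW t1).
  have h3 := le_trans (gsq_le_bump 1) (bump_le1 1); lra.
have E00 : E 0 = 0 by rewrite /E subrr.
have hs : has_sup (range E).
  split; first by exists (E 0); exists 0.
  exists (4 * bump 0) => _ [t _ <-]; have [t0|/ltW t0] := leP 0 t.
    by have := Ebd _ _ (lexx 0) t0; rewrite E00 subr0.
  apply: le_trans (Emono _ _ t0) _; rewrite E00 mulr_ge0// bump_ge0//.
have EL t : E t <= sup (range E) by apply: ub_le_sup; [exact: hs.2|exists t].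
exists E, (sup (range E)); split => //.
  apply: lt_le_trans (EL 1); have [c _] := @mvt_dir R R^o _ _ 0 1 1 dE ler01.
  by rewrite /GRing.scale /= !mulr1 add0r E00 subr0 mul1r => ->; exact: gsq_gt0.
move=> t t0; rewrite distrC ger0_norm ?subr_ge0// lerBlDr.
apply: ge_sup; first by exists (E 0); exists 0.
move=> _ [x _ <-]; have [tx|/ltW xt] := leP t x; first by rewrite -lerBlDr Ebd.
by apply: le_trans (Emono _ _ xt) _; rewrite lerDr mulr_ge0// bump_ge0.
Qed.

End RiemannSums.

Section GridSums.
Context {R : realType}.
Implicit Types (n : nat) (s t u v : R).

(* The spacing [gh n] is small and the extent [gm n * gh n] is large, while
   [gm n * gh n ^+ 2], which controls the error of Riemann sums, is small. *)
Definition gr n : R := n.+1%:R^-1.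
Definition gh n : R := gr n ^+ 4.
Definition gm n : nat := (n.+1 ^ 6)%N.

Lemma gr_gt0 n : 0 < gr n. Proof. by rewrite invr_gt0 ltr0n. Qed.
Lemma gh_gt0 n : 0 < gh n. Proof. by rewrite exprn_gt0// gr_gt0. Qed.
Lemma gr_le1 n : gr n <= 1. Proof. by rewrite invf_le1 ?ltr0n// ler1n. Qed.
Lemma gr2_le n : gr n ^+ 2 <= gr n.
Proof. by rewrite expr2 ler_piMr ?gr_le1// ltW// gr_gt0. Qed.
Lemma gr2_le1 n : gr n ^+ 2 <= 1.
Proof. exact: le_trans (gr2_le n) (gr_le1 n). Qed.
Lemma gm_gt0 n : 0 < (gm n)%:R :> R. Proof. by rewrite ltr0n expn_gt0. Qed.
Lemma gm_gh n : (gm n)%:R * gh n = (gr n ^+ 2)^-1.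
Proof. by rewrite /gh /gm /gr natrX; field. Qed.
Lemma gm_gh2 n : (gm n)%:R * gh n ^+ 2 = gr n ^+ 2.
Proof. by rewrite /gh /gm /gr natrX; field. Qed.

Lemma is_derive_bump t : is_derive t (1 : R) bump (- (2 * t * bump t ^+ 2)).
Proof.
have t0 : 1 + t ^+ 2 != 0 by rewrite gt_eqF// ltr_wpDr// sqr_ge0.
have h : is_derive t (1 : R) (fun t => 1 + t ^+ 2) (2 * t).
  by apply: is_derive_eq; rewrite /GRing.scale /=; ring.
have := is_deriveV (f := fun t : R => 1 + t ^+ 2) t0 h.
rewrite /bump; set a := - _ *: _; set b := - _.
suff -> : a = b by [].
by rewrite /a /b /GRing.scale /= /bump -exprVn; ring.
Qed.

(** [bump] has the primitive arctan, whose total variation is pi, and |[bump]'| <= 1. The bound is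
    uniform in the offset s. *)
Lemma sum_bump s h m : 0 <= h ->
  \sum_(j < m) h * bump (s + j%:R * h) <= pi + m%:R * h ^+ 2.
Proof.
move=> h0.
have da (t : R) : is_derive t (1 : R) (@atan R) (bump t).
  by apply: DeriveDef; [exact: derivable_atan|rewrite -derive1E derive1_atan].
have b1 t : `|- (2 * t * bump t ^+ 2)| <= 1.
  rewrite normrN normrM (ger0_norm (sqr_ge0 _)).
  have : `|2 * t| * bump t <= 1.
    rewrite /bump ler_pdivrMr ?ltr_wpDr ?sqr_ge0// mul1r normrM ger0_norm//.
    rewrite -(real_normK (num_real t)); have := sqr_ge0 (`|t| - 1); nra.
  have := bump_le1 t; have := bump_ge0 t; rewrite expr2 => ? ? ?.
  rewrite mulrA -[leRHS]mulr1; apply: ler_pM => //; rewrite mulr_ge0//.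
have := riemann_sum s h m da is_derive_bump b1; rewrite ler_norml => /andP[_].
rewrite mul1r => h1; have := atan_ltpi2 (s + m%:R * h); have := atan_gtNpi2 s.
move: h1; set A := \sum_(j < m) _; set B := m%:R * h ^+ 2 => h1 h2 h3; lra.
Qed.

(** For fixed l the sum over j is a Riemann sum on [- l h, (m - l) h], which by oddness is close to
    F((m - l) h) + F(l h). This differs from 2 L only for l near the ends, and the average of the
    deviations B [bump] over l is of order 1 / (m h) = [gr]^2. *)
Lemma double_riemann (F f f' : R -> R) c L B n :
  (forall t : R, is_derive t (1 : R) F (f t)) -> (forall t : R, is_derive t (1 : R) f (f' t)) ->
  (forall t, `|f' t| <= c) -> (forall t, F (- t) = - F t) ->
  (forall t, 0 <= t -> `|F t - L| <= B * bump t) ->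
  `|\sum_(l < gm n) \sum_(j < gm n) gh n / (gm n)%:R * f ((j%:R - l%:R) * gh n) - 2 * L| <=
    (c + 2 * B * (pi + 1)) * gr n ^+ 2.
Proof.
move=> dF df fc FN FL; set m := gm n; set h := gh n; have m0 : 0 < m%:R :> R := gm_gt0 n.
have h0 : 0 < h := gh_gt0 n.
have B0 : 0 <= B by have := le_trans (normr_ge0 _) (FL 0 (lexx _)); rewrite pmulr_lge0 ?bump_gt0.
have -> : \sum_(l < m) \sum_(j < m) h / m%:R * f ((j%:R - l%:R) * h) - 2 * L =
  \sum_(l < m) m%:R^-1 * (\sum_(j < m) h * f (- (l%:R * h) + j%:R * h) - 2 * L).
  have e2 : 2 * L = \sum_(l < m) m%:R^-1 * (2 * L).
    by rewrite sumr_const card_ord -[RHS]mulr_natl mulrA divff ?mul1r// gt_eqF.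
  rewrite [in LHS]e2 -sumrB; apply: eq_bigr => l _; rewrite mulrBr mulr_sumr; congr (_ - _).
  by apply: eq_bigr => j _; rewrite (mulrC h) -mulrA mulrBl (addrC (- _)).
apply: le_trans (ler_norm_sum _ _ _) _.
have term (l : 'I_m) : `|\sum_(j < m) h * f (- (l%:R * h) + j%:R * h) - 2 * L| <=
   c * gr n ^+ 2 + B * (bump (- (m%:R * h) + l%:R * h) + bump (0 + l%:R * h)).
  have := riemann_sum (- (l%:R * h)) h m dF df fc.
  rewrite (mulrCA m%:R c) gm_gh2 FN opprK add0r.
  have i1 : 0 <= l%:R * h by rewrite mulr_ge0// ltW.
  have i2 : 0 <= - (l%:R * h) + m%:R * h.
    by rewrite addrC subr_ge0 ler_wpM2r ?(ltW h0)// ler_nat ltnW.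
  have := FL _ i1; have := FL _ i2.
  have -> : bump (- (m%:R * h) + l%:R * h) = bump (- (l%:R * h) + m%:R * h).
    by rewrite /bump; congr (1 + _)^-1; ring.
  set S := \sum_(j < m) _; set a := F (_ + _); set b := F _; rewrite mulrDr => e1 e2 e3.
  have -> : S - 2 * L = (S - (a + b)) + ((a - L) + (b - L)) by ring.
  by rewrite (le_trans (ler_normD _ _))// lerD// (le_trans (ler_normD _ _))// lerD.
apply: (@le_trans _ _ (\sum_(l < m) m%:R^-1 * (c * gr n ^+ 2 +
    B * (bump (- (m%:R * h) + l%:R * h) + bump (0 + l%:R * h))))).
  apply: ler_sum => l _; rewrite normrM ger0_norm ?invr_ge0 ?(ltW m0)//.
  by rewrite ler_pM2l ?invr_gt0.
under eq_bigr do rewrite mulrDr; rewrite big_split /= sumr_const card_ord -[_ *+ m]mulr_natl mulrA.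
rewrite mulrA divff ?gt_eqF// mul1r mulrDl lerD2l.
have s1 := sum_bump (- (m%:R * h)) m (ltW h0); have s2 := sum_bump 0 m (ltW h0).
have -> : \sum_(i < m) m%:R^-1 * (B * (bump (- (m%:R * h) + i%:R * h) + bump (0 + i%:R * h))) =
   (m%:R * h)^-1 * (B * (\sum_(i < m) h * bump (- (m%:R * h) + i%:R * h) +
     \sum_(i < m) h * bump (0 + i%:R * h))).
  rewrite -big_split /= !mulr_sumr; apply: eq_bigr => i _.
  by field; rewrite !gt_eqF.
rewrite [X in X^-1]gm_gh invrK mulrC ler_wpM2r ?sqr_ge0// (mulrC 2) -!mulrA ler_wpM2l//.
move: s1 s2; rewrite (gm_gh2 n); have := gr2_le1 n.
set x := \sum_(_ < _) _; set y := \sum_(_ < _) _; lra.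
Qed.

Lemma double_sum_bump n : \sum_(l < gm n) \sum_(j < gm n) gh n / (gm n)%:R *
  bump ((j%:R - l%:R) * gh n) <= pi + 1.
Proof.
have -> : \sum_(l < gm n) \sum_(j < gm n) gh n / (gm n)%:R * bump ((j%:R - l%:R) * gh n) =
  \sum_(l < gm n) (gm n)%:R^-1 * \sum_(j < gm n) gh n * bump (- (l%:R * gh n) + j%:R * gh n).
  apply: eq_bigr => l _; rewrite mulr_sumr; apply: eq_bigr => j _.
  by rewrite (mulrC (gh n)) -mulrA mulrBl (addrC (- _)).
apply: (@le_trans _ _ (\sum_(l < gm n) (gm n)%:R^-1 * (pi + 1))).
  apply: ler_sum => l _; rewrite ler_pM2l ?invr_gt0 ?gm_gt0//.
  apply: le_trans (sum_bump _ _ (ltW (gh_gt0 n))) _.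
  by rewrite gm_gh2 lerD2l gr2_le1.
by rewrite sumr_const card_ord -[leLHS]mulr_natl mulrA divff ?mul1r// gt_eqF// gm_gt0.
Qed.

(** Positions range over both signs, hence twice as many points as for one of the two
    frequencies. *)
Definition xgrid n (k : 'I_(2 * gm n)) : R := (k%:R - (gm n)%:R) * gh n.

Lemma sum_bump_xgrid n : \sum_(k < 2 * gm n) gh n * bump (xgrid k) <= pi + 2.
Proof.
have -> : \sum_(k < 2 * gm n) gh n * bump (xgrid k) =
  \sum_(k < 2 * gm n) gh n * bump (- ((gm n)%:R * gh n) + k%:R * gh n).
  by apply: eq_bigr => k _; rewrite /xgrid mulrBl addrC.
apply: le_trans (sum_bump _ _ (ltW (gh_gt0 n))) _.
by rewrite natrM -mulrA gm_gh2 lerD2l ler_piMr// gr2_le1.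
Qed.

End GridSums.

(** * A nonnegative approximate identity *)

Section FejerKernel.
Context {R : realType}.
Implicit Types (n : nat) (s t u v y : R).

(* A Fejer kernel: averaging frequencies over differences of two grid points
   makes the kernel nonnegative, so that it is an approximate identity as soon
   as its mass and second moment are under control. *)
Definition fq n u : R := gh n / (gm n)%:R *
  ((\sum_(j < gm n) cos (j%:R * gh n * u)) ^+ 2 + (\sum_(j < gm n) sin (j%:R * gh n * u)) ^+ 2).

Lemma fq_ge0 n u : 0 <= fq n u.
Proof. by rewrite mulr_ge0 ?addr_ge0 ?sqr_ge0// divr_ge0// ltW// gh_gt0. Qed.

Lemma fqE n u : fq n u = \sum_(l < gm n) \sum_(j < gm n)
  gh n / (gm n)%:R * cos ((j%:R - l%:R) * gh n * u).
Proof.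
rewrite /fq 2!expr2 2!mulr_suml -big_split /= mulr_sumr; apply: eq_bigr => l _.
rewrite 2!mulr_sumr -big_split /= mulr_sumr; apply: eq_bigr => j _; congr (_ * _).
rewrite (_ : (j%:R - l%:R) * gh n * u = j%:R * gh n * u - l%:R * gh n * u); last by ring.
by rewrite cosB mulrC [X in _ + X]mulrC.
Qed.

Lemma continuous_scos a : continuous (fun u : R => cos (a * u)).
Proof.
move=> u; apply: (continuous_comp (f := fun u : R => a * u)); last exact: continuous_cos.
by apply: cvgM; [exact: cvg_cst|exact: cvg_id].
Qed.

Lemma continuous_sumr I (r : seq I) (F : I -> R -> R) : (forall i, continuous (F i)) ->
  continuous (fun u => \sum_(i <- r) F i u).
Proof.
move=> cF; elim: r => [|i r IH].
  by under eq_fun do rewrite big_nil; exact: cst_continuous.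
have -> : (fun u => \sum_(k <- i :: r) F k u) = fun u => F i u + \sum_(k <- r) F k u.
  by apply/funext => u; rewrite big_cons.
by move=> u; apply: cvgD; [exact: cF|exact: IH].
Qed.

Lemma rI_sum I (r : seq I) (F : I -> R -> R) K : (forall i, continuous (F i)) ->
  (forall i t, `|F i t| <= K * bump t) ->
  rI (fun t => \sum_(i <- r) F i t) = \sum_(i <- r) rI (F i).
Proof.
move=> cF dF; elim: r => [|i r IH].
  by rewrite big_nil; under eq_fun do rewrite big_nil; exact: rI0.
rewrite big_cons -IH; under eq_fun do rewrite big_cons.
apply: (rID (K := K) (L := K *+ size r)) => //; first exact: continuous_sumr.
move=> t; elim: {IH} r => [|j r IHr]; first by rewrite big_nil normr0 mulr0n mul0r.
by rewrite big_cons mulrS mulrDl (le_trans (ler_normD _ _))// lerD.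
Qed.

Lemma rI_fq (p : R -> R) n : continuous p -> (forall u, `|p u| <= 1 + u ^+ 2) ->
  rI (fun u => p u * gw 2^-1 u * fq n u) = \sum_(l < gm n) \sum_(j < gm n)
    gh n / (gm n)%:R * rI (fun u => p u * gw 2^-1 u * cos ((j%:R - l%:R) * gh n * u)).
Proof.
move=> cp p1; have h20 : 0 < 2^-1 :> R by rewrite invr_gt0.
set c := gh n / (gm n)%:R.
pose F (l j : nat) u := p u * gw 2^-1 u * cos ((j%:R - l%:R) * gh n * u).
have cF l j : continuous (F l j).
  by apply: continuous_gw_trig => //; exact: continuous_scos.
have dF l j u : `|F l j u| <= gwC 2^-1 * bump u.
  by apply: (gw_trig_dom h20 p1 (fun u => cos_max _)).
have cF2 l j : continuous (fun u => c * F l j u) by move=> u; apply: cvgM; [exact: cvg_cst|exact: cF].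
have dF2 l j u : `|c * F l j u| <= (`|c| * gwC 2^-1) * bump u by exact: (bZ c (dF l j)).
have -> : (fun u => p u * gw 2^-1 u * fq n u) = fun u => \sum_(l < gm n)
    \sum_(j < gm n) c * F l j u.
  apply/funext => u; rewrite fqE mulr_sumr; apply: eq_bigr => l _.
  by rewrite mulr_sumr; apply: eq_bigr => j _; rewrite mulrCA.
rewrite (@rI_sum _ _ (fun (l : 'I_(gm n)) u => \sum_(j < gm n) c * F l j u)
  ((`|c| * gwC 2^-1) *+ gm n)); last first.
- move=> l u; apply: le_trans (ler_norm_sum _ _ _) _.
  rewrite -mulr_natl -mulrA mulr_natl -[X in _ *+ X]card_ord -sumr_const.
  by apply: ler_sum => j _.
- by move=> l; apply: continuous_sumr.
apply: eq_bigr => l _.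
rewrite (@rI_sum _ _ (fun (j : 'I_(gm n)) u => c * F l j u) (`|c| * gwC 2^-1))//.
by apply: eq_bigr => j _; rewrite (rIZ c (cF l j) (dF l j)).
Qed.

Let abs_le_sq t : `|t| <= 1 + t ^+ 2.
Proof.
rewrite -(real_normK (num_real t)); have := sqr_ge0 (`|t| - 1); have := normr_ge0 t; nra.
Qed.

Let gsq_mul_bound t c0 c1 : 0 <= t -> 0 <= c0 -> 0 <= c1 -> (c0 + c1 * t + c1 * t ^+ 2 / 2) * gsq (Num.sqrt t) <= c0 + 2 * c1.
Proof.
move=> t0 c00 c10; rewrite /gsq sqr_sqrtr// expRN ler_pdivrMr ?expR_gt0//.
have h1 := expR_ge1Dx t; have h2 := exp_coeff_le_expR 2 t0.
have h3 := expR_ge0 t.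
have e : 2`!%:R = 2 :> R by []. rewrite e in h2.
have : c1 * t + c1 * t ^+ 2 / 2 <= 2 * c1 * expR t.
  rewrite -mulrA -mulrDr -mulrA mulrCA ler_wpM2l//; lra.
have : c0 <= c0 * expR t by rewrite ler_peMr//; lra.
rewrite mulrDl; lra.
Qed.

Let gsq_poly t c0 c1 : 0 <= c0 -> 0 <= c1 -> (c0 + c1 * t ^+ 2 + c1 * t ^+ 4 / 2) * gsq t <= c0 + 2 * c1.
Proof.
move=> c00 c10; have := gsq_mul_bound (sqr_ge0 t) c00 c10.
by rewrite sqrtr_sqr /gsq real_normK ?num_real// -exprM.
Qed.

Let dgsq_bound t : `|- (2 * t * gsq t)| <= 4.
Proof.
rewrite normrN normrM (ger0_norm (gsq_ge0 t)).
have := gsq_poly t (c0 := 2) (c1 := 1) (ler0n _ 2) ler01.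
have : `|2 * t| <= 2 + 1 * t ^+ 2 + 1 * t ^+ 4 / 2.
  rewrite normrM ger0_norm//; have := abs_le_sq t; have : 0 <= t ^+ 4 by rewrite exprn_even_ge0.
  have := sqr_ge0 (`|t| - 1); rewrite -(real_normK (num_real t)); nra.
have := gsq_ge0 t => h0 h1 h2; have := ler_wpM2r h0 h1; lra.
Qed.

(** Integrating the Gaussian exp(- u^2 / 4) against each cosine gives a multiple of exp(- t^2) at a
    difference of grid points, so the mass is a double Riemann sum of [gsq]. *)
Lemma fq_mass : exists2 A, 0 < A & exists C, forall n,
  `|rI (fun u => 1 * gw 2^-1 u * fq n u) - A| <= C * gr n ^+ 2.
Proof.
have [E [L [L0 dE EN EL]]] := @erf_exists R.
have h20 : 0 < 2^-1 :> R by rewrite invr_gt0.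
have m0 := gmass_gt0 h20.
exists (gmass 2^-1 * (2 * L)); first by rewrite !mulr_gt0.
have db := dgsq_bound.
exists (gmass 2^-1 * (4 + 2 * 4 * (pi + 1))) => n.
rewrite rI_fq; [|exact: cst_continuous|by move=> u; rewrite normr1 lerDl sqr_ge0].
have -> : \sum_(l < gm n) \sum_(j < gm n) gh n / (gm n)%:R *
   rI (fun u => 1 * gw 2^-1 u * cos ((j%:R - l%:R) * gh n * u)) = gmass 2^-1 *
  \sum_(l < gm n) \sum_(j < gm n) gh n / (gm n)%:R * gsq ((j%:R - l%:R) * gh n).
  rewrite mulr_sumr; apply: eq_bigr => l _; rewrite mulr_sumr; apply: eq_bigr => j _.
  rewrite -/(Ecos 2^-1 _) EcosE// mulrCA; congr (_ * (_ * expR _)).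
  by rewrite mulfV// divr1.
rewrite -mulrBr normrM (gtr0_norm m0) -mulrA ler_pM2l//.
exact: (double_riemann n dE (is_derive_gsq (R:=R)) db EN EL).
Qed.

(** The transform of u^2 exp(- u^2 / 4) is a multiple of the derivative of t exp(- t^2). This
    primitive vanishes at infinity, so [double_riemann] applies with L = 0 and leaves only the error
    term. *)
Lemma fq_second_moment : exists C, forall n,
  rI (fun u => u * u * gw 2^-1 u * fq n u) <= C * gr n ^+ 2.
Proof.
have h20 : 0 < 2^-1 :> R by rewrite invr_gt0.
have m0 := gmass_gt0 h20.
pose F t : R := t * gsq t; pose f t := (1 - 2 * t ^+ 2) * gsq t.
pose f' t : R := (- 6 * t + 4 * t ^+ 3) * gsq t.
have dF (t : R) : is_derive t (1 : R) F (f t).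
  have h := is_derive_gsq t; rewrite /F; apply: is_derive_eq.
  by rewrite /f /GRing.scale /=; ring.
have df (t : R) : is_derive t (1 : R) f (f' t).
  have h := is_derive_gsq t; rewrite /f; apply: is_derive_eq.
  by rewrite /f' /GRing.scale /=; ring.
have FN t : F (- t) = - F t by rewrite /F /gsq sqrrN mulNr.
have FL t : 0 <= t -> `|F t - 0| <= 4 * bump t.
  rewrite subr0 => t0; rewrite ger0_norm ?mulr_ge0 ?gsq_ge0//.
  rewrite /bump ler_pdivlMr ?ltr_wpDr ?sqr_ge0// /F mulrAC.
  have := gsq_poly t (c0 := 2) (c1 := 1) (ler0n _ 2) ler01.
  have : t * (1 + t ^+ 2) <= 2 + 1 * t ^+ 2 + 1 * t ^+ 4 / 2.
    have e : t ^+ 4 = t ^+ 2 * t ^+ 2 by rewrite -exprD. rewrite e.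
    have := sqr_ge0 (t - 1); have := sqr_ge0 (t ^+ 2); have := sqr_ge0 t; nra.
  have := gsq_ge0 t => h0 h1 h2; have := ler_wpM2r h0 h1; lra.
have db t : `|f' t| <= 40.
  rewrite normrM (ger0_norm (gsq_ge0 t)).
  have := gsq_poly t (c0 := 10) (c1 := 15) (ler0n _ 10) (ler0n _ 15).
  have : `|- 6 * t + 4 * t ^+ 3| <= 10 + 15 * t ^+ 2 + 15 * t ^+ 4 / 2.
    have e : t ^+ 4 = t ^+ 2 * t ^+ 2 by rewrite -exprD. rewrite e exprS.
    have := sqr_ge0 (t - 1); have := sqr_ge0 (t + 1); have := sqr_ge0 (t ^+ 2 - t); have := sqr_ge0 (t ^+ 2 + t); have := sqr_ge0 t.
    rewrite ler_norml; nra.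
  have := gsq_ge0 t => h0 h1 h2; have := ler_wpM2r h0 h1; lra.
exists (gmass 2^-1 * 2 * (40 + 2 * 4 * (pi + 1))) => n.
rewrite rI_fq; last 2 first.
- by move=> u; apply: cvgM; exact: cvg_id.
- by move=> u; rewrite -expr2 ger0_norm ?sqr_ge0// lerDr.
have -> : \sum_(l < gm n) \sum_(j < gm n) gh n / (gm n)%:R *
   rI (fun u => u * u * gw 2^-1 u * cos ((j%:R - l%:R) * gh n * u)) = gmass 2^-1 * 2 *
  \sum_(l < gm n) \sum_(j < gm n) gh n / (gm n)%:R * f ((j%:R - l%:R) * gh n).
  rewrite mulr_sumr; apply: eq_bigr => l _; rewrite mulr_sumr; apply: eq_bigr => j _.
  rewrite -/(Euucos 2^-1 _) EuucosE// mulrCA invrK; congr (_ * (_ * _)).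
  by rewrite /f mulfV// divr1 (mulrC 2).
rewrite -[leRHS]mulrA ler_pM2l ?mulr_gt0//.
have := double_riemann n dF df db FN FL; rewrite mulr0 subr0.
exact: le_trans (ler_norm _).
Qed.

Definition gP n v : R := \sum_(k < 2 * gm n) gh n * gsq (xgrid k - v).

Lemma gP_ge0 n v : 0 <= gP n v.
Proof. by apply: sumr_ge0 => k _; rewrite mulr_ge0 ?gsq_ge0// ltW// gh_gt0. Qed.

Let xgridE n v (k : nat) : (k%:R - (gm n)%:R) * gh n - v =
  (- ((gm n)%:R * gh n) - v) + k%:R * gh n.
Proof. by ring. Qed.

Lemma gP_le n v : gP n v <= pi + 2.
Proof.
apply: (@le_trans _ _ (\sum_(k < 2 * gm n) gh n * bump ((- ((gm n)%:R * gh n) - v) + k%:R * gh n))).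
  by apply: ler_sum => k _; rewrite ler_pM2l ?gh_gt0// /xgrid xgridE gsq_le_bump.
apply: le_trans (sum_bump _ _ (ltW (gh_gt0 n))) _.
by rewrite natrM -mulrA gm_gh2 lerD2l ler_piMr// gr2_le1.
Qed.

Lemma gP_facts : exists2 A, 0 < A & exists2 D, 0 <= D & forall n v,
  `|gP n v - A| <= D * (1 + `|v|) * gr n.
Proof.
have [E [L [L0 dE EN EL]]] := @erf_exists R.
have db := dgsq_bound.
have PE n v : `|gP n v - (E ((gr n ^+ 2)^-1 - v) + E ((gr n ^+ 2)^-1 + v))| <= 8 * gr n ^+ 2.
  have := riemann_sum (- ((gm n)%:R * gh n) - v) (gh n) (2 * gm n) dE (is_derive_gsq (R:=R)) db.
  rewrite natrM.
  have -> : 2 * (gm n)%:R * (4 * gh n ^+ 2) = 8 * ((gm n)%:R * gh n ^+ 2) :> R by ring.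
  have -> : - ((gm n)%:R * gh n) - v + 2 * (gm n)%:R * gh n = (gm n)%:R * gh n - v :> R by ring.
  rewrite gm_gh2 -opprD EN opprK gm_gh.
  suff -> : \sum_(j < 2 * gm n) gh n * gsq (- ((gr n ^+ 2)^-1 + v) + j%:R * gh n) = gP n v by [].
  by apply: eq_bigr => k _; rewrite /xgrid xgridE gm_gh opprD.
exists (2 * L); first by rewrite mulr_gt0.
have pi0 := @pi_ge0 R.
exists (40 + 2 * (2 * L + pi + 2)) => [|n v]; first by lra.
have r0 := @gr_gt0 R n; have r20 : 0 < gr n ^+ 2 :> R by rewrite exprn_gt0.
have nv0 := normr_ge0 v; have rr := @gr2_le R n.
(* Beyond half the extent of the grid, (1 + |v|) [gr] is bounded below and the trivial bound on [gP]
   suffices; inside, both ends of the grid are far from v. *)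
have [hv|hv] := leP `|v| ((gr n ^+ 2)^-1 / 2); last first.
  have P0 := gP_ge0 n v; have P1 := gP_le n v.
  apply: (@le_trans _ _ (2 * L + pi + 2)).
    by rewrite ler_norml; apply/andP; split; lra.
  have h1 : 1 <= 2 * `|v| * gr n ^+ 2.
    move: hv; rewrite ltr_pdivrMr// -(ltr_pM2r r20) mulVf ?gt_eqF// => /ltW; lra.
  have h2 : 1 <= 2 * (1 + `|v|) * gr n.
    by apply: le_trans h1 _; apply: ler_pM; rewrite ?(ltW r20)//; lra.
  have h3 : 0 <= 2 * L + pi + 2 by lra.
  have h4 := ler_wpM2l h3 h2.
  have h5 : 0 <= (1 + `|v|) * gr n by rewrite mulr_ge0 ?(ltW r0)//; lra.
  rewrite mulr1 in h4; apply: le_trans h4 _.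
  rewrite [leRHS](_ : _ = 40 * ((1 + `|v|) * gr n) +
     (2 * L + pi + 2) * (2 * (1 + `|v|) * gr n)); last by ring.
  by rewrite lerDr mulr_ge0.
have b4 (x : R) : (gr n ^+ 2)^-1 / 2 <= x -> 4 * bump x <= 16 * gr n ^+ 2.
  move=> hx; have i0 : 0 < (gr n ^+ 2)^-1 / 2 :> R by rewrite divr_gt0// invr_gt0.
  have x0 : 0 < x by exact: lt_le_trans i0 hx.
  rewrite /bump ler_pdivrMr ?ltr_wpDr ?sqr_ge0//.
  have h1 : 1 <= 2 * x * gr n ^+ 2.
    by have := ler_wpM2r (ltW r20) hx; rewrite mulrAC mulVf ?(gt_eqF r20)//; lra.
  have h2 : 1 <= (2 * x * gr n ^+ 2) ^+ 2 by rewrite exprn_ege1.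
  have h3 := @gr2_le1 R n.
  have h4 : (2 * x * gr n ^+ 2) ^+ 2 = 4 * (x ^+ 2 * (gr n ^+ 2 * gr n ^+ 2)) by ring.
  have h5 : x ^+ 2 * (gr n ^+ 2 * gr n ^+ 2) <= x ^+ 2 * (gr n ^+ 2).
    by rewrite ler_wpM2l ?sqr_ge0// ler_piMr// ltW.
  nra.
have hp1 : ((gr n : R) ^+ 2)^-1 / 2 <= (gr n ^+ 2)^-1 - v by have := ler_norm v; lra.
have hp2 : ((gr n : R) ^+ 2)^-1 / 2 <= (gr n ^+ 2)^-1 + v by have := ler_norm (- v); rewrite normrN; lra.
have i0 : 0 <= (gr n ^+ 2)^-1 / 2 :> R by rewrite divr_ge0// invr_ge0 ltW.
have := EL _ (le_trans i0 hp1); have := EL _ (le_trans i0 hp2); have := PE n v.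
have := b4 _ hp1; have := b4 _ hp2.
set a := E _; set b := E _; set p := gP n v; set x := 4 * bump _; set y := 4 * bump _.
move=> h1 h2 h3 h4 h5.
have : `|p - 2 * L| <= 40 * gr n ^+ 2.
  by move: h3 h4 h5; rewrite !ler_norml => /andP[? ?] /andP[? ?] /andP[? ?]; apply/andP; split; lra.
move=> h; apply: le_trans h _.
have h6 : 40 <= (40 + 2 * (2 * L + pi + 2)) * (1 + `|v|).
  by apply: (@le_trans _ _ (40 * 1)); [rewrite mulr1|apply: ler_pM => //; lra].
by apply: ler_pM => //; exact: ltW.
Qed.

Definition gT n t : R := gw 2^-1 t * fq n t.

Lemma gT_ge0 n t : 0 <= gT n t. Proof. by rewrite mulr_ge0 ?gw_ge0 ?fq_ge0. Qed.

Lemma continuous_fq n : continuous (fq n).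
Proof.
have -> : fq n = fun u => \sum_(l < gm n) \sum_(j < gm n)
  gh n / (gm n)%:R * cos ((j%:R - l%:R) * gh n * u) by apply/funext => u; exact: fqE.
apply: continuous_sumr => l; apply: continuous_sumr => j u.
by apply: cvgM; [exact: cvg_cst|exact: continuous_scos].
Qed.

Lemma continuous_gP n (h : R -> R) : continuous h -> continuous (fun t => gP n (h t)).
Proof.
move=> ch; have gE : gsq = gw 2 :> (R -> R) by apply/funext => x; rewrite gsq_gw.
rewrite /gP gE; apply: continuous_sumr => k u; apply: cvgM; first exact: cvg_cst.
apply: (continuous_comp (f := fun t => xgrid k - h t)); last exact: continuous_gw.
by apply: cvgB; [exact: cvg_cst|exact: ch].
Qed.

Lemma fq_le n u : fq n u <= (gm n)%:R * gh n.
Proof.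
rewrite fqE; apply: (@le_trans _ _ (\sum_(l < gm n) \sum_(j < gm n) gh n / (gm n)%:R)).
  apply: ler_sum => l _; apply: ler_sum => j _; rewrite ler_piMr ?cos_le1//.
  by rewrite divr_ge0// ltW// gh_gt0.
under eq_bigr do rewrite sumr_const card_ord -[_ *+ _]mulr_natl mulrCA divff ?mulr1 ?gt_eqF ?gm_gt0//.
by rewrite sumr_const card_ord mulr_natl.
Qed.

Lemma gT_dom (p : R -> R) B n : continuous p -> (forall t, `|p t| <= B * (1 + t ^+ 2)) ->
  continuous (fun t => p t * gT n t) /\
  forall t, `|p t * gT n t| <= (B * ((gm n)%:R * gh n) * gwC 2^-1) * bump t.
Proof.
move=> cp pB; split=> t.
  apply: cvgM; first exact: cp.
  by apply: cvgM; [exact: continuous_gw|exact: continuous_fq].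
have h20 : 0 < 2^-1 :> R by rewrite invr_gt0.
have h := gw_bump2 t h20; rewrite -/(gwC 2^-1) in h.
have Q0 : 0 <= (gm n)%:R * gh n :> R by rewrite mulr_ge0// ltW// gh_gt0.
have B0 : 0 <= B by have := le_trans (normr_ge0 _) (pB 0); rewrite expr0n addr0 mulr1.
rewrite normrM (ger0_norm (gT_ge0 _ _)) /gT.
apply: (@le_trans _ _ (B * (1 + t ^+ 2) * (gw 2^-1 t * ((gm n)%:R * gh n)))).
  apply: ler_pM; [by []|exact: (gT_ge0 n t)|exact: pB|].
  by apply: ler_wpM2l; [exact: gw_ge0|exact: fq_le].
rewrite (_ : _ * _ = B * ((gm n)%:R * gh n) * ((1 + t ^+ 2) * gw 2^-1 t)); last by ring.
by rewrite -[leRHS]mulrA ler_wpM2l ?(mulr_ge0 B0 Q0).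
Qed.

Lemma gT_le (p q : R -> R) A B n : continuous p -> continuous q ->
  (forall t, `|p t| <= A * (1 + t ^+ 2)) -> (forall t, `|q t| <= B * (1 + t ^+ 2)) ->
  (forall t, p t <= q t) -> rI (fun t => p t * gT n t) <= rI (fun t => q t * gT n t).
Proof.
move=> cp cq pA qB pq; have [c1 d1] := gT_dom n cp pA; have [c2 d2] := gT_dom n cq qB.
by apply: (rI_le c1 c2 d1 d2) => t; rewrite ler_wpM2r ?gT_ge0.
Qed.

Lemma gT_lin (a b : R) n : rI (fun t => (a + b * (t * t)) * gT n t) =
  a * rI (fun t => 1 * gw 2^-1 t * fq n t) + b * rI (fun t => t * t * gw 2^-1 t * fq n t).
Proof.
have e1 : (fun t : R => 1 * gw 2^-1 t * fq n t) = fun t => 1 * gT n t.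
  by apply/funext => t; rewrite /gT mulrA.
have e2 : (fun t : R => t * t * gw 2^-1 t * fq n t) = fun t => t * t * gT n t.
  by apply/funext => t; rewrite /gT mulrA.
have c1 : continuous (fun _ : R => 1 : R) by exact: cst_continuous.
have c2 : continuous (fun t : R => t * t) by move=> t; apply: cvgM; exact: cvg_id.
have l1 t : `|1 : R| <= 1 * (1 + t ^+ 2) by rewrite mul1r normr1 lerDl sqr_ge0.
have l2 t : `|t * t| <= 1 * (1 + t ^+ 2) by rewrite mul1r -expr2 ger0_norm ?sqr_ge0// lerDr.
have [k1 d1] := gT_dom n c1 l1; have [k2 d2] := gT_dom n c2 l2.
rewrite e1 e2 -(rIZ a k1 d1) -(rIZ b k2 d2).
rewrite -(rID (cZ (c := a) k1) (cZ (c := b) k2) (bZ a d1) (bZ b d2)); congr rI.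
by apply/funext => t; ring.
Qed.

(** The kernel of the one-dimensional Gabor sum, by [sum_gw1]: positions see the midpoint of s and
    y, frequencies see the difference. *)
Definition fker n y s : R := gP n ((s + y) / 2) * gT n (s - y).

Lemma fker_ge0 n y s : 0 <= fker n y s.
Proof. by rewrite mulr_ge0 ?gP_ge0 ?gT_ge0. Qed.

Let cmid y : continuous (fun t : R => (t + y + y) / 2).
Proof.
move=> t; apply: cvgM; last exact: cvg_cst.
by apply: cvgD; [apply: cvgD; [exact: cvg_id|exact: cvg_cst]|exact: cvg_cst].
Qed.

Let cabsr : continuous (fun t : R => `|t|).
Proof. by move=> t; apply: cvg_norm; exact: cvg_id. Qed.

Let fker_shift y n : (continuous (fker n y) /\ exists K, forall s, `|fker n y s| <= K * bump s) /\
  (continuous (fun s => `|s - y| * fker n y s) /\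
   exists K, forall s, `| `|s - y| * fker n y s| <= K * bump s).
Proof.
have pi2 : 0 <= pi + 2 :> R by rewrite addr_ge0 ?pi_ge0.
have key (p : R -> R) : continuous p -> (forall t, `|p t| <= 1 + t ^+ 2) ->
   continuous (fun s => p (s - y) * fker n y s) /\
   exists K, forall s, `|p (s - y) * fker n y s| <= K * bump s.
  move=> cp p1; pose q t := p t * gP n ((t + y + y) / 2).
  have cP := continuous_gP (n := n) (@cmid y).
  have cq : continuous q by move=> t; apply: cvgM; [exact: cp|exact: cP].
  have qb t : `|q t| <= (pi + 2) * (1 + t ^+ 2).
    rewrite normrM mulrC; apply: ler_pM => //.
    by rewrite ger0_norm ?gP_ge0 ?gP_le.
  have [k d] := gT_dom n cq qb.
  have e : (fun s => p (s - y) * fker n y s) = (fun t => q t * gT n t) \o (fun s => s - y).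
    by apply/funext => s; rewrite /= /q /fker subrK mulrA.
  split.
    rewrite e => s; apply: continuous_comp; last exact: k.
    by apply: cvgB; [exact: cvg_id|exact: cvg_cst].
  set K := (pi + 2) * _ * _ in d; exists (K * (2 * (1 + y ^+ 2))) => s.
  have -> : p (s - y) * fker n y s = q (s - y) * gT n (s - y) by have := congr1 (@^~ s) e.
  apply: le_trans (d _) _; rewrite -mulrA ler_wpM2l//.
    by have := le_trans (normr_ge0 _) (d 0); rewrite pmulr_lge0 ?bump_gt0.
  by have := bump_shift (- y) s; rewrite sqrrN.
split; last by apply: (key (fun t => `|t|)) => [|t]; [exact: cabsr|rewrite normr_id].
have -> : fker n y = fun s => 1 * fker n y s by apply/funext => s; rewrite mul1r.
by apply: (key (fun=> 1)) => [|t]; [exact: cst_continuous|rewrite normr1 lerDl sqr_ge0].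
Qed.

Lemma fker_dom y n : continuous (fker n y) /\ exists K, forall s, `|fker n y s| <= K * bump s.
Proof. by have [] := fker_shift y n. Qed.

Lemma fker_abs_dom y n : continuous (fun s => `|s - y| * fker n y s) /\
   exists K, forall s, `| `|s - y| * fker n y s| <= K * bump s.
Proof. by have [] := fker_shift y n. Qed.

(** The position factor is replaced by its limit A1 up to an error growing linearly in the midpoint,
    which the second moment of the frequency factor controls. *)
Lemma fker_facts : exists2 c, 0 < c & forall y, exists C, forall n,
  `|rI (fker n y) - c| <= C * gr n /\ rI (fun s => `|s - y| * fker n y s) <= C * gr n.
Proof.
have [A0 A00 [C1 hA]] := fq_mass; have [C2 hV] := fq_second_moment.
have [A1 A10 [D D0 hP]] := gP_facts.
have pi2 : 0 <= pi + 2 :> R by rewrite addr_ge0 ?pi_ge0.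
exists (A1 * A0) => [|y]; first by rewrite mulr_gt0.
have y0 := normr_ge0 y.
exists (A1 * C1 + D * (2 + `|y|) * (A0 + C1 + C2) + (pi + 2) * (A0 + C1 + C2)) => n.
set a := rI (fun u => 1 * gw 2^-1 u * fq n u) in hA *.
have r0 := @gr_gt0 R n; have r1 := @gr_le1 R n; have r2 := @gr2_le R n.
have hAn := hA n; rewrite -/a in hAn.
set v := rI (fun u => u * u * gw 2^-1 u * fq n u) in hV *; have hVn := hV n; rewrite -/v in hVn.
have C10 : 0 <= C1 by have := le_trans (normr_ge0 _) hAn; rewrite pmulr_lge0 ?exprn_gt0.
have v0 : 0 <= v.
  have := @gT_le (fun=> 0) (fun t => t * t) 0 1 n.
  rewrite (_ : (fun t => t * t * gT n t) = fun u => u * u * gw 2^-1 u * fq n u); last first.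
    by apply/funext => t; rewrite /gT mulrA.
  rewrite (_ : (fun t => 0 * gT n t) = fun=> 0) ?rI0; last by apply/funext => t; rewrite mul0r.
  apply.
  - exact: cst_continuous.
  - by move=> t; apply: cvgM; exact: cvg_id.
  - by move=> t; rewrite normr0 mul0r.
  - by move=> t; rewrite mul1r -expr2 ger0_norm ?sqr_ge0// lerDr.
  - by move=> t; rewrite -expr2 sqr_ge0.
have C20 : 0 <= C2 by have := le_trans v0 hVn; rewrite pmulr_lge0 ?exprn_gt0.
have a1 : a <= A0 + C1.
  have := ler_norm (a - A0); have : C1 * gr n ^+ 2 <= C1 by rewrite ler_piMr// gr2_le1.
  lra.
have av : a + v <= A0 + C1 + C2.
  have : C2 * gr n ^+ 2 <= C2 by rewrite ler_piMr// gr2_le1.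
  lra.
have S0 : 0 <= A0 + C1 + C2 by lra.
have [[k1 [K1 d1]] [k2 [K2 d2]]] := fker_shift y n.
have e1 : rI (fker n y) = rI (fun t => gP n ((t + y + y) / 2) * gT n t).
  by rewrite -(rI_shift y k1 d1); congr rI; apply/funext => t; rewrite /fker addrK.
have e2 : rI (fun s => `|s - y| * fker n y s) =
    rI (fun t => (`|t| * gP n ((t + y + y) / 2)) * gT n t).
  by rewrite -(rI_shift y k2 d2); congr rI; apply/funext => t; rewrite /fker addrK mulrA.
have cP := continuous_gP (n := n) (@cmid y).
have Pb t : `|gP n ((t + y + y) / 2)| <= (pi + 2) * (1 + t ^+ 2).
  rewrite ger0_norm ?gP_ge0// (le_trans (gP_le _ _))// ler_peMr// lerDl sqr_ge0//.
have near t : `|gP n ((t + y + y) / 2) - A1| <= D * (2 + `|y|) * gr n * (1 + t ^+ 2).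
  apply: le_trans (hP n _) _; rewrite -!mulrA ler_wpM2l// [leLHS]mulrC [leRHS]mulrCA.
  rewrite ler_wpM2l ?(ltW r0)//.
  have : `|(t + y + y) / 2| <= `|t| / 2 + `|y|.
    rewrite normrM [in `|2^-1|]ger0_norm//; have := ler_normD (t + y) y; have := ler_normD t y; lra.
  have := sqr_ge0 (`|t| - 1); have := normr_ge0 t; rewrite -(real_normK (num_real t)); nra.
have lq (x z : R) : forall t, `|x + z * (t * t)| <= (`|x| + `|z|) * (1 + t ^+ 2).
  move=> t; rewrite mulrDl (le_trans (ler_normD _ _))// lerD//.
    by rewrite ler_peMr// lerDl sqr_ge0.
  by rewrite normrM -expr2 (ger0_norm (sqr_ge0 t)) ler_wpM2l// lerDr.
have cq (x z : R) : continuous (fun t : R => x + z * (t * t)).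
  move=> t; apply: cvgD; first exact: cvg_cst.
  by apply: cvgM; [exact: cvg_cst|apply: cvgM; exact: cvg_id].
have B1 : rI (fker n y) <= (A1 + D * (2 + `|y|) * gr n) * a + (D * (2 + `|y|) * gr n) * v.
  rewrite e1 /a /v -gT_lin; apply: (gT_le n cP (cq _ _) Pb (lq _ _)) => t.
  by have := le_trans (ler_norm _) (near t); rewrite -expr2; lra.
have B2 : (A1 - D * (2 + `|y|) * gr n) * a + (- (D * (2 + `|y|) * gr n)) * v <= rI (fker n y).
  rewrite e1 /a /v -gT_lin; apply: (gT_le n (cq _ _) cP (lq _ _) Pb) => t.
  by have := near t; rewrite ler_norml -expr2 => /andP[]; lra.
(* From |t| <= [gr] + t^2 / [gr]: the second moment is of order [gr]^2, so both terms are of order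
   [gr]. *)
have B3 : rI (fun s => `|s - y| * fker n y s) <= ((pi + 2) * gr n) * a + ((pi + 2) / gr n) * v.
  rewrite e2 /a /v -gT_lin; apply: (gT_le (A := pi + 2) n _ (cq _ _) _ (lq _ _)) => t.
  - by apply: cvgM; [exact: cabsr|exact: cP].
  - rewrite normrM normr_id mulrC; apply: ler_pM => //.
    by rewrite ger0_norm ?gP_ge0 ?gP_le.
  - rewrite -mulrA -mulrDr mulrC; apply: ler_pM; rewrite ?gP_ge0 ?gP_le//.
    have -> : gr n + (gr n)^-1 * (t * t) = (gr n ^+ 2 + t ^+ 2) / gr n.
      by field; rewrite gt_eqF.
    rewrite ler_pdivlMr//; have := sqr_ge0 (`|t| - gr n); have := normr_ge0 t; rewrite -(real_normK (num_real t)); nra.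
have Dy : 0 <= D * (2 + `|y|) by rewrite mulr_ge0// addr_ge0.
have pC : C1 * gr n ^+ 2 <= C1 * gr n by rewrite ler_wpM2l.
split.
  have h1 : D * (2 + `|y|) * gr n * (a + v) <= D * (2 + `|y|) * gr n * (A0 + C1 + C2).
    by rewrite ler_wpM2l// mulr_ge0// ltW.
  have h2 : `|A1 * (a - A0)| <= A1 * (C1 * gr n).
    by rewrite normrM (gtr0_norm A10) ler_pM2l// (le_trans hAn).
  have h3 : 0 <= (pi + 2) * (A0 + C1 + C2) * gr n by rewrite !mulr_ge0// ltW.
  move: h2; rewrite !ler_norml => /andP[h2 h4]; apply/andP; split; lra.
apply: le_trans B3 _.
have h1 : v / gr n <= C2 * gr n by rewrite ler_pdivrMr// -mulrA -expr2.
have h2 : (pi + 2) * (v / gr n) <= (pi + 2) * (C2 * gr n) by rewrite ler_wpM2l.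
have h3 : (pi + 2) * gr n * a <= (pi + 2) * gr n * (A0 + C1) by rewrite ler_wpM2l// mulr_ge0// ltW.
have h4 : 0 <= (A1 * C1 + D * (2 + `|y|) * (A0 + C1 + C2)) * gr n.
  by rewrite mulr_ge0 ?(ltW r0)// addr_ge0// ?mulr_ge0// ltW.
have h5 : (pi + 2) / gr n * v = (pi + 2) * (v / gr n) by ring.
rewrite h5; lra.
Qed.

End FejerKernel.

(** * Identification of the kernel of a Gabor sum *)

Section GaborGrid.
Context {R : realType}.
Implicit Types (n : nat) (s t y : R).

(* A position and two frequencies, whose difference is the frequency used. *)
Definition gidx n : finType := ('I_(2 * gm n) * ('I_(gm n) * 'I_(gm n)))%type.

Definition gxi n (i : gidx n) : R := (i.2.1%:R - i.2.2%:R) * gh n.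

(** The cell size in position times that in frequency, averaged over the [gm n] values of the second
    frequency. *)
Definition gw0 n : R := gh n * (gh n / (gm n)%:R).

Lemma gw0_gt0 n : 0 < gw0 n.
Proof. by rewrite mulr_gt0 ?gh_gt0// divr_gt0 ?gh_gt0 ?gm_gt0. Qed.

Lemma sum_cis (r : seq nat) (F : nat -> R) : \sum_(j <- r) cis (F j) =
  (\sum_(j <- r) cos (F j)) +i* (\sum_(j <- r) sin (F j)).
Proof.
elim: r => [|j r IH]; first by rewrite !big_nil.
by rewrite !big_cons IH.
Qed.

(** The identity (s - c)^2 + (y - c)^2 = 2 (c - (s + y) / 2)^2 + (s - y)^2 / 2 separates position
    from difference, and the sum over pairs of frequencies is the squared modulus of an exponential
    sum. *)
Lemma sum_gw1 n s y : \sum_(i : gidx n) (gw0 n)%:C *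
   (gw1 1 (xgrid i.1) (- gxi i) s * gw1 1 (xgrid i.1) (gxi i) y) = (fker n y s)%:C.
Proof.
pose u := s - y.
have E (i : gidx n) : (gw0 n)%:C * (gw1 1 (xgrid i.1) (- gxi i) s * gw1 1 (xgrid i.1) (gxi i) y) =
   (gh n * gsq (xgrid i.1 - (s + y) / 2) * gw 2^-1 u * (gh n / (gm n)%:R))%:C *
    (cis (i.2.1%:R * gh n * u) * cis (- (i.2.2%:R * gh n * u))).
  rewrite /gw1 mulrACA -cisD -cisD -rmorphM /= -expRD mulrCA mulrC -rmorphM /=.
  congr (_%:C * cis _); last by rewrite /gxi /u; ring.
  rewrite (_ : expR _ = gsq (xgrid i.1 - (s + y) / 2) * gw 2^-1 u); first by rewrite /gw0; ring.
  by rewrite /gsq /gw -expRD; congr expR; rewrite /u; field.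
under eq_bigr do rewrite E.
rewrite -(pair_bigA _ (fun (k : 'I_(2 * gm n)) (q : 'I_(gm n) * 'I_(gm n)) =>
  (gh n * gsq (xgrid k - (s + y) / 2) * gw 2^-1 u * (gh n / (gm n)%:R))%:C *
    (cis (q.1%:R * gh n * u) * cis (- (q.2%:R * gh n * u))))) /=.
under eq_bigr do rewrite -mulr_sumr.
rewrite -mulr_suml -(pair_bigA _ (fun (j l : 'I_(gm n)) =>
   cis (j%:R * gh n * u) * cis (- (l%:R * gh n * u)))) /=.
under [X in _ * X]eq_bigr do rewrite -mulr_sumr.
rewrite -mulr_suml -(rmorph_sum (@real_complex R)) -2!mulr_suml.
have sc (F : nat -> R) : \sum_(j < gm n) cis (F j) =
    (\sum_(j < gm n) cos (F j)) +i* (\sum_(j < gm n) sin (F j)).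
  by have := sum_cis (index_iota 0 (gm n)) F; rewrite !big_mkord.
rewrite (sc (fun j => j%:R * gh n * u)) (sc (fun j => - (j%:R * gh n * u))).
under [X in _ * (_ * (X +i* _))]eq_bigr do rewrite cosN.
under [X in _ * (_ * (_ +i* X))]eq_bigr do rewrite sinN.
rewrite sumrN /fker /gT /fq /gP -/u.
set a := \sum_(_ < _) _; set b := \sum_(_ < _) _; set c := \sum_(_ < _) _.
have -> : (b +i* c) * (b +i* - c) = (b ^+ 2 + c ^+ 2)%:C.
  by apply: complex_eqP; rewrite ?ReM ?ImM /=; ring.
by rewrite -rmorphM /=; congr (_%:C); ring.
Qed.

End GaborGrid.

Section Gabor.
Context {R : realType} {N : nat}.
Implicit Types (f : 'rV[R]_N -> R[i]) (X : phase R N).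

Definition glam n : finType := {ffun 'I_N -> @gidx n}.

Definition gpt n (la : glam n) : phase R N :=
  (\row_j xgrid (la j).1, \row_j gxi (la j)).

(** Reversing the frequency conjugates the wave packet; a bilinear pairing needs this in place of a
    conjugation. *)
Definition flip X : phase R N := (X.1, - X.2).

Lemma gabor_kernel n (s y : 'rV[R]_N) :
  \sum_(la : glam n) ((gw0 n ^+ N)%:C * (gwin 1 (gpt la).1 (- (gpt la).2) s * wave_packet (gpt la) y)) =
  (\prod_(j < N) fker n (y 0 j) (s 0 j))%:C.
Proof.
rewrite (rmorph_prod (@real_complex R)).
under [RHS]eq_bigr do rewrite /= -sum_gw1.
rewrite bigA_distr_bigA /=; apply: eq_bigr => la _.
rewrite big_split /= prodr_const card_ord rmorphXn /=; congr (_ * _).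
rewrite big_split /= (surjective_pairing (gpt la)) -gwin1 !gwin_prod.
by congr (_ * _); apply: eq_bigr => j _; rewrite /= !mxE.
Qed.

Lemma rint_sum I (r : seq I) (F : I -> 'rV[R]_N -> R) K : (forall i, scont (F i)) ->
  (forall i x, `|F i x| <= K * wgt x) ->
  rint (fun x => \sum_(i <- r) F i x) = \sum_(i <- r) rint (F i).
Proof.
move=> cF dF; elim: r => [|i r IH].
  by rewrite big_nil; under eq_fun do rewrite big_nil; exact: rint0.
rewrite big_cons -IH; under eq_fun do rewrite big_cons.
apply: (rintD (K := K) (L := K *+ size r)) => //; first exact: scont_sum.
move=> x; elim: {IH} r => [|j r IHr]; first by rewrite big_nil normr0 mulr0n mul0r.
by rewrite big_cons mulrS mulrDl (le_trans (ler_normD _ _))// lerD.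
Qed.

Lemma cvg_prodr (r : seq 'I_N) (F : nat -> 'I_N -> R) (l : 'I_N -> R) :
  (forall i, F n i @[n --> \oo] --> l i) ->
  \prod_(i <- r) F n i @[n --> \oo] --> \prod_(i <- r) l i.
Proof.
move=> h; elim: r => [|i r IH].
  by under eq_fun do rewrite big_nil; rewrite big_nil; exact: cvg_cst.
by under eq_fun do rewrite big_cons; rewrite big_cons; apply: cvgM; [exact: h|exact: IH].
Qed.

Lemma cvg_sumr (r : seq 'I_N) (F : nat -> 'I_N -> R) (l : 'I_N -> R) :
  (forall i, F n i @[n --> \oo] --> l i) ->
  \sum_(i <- r) F n i @[n --> \oo] --> \sum_(i <- r) l i.
Proof.
move=> h; elim: r => [|i r IH].
  by under eq_fun do rewrite big_nil; rewrite big_nil; exact: cvg_cst.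
by under eq_fun do rewrite big_cons; rewrite big_cons; apply: cvgD; [exact: h|exact: IH].
Qed.

Lemma cvg_gr : gr n @[n --> \oo] --> (0 : R).
Proof. exact: cvg_harmonic. Qed.

Lemma cvg_rate (a : nat -> R) l C : (forall n, `|a n - l| <= C * gr n) ->
  a n @[n --> \oo] --> l.
Proof.
move=> h; apply/cvgrPdist_le => e e0.
have hC : C * gr n @[n --> \oo] --> (0 : R).
  by rewrite -(mulr0 C); apply: cvgM; [exact: cvg_cst|exact: cvg_gr].
move/cvgrPdist_le : hC => /(_ _ e0); apply: filterS => n; rewrite sub0r normrN => hn.
by rewrite distrC (le_trans (h n))// (le_trans (ler_norm _)).
Qed.

Lemma lip_coord (f : 'rV[R]_N -> R[i]) theta C M : coordb theta C M f ->
  exists2 L, 0 <= L & forall x y, cabs (f x - f y) <= L * \sum_(i < N) `|x 0 i - y 0 i|.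
Proof.
move=> [sf _ hf]; pose B := `|M| * (`|C| * gbd theta 1).
have pd j x := smooth_pd j [::] x sf.
have pb j x : cabs (foldr (@pderiv R N) f [:: j] x) <= B.
  have := hf j 0%N 1%N x; rewrite expr0 mul1r /= add0n expr1 => /le_trans; apply.
  rewrite /B (le_trans (ler_norm _))// normrM ler_wpM2l// normrM ler_wpM2l//.
  by rewrite ger0_norm// ltW// gbd_gt0.
have B0 : 0 <= B by rewrite !mulr_ge0// ltW// gbd_gt0.
exists (2 * (B *+ N)) => [|x y]; first by rewrite mulr_ge0// mulrn_wge0.
have h1 := lip_dir (fun j x => (pd j x).1) (fun j x => le_trans (Re_le_cabs _) (pb j x)) x y.
have h2 := lip_dir (fun j x => (pd j x).2) (fun j x => le_trans (Im_le_cabs _) (pb j x)) x y.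
apply: le_trans (cabs_leReIm _) _; rewrite ReD ReN ImD ImN.
apply: le_trans (lerD h1 h2) _.
have nle : `|x - y| <= \sum_(i < N) `|x 0 i - y 0 i|.
  apply: norm_le_coord => [|j]; first exact: sumr_ge0.
  by rewrite (bigD1 j)//= !mxE lerDl sumr_ge0.
rewrite -mulrDl -mulr2n -[(_ *+ N) *+ 2]mulr_natl ler_wpM2l// mulr_ge0// mulrn_wge0//.
Qed.

(** A Lipschitz bound turns the error into integrals of |s_i - y_i| against the product kernel. Each
    factorizes into one first moment, which tends to zero, and masses, which tend to the normalizing
    constant. *)
Lemma gabor_main : exists2 c : R, 0 < c & forall theta C M f y, coordb theta C M f ->
  ccvg \oo (fun n => \sum_(la : glam n) (c * gw0 n ^+ N)%:C * gwt 1 f (flip (gpt la)) *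
    wave_packet (gpt la) y) (f y).
Proof.
have [c c0 hc] := @fker_facts R.
exists (c ^+ N)^-1 => [|theta C M f y hf]; first by rewrite invr_gt0 exprn_gt0.
have cN0 : 0 < c ^+ N by rewrite exprn_gt0.
have [sf fM _] := hf.
have cf : cscont f := smooth_cscont [::] sf.
have [L L0 fL] := lip_coord hf.
have /choice[Cy hCy] : forall j : 'I_N, exists Cy, forall n,
  `|rI (fker n (y 0 j)) - c| <= Cy * gr n /\
   rI (fun s => `|s - y 0 j| * fker n (y 0 j) s) <= Cy * gr n by move=> j; exact: hc.
have /choice[K hK] : forall nj : nat * 'I_N, exists K, [/\ continuous (fker nj.1 (y 0 nj.2)),
     continuous (fun s => `|s - y 0 nj.2| * fker nj.1 (y 0 nj.2) s),
     forall s, `|fker nj.1 (y 0 nj.2) s| <= K * bump s &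
     forall s, `| `|s - y 0 nj.2| * fker nj.1 (y 0 nj.2) s| <= K * bump s].
  move=> [n j] /=; have [k1 [K1 d1]] := fker_dom (y 0 j) n.
  have [k2 [K2 d2]] := fker_abs_dom (y 0 j) n.
  exists (Num.max K1 K2); split=> // s.
    by rewrite (le_trans (d1 s))// ler_wpM2r ?bump_ge0// le_max lexx.
  by rewrite (le_trans (d2 s))// ler_wpM2r ?bump_ge0// le_max lexx orbT.
pose Kf n (s : 'rV[R]_N) := \prod_(j < N) fker n (y 0 j) (s 0 j).
(* The factors of the product kernel with the weight |s_i - y_i| put into coordinate i. *)
pose G n i j := if j == i then fun s => `|s - y 0 j| * fker n (y 0 j) s else fker n (y 0 j).
have GE n i (s : 'rV[R]_N) : `|s 0 i - y 0 i| * Kf n s = \prod_(j < N) G n i j (s 0 j).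
  rewrite /Kf (bigD1 i)//= [RHS](bigD1 i)//= /G eqxx mulrA; congr (_ * _).
  by apply: eq_bigr => j /negPf ->.
have Gc n i j : continuous (G n i j).
  by rewrite /G; have [] := hK (n, j); case: (j == i).
have Gd n i j s : `|G n i j s| <= K (n, j) * bump s.
  by rewrite /G; have [] := hK (n, j) => _ _ h1 h2; case: (j == i).
have Kc n : scont (Kf n).
  apply: scont_prod => j; apply: (scont_comp (h := fker n (y 0 j))); last exact: scont_coord.
  by have [] := hK (n, j).
have Kd n s : `|Kf n s| <= (\prod_(j < N) K (n, j)) * wgt s.
  rewrite normr_prod /wgt -big_split /=; apply: ler_prod => j _; rewrite normr_ge0 /=.
  by have [] := hK (n, j).
have K0 n s : 0 <= Kf n s by apply: prodr_ge0 => j _; exact: fker_ge0.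
have GKc n i : scont (fun s : 'rV[R]_N => `|s 0 i - y 0 i| * Kf n s).
  have -> : (fun s : 'rV[R]_N => `|s 0 i - y 0 i| * Kf n s) = fun s => \prod_(j < N) G n i j (s 0 j).
    by apply/funext => s; rewrite GE.
  by apply: scont_prod => j; apply: (scont_comp (h := G n i j)); last exact: scont_coord.
have GKd n i (s : 'rV[R]_N) : `| `|s 0 i - y 0 i| * Kf n s| <= (\prod_(j < N) K (n, j)) * wgt s.
  rewrite GE normr_prod /wgt -big_split /=; apply: ler_prod => j _; rewrite normr_ge0 /=.
  exact: Gd.
pose A n := \sum_(i < N) \prod_(j < N) rI (G n i j).
pose P n := \prod_(j < N) rI (fker n (y 0 j)).
have PE n : rint (Kf n) = P n.
  apply: (rint_prod (b := fun j => fker n (y 0 j)) (K := fun j => K (n, j))) => [j|j t];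
    by have [] := hK (n, j).
have cvM j : rI (fker n (y 0 j)) @[n --> \oo] --> c.
  by apply: (cvg_rate (C := Cy j)) => n; have [] := hCy j n.
have cvP : P n @[n --> \oo] --> c ^+ N.
  have -> : c ^+ N = \prod_(j < N) c by rewrite prodr_const card_ord.
  exact: cvg_prodr.
have cvA : A n @[n --> \oo] --> (0 : R).
  have -> : 0 = \sum_(i < N) \prod_(j < N) (if j == i then 0 else c) :> R.
    by rewrite big1// => i _; rewrite (bigD1 i)//= eqxx mul0r.
  apply: cvg_sumr => i; apply: cvg_prodr => j; rewrite /G; case: eqP => // _.
  apply: (cvg_rate (C := Cy j)) => n; rewrite subr0 ger0_norm; first by have [] := hCy j n.
  have [_ k _ d] := hK (n, j).
  have := @rI_le R (fun=> 0) _ 0 (K (n, j)) (@cst_continuous _ _ 0) k _ d _.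
  rewrite rI0; apply => t; first by rewrite normr0 mul0r.
  by rewrite mulr_ge0 ?fker_ge0.
have KfC n : cscont (fun s => (Kf n s)%:C) by exact: cscontR.
have KfN n : cnice (fun s => (Kf n s)%:C).
  split=> //; exists (\prod_(j < N) K (n, j)) => s; rewrite cabsR; exact: Kd.
have fKN n : cnice (fun s => f s * (Kf n s)%:C) by exact: (cnice_bounded cf fM).
have EP n : cint (fun s => (Kf n s)%:C) = (P n)%:C.
  by apply: complex_eqP; rewrite /= ?PE// rint0.
have FE n : \sum_(la : glam n) ((c ^+ N)^-1 * gw0 n ^+ N)%:C * gwt 1 f (flip (gpt la)) *
    wave_packet (gpt la) y = ((c ^+ N)^-1)%:C * cint (fun s => f s * (Kf n s)%:C).
  rewrite [RHS](_ : _ = ((c ^+ N)^-1)%:C * cint (fun s => \sum_(la : glam n)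
     (gw0 n ^+ N)%:C * wave_packet (gpt la) y * (f s * gwin 1 (gpt la).1 (- (gpt la).2) s))).
    have nice (la : glam n) : cnice (fun s => f s * gwin 1 (gpt la).1 (- (gpt la).2) s).
      by apply: (cnice_bounded cf fM); exact: gwin_cnice.
    have [_ ->] := cint_sum (index_enum (glam n)) (fun la => cniceZ ((gw0 n ^+ N)%:C * wave_packet (gpt la) y) (nice la)).
    rewrite mulr_sumr; apply: eq_bigr => la _; rewrite cintZ// rmorphM /= /gwt /flip /=.
    by rewrite -[LHS]mulrA -[LHS]mulrA; congr (_ * _); rewrite -[RHS]mulrA; congr (_ * _); exact: mulrC.
  congr (_ * cint _); apply/funext => s; rewrite /Kf -gabor_kernel mulr_sumr.
  by apply: eq_bigr => la _; ring.
have D n : cabs (cint (fun s => f s * (Kf n s)%:C) - f y * (P n)%:C) <= 2 * (L * A n).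
  have -> : cint (fun s => f s * (Kf n s)%:C) - f y * (P n)%:C =
      cint (fun s => (f s - f y) * (Kf n s)%:C).
    rewrite -EP -cintZ// -mulN1r -cintZ; last exact: cniceZ.
    rewrite -cintD//; last by apply: cniceZ; exact: cniceZ.
    by congr cint; apply/funext => s; ring.
  have sc : scont (fun s : 'rV[R]_N => L * \sum_(i < N) `|s 0 i - y 0 i| * Kf n s).
    by apply: scontM; [exact: scont_cst|exact: scont_sum].
  have sd (s : 'rV[R]_N) : `|\sum_(i < N) `|s 0 i - y 0 i| * Kf n s| <=
     ((\prod_(j < N) K (n, j)) *+ N) * wgt s.
    apply: le_trans (ler_norm_sum _ _ _) _.
    rewrite mulrnAl -[X in _ *+ X]card_ord -sumr_const; apply: ler_sum => i _; exact: GKd.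
  have -> : A n = rint (fun s : 'rV[R]_N => \sum_(i < N) `|s 0 i - y 0 i| * Kf n s).
    rewrite (rint_sum _ (GKc n) (GKd n)); apply: eq_bigr => i _.
    rewrite -(rint_prod (Gc n i) (Gd n i)); congr rint.
    by apply/funext => s; rewrite GE.
  rewrite -(rintZ L _ sd); last exact: scont_sum.
  apply: (cint_le (K := L * ((\prod_(j < N) K (n, j)) *+ N))) => //.
  - apply: cscontM => //.
    by apply: (cscontD (g := fun=> - f y)) => //; exact: cscont_cst.
  - move=> s; rewrite -mulrA ler_wpM2l// (le_trans _ (sd s))// ler_norm//.
  - move=> s; rewrite cabsM cabsR ger0_norm// -mulr_suml mulrA ler_wpM2r//.
apply: (ccvg_squeeze (b := fun n => (c ^+ N)^-1 * (2 * (L * A n)) +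
   cabs (f y) * ((c ^+ N)^-1 * `|P n - c ^+ N|))) => [n|].
  rewrite FE.
  have -> : ((c ^+ N)^-1)%:C * cint (fun s => f s * (Kf n s)%:C) - f y =
    ((c ^+ N)^-1)%:C * (cint (fun s => f s * (Kf n s)%:C) - f y * (P n)%:C) +
     f y * (((c ^+ N)^-1)%:C * (P n - c ^+ N)%:C).
    rewrite rmorphB /= mulrBr mulrBr mulrBr; have -> : ((c ^+ N)^-1)%:C * (c ^+ N)%:C = 1 :> R[i].
      by rewrite -rmorphM /= mulVf ?gt_eqF.
    ring.
  apply: le_trans (cabsD _ _) _; rewrite 3!cabsM !cabsR gtr0_norm ?invr_gt0// lerD2r.
  by rewrite ler_wpM2l ?invr_ge0 ?(ltW cN0).
rewrite -[0](_ : (c ^+ N)^-1 * (2 * (L * 0)) + cabs (f y) * ((c ^+ N)^-1 * `|c ^+ N - c ^+ N|) = 0); last first.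
  by rewrite subrr normr0 !mulr0 addr0.
apply: cvgD; apply: cvgM; try exact: cvg_cst.
  by apply: cvgM; [exact: cvg_cst|apply: cvgM; [exact: cvg_cst|exact: cvA]].
apply: cvgM; first exact: cvg_cst.
by apply: cvg_norm; apply: cvgB; [exact: cvP|exact: cvg_cst].
Qed.

Definition gwc : R := sval (cid2 gabor_main).

Definition gwts n : R := gwc * gw0 n ^+ N.

Lemma gwts_ge0 n : 0 <= gwts n.
Proof. by rewrite mulr_ge0 ?exprn_ge0 ?(ltW (gw0_gt0 n))// ltW// /gwc; case: cid2. Qed.

Definition gabor_sum f n y : R[i] :=
  \sum_(la : glam n) (gwts n)%:C * gwt 1 f (flip (gpt la)) * wave_packet (gpt la) y.

Lemma gabor_cvg theta C M f y : coordb theta C M f ->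
  ccvg \oo (fun n => gabor_sum f n y) (f y).
Proof. by rewrite /gabor_sum /gwts /gwc; case: cid2 => c c0 /= h; exact: h. Qed.

Lemma exp_powR_bump p e : 1 <= p -> 0 < e -> exists2 K, 0 <= K &
  forall t : R, expR (- (e * `|t| `^ p)) <= K * bump t.
Proof.
move=> p1 e0; exists (2 + 2 / e ^+ 2) => [|t].
  by rewrite addr_ge0// divr_ge0// sqr_ge0.
set r := `|t| `^ p; have r0 : 0 <= r by exact: powR_ge0.
have er0 : 0 <= e * r by rewrite mulr_ge0// ltW.
rewrite /bump ler_pdivlMr ?ltr_wpDr ?sqr_ge0// expRN mulrC ler_pdivrMr ?expR_gt0//.
have h1 := expR_ge1Dx (e * r).
have h2 : (e * r) ^+ 2 / 2 <= expR (e * r) by have := exp_coeff_le_expR 2 er0.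
have h3 : r ^+ 2 <= 2 / e ^+ 2 * expR (e * r).
  have -> : r ^+ 2 = 2 / e ^+ 2 * ((e * r) ^+ 2 / 2) by field; rewrite gt_eqF.
  by rewrite ler_wpM2l// divr_ge0// sqr_ge0.
have h4 : 0 <= 2 / e ^+ 2 * expR (e * r) by rewrite mulr_ge0 ?expR_ge0// divr_ge0// sqr_ge0.
have t2 : t ^+ 2 <= 1 + r ^+ 2.
  have [t1|t1] := leP `|t| 1.
    rewrite -(real_normK (num_real t)); have := sqr_ge0 r; have := normr_ge0 t; nra.
  have : `|t| <= r by rewrite -[leLHS]powRr1// /r ler_powR// ltW.
  rewrite -(real_normK (num_real t)); have := normr_ge0 t; nra.
rewrite mulrDl; lra.
Qed.

Lemma phw_ge_coords theta X : 0 < theta ->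
  N.+1%:R^-1 * \sum_(j < N) (`|X.1 0 j| `^ theta^-1 + `|X.2 0 j| `^ theta^-1) <= phw theta X.
Proof.
move=> t0; rewrite ler_pdivrMl ?ltr0n//.
apply: (@le_trans _ _ (\sum_(j < N) phw theta X)).
  apply: ler_sum => j _; rewrite lerD// ge0_ler_powR ?invr_ge0 ?(ltW t0)// ?nnegrE//;
    exact: coord_le_norm.
by rewrite sumr_const card_ord -[leLHS]mulr_natl ler_wpM2r ?phw_ge0// ler_nat.
Qed.

(** The exponential is at most a product over coordinates of multiples of [bump], so the sum
    factorizes and the uniform bounds on sums of [bump] apply. *)
Lemma gabor_weight theta e : 0 < theta <= 1 -> 0 < e -> exists2 K, 0 <= K &
  forall n, \sum_(la : glam n) gwts n * expR (- (e * phw theta (gpt la))) <= K.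
Proof.
(* [phw] dominates the sum of the coordinate weights divided by N + 1; N + 1 keeps the case N = 0
   harmless. *)
move=> /andP[t0 t1] e0; pose e1 := e / N.+1%:R; have e10 : 0 < e1 by rewrite divr_gt0.
have p1 : 1 <= theta^-1 by rewrite invf_ge1.
have [K K0 hK] := exp_powR_bump p1 e10.
have gwc0 : 0 <= gwc by rewrite ltW// /gwc; case: cid2.
have pi1 : 0 <= (pi + 2) * (pi + 1) :> R by rewrite mulr_ge0// addr_ge0// pi_ge0.
exists (gwc * (K ^+ 2 * ((pi + 2) * (pi + 1))) ^+ N) => [|n].
  by rewrite mulr_ge0// exprn_ge0// mulr_ge0// sqr_ge0.
pose G (i : gidx n) : R := gw0 n * (expR (- (e1 * `|xgrid i.1| `^ theta^-1)) *
  expR (- (e1 * `|gxi i| `^ theta^-1))).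
apply: (@le_trans _ _ (\sum_(la : glam n) gwc * \prod_(j < N) G (la j))).
  apply: ler_sum => la _; rewrite /gwts -mulrA ler_wpM2l// /G big_split /= prodr_const card_ord.
  rewrite ler_wpM2l ?exprn_ge0 ?(ltW (gw0_gt0 n))//.
  under [leRHS]eq_bigr do rewrite -expRD.
  rewrite -expR_sum ler_expR; apply: le_trans (_ : - (e * (N.+1%:R^-1 * \sum_(j < N)
    (`|(gpt la).1 0 j| `^ theta^-1 + `|(gpt la).2 0 j| `^ theta^-1))) <= _).
    by rewrite lerN2 ler_pM2l// phw_ge_coords.
  rewrite mulrA -/e1 mulr_sumr -sumrN; apply: ler_sum => j _.
  by rewrite !mxE mulrDr opprD.
rewrite -mulr_sumr ler_wpM2l// -(bigA_distr_bigA (fun _ : 'I_N => G)) /=.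
rewrite prodr_const card_ord lerXn2r ?nnegrE//.
- by apply: sumr_ge0 => i _; rewrite mulr_ge0 ?(ltW (gw0_gt0 n))// mulr_ge0 ?expR_ge0.
- by rewrite mulr_ge0// sqr_ge0.
pose H (k : 'I_(2 * gm n)) (q : 'I_(gm n) * 'I_(gm n)) : R := (gh n * (K * bump (xgrid k))) *
   (gh n / (gm n)%:R * (K * bump ((q.1%:R - q.2%:R) * gh n))).
apply: (@le_trans _ _ (\sum_(i : gidx n) H i.1 i.2)).
  have g0 := ltW (@gh_gt0 R n); have g1 : 0 <= gh n / (gm n)%:R :> R by rewrite divr_ge0.
  apply: ler_sum => i _; rewrite /G /H /gw0 mulrACA; apply: ler_pM.
  - by rewrite mulr_ge0 ?expR_ge0.
  - by rewrite mulr_ge0 ?expR_ge0.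
  - by apply: ler_wpM2l => //; exact: hK.
  - by apply: ler_wpM2l => //; exact: hK.
rewrite -(pair_bigA _ H) /=; under eq_bigr do rewrite -mulr_sumr.
rewrite -mulr_suml (_ : K ^+ 2 * _ = (K * (pi + 2)) * (K * (pi + 1))); last by ring.
apply: ler_pM.
- apply: sumr_ge0 => k _; apply: (mulr_ge0 (ltW (gh_gt0 n))).
  by rewrite mulr_ge0 ?bump_ge0.
- apply: sumr_ge0 => q _; apply: mulr_ge0; first by rewrite divr_ge0// ltW// gh_gt0.
  by rewrite mulr_ge0 ?bump_ge0.
- under eq_bigr do rewrite mulrCA; rewrite -mulr_sumr ler_wpM2l//; exact: sum_bump_xgrid.
- under eq_bigr do rewrite mulrCA; rewrite -mulr_sumr ler_wpM2l//.
  rewrite -(pair_bigA _ (fun j l : 'I_(gm n) => gh n / (gm n)%:R * bump ((j%:R - l%:R) * gh n))) /=.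
  by rewrite exchange_big /=; exact: double_sum_bump.
Qed.

End Gabor.

Arguments gwts {R} N n.

(** * Functionals on Gelfand-Shilov spaces *)

Section GelfandShilovClasses.
Context {R : realType} {N : nat}.
Implicit Types (f g : 'rV[R]_N -> R[i]) (C M theta : R).
Notation dd f s := (foldr (@pderiv R N) f s).

Definition mword (b : {ffun 'I_N -> nat}) : seq 'I_N :=
  flatten [seq nseq (b j) j | j <- enum 'I_N].

Lemma mderiv_dd b f : mderiv b f = dd f (mword b).
Proof.
rewrite /mderiv /mword; elim: (enum 'I_N) => //= j r ->.
by rewrite foldr_cat iter_foldr.
Qed.

Lemma size_mword b : size (mword b) = mdeg b.
Proof.
rewrite /mword size_flatten /shape -map_comp sumnE big_map big_enum /=.
by apply: eq_bigr => j _; rewrite /= size_nseq.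
Qed.

Definition mone (j : 'I_N) (k : nat) : {ffun 'I_N -> nat} :=
  [ffun i => if i == j then k else 0%N].

Lemma mdeg_mone j k : mdeg (mone j k) = k.
Proof.
rewrite /mdeg (bigD1 j)//= big1 ?addn0 ?ffunE ?eqxx// => i /negPf ij.
by rewrite ffunE ij.
Qed.

Lemma mfact_mone j k : mfact (mone j k) = k`!.
Proof.
rewrite /mfact (bigD1 j)//= big1 ?muln1 ?ffunE ?eqxx// => i /negPf ij.
by rewrite ffunE ij.
Qed.

Lemma mpow_mone (x : 'rV[R]_N) j k : mpow x (mone j k) = x 0 j ^+ k.
Proof.
rewrite /mpow (bigD1 j)//= big1 ?mulr1 ?ffunE ?eqxx// => i /negPf ij.
by rewrite ffunE ij expr0.
Qed.

Lemma mderiv_mone j l f : mderiv (mone j l) f = iter l (pderiv j) f.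
Proof.
rewrite mderiv_dd iter_foldr; congr foldr; rewrite /mword.
have : uniq (enum 'I_N) by exact: enum_uniq.
have : j \in enum 'I_N by rewrite mem_enum.
elim: (enum 'I_N) => //= i r IH; rewrite inE ffunE => /predU1P[<- /andP[jr _]|jr /andP[ir ur]].
  rewrite eqxx; suff -> : flatten [seq nseq (mone j l i) i | i <- r] = [::] by rewrite cats0.
  elim: r jr {IH} => //= k r IH; rewrite inE ffunE negb_or => /andP[jk jr].
  by rewrite eq_sym (negPf jk) IH.
by case: eqP ir => [->|_ _]; [rewrite jr|exact: IH].
Qed.

Lemma gs_norm_le theta C f (M : R) a b x : 0 < C -> (gs_norm theta C f <= M%:E)%E ->
  cabs ((mpow x a)%:C * mderiv b f x) <=
  M * (C ^+ (mdeg a + mdeg b) * (mfact a * mfact b)%:R `^ theta).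
Proof.
move=> C0 h; have p0 : 0 < (mfact a * mfact b)%:R :> R.
  by rewrite ltr0n muln_gt0 !prodn_gt0// => j; exact: fact_gt0.
have : ((C ^- (mdeg a + mdeg b) * (mfact a * mfact b)%:R `^ (- theta)
         * cabs ((mpow x a)%:C * mderiv b f x))%:E <= M%:E)%E.
  by apply: le_trans h; apply: ereal_sup_ubound; exists a, b, x.
rewrite lee_fin powRN -invfM mulrC ler_pdivrMr//.
by rewrite mulr_gt0 ?exprn_gt0 ?powR_gt0.
Qed.

(** Only multi-indices supported on one coordinate are used, and k! l! <= (k + l)! changes to total
    degree without loss. *)
Lemma gs_norm_coordb theta C M f : 0 <= theta -> 0 < C -> smooth f ->
  (gs_norm theta C f <= M%:E)%E -> 0 <= M /\ coordb theta (Num.max 1 C) M f.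
Proof.
move=> t0 C0 sf h.
have z0 : mdeg ([ffun=> 0%N] : {ffun 'I_N -> nat}) = 0%N.
  by rewrite /mdeg big1// => j _; rewrite ffunE.
have f0 : mfact ([ffun=> 0%N] : {ffun 'I_N -> nat}) = 1%N.
  by rewrite /mfact big1// => j _; rewrite ffunE.
have p0 x : mpow x ([ffun=> 0%N] : {ffun 'I_N -> nat}) = 1 :> R.
  by rewrite /mpow big1// => j _; rewrite ffunE expr0.
have d0 : mderiv ([ffun=> 0%N] : {ffun 'I_N -> nat}) f = f.
  by rewrite /mderiv; elim: (enum _) => //= j r ->; rewrite ffunE.
have fM y : cabs (f y) <= M.
  have := gs_norm_le [ffun=> 0%N] [ffun=> 0%N] y C0 h.
  by rewrite z0 f0 p0 d0 mul1r powR1 expr0 !mulr1.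
have M0 : 0 <= M := le_trans (cabs_ge0 _) (fM 0).
split=> //; split=> // j k l y.
have := gs_norm_le (mone j k) (mone j l) y C0 h.
rewrite mpow_mone mderiv_mone !mdeg_mone !mfact_mone cabsM cabsR normrX => /le_trans; apply.
rewrite ler_wpM2l//; apply: ler_pM; rewrite ?exprn_ge0 ?powR_ge0 ?(ltW C0)//.
  by rewrite lerXn2r ?nnegrE ?(ltW C0) ?le_max ?lexx ?orbT// ?ler01.
rewrite /gbd ge0_ler_powR ?nnegrE// ler_nat.
by rewrite -(bin_fact (leq_addr l k)) addKn leq_pmull// bin_gt0 leq_addr.
Qed.

Lemma fact_sum_le I (r : seq I) (a : I -> nat) :
  ((\sum_(i <- r) a i)`! <= 2 ^ (size r * \sum_(i <- r) a i) * \prod_(i <- r) (a i)`!)%N.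
Proof.
elim: r => [|i r IH]; first by rewrite !big_nil.
rewrite !big_cons /=; apply: leq_trans (factD_le _ _) _.
rewrite mulSn [in leqRHS]expnD -[leqRHS]mulnA leq_mul2l; apply/orP; right.
rewrite [leqRHS]mulnCA leq_mul2l; apply/orP; right; apply: leq_trans IH _.
by rewrite leq_mul2r leq_exp2l// leq_mul2l leq_addl !orbT.
Qed.

(** Each splitting of a factorial costs a power of two, and there are N splittings for each of [a]
    and [b] and one between them. *)
Lemma mfact_ge (a b : {ffun 'I_N -> nat}) :
  ((mdeg a + mdeg b)`! <= (2 ^ N.+1) ^ (mdeg a + mdeg b) * (mfact a * mfact b))%N.
Proof.
have h (c : {ffun 'I_N -> nat}) : ((mdeg c)`! <= 2 ^ (N * mdeg c) * mfact c)%N.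
  by have := fact_sum_le (enum 'I_N) c; rewrite size_enum_ord !big_enum.
apply: leq_trans (factD_le _ _) _.
rewrite -expnM mulSn [in leqRHS]expnD -[leqRHS]mulnA leq_mul2l; apply/orP; right.
by rewrite mulnDr expnD mulnACA leq_mul.
Qed.

Lemma gsb_gs_norm theta C M f : 0 <= theta <= 1 -> 0 < C -> gsb theta C M f ->
  (gs_norm theta (2 ^+ N.+1 * C) f <= M%:E)%E.
Proof.
move=> /andP[t0 t1] C0 hf; have M0 := gsb_ge0 C0 hf; have [sf h] := hf.
apply: ge_ereal_sup => _ [a [b [x ->]]]; rewrite lee_fin.
have p0 : 0 < (mfact a * mfact b)%:R :> R.
  by rewrite ltr0n muln_gt0 !prodn_gt0// => j; exact: fact_gt0.
have C20 : 0 < 2 ^+ N.+1 * C by rewrite mulr_gt0 ?exprn_gt0.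
rewrite powRN -invfM mulrC ler_pdivrMr ?mulr_gt0 ?exprn_gt0 ?powR_gt0//.
rewrite cabsM cabsR mderiv_dd.
have xa : `|mpow x a| <= `|x| ^+ mdeg a.
  rewrite /mpow normr_prod -prodrXr; apply: ler_prod => j _; rewrite normr_ge0 normrX /=.
  by rewrite lerXn2r ?nnegrE// coord_le_norm.
apply: le_trans (ler_wpM2r (cabs_ge0 _) xa) _; apply: le_trans (h _ _ _) _.
rewrite size_mword ler_wpM2l// exprMn -mulrA mulrCA ler_wpM2l ?exprn_ge0 ?(ltW C0)//.
set k := (mdeg a + mdeg b)%N; rewrite /gbd.
apply: (@le_trans _ _ (((2 ^ N.+1) ^ k * (mfact a * mfact b))%:R `^ theta)).
  by rewrite ge0_ler_powR ?nnegrE// ler_nat mfact_ge.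
rewrite natrM powRM// ler_wpM2r ?powR_ge0// !natrX -[leRHS]powRr1 ?exprn_ge0//.
by rewrite ler_powR// exprn_ege1// exprn_ege1// ler1n.
Qed.

Lemma gsb_gs theta C M f : 0 <= theta <= 1 -> 0 < C -> gsb theta C M f -> gs theta f.
Proof.
move=> t01 C0 hf; exists (2 ^+ N.+1 * C); first by rewrite /= mulr_gt0 ?exprn_gt0.
split; first by have [] := hf.
by apply: le_lt_trans (gsb_gs_norm t01 C0 hf) _; rewrite ltry.
Qed.

Lemma gsb_sum theta C I (r : seq I) (c : I -> R[i]) (F : I -> 'rV[R]_N -> R[i]) (M : I -> R) :
  0 <= C -> (forall i, gsb theta C (M i) (F i)) ->
  gsb theta C (\sum_(i <- r) cabs (c i) * M i) (fun y => \sum_(i <- r) c i * F i y).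
Proof.
move=> C0 h; elim: r => [|i r IH].
  by rewrite big_nil; under eq_fun do rewrite big_nil; exact: gsb0.
rewrite big_cons; have -> : (fun y => \sum_(k <- i :: r) c k * F k y) =
    fun y => c i * F i y + \sum_(k <- r) c k * F k y by apply/funext => y; rewrite big_cons.
exact: gsb_lin.
Qed.

End GelfandShilovClasses.

Section GelfandShilovSpace.
Context {R : realType} {N : nat} (theta : R).
Hypothesis htheta : 2^-1 <= theta < 1.
Implicit Types (f g : 'rV[R]_N -> R[i]) (C M : R) (u : functional R N).

Let t0 : 0 < theta. Proof. by case/andP: htheta => h _; apply: lt_le_trans h; rewrite invr_gt0. Qed.
Let t1 : theta <= 1. Proof. by case/andP: htheta => _ /ltW. Qed.
Let t01 : 0 <= theta <= 1. Proof. by rewrite ltW. Qed.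
Let t01' : 0 < theta <= 1. Proof. by rewrite t0. Qed.

Lemma phw_flip X : phw theta (@flip R N X) = phw theta X.
Proof. by rewrite /phw /flip /= normrN. Qed.

Definition dec_rate a C : R := theta / 4 * (((2 + a) * C)^-1 `^ theta^-1).

Lemma dec_rate_gt0 a C : 1 <= a -> 1 <= C -> 0 < dec_rate a C.
Proof.
move=> a1 C1; rewrite mulr_gt0 ?divr_gt0// powR_gt0// invr_gt0 mulr_gt0 ?(lt_le_trans _ C1)//.
by rewrite addr_gt0// (lt_le_trans _ a1).
Qed.

(** The coefficients decay at rate e, while packets measured in the step 6 / dl grow at rate dl <= e
    / 2; the remaining rate e / 2 makes the sum finite by [gabor_weight]. *)
Lemma gabor_sum_gsb C : 1 <= C -> exists C' K, [/\ 1 <= C', 0 <= K &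
  forall M f n, 0 <= M -> coordb theta C M f -> gsb theta C' (K * M) (gabor_sum f n)].
Proof.
move=> C1; set e := dec_rate 1 C; have e0 : 0 < e by exact: dec_rate_gt0.
pose dl := Num.min 2^-1 (e / 2).
have dl0 : 0 < dl <= 2^-1 by rewrite lt_min ge_min lexx /= invr_gt0 ltr0n divr_gt0.
have dle : dl <= e / 2 by rewrite ge_min lexx orbT.
have [K K0 hK] := gabor_weight (N := N) t01' (divr_gt0 e0 (ltr0n _ 2)).
have d0 : 0 < dl by case/andP: dl0.
exists (6 / dl), (2 * (2 * gmass 1 ^+ N) * expR 1 * K); split.
- by rewrite ler_pdivlMr// mul1r; case/andP: dl0 => _ h; apply: le_trans h _; lra.
- by rewrite !mulr_ge0 ?expR_ge0// exprn_ge0// ltW// gmass_gt0.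
move=> M f n M0 hf; apply: gsb_le; last first.
- apply: gsb_sum => [|la]; first by rewrite divr_ge0// ltW.
  exact: (gsb_wave (gpt la) htheta dl0).
- have g0 : 0 <= gmass 1 ^+ N :> R by rewrite exprn_ge0// ltW// gmass_gt0.
  set G := gmass 1 ^+ N in g0 *; set E := expR 1.
  have A0 : 0 <= 2 * (2 * G) * E * M by rewrite !mulr_ge0// expR_ge0.
  apply: (@le_trans _ _ (\sum_(la : glam n) (2 * (2 * G) * E * M) *
      (gwts N n * expR (- (e / 2 * phw theta (gpt la)))))); last first.
    rewrite -mulr_sumr (mulrAC _ K); apply: ler_wpM2l; first exact: A0.
    exact: hK.
  apply: ler_sum => la _; rewrite cabsM cabsR (ger0_norm (gwts_ge0 _)).
  have := gwt_decay (flip (gpt la)) htheta (lexx 1) C1 M0 hf.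
  rewrite phw_flip -/(dec_rate 1 C) -/e -/G; have := @phw_ge0 _ N theta (gpt la).
  set p := phw theta _ => p0 h; have w0 := @gwts_ge0 R N n; set w := gwts N n in w0 *.
  have hE : expR (- (e * p)) * expR (dl * p) <= expR (- (e / 2 * p)).
    rewrite -expRD ler_expR; have := ler_wpM2r p0 dle; lra.
  apply: (@le_trans _ _ (w * (2 * (2 * G * M) * expR (- (e * p))) * (E * expR (dl * p)))).
    by rewrite ler_wpM2r ?ler_wpM2l// mulr_ge0 ?expR_ge0.
  rewrite (_ : _ * (E * _) = 2 * (2 * G) * E * M * (w * (expR (- (e * p)) * expR (dl * p)))).
    by rewrite ler_wpM2l// ler_wpM2l.
  by ring.
- by rewrite divr_ge0// ltW.
Qed.

(** Bounds on one coordinate at a time already imply bounds on all mixed derivatives and powers: the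
    Gabor sums satisfy the latter uniformly and converge pointwise to f. *)
Lemma coordb_gsb C : 1 <= C -> exists C' K, [/\ 1 <= C', 0 <= K &
  forall M f, 0 <= M -> coordb theta C M f -> gsb theta C' (K * M) f].
Proof.
move=> C1; have [C' [K [C'1 K0 h]]] := gabor_sum_gsb C1; exists C', K; split=> // M f M0 hf.
apply: (@gsb_limit _ _ _ _ _ (gabor_sum f)) => [n|x]; first exact: h.
exact: gabor_cvg hf.
Qed.

Lemma step_gsb C : 0 < C -> exists C' K, [/\ 1 <= C', 0 <= K &
  forall M f, smooth f -> (gs_norm theta C f <= M%:E)%E -> gsb theta C' (K * M) f].
Proof.
move=> C0; have C1 : 1 <= Num.max 1 C by rewrite le_max lexx.
have [C' [K [C'1 K0 h]]] := coordb_gsb C1; exists C', K; split=> // M f sf hf.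
by have [M0 hc] := gs_norm_coordb (ltW t0) C0 sf hf; exact: h.
Qed.

Lemma gsP f : gs theta f <-> exists C M, [/\ 1 <= C, 0 <= M & gsb theta C M f].
Proof.
split=> [[C /= C0 [sf hf]]|[C [M [C1 _ hf]]]]; last first.
  by apply: gsb_gs hf => //; exact: lt_le_trans C1.
have [C' [K [C'1 K0 h]]] := step_gsb C0.
have [M M0 hM] : exists2 M : R, 0 <= M & (gs_norm theta C f <= M%:E)%E.
  case: (gs_norm theta C f) hf => [r _|//|_].
    by exists (Num.max 0 r); rewrite ?le_max ?lexx// lee_fin le_max lexx orbT.
  by exists 0; rewrite ?leNye.
by exists C', (K * M); split=> //; [exact: mulr_ge0|exact: h].
Qed.

Lemma gs_lin a f g : gs theta f -> gs theta g -> gs theta (fun x => a * f x + g x).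
Proof.
move=> /gsP[C [M [C1 M0 hf]]] /gsP[D [L [D1 L0 hg]]].
have m1 : 1 <= Num.max C D by rewrite le_max C1.
have h0 (x : R) : 1 <= x -> 0 <= x by exact: le_trans ler01.
apply/gsP; exists (Num.max C D), (cabs a * M + L); split=> //.
  by rewrite addr_ge0// mulr_ge0// cabs_ge0.
apply: gsb_lin.
  by apply: (gsb_leC _ _ _ hf) => //; [exact: h0|rewrite le_max lexx].
by apply: (gsb_leC _ _ _ hg) => //; [exact: h0|rewrite le_max lexx orbT].
Qed.

Lemma gs0 : gs theta (fun _ : 'rV[R]_N => 0 : R[i]).
Proof. by apply: gsb_gs (gsb0 theta ler01) => //. Qed.

Lemma gsZ a f : gs theta f -> gs theta (fun x => a * f x).
Proof.
by move=> hf; have := gs_lin a hf gs0; under eq_fun do rewrite addr0.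
Qed.

Lemma gs_wave (X : phase R N) : gs theta (wave_packet X).
Proof.
have h : 0 < (2^-1 : R) <= 2^-1 by rewrite lexx invr_gt0 ltr0n.
by apply: gsb_gs (gsb_wave X htheta h) => //.
Qed.

Definition gslin u := forall a f g, gs theta f -> gs theta g ->
  u (fun x => a * f x + g x) = a * u f + u g.

Definition gsbounded u := forall C, 0 < C -> exists2 K, 0 <= K &
  forall M f, gsb theta C M f -> cabs (u f) <= K * M.

Lemma gslin0 u : gslin u -> u (fun=> 0) = 0.
Proof.
move=> h; have := h (-1) _ _ gs0 gs0; under eq_fun do rewrite mulr0 addr0.
by move=> ->; rewrite mulN1r addNr.
Qed.

Lemma gslinZ u a f : gslin u -> gs theta f -> u (fun x => a * f x) = a * u f.
Proof.
move=> h hf; have := h a _ _ hf gs0; rewrite gslin0// addr0 => <-; congr u.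
by apply/funext => x; rewrite addr0.
Qed.

Lemma gslinD u f g : gslin u -> gs theta f -> gs theta g ->
  u (fun x => f x + g x) = u f + u g.
Proof.
move=> h hf hg; have := h 1 _ _ hf hg; rewrite mul1r => <-; congr u.
by apply/funext => x; rewrite mul1r.
Qed.

Lemma gslin_sum u I (r : seq I) (c : I -> R[i]) (F : I -> 'rV[R]_N -> R[i]) : gslin u ->
  (forall i, gs theta (F i)) -> gs theta (fun y => \sum_(i <- r) c i * F i y) /\
  u (fun y => \sum_(i <- r) c i * F i y) = \sum_(i <- r) c i * u (F i).
Proof.
move=> ul hF; elim: r => [|i r [IH1 IH2]].
  rewrite big_nil; under eq_fun do rewrite big_nil.
  by split; [exact: gs0|exact: gslin0].
have -> : (fun y => \sum_(k <- i :: r) c k * F k y) =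
    fun y => c i * F i y + \sum_(k <- r) c k * F k y by apply/funext => y; rewrite big_cons.
by rewrite big_cons -IH2 -ul//; split=> //; exact: gs_lin.
Qed.

(** Continuity in the inductive limit topology is boundedness on each step. One direction rescales
    into an absolutely convex neighbourhood; the other uses that the set where |u| < e is itself
    absolutely convex. *)
Lemma ultradistP u : ultradist theta u <-> gslin u /\ gsbounded u.
Proof.
split=> [[ul uc]|[ul ub]].
  split=> // C C0; have [V [VU Vgs Vabs Vr]] := uc _ gs0 1 ltr01.
  have C'0 : 0 < 2 ^+ N.+1 * C by rewrite mulr_gt0 ?exprn_gt0.
  have [r r0 hr] := Vr _ C'0; exists (2 / r); first by rewrite divr_ge0// ltW.
  have u1 f : V f -> cabs (u f) < 1.
    move=> /VU /=; rewrite (gslin0 ul) subr0; set g := (fun x => 0 + f x).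
    by have -> : g = f by apply/funext => x; rewrite /g add0r.
  move=> M f hf; have M0 := gsb_ge0 C0 hf.
  (* The slack eta avoids dividing by M = 0. *)
  suff key eta : 0 < eta -> cabs (u f) <= 2 / r * (M + eta).
    apply/ler_addgt0Pr => eta eta0; have := key (r / 2 * eta).
    rewrite mulrDr [X in _ + X](_ : _ = eta); last by field; rewrite gt_eqF.
    by apply; rewrite mulr_gt0// divr_gt0.
  move=> eta0; have Me : 0 < M + eta by rewrite ltr_wpDl.
  set c := r / (2 * (M + eta)); have c0 : 0 < c by rewrite divr_gt0// mulr_gt0.
  have gf : gs theta f by apply: gsb_gs hf.
  have hcf : gsb theta C (cabs c%:C * M + 0) (fun x => c%:C * f x + 0).
    by apply: gsb_lin => //; apply: gsb0; exact: ltW.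
  have cf : V (fun x => c%:C * f x + 0).
    apply: hr; last first.
      apply: le_lt_trans (gsb_gs_norm t01 C0 hcf) _; rewrite lte_fin addr0 cabsR gtr0_norm//.
      rewrite /c mulrAC ltr_pdivrMr ?mulr_gt0// ltr_pM2l//; lra.
    split; first by have [] := hcf.
    by apply: le_lt_trans (gsb_gs_norm t01 C0 hcf) _; rewrite ltry.
  have := u1 _ cf; rewrite (ul _ _ _ gf gs0) (gslin0 ul) addr0 cabsM cabsR gtr0_norm//.
  rewrite mulrC -ltr_pdivlMr// => /ltW /le_trans; apply.
  by rewrite /c mul1r invf_div mulrAC.
split=> // f gf e e0.
exists [set g | gs theta g /\ cabs (u g) < e]; split.
- move=> g [gg ug] /=; have -> : u (fun x => f x + g x) = u f + u g by exact: gslinD.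
  by rewrite addrAC subrr add0r.
- by move=> g [].
- move=> g h a b [gg ug] [gh uh] ab; split; first by apply: gs_lin => //; exact: gsZ.
  rewrite (ul _ _ _ gg (gsZ b gh)) (gslinZ _ ul gh).
  apply: le_lt_trans (cabsD _ _) _; rewrite !cabsM.
  have m0 : 0 <= Num.max (cabs (u g)) (cabs (u h)) by rewrite le_max cabs_ge0.
  apply: (@le_lt_trans _ _ (Num.max (cabs (u g)) (cabs (u h)))); last by rewrite gt_max ug.
  apply: (@le_trans _ _ ((cabs a + cabs b) * Num.max (cabs (u g)) (cabs (u h)))).
    by rewrite mulrDl lerD// ler_wpM2l ?cabs_ge0// le_max lexx ?orbT.
  by rewrite ler_piMl.
- move=> C C0; have [C' [K [C'1 K0 hK]]] := step_gsb C0.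
  have C'0 : 0 < C' by exact: lt_le_trans C'1.
  have [L L0 hL] := ub _ C'0.
  pose r := e / (2 * (L * K + 1)); have lk : 0 < L * K + 1 by rewrite ltr_wpDl// mulr_ge0.
  have r0 : 0 < r by rewrite divr_gt0// mulr_gt0.
  exists r => // g [sg ng] ngr; split; first by exists C.
  apply: le_lt_trans (hL _ _ (hK _ _ sg (ltW ngr))) _.
  rewrite /r mulrA mulrA ltr_pdivrMr ?mulr_gt0// mulrC ltr_pM2l//.
  have : 0 <= L * K by exact: mulr_ge0. lra.
Qed.

Lemma gsbounded_cvg0 u C M I (F : set_system I) {FF : Filter F} (e_ : I -> 'rV[R]_N -> R[i]) :
  gsbounded u -> 0 < C -> (forall i, gsb theta C M (e_ i)) -> (forall x, ccvg F (e_ ^~ x) 0) ->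
  ccvg F (fun i => u (e_ i)) 0.
Proof.
move=> ub C0 he e_0; apply/ccvgP => eps eps0; have C20 : 0 < 2 * C by rewrite mulr_gt0.
have [K K0 hK] := ub _ C20.
have eta0 : 0 < eps / (2 * (K + 1)) by rewrite divr_gt0// mulr_gt0// ltr_wpDl.
have hs : \forall i \near F, gsb theta (2 * C) (eps / (2 * (K + 1))) (e_ i).
  by apply: (gsb_small (M := M)) => //; exact: ltW.
apply: filterS hs => i hi.
rewrite subr0; apply: le_lt_trans (hK _ _ hi) _.
rewrite mulrA ltr_pdivrMr ?mulr_gt0// ?ltr_wpDl// mulrC ltr_pM2l//; lra.
Qed.

Lemma gslin_cvg u C M I (F : set_system I) {FF : Filter F} (f_ : I -> 'rV[R]_N -> R[i]) f :
  gslin u -> gsbounded u -> 0 < C -> (forall i, gsb theta C M (f_ i)) -> gsb theta C M f ->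
  (forall x, ccvg F (f_ ^~ x) (f x)) -> ccvg F (fun i => u (f_ i)) (u f).
Proof.
move=> ul ub C0 hf_ hf cf.
have gf : gs theta f by apply: gsb_gs hf.
have gf_ i : gs theta (f_ i) by apply: gsb_gs (hf_ i).
have h : ccvg F (fun i => u (fun x => -1 * f x + f_ i x)) 0.
  apply: (gsbounded_cvg0 (C := C) (M := cabs (-1) * M + M)) => // [i|x].
    exact: gsb_lin.
  have h : ccvg F (fun i => -1 * f x + f_ i x) (-1 * f x + f x).
    by apply: ccvgD => //; exact: ccvg_cst.
  by have e : -1 * f x + f x = 0 by [ring]; rewrite e in h.
have h2 : ccvg F (fun i => u f + u (fun x => -1 * f x + f_ i x)) (u f + 0).
  by apply: ccvgD => //; exact: ccvg_cst.
rewrite addr0 in h2; apply: ccvg_ext h2 => i.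
by rewrite (ul _ _ _ gf (gf_ i)) mulN1r addrA subrr add0r.
Qed.

Lemma gabor_repr u f : gslin u -> gsbounded u -> gs theta f ->
  ccvg \oo (fun n => \sum_(la : glam n) (gwts N n)%:C * gwt 1 f (flip (gpt la)) *
     u (wave_packet (gpt la))) (u f).
Proof.
move=> ul ub /gsP[C [M [C1 M0 hf]]]; have C0 : 0 < C by exact: lt_le_trans C1.
have hc := gsb_coordb hf.
have [C' [K [C'1 K0 h]]] := gabor_sum_gsb C1; have C'0 : 0 < C' by exact: lt_le_trans C'1.
have gS n : gsb theta C' (K * M) (gabor_sum f n) by exact: h.
have cS x : ccvg \oo (fun n => gabor_sum f n x) (f x) by exact: gabor_cvg hc.
have hf' : gsb theta C' (K * M) f by exact: gsb_limit gS cS.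
have hu : ccvg \oo (fun n => u (gabor_sum f n)) (u f).
  by apply: (gslin_cvg (C := C') (M := K * M)).
apply: ccvg_ext hu => n.
by have [_ ->] := gslin_sum (index_enum (glam n)) (fun la => (gwts N n)%:C * gwt 1 f (flip (gpt la))) ul
   (fun la => gs_wave (gpt la)).
Qed.

Lemma wave_growth u d : gsbounded u -> 0 < d -> exists2 K, 0 <= K &
  forall X : phase R N, cabs (u (wave_packet X)) <= K * expR (d * phw theta X).
Proof.
move=> ub d0; pose dl := Num.min 2^-1 d.
have dl0 : 0 < dl <= 2^-1 by rewrite lt_min ge_min lexx /= invr_gt0 ltr0n d0.
have d10 : 0 < dl by case/andP: dl0.
have [K K0 hK] := ub (6 / dl) (divr_gt0 (ltr0n _ 6) d10).
exists (K * expR 1) => [|X]; first by rewrite mulr_ge0// expR_ge0.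
apply: le_trans (hK _ _ (gsb_wave X htheta dl0)) _; rewrite -mulrA ler_wpM2l// ler_wpM2l ?expR_ge0//.
by rewrite ler_expR ler_wpM2r ?phw_ge0// ge_min lexx orbT.
Qed.

End GelfandShilovSpace.

(** * Uniform boundedness on the steps *)

Section UniformBoundedness.
Context {R : realType} {N : nat} (theta : R).
Hypothesis htheta : 2^-1 <= theta < 1.
Implicit Types (f g : 'rV[R]_N -> R[i]) (C M : R) (u : functional R N).

Let t0 : 0 < theta. Proof. by case/andP: htheta => h _; apply: lt_le_trans h; rewrite invr_gt0. Qed.
Let t1 : theta <= 1. Proof. by case/andP: htheta => _ /ltW. Qed.
Let t01 : 0 <= theta <= 1. Proof. by rewrite ltW. Qed.

Lemma gsbZ C M a f : 0 <= C -> gsb theta C M f -> gsb theta C (cabs a * M) (fun x => a * f x).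
Proof.
move=> C0 hf; have := gsb_lin a hf (gsb0 theta C0).
by rewrite addr0; under eq_fun do rewrite addr0.
Qed.

Lemma gsb_point C M f y : gsb theta C M f -> cabs (f y) <= M.
Proof. by move=> hf; have := gsb_dd [::] y hf; rewrite /= expr0 /gbd fact0 powR1 !mulr1. Qed.

(* [B] is the norm of [u] on the step; [g] is nearly norming (for the gliding
   hump in [banach_steinhaus]). *)
Lemma near_norming u C : 0 < C -> gslin theta u -> gsbounded theta u -> forall K f M, 0 <= K ->
  gsb theta C M f -> K * M < cabs (u f) -> exists g B, [/\ gsb theta C 1 g, K <= B,
    forall L h, gsb theta C L h -> cabs (u h) <= B * L & 2 / 3 * B <= cabs (u g)].
Proof.
move=> C0 ul ub K f M K0 hf hK; have C0' := ltW C0; have M0 := gsb_ge0 C0 hf.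
have [A A0 hA] := ub _ C0.
have gsf L (h : 'rV[R]_N -> R[i]) : gsb theta C L h -> gs theta h by move=> hh; apply: gsb_gs hh.
have Mp : 0 < M.
  rewrite lt_neqAle M0 andbT; apply/eqP => M_0.
  by have := hA _ _ hf; move: hK; rewrite -M_0 !mulr0 => h1 /(lt_le_trans h1); rewrite ltxx.
have scale L h : 0 < L -> gsb theta C L h -> gsb theta C 1 (fun x => (L^-1)%:C * h x) /\
    cabs (u (fun x => (L^-1)%:C * h x)) = cabs (u h) / L.
  move=> L0 hh; split.
    have := gsbZ (L^-1)%:C C0' hh; rewrite cabsR gtr0_norm ?invr_gt0//.
    by rewrite mulVf ?gt_eqF.
  by rewrite (gslinZ htheta _ ul (gsf _ _ hh)) cabsM cabsR gtr0_norm ?invr_gt0// mulrC.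
pose S := [set r | exists2 h, gsb theta C 1 h & r = cabs (u h)].
have Sne : S !=set0 by exists (cabs (u (fun=> 0))), (fun=> 0) => //;
  apply: (gsb_le C0' ler01); apply: gsb0.
have hS : has_sup S.
  by split=> //; exists A => _ [h hh ->]; have := hA _ _ hh; rewrite mulr1.
have ubS h : gsb theta C 1 h -> cabs (u h) <= sup S.
  by move=> hh; apply: ub_le_sup; [exact: hS.2|exists h].
have [f1 f2] := scale _ _ Mp hf.
have KS : K < sup S by apply: lt_le_trans (ubS _ f1); rewrite f2 ltr_pdivlMr.
have S0 : 0 < sup S by exact: le_lt_trans KS.
have [] := sup_adherent (divr_gt0 S0 (ltr0n _ 3)) hS.
move=> _ [g hg ->] hgS; exists g, (sup S); split=> //.
- exact: ltW.
- move=> L h hh; have L0 := gsb_ge0 C0 hh.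
  move: L0; rewrite le_eqVlt => /predU1P[L0|L0].
    by have := hA _ _ hh; rewrite -L0 !mulr0.
  by have [h1 h2] := scale _ _ L0 hh; have := ubS _ h1; rewrite h2 ler_pdivrMr.
- lra.
Qed.

Lemma ccvg_cauchy (x : nat -> R[i]) (e : nat -> R) : e n @[n --> \oo] --> 0 ->
  (forall n k, cabs (x (n + k)%N - x n) <= e n) -> exists z, ccvg \oo x z.
Proof.
move=> e0 xe.
have key (r : nat -> R) : (forall n k, `|r (n + k)%N - r n| <= e n) -> cvg (r n @[n --> \oo]).
  move=> re; apply: cauchy_cvg; apply/cauchy_ballP => d d0.
  have d20 : 0 < d / 2 by rewrite divr_gt0.
  move/cvgrPdist_lt : e0 => /(_ _ d20)[n0 _ hn0].
  have en0 : e n0 < d / 2 by have := hn0 n0 (leqnn _); rewrite sub0r normrN; apply: le_lt_trans; rewrite ler_norm.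
  pose S := [set t : R | `|t - r n0| <= e n0].
  have hS : \forall n \near \oo, S (r n).
    by exists n0 => // n /= hn; have := re n0 (n - n0)%N; rewrite subnKC.
  exists (S, S) => // -[a b] [/= ha hb].
  rewrite /ball /= (_ : a - b = (a - r n0) - (b - r n0)); last by ring.
  by apply: le_lt_trans (ler_normB _ _) _; rewrite /S /= in ha hb; lra.
have c1 : cvg (complex.Re (x n) @[n --> \oo]).
  by apply: (key (fun n => complex.Re (x n))) => n k; rewrite -ReN -ReD; apply: le_trans (Re_le_cabs _) _.
have c2 : cvg (complex.Im (x n) @[n --> \oo]).
  by apply: (key (fun n => complex.Im (x n))) => n k; rewrite -ImN -ImD; apply: le_trans (Im_le_cabs _) _.
exists (lim (complex.Re (x n) @[n --> \oo]) +i* lim (complex.Im (x n) @[n --> \oo])).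
by apply/ccvgReIm.
Qed.

(** Completeness of one step, through pointwise limits. The sum of 3^-(k+1) over k >= n is 3^-n /
    2. *)
Lemma gsb_series C (g : nat -> 'rV[R]_N -> R[i]) (c : nat -> R[i]) (x : nat -> 'rV[R]_N -> R[i]) :
  0 < C -> (forall n, gsb theta C 1 (g n)) -> (forall n, cabs (c n) <= 3^-1 ^+ n.+1) ->
  (forall n, x n.+1 = fun y => c n * g n y + x n y) ->
  exists z, forall n, gsb theta C (2^-1 * 3^-1 ^+ n) (fun y => z y - x n y).
Proof.
move=> C0 hg hc xS; have C0' := ltW C0.
pose e n : R := 2^-1 * 3^-1 ^+ n.
have e0 n : 0 <= e n by rewrite mulr_ge0 ?exprn_ge0.
have diff n k : gsb theta C (e n - e (n + k)%N) (fun y => x (n + k)%N y - x n y).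
  elim: k => [|k IH].
    rewrite addn0 subrr; under eq_fun do rewrite subrr; exact: gsb0.
  rewrite addnS xS; have := gsb_lin (c (n + k)%N) (hg (n + k)%N) IH.
  have -> : (fun y => c (n + k)%N * g (n + k)%N y + (x (n + k)%N y - x n y)) =
    fun y => c (n + k)%N * g (n + k)%N y + x (n + k)%N y - x n y.
    by apply/funext => y; rewrite addrA.
  apply: gsb_le => //; rewrite mulr1.
  have := hc (n + k)%N; rewrite /e [3^-1 ^+ (n + k).+1]exprS; lra.
have diff' n k : gsb theta C (e n) (fun y => x (n + k)%N y - x n y).
  by apply: (gsb_le C0' _ (diff n k)); rewrite gerBl.
have ecv : e n @[n --> \oo] --> (0 : R).
  rewrite -(mulr0 2^-1); apply: cvgM; first exact: cvg_cst.
  by apply: cvg_expr; rewrite ger0_norm ?invr_ge0// invf_lt1// ltr1n.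
have /choice[z hz] : forall y, exists z, ccvg \oo (fun n => x n y) z.
  by move=> y; apply: (ccvg_cauchy ecv) => n k; exact: (gsb_point y (diff' n k)).
exists z => n; apply: (gsb_limit (f_ := fun k y => x (n + k)%N y - x n y)) => [k|y]; first exact: diff'.
have h : ccvg \oo (fun k => x (n + k)%N y) (z y).
  have := hz y; rewrite /ccvg -(cvg_shiftn n).
  by apply: cvg_trans; under eq_fun do rewrite addnC.
by apply: ccvgB => //; exact: ccvg_cst.
Qed.

(** A gliding hump: if the norms were unbounded, a signed series of nearly norming elements with
    coefficients 3^-(n+1) would lie in the step and have unbounded values. *)
Lemma banach_steinhaus I (s : I -> functional R N) :
  (forall i, gslin theta (s i)) -> (forall i, gsbounded theta (s i)) ->
  (forall f, gs theta f -> exists B, forall i, cabs (s i f) <= B) ->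
  forall C, 0 < C -> exists2 K, 0 <= K &
    forall i M f, gsb theta C M f -> cabs (s i f) <= K * M.
Proof.
move=> sl sb pb C C0; have C0' := ltW C0; apply: contrapT => nK.
have ex K : 0 <= K -> exists igB : I * ('rV[R]_N -> R[i]) * R, [/\ gsb theta C 1 igB.1.2, K <= igB.2,
    forall L h, gsb theta C L h -> cabs (s igB.1.1 h) <= igB.2 * L &
    2 / 3 * igB.2 <= cabs (s igB.1.1 igB.1.2)].
  move=> K0; apply: contrapT => nex; apply: nK; exists K => // i M f hf.
  rewrite leNgt; apply/negP => hK; apply: nex.
  have [g [B h]] := near_norming C0 (sl i) (sb i) K0 hf hK.
  by exists (i, g, B).
have /choice[p hp] : forall n : nat, exists igB : I * ('rV[R]_N -> R[i]) * R, [/\ gsb theta C 1 igB.1.2,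
    3 ^+ n.+1 * n%:R <= igB.2,
    forall L h, gsb theta C L h -> cabs (s igB.1.1 h) <= igB.2 * L &
    2 / 3 * igB.2 <= cabs (s igB.1.1 igB.1.2)].
  by move=> n; apply: ex; rewrite mulr_ge0 ?exprn_ge0.
pose T n := s (p n).1.1; pose g n := (p n).1.2; pose B n := (p n).2.
pose a n : R[i] := (3^-1 ^+ n.+1)%:C.
(* Of v + w and v - w one has modulus at least |w|; the sign is chosen so that the new term is not
   cancelled by the earlier ones. *)
pose sg n (x : 'rV[R]_N -> R[i]) : R[i] :=
  if 3^-1 ^+ n.+1 * cabs (T n (g n)) <= cabs (T n (fun y => a n * g n y + x y)) then a n else - a n.
pose x := fix x n : 'rV[R]_N -> R[i] :=
  match n with 0 => fun=> 0 | n1.+1 => fun y => sg n1 (x n1) * g n1 y + x n1 y end.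
have gg n : gs theta (g n) by have [h _ _ _] := hp n; apply: gsb_gs h.
have gx n : gs theta (x n) by elim: n => [|n IH]; [exact: gs0|exact: gs_lin].
have i3 n : 0 <= 3^-1 ^+ n :> R by rewrite exprn_ge0.
have [z hz] : exists z, forall n, gsb theta C (2^-1 * 3^-1 ^+ n) (fun y => z y - x n y).
  apply: (gsb_series (c := fun n => sg n (x n)) C0 (g := g)) => [n|n|//].
    by have [] := hp n.
  by rewrite /sg; case: ifP => _; rewrite ?cabsN cabsR ger0_norm.
have gz : gs theta z.
  have := hz 0%N; under eq_fun do rewrite subr0.
  by move=> h; apply: gsb_gs h.
have [Bz hBz] := pb _ gz.
(* The new term gives at least 3^-(n+1) (2/3) B_n and the tail takes away at most 3^-(n+1) B_n / 2;
   with B_n >= 3^(n+1) n there remains n / 6. *)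
have key n : n%:R / 6 <= Bz.
  apply: le_trans (hBz (p n).1.1); rewrite -/(T n).
  have [_ h1 h2 h3] := hp n; rewrite -/(T n) -/(g n) -/(B n) in h1 h2 h3.
  have Tl : gslin theta (T n) by exact: sl.
  have low : 3^-1 ^+ n.+1 * cabs (T n (g n)) <= cabs (T n (x n.+1)).
    rewrite [x n.+1]/= -/x /sg; case: ifP => // /negbT; rewrite -ltNge.
    rewrite !Tl//; set w := T n (g n); set v := T n (x n) => h.
    have e : 2%:R * (a n * w) = (a n * w + v) - (- a n * w + v) by ring.
    have := cabsD (a n * w + v) (- (- a n * w + v)); rewrite -e cabsN !cabsM cabs_natr cabsR ger0_norm//.
    lra.
  have dz := h2 _ _ (hz n.+1).
  have e : T n z = T n (fun y => z y - x n.+1 y) + T n (x n.+1).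
    rewrite -(gslinD Tl)//; last by have := hz n.+1; move=> h; apply: gsb_gs h.
    by congr (T n _); apply/funext => y; rewrite subrK.
  have := cabsD (T n z) (- (T n (fun y => z y - x n.+1 y))).
  rewrite {1}e addrAC subrr add0r cabsN => h4.
  have p3 : 0 < 3^-1 ^+ n.+1 :> R by rewrite exprn_gt0.
  have h5 : 3^-1 ^+ n.+1 * (2 / 3 * B n) <= 3^-1 ^+ n.+1 * cabs (T n (g n)) by rewrite ler_wpM2l.
  have h6 : n%:R <= 3^-1 ^+ n.+1 * B n.
    have := ler_wpM2l (ltW p3) h1; rewrite mulrA -exprMn mulVf ?expr1n ?mul1r//.
  lra.
have := key (6 * (Num.truncn Bz).+1)%N; rewrite natrM mulrAC mulfV// mul1r.
by have := truncnS_gt Bz; rewrite ltNge => /negP.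
Qed.

Lemma growth_of_equib I (s : I -> functional R N) :
  (forall C, 0 < C -> exists2 K, 0 <= K & forall i M f, gsb theta C M f -> cabs (s i f) <= K * M) ->
  forall d, 0 < d -> exists2 K, 0 <= K &
    forall i (X : phase R N), cabs (s i (wave_packet X)) <= K * expR (d * phw theta X).
Proof.
move=> ub d d0; pose dl := Num.min 2^-1 d.
have dl0 : 0 < dl <= 2^-1 by rewrite lt_min ge_min lexx /= invr_gt0 ltr0n d0.
have d10 : 0 < dl by case/andP: dl0.
have [K K0 hK] := ub (6 / dl) (divr_gt0 (ltr0n _ 6) d10).
exists (K * expR 1) => [|i X]; first by rewrite mulr_ge0// expR_ge0.
apply: le_trans (hK i _ _ (gsb_wave X htheta dl0)) _; rewrite -mulrA ler_wpM2l// ler_wpM2l ?expR_ge0//.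
by rewrite ler_expR ler_wpM2r ?phw_ge0// ge_min lexx orbT.
Qed.

(** A converse of [growth_of_equib]: the reproducing formula pairs the growth of s_i(g_X), at rate e
    / 2, with the decay at rate e of the transform of f. *)
Lemma equib_of_growth I (s : I -> functional R N) :
  (forall i, gslin theta (s i)) -> (forall i, gsbounded theta (s i)) ->
  (forall d, 0 < d -> exists2 K, 0 <= K &
    forall i (X : phase R N), cabs (s i (wave_packet X)) <= K * expR (d * phw theta X)) ->
  forall C, 1 <= C -> exists2 K, 0 <= K &
    forall i M f, gsb theta C M f -> cabs (s i f) <= K * M.
Proof.
move=> sl sb gr C C1; have C0 : 0 < C by exact: lt_le_trans C1.
set e := @dec_rate R theta 1 C; have e0 : 0 < e by apply: dec_rate_gt0.
have t01' : 0 < theta <= 1 by rewrite t0.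
have e20 : 0 < e / 2 by rewrite divr_gt0.
have [K K0 hK] := gr _ e20; have [W W0 hW] := gabor_weight (N := N) t01' e20.
have g0 : 0 <= gmass 1 ^+ N :> R by rewrite exprn_ge0// ltW// gmass_gt0.
set G := gmass 1 ^+ N in g0 *.
exists (2 * (2 * G) * K * W) => [|i M f hf]; first by rewrite !mulr_ge0.
have M0 := gsb_ge0 C0 hf; have gf : gs theta f by apply: gsb_gs hf.
have h := gabor_repr htheta (sl i) (sb i) gf; apply: (ccvg_le _ h); apply: nearW => n.
apply: le_trans (cabs_sum _ _ _) _.
apply: (@le_trans _ _ (\sum_(la : glam n) (2 * (2 * G * M) * K) *
    (gwts N n * expR (- (e / 2 * phw theta (gpt la)))))); last first.
  rewrite -mulr_sumr (_ : _ * K * W * M = (2 * (2 * G * M) * K) * W); last by ring.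
  by apply: ler_wpM2l; [rewrite !mulr_ge0|exact: hW].
apply: ler_sum => la _; rewrite 2!cabsM cabsR (ger0_norm (gwts_ge0 _)).
have := gwt_decay (flip (gpt la)) htheta (lexx 1) C1 M0 (gsb_coordb hf).
rewrite phw_flip -/(dec_rate theta 1 C) -/e -/G; have := @phw_ge0 _ N theta (gpt la).
have := hK i (gpt la).
set p := phw theta _ => h1 p0 h2; have w0 := @gwts_ge0 R N n; set w := gwts N n in w0 *.
have hE : expR (- (e * p)) * expR (e / 2 * p) = expR (- (e / 2 * p)).
  by rewrite -expRD; congr expR; field.
apply: (@le_trans _ _ (w * (2 * (2 * G * M) * expR (- (e * p))) * (K * expR (e / 2 * p)))).
  by apply: ler_pM; [exact: (mulr_ge0 w0 (cabs_ge0 _))|exact: cabs_ge0|exact: (ler_wpM2l w0 h2)|].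
by rewrite -hE le_eqVlt; apply/orP; left; apply/eqP; ring.
Qed.

(** One Gabor sum approximates f within a step on which the s_i are equibounded, and on that finite
    sum the convergence is known. This allows weak convergence to be tested on wave packets. *)
Lemma wave_cvg_gs (s : nat -> functional R N) :
  (forall i, gslin theta (s i)) -> (forall i, gsbounded theta (s i)) ->
  (forall d, 0 < d -> exists2 K, 0 <= K &
    forall i (X : phase R N), cabs (s i (wave_packet X)) <= K * expR (d * phw theta X)) ->
  (forall X : phase R N, ccvg \oo (fun n => s n (wave_packet X)) 0) ->
  forall f, gs theta f -> ccvg \oo (fun n => s n f) 0.
Proof.
move=> sl sb gr sw f gf; have /(gsP htheta)[C [M [C1 M0 hf]]] := gf.
have hc := gsb_coordb hf.
have [C' [K [C'1 K0 h]]] := gabor_sum_gsb (N := N) htheta C1; have C'0 : 0 < C' by exact: lt_le_trans C'1.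
have gS n : gsb theta C' (K * M) (gabor_sum f n) by exact: h.
have cS x : ccvg \oo (fun n => gabor_sum f n x) (f x) by exact: gabor_cvg hc.
have hf' : gsb theta C' (K * M) f by exact: gsb_limit gS cS.
have C'2 : 1 <= 2 * C' by rewrite (le_trans C'1)// ler_peMl ?ler1n// ltW.
have [L L0 hL] := equib_of_growth sl sb gr C'2.
apply/ccvgP => eps eps0.
have eta0 : 0 < eps / (4 * (L + 1)) by rewrite divr_gt0// mulr_gt0// ltr_wpDl.
have gd n : gsb theta C' (cabs (-1) * (K * M) + K * M) (fun x => -1 * gabor_sum f n x + f x).
  exact: gsb_lin.
have cd x : ccvg \oo (fun n => -1 * gabor_sum f n x + f x) 0.
  have hh : ccvg \oo (fun n => -1 * gabor_sum f n x + f x) (-1 * f x + f x).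
    by apply: ccvgD; [apply: ccvgZ; exact: cS|exact: ccvg_cst].
  by have e : -1 * f x + f x = 0 by [ring]; rewrite e in hh.
have [m _ hm] := gsb_small (ltW t0) C'0 gd cd eta0.
have {}hm := hm m (leqnn m).
have gSm : gs theta (gabor_sum f m) by apply: gsb_gs (gS m).
have e1 k : s k f = s k (fun x => -1 * gabor_sum f m x + f x) + s k (gabor_sum f m).
  by rewrite (sl k)// mulN1r addrAC addNr add0r.
have hk : ccvg \oo (fun k => s k (gabor_sum f m)) 0.
  have -> : (fun k => s k (gabor_sum f m)) = fun k => \sum_(la : glam m)
      ((gwts N m)%:C * gwt 1 f (flip (gpt la))) * s k (wave_packet (gpt la)).
    apply/funext => k; have [_ <-] := gslin_sum htheta (index_enum (glam m))
      (fun la => (gwts N m)%:C * gwt 1 f (flip (gpt la))) (sl k) (fun la => gs_wave htheta (gpt la)).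
    by [].
  have hs : ccvg \oo (fun k => \sum_(la : glam m)
      ((gwts N m)%:C * gwt 1 f (flip (gpt la))) * s k (wave_packet (gpt la)))
     (\sum_(la : glam m) ((gwts N m)%:C * gwt 1 f (flip (gpt la))) * 0).
    by apply: ccvg_sum => la; apply: ccvgZ; exact: sw.
  by rewrite [X in ccvg _ _ X]big1 in hs => // la _; rewrite mulr0.
have eps2 : 0 < eps / 2 by rewrite divr_gt0.
have /ccvgP /(_ _ eps2) := hk; apply: filterS => k; rewrite !subr0 => h2.
rewrite e1; apply: le_lt_trans (cabsD _ _) _.
have h3 : cabs (s k (fun x => -1 * gabor_sum f m x + f x)) <= eps / 4.
  apply: le_trans (hL k _ _ hm) _; rewrite invfM !mulrA ler_pdivrMr ?ltr_wpDl//.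
  have : 0 <= eps / 4 by rewrite divr_ge0// ltW.
  lra.
lra.
Qed.

Lemma ccvg_bounded (x : nat -> R[i]) z : ccvg \oo x z -> exists B, forall n, cabs (x n) <= B.
Proof.
move=> h; have /cvg_seq_bounded[B [_ hB]] : cvg (cabs (x n - z) @[n --> \oo]).
  by apply/cvg_ex; exists 0.
exists (B + 1 + cabs z) => n; have := hB (B + 1); rewrite ltrDl ltr01 => /(_ isT n I) /=.
rewrite ger0_norm ?cabs_ge0// => h1.
by have := cabsD (x n - z) z; rewrite subrK; lra.
Qed.

Lemma weak_growth (s : nat -> functional R N) :
  (forall i, gslin theta (s i)) -> (forall i, gsbounded theta (s i)) ->
  (forall f, gs theta f -> ccvg \oo (fun n => s n f) 0) ->
  forall d, 0 < d -> exists2 K, 0 <= K &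
    forall i (X : phase R N), cabs (s i (wave_packet X)) <= K * expR (d * phw theta X).
Proof.
move=> sl sb sw; apply: growth_of_equib; apply: banach_steinhaus => // f gf.
exact: ccvg_bounded (sw _ gf).
Qed.

Lemma continuous_sumT (T : topologicalType) I (r : seq I) (F : I -> T -> R) :
  (forall i, continuous (F i)) -> continuous (fun x => \sum_(i <- r) F i x).
Proof.
move=> cF; elim: r => [|i r IH].
  by under eq_fun do rewrite big_nil; exact: cst_continuous.
have -> : (fun x => \sum_(k <- i :: r) F k x) = fun x => F i x + \sum_(k <- r) F k x.
  by apply/funext => x; rewrite big_cons.
by move=> x; apply: cvgD; [exact: cF|exact: IH].
Qed.

Lemma continuous_gaussT (T : topologicalType) (a b : T -> R) : continuous a -> continuous b ->
  continuous (fun x => cos (- a x) * expR (- (b x / 2))) /\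
  continuous (fun x => sin (- a x) * expR (- (b x / 2))).
Proof.
move=> ca cb.
have ce : continuous (fun x => expR (- (b x / 2))).
  move=> x; apply: (continuous_comp (f := fun x => - (b x / 2))); last exact: continuous_expR.
  by apply: cvgN; apply: cvgM; [exact: cb|exact: cvg_cst].
have cN : continuous (fun x => - a x) by move=> x; apply: cvgN; exact: ca.
split=> x; apply: cvgM; try exact: ce.
  by apply: (continuous_comp (f := fun x => - a x)); [exact: cN|exact: continuous_cos].
by apply: (continuous_comp (f := fun x => - a x)); [exact: cN|exact: continuous_sin].
Qed.

Lemma continuous_phase_coord j : continuous (fun X : phase R N => X.1 0 j) /\
  continuous (fun X : phase R N => X.2 0 j).
Proof.
have cc : continuous (fun x : 'rV[R]_N => x 0 j).
  apply: (@lip_continuous _ _ _ 1) => x y; rewrite mul1r.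
  by have := coord_le_norm (x - y) j; rewrite !mxE.
split=> -[a b].
  by apply: (cvg_comp _ (fun x : 'rV[R]_N => x 0 j) cvg_fst); exact: cc.
by apply: (cvg_comp _ (fun x : 'rV[R]_N => x 0 j) cvg_snd); exact: cc.
Qed.

Lemma continuous_mulT (T : topologicalType) (a b : T -> R) : continuous a -> continuous b ->
  continuous (fun x => a x * b x).
Proof. by move=> ca cb x; apply: cvgM; [exact: ca|exact: cb]. Qed.

Lemma continuous_addT (T : topologicalType) (a b : T -> R) : continuous a -> continuous b ->
  continuous (fun x => a x + b x).
Proof. by move=> ca cb x; apply: cvgD; [exact: ca|exact: cb]. Qed.

Lemma continuous_cstT (T : topologicalType) (a : R) : continuous (fun _ : T => a).
Proof. exact: cst_continuous. Qed.

Lemma wave_ccvg (X : phase R N) y : ccvg (nbhs X) (fun Z => wave_packet Z y) (wave_packet X y).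
Proof.
have ca : continuous (fun Z : phase R N => dotp y Z.2).
  apply: continuous_sumT => j; apply: continuous_mulT; first exact: continuous_cstT.
  exact: (continuous_phase_coord j).2.
have cb : continuous (fun Z : phase R N => enorm (y - Z.1) ^+ 2).
  have -> : (fun Z : phase R N => enorm (y - Z.1) ^+ 2) = fun Z =>
      \sum_(j < N) (y 0 j + -1 * Z.1 0 j) * (y 0 j + -1 * Z.1 0 j).
    apply/funext => Z; rewrite enorm_sq; apply: eq_bigr => j _.
    by rewrite !mxE mulN1r expr2.
  have cj j : continuous (fun Z : phase R N => y 0 j + -1 * Z.1 0 j).
    apply: continuous_addT; first exact: continuous_cstT.
    by apply: continuous_mulT; [exact: continuous_cstT|exact: (continuous_phase_coord j).1].
  by apply: continuous_sumT => j; apply: continuous_mulT.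
have [h1 h2] := continuous_gaussT ca cb.
have e1 : (fun Z : phase R N => complex.Re (wave_packet Z y)) =
    fun Z => cos (- dotp y Z.2) * expR (- (enorm (y - Z.1) ^+ 2 / 2)).
  by apply/funext => Z; rewrite ReM /= mulr0 subr0.
have e2 : (fun Z : phase R N => complex.Im (wave_packet Z y)) =
    fun Z => sin (- dotp y Z.2) * expR (- (enorm (y - Z.1) ^+ 2 / 2)).
  by apply/funext => Z; rewrite ImM /= mulr0 add0r.
apply/ccvgReIm; split.
  by have := h1 X; rewrite -e1.
by have := h2 X; rewrite -e2.
Qed.

Lemma continuous_phase_norm : continuous (fun X : phase R N => `|X.1|) /\
  continuous (fun X : phase R N => `|X.2|).
Proof.
have cc : continuous (fun x : 'rV[R]_N => `|x|) by exact: norm_continuous.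
split=> -[a b].
  by apply: (cvg_comp _ (fun x : 'rV[R]_N => `|x|) cvg_fst); exact: cc.
by apply: (cvg_comp _ (fun x : 'rV[R]_N => `|x|) cvg_snd); exact: cc.
Qed.

(** Continuity of the packet in X for the norm of a step, from pointwise continuity and [gsb_small].
    The constant is 24 = 2 (6 / delta) with delta = 1/2. *)
Lemma wave_gsb_cvg (X : phase R N) C eta : 24 <= C -> 0 < eta ->
  \forall Z \near X, gsb theta C eta (fun y => -1 * wave_packet X y + wave_packet Z y).
Proof.
move=> C24 eta0; pose A := `|X.1| + `|X.2| + 1.
have A0 : 0 <= A by rewrite !addr_ge0.
pose B : R := expR 1 * expR (2^-1 * (A `^ theta^-1 + A `^ theta^-1)).
have h2 : 0 < (2^-1 : R) <= 2^-1 by rewrite lexx invr_gt0 ltr0n.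
have gB Z : `|Z.1| <= A -> `|Z.2| <= A -> gsb theta (6 / 2^-1) B (@wave_packet R N Z).
  move=> Z1 Z2; apply: gsb_le (gsb_wave Z htheta h2); first by rewrite divr_ge0.
  rewrite ler_wpM2l ?expR_ge0// ler_expR ler_wpM2l ?invr_ge0// lerD// ge0_ler_powR ?nnegrE//;
    by rewrite invr_ge0 ltW.
have XA1 : `|X.1| < A by rewrite /A -addrA ltrDl ltr_wpDl.
have XA2 : `|X.2| < A by rewrite /A [`|X.1| + _]addrC -addrA ltrDl ltr_wpDl.
(* [gsb_small] wants a bound for every index, so the family is set to zero away from X, where the
   packets are not uniformly bounded. *)
pose e_ (Z : phase R N) : 'rV[R]_N -> R[i] := if (`|Z.1| <= A) && (`|Z.2| <= A) then
   fun y => -1 * wave_packet X y + wave_packet Z y else fun=> 0.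
have C12 : 0 <= 6 / 2^-1 :> R by rewrite divr_ge0.
have C12' : 0 < 6 / 2^-1 :> R by rewrite divr_gt0// invr_gt0.
have B0 : 0 <= B by rewrite mulr_ge0 ?expR_ge0.
have he Z : gsb theta (6 / 2^-1) (cabs (-1) * B + B) (e_ Z).
  rewrite /e_; case: ifP => [/andP[h3 h4]|_].
    by apply: gsb_lin; apply: gB => //; exact: ltW.
  apply: (gsb_le C12 _ (gsb0 theta C12)).
  by rewrite addr_ge0// mulr_ge0 ?cabs_ge0.
have e0 y : ccvg (nbhs X) (e_ ^~ y) 0.
  have hw : ccvg (nbhs X) (fun Z => -1 * wave_packet X y + wave_packet Z y)
      (-1 * wave_packet X y + wave_packet X y).
    by apply: ccvgD; [exact: ccvg_cst|exact: wave_ccvg].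
  have e : -1 * wave_packet X y + wave_packet X y = 0 by ring.
  rewrite e in hw; apply: (ccvg_squeeze _ hw) => Z; rewrite /e_ 2!subr0.
  by case: ifP => // _; rewrite cabs0; exact: cabs_ge0.
have hs : \forall Z \near X, gsb theta (2 * (6 / 2^-1)) eta (e_ Z).
  by apply: (gsb_small (ltW t0) C12' he e0 eta0).
have n1 : \forall Z \near X, `|Z.1| < A by have := @cvgr_lt R _ (nbhs X) (nbhs_filter X) (fun Z : phase R N => `|Z.1|) `|X.1| (continuous_phase_norm.1 X) A XA1.
have n2 : \forall Z \near X, `|Z.2| < A by have := @cvgr_lt R _ (nbhs X) (nbhs_filter X) (fun Z : phase R N => `|Z.2|) `|X.2| (continuous_phase_norm.2 X) A XA2.
near=> Z; have : gsb theta (2 * (6 / 2^-1)) eta (e_ Z) by near: Z.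
rewrite /e_ (_ : (`|Z.1| <= A) && (`|Z.2| <= A)).
  apply: (gsb_leC (C := 2 * (6 / 2^-1))); [by rewrite mulr_ge0| |exact: ltW].
  by rewrite invrK; lra.
by apply/andP; split; apply: ltW; near: Z.
Unshelve. all: by end_near. Qed.

(** Equiboundedness and continuity of X |-> g_X upgrade pointwise convergence to uniform convergence
    on compact sets of phase space. *)
Lemma wave_cvg_uniform (s : nat -> functional R N) :
  (forall i, gslin theta (s i)) -> (forall i, gsbounded theta (s i)) ->
  (forall f, gs theta f -> ccvg \oo (fun n => s n f) 0) ->
  forall r eta, 0 < eta -> \forall n \near \oo, forall X : phase R N,
    `|X.1| <= r -> `|X.2| <= r -> cabs (s n (wave_packet X)) <= eta.
Proof.
move=> sl sb sw r eta eta0.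
have cK : compact ([set x : 'rV[R]_N | `|x| <= r] `*` [set x : 'rV[R]_N | `|x| <= r]).
  by apply: compact_setX; exact: ball_compact.
have C240 : 0 < 24 :> R by [].
have [K K0 hK] := banach_steinhaus sl sb (fun f gf => ccvg_bounded (sw f gf)) C240.
have main : \forall n \near \oo, ([set x : 'rV[R]_N | `|x| <= r] `*` [set x : 'rV[R]_N | `|x| <= r])
   `<=` (fun X => cabs (s n (wave_packet X)) <= eta).
  move/compact_near_coveringP : cK; apply => X _.
  have e20 : 0 < eta / 2 by rewrite divr_gt0.
  have eK : 0 < eta / (2 * (K + 1)) by rewrite divr_gt0// mulr_gt0// ltr_wpDl.
  have h1 : \forall n \near \oo, cabs (s n (wave_packet X)) < eta / 2.
    by have /ccvgP /(_ _ e20) := sw _ (gs_wave htheta X); apply: filterS => n; rewrite subr0.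
  have h2 := wave_gsb_cvg X (lexx 24) eK.
  near=> Z n => /=.
  have hz : gsb theta 24 (eta / (2 * (K + 1))) (fun y => -1 * wave_packet X y + wave_packet Z y).
    by near: Z.
  have hn : cabs (s n (wave_packet X)) < eta / 2 by near: n.
  have h3 := hK n _ _ hz.
  rewrite (sl n) in h3; [|exact: gs_wave|exact: gs_wave].
  have e : s n (wave_packet Z) = (-1 * s n (wave_packet X) + s n (wave_packet Z)) + s n (wave_packet X).
    by rewrite mulN1r addrAC addNr add0r.
  rewrite e; apply: le_trans (cabsD _ _) _.
  have : K * (eta / (2 * (K + 1))) <= eta / 2.
    rewrite mulrA ler_pdivrMr ?mulr_gt0// ?ltr_wpDl// (_ : eta / 2 * (2 * (K + 1)) = eta * K + eta); last by field.
    by rewrite mulrC lerDl ltW.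
  lra.
by apply: filterS main => n h X X1 X2; exact: h.
Unshelve. all: by end_near. Qed.

End UniformBoundedness.

(** * Decay in cones *)

Section ConeCompactness.
Context {R : realType}.

Lemma near_fst (A B : topologicalType) (x0 : A) (y0 : B) (P : A -> Prop) :
  (\forall x \near x0, P x) -> \forall w \near (x0, y0), P w.1.
Proof. by move=> h; exact: (@cvg_fst _ _ (nbhs x0) (nbhs y0) _ _ h). Qed.

Lemma near_snd (A B : topologicalType) (x0 : A) (y0 : B) (P : B -> Prop) :
  (\forall y \near y0, P y) -> \forall w \near (x0, y0), P w.2.
Proof. by move=> h; exact: (@cvg_snd _ _ (nbhs x0) (nbhs y0) _ _ h). Qed.

Lemma near_gtT (T : topologicalType) (f : T -> R) x r : continuous f -> r < f x ->
  \forall y \near x, r < f y.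
Proof. by move=> cf rx; exact: (@cvgr_gt R _ (nbhs x) (nbhs_filter x) f (f x) (cf x) r rx). Qed.

Lemma near_ltT (T : topologicalType) (f : T -> R) x r : continuous f -> f x < r ->
  \forall y \near x, f y < r.
Proof. by move=> cf rx; exact: (@cvgr_lt R _ (nbhs x) (nbhs_filter x) f (f x) (cf x) r rx). Qed.

Lemma cone_uniform (Z W : topologicalType) (K : set Z) (y0 : W) I (b : I -> R -> Z -> W -> R) (p : R) :
  compact K ->
  (forall z0, K z0 -> exists C e : R, 0 < e /\
     \forall z \near z0 & y \near y0, forall i s, 0 < s -> b i s z y <= C * expR (- (e * s `^ p))) ->
  exists C e : R, [/\ 0 <= C, 0 < e & \forall y \near y0, forall z, K z -> forall i s, 0 < s ->
    b i s z y <= C * expR (- (e * s `^ p))].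
Proof.
move=> cK h.
(* One integer controls both the constant and the inverse of the rate, so the statement is monotone
   in it and fits near-covering compactness. *)
pose P (yn : W * nat) (z : Z) := forall i s, 0 < s ->
   b i s z yn.1 <= yn.2.+1%:R * expR (- (yn.2.+1%:R^-1 * s `^ p)).
have main : \forall yn \near filter_prod (nbhs y0) \oo, K `<=` P yn.
  move/compact_near_coveringP : cK; apply => z0 Kz0.
  have [C [e [e0 hC]]] := h z0 Kz0.
  have [n0 hn0] : exists n0 : nat, C <= n0%:R /\ e^-1 <= n0%:R.
    exists (maxn (Num.truncn C).+1 (Num.truncn e^-1).+1).
    by split; rewrite (le_trans (ltW (truncnS_gt _)))// ler_nat leq_max leqnn ?orbT.
  case: hC => -[A B] /= [nA nB] AB.
  exists (A, B `*` [set n | (n0 <= n)%N]) => /=; first by split=> //; exists (B, [set n | (n0 <= n)%N]) => //; split=> //; exists n0.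
  move=> [z [y n]] [/= Az [/= By hn]] i s s0; have := AB (z, y) (conj Az By) i s s0 => /= /le_trans; apply.
  have n1 : n0%:R <= n.+1%:R :> R by rewrite ler_nat (leq_trans hn).
  apply: (@le_trans _ _ (n.+1%:R * expR (- (e * s `^ p)))).
    by rewrite ler_wpM2r ?expR_ge0// (le_trans hn0.1).
  rewrite ler_wpM2l// ler_expR lerN2 ler_wpM2r ?powR_ge0//.
  by rewrite -[leRHS]invrK lef_pV2 ?posrE ?invr_gt0 ?ltr0n// (le_trans hn0.2).
case: main => -[A B] /= [nA [n0 _ hB]] AB.
exists n0.+1%:R, n0.+1%:R^-1; split=> //; apply: filterS nA => y Ay z Kz i s s0.
by have := AB (y, n0) (conj Ay (hB n0 (leqnn _))) z Kz i s s0.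
Qed.

End ConeCompactness.

(** * Transfer of decay along rays *)

Section Transfer.
Context {R : realType} {N M : nat} (theta : R).
Hypothesis htheta : 2^-1 <= theta < 1.
Notation p := (theta^-1).

Let t0 : 0 < theta. Proof. by case/andP: htheta => h _; apply: lt_le_trans h; rewrite invr_gt0. Qed.

Definition nrm3 (z : phase R N * R) : R := Num.max (Num.max `|z.1.1| `|z.1.2|) `|z.2|.

(** Decay along the rays through a neighbourhood of [X0], uniform in the index; for [X0] nonzero
    this is decay in an open cone ([WFP]). *)
Definition decays_at I (a : I -> phase R N -> R) (X0 : phase R N) :=
  exists C e : R, 0 < e /\ \forall X \near X0, forall i s, 0 < s ->
    a i (s *: X) <= C * expR (- (e * s `^ p)).

Lemma phwZ n (X : phase R n) s : 0 <= s -> phw theta (s *: X) = s `^ p * phw theta X.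
Proof.
by move=> s0; rewrite /phw /= !normrZ (ger0_norm s0) !powRM// mulrDr.
Qed.

(* By homogeneity it suffices to bound [a] times the kernel on rays through the
   unit sphere of [(X, t)]: where [q] does not vanish the kernel beats the growth
   of [a], and elsewhere [a] itself decays. *)
Lemma transfer I (a : I -> phase R N -> R) (q : phase R N -> phase R M -> R) (Y0 : phase R M) c :
  0 < c -> (forall i X, 0 <= a i X) ->
  (forall d, 0 < d -> exists2 K, 0 <= K & forall i X, a i X <= K * expR (d * phw theta X)) ->
  (forall X Y, 0 <= q X Y) -> (forall s X Y, 0 < s -> q (s *: X) (s *: Y) = s * q X Y) ->
  continuous (fun w : (phase R N * R) * phase R M => q w.1.1 (w.1.2 *: w.2)) ->
  (forall X t, 0 <= t -> (X, t) != 0 -> q X (t *: Y0) = 0 -> decays_at a X) ->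
  exists C e, [/\ 0 <= C, 0 < e & \forall Y \near Y0, forall i X t, 0 <= t ->
    a i X * expR (- (c * q X (t *: Y) `^ p)) <= C * expR (- (e * (phw theta X + t `^ p)))].
Proof.
move=> c0 a0 gr q0 qZ cq hdec.
pose Kb : set (phase R N * R) := ([set x : 'rV[R]_N | `|x| <= 1] `*` [set x : 'rV[R]_N | `|x| <= 1])
   `*` [set` `[0, 1]].
have cKb : compact Kb.
  by apply: compact_setX; [apply: compact_setX; exact: ball_compact|exact: segment_compact].
(* Being zero off the unit sphere of [nrm3], [b] lets the compact box [Kb] stand in for the sphere;
   near the origin nothing has to be shown. *)
pose b (i : I) (s : R) (z : phase R N * R) (Y : phase R M) : R := if nrm3 z == 1 then
  a i (s *: z.1) * expR (- (c * q (s *: z.1) ((s * z.2) *: Y) `^ p)) else 0.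
have [|C [e [C0 e0 hC]]] := @cone_uniform R _ _ Kb Y0 I b p cKb.
  move=> [X0 tau0] [_ /=]; rewrite in_itv /= => /andP[tau00 _].
  have [z0|z0] := eqVneq (X0, tau0) 0.
    exists 0, 1; split; first exact: ltr01.
    have n1 : \forall X \near X0, `|X.1| < 1 /\ `|X.2| < 1.
      have [X00 _] : X0 = 0 /\ tau0 = 0 by case: z0.
      have [c1 c2] := @continuous_phase_norm R N.
      have l1 : `|X0.1| < 1 by rewrite X00 normr0.
      have l2 : `|X0.2| < 1 by rewrite X00 normr0.
      have h1 := near_ltT c1 l1.
      have h2 := near_ltT c2 l2.
      by apply: filterS2 h1 h2.
    have n2 : \forall t \near tau0, `|t| < 1.
      have [_ ->] : X0 = 0 /\ tau0 = 0 by case: z0.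
      have l0 : `|0 : R| < 1 by rewrite normr0.
      exact: (near_ltT (@norm_continuous _ _) l0).
    have n12 : \forall w \near ((X0, tau0), Y0), (`|w.1.1.1| < 1 /\ `|w.1.1.2| < 1) /\ `|w.1.2| < 1.
      have h1 : \forall w \near ((X0, tau0), Y0), `|w.1.1.1| < 1 /\ `|w.1.1.2| < 1.
        by apply: (@near_fst _ _ _ _ (fun z => `|z.1.1| < 1 /\ `|z.1.2| < 1)); apply: (@near_fst _ _ _ _ (fun X => `|X.1| < 1 /\ `|X.2| < 1)).
      have h2 : \forall w \near ((X0, tau0), Y0), `|w.1.2| < 1.
        by apply: (@near_fst _ _ _ _ (fun z => `|z.2| < 1)); apply: (@near_snd _ _ _ _ (fun t => `|t| < 1)).
      by apply: filterS2 h1 h2.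
    apply: filterS n12 => -[[X t] Y] /= [[h1 h2] h3] i s s0.
    rewrite /b ifF ?mul0r//; apply/negbTE; rewrite lt_eqF// /nrm3 /= !gt_max h1 h2 h3//.
  have [qz|qz] := eqVneq (q X0 (tau0 *: Y0)) 0.
    have [C [e [e0 hC]]] := hdec _ _ tau00 z0 qz; exists (Num.max C 0), e; split=> //.
    pose Q (X : phase R N) := forall i (s : R), 0 < s -> a i (s *: X) <= C * expR (- (e * s `^ p)).
    have h1 : \forall w \near ((X0, tau0), Y0), Q w.1.1.
      by apply: (@near_fst _ _ _ _ (fun z : phase R N * R => Q z.1)); apply: (@near_fst _ _ _ _ Q).
    apply: filterS h1 => -[[X t] Y] /= h1 i s s0; rewrite /b; case: ifP => _; last first.
      by rewrite mulr_ge0 ?expR_ge0// le_max lexx orbT.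
    apply: (@le_trans _ _ (C * expR (- (e * s `^ p)))); last first.
      by rewrite ler_wpM2r ?expR_ge0// le_max lexx.
    apply: le_trans (h1 i s s0); rewrite ler_piMr// -expR0 ler_expR oppr_le0.
    by rewrite mulr_ge0 ?powR_ge0// ltW.
  have q00 : 0 < q X0 (tau0 *: Y0) by rewrite lt_neqAle eq_sym qz q0.
  set q1 := q X0 (tau0 *: Y0) / 2; have q10 : 0 < q1 by rewrite divr_gt0.
  have q1lt : q1 < q X0 (tau0 *: Y0) by rewrite /q1; lra.
  have hq : \forall w \near ((X0, tau0), Y0), q1 < q w.1.1 (w.1.2 *: w.2).
    have := @near_gtT _ _ _ ((X0, tau0), Y0) q1 cq q1lt; exact.
  (* On the box [phw] is at most 2, so growth at rate d costs 2 d out of the 4 d supplied by the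
     kernel. *)
  set d := c * q1 `^ p / 4; have d0 : 0 < d by rewrite divr_gt0// mulr_gt0// powR_gt0.
  have [K K0 hK] := gr _ d0.
  exists K, (2 * d); split; first by rewrite mulr_gt0.
  apply: filterS hq => -[[X tau] Y] /= hqw i s s0; rewrite /b.
  case: ifP => [/eqP n1|_]; last by rewrite mulr_ge0// expR_ge0.
  have [X1 X2] : `|X.1| <= 1 /\ `|X.2| <= 1.
    by rewrite -n1 /nrm3 /= !le_max !lexx !orbT.
  have ph2 : phw theta X <= 2.
    have pp (x : R) : 0 <= x -> x <= 1 -> x `^ p <= 1.
      by move=> x0 x1; have -> : 1 = 1 `^ p :> R by [rewrite powR1]; rewrite ge0_ler_powR ?nnegrE ?invr_ge0 ?(ltW t0).
    by rewrite /phw (_ : 2 = 1 + 1 :> R)// lerD// pp.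
  rewrite -scalerA qZ// /d powRM//; last exact: ltW.
  set S := s `^ p; have S0 : 0 <= S by exact: powR_ge0.
  apply: (@le_trans _ _ (K * expR (d * (S * 2)) * expR (- (c * (S * q1 `^ p))))).
    apply: ler_pM; rewrite ?expR_ge0//.
      apply: le_trans (hK _ _) _; rewrite ler_wpM2l// ler_expR (ler_wpM2l (ltW d0))//.
      by rewrite phwZ ?(ltW s0)// ler_wpM2l.
    rewrite ler_expR lerN2 (ler_wpM2l (ltW c0))// ler_wpM2l//.
    by rewrite ge0_ler_powR ?nnegrE ?invr_ge0 ?(ltW t0) ?(ltW q10) ?(ltW hqw).
  rewrite -mulrA -expRD ler_wpM2l// ler_expR /d; lra.
have [K K0 hK] := gr 1 ltr01.
(* Each of the three terms |X.1|^p, |X.2|^p, t^p is at most r^p, where r is the norm of (X, t). *)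
exists (Num.max C K), (e / 3); split; [by rewrite le_max C0|by rewrite divr_gt0|].
apply: filterS hC => Y hY i X t t_ge0.
have ph0 (x : R) : 0 <= c * x `^ p by rewrite mulr_ge0 ?powR_ge0// ltW.
set r := nrm3 (X, t).
have r0 : 0 <= r by rewrite /r /nrm3 !le_max normr_ge0.
have [X1 [X2 X3]] : `|X.1| <= r /\ (`|X.2| <= r /\ t <= r).
  by rewrite /r /nrm3 /= !le_max !lexx (ger0_norm t_ge0) lexx !orbT.
have [rz|rnz] := eqVneq r 0.
  have tz : t = 0 by apply/eqP; rewrite eq_le t_ge0 andbT -rz.
  have Xz : X = 0.
    by apply: injective_projections; apply/eqP; rewrite -normr_le0 -rz.
  have p0 : (0 : R) `^ p = 0 by rewrite powR0// invr_eq0 gt_eqF.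
  have -> : phw theta X + t `^ p = 0 by rewrite Xz tz /phw /= !normr0 p0 !addr0.
  rewrite mulr0 oppr0 expR0 mulr1.
  apply: (@le_trans _ _ (K * 1)); last by rewrite mulr1 le_max lexx orbT.
  apply: ler_pM; rewrite ?expR_ge0//; last by rewrite -expR0 ler_expR oppr_le0.
  have := hK i X; rewrite Xz /phw /= !normr0 p0 !addr0 mulr0 expR0 mulr1.
  by rewrite -Xz.
have rp : 0 < r by rewrite lt_neqAle eq_sym rnz.
have ri0 : 0 <= r^-1 by rewrite invr_ge0.
have nz : nrm3 (r^-1 *: X, r^-1 * t) = 1.
  rewrite /nrm3 /= !normrZ ?normrM !(ger0_norm ri0) -!maxr_pMr//.
  by rewrite -[X in _ * X]/r mulVf.
have kz : Kb (r^-1 *: X, r^-1 * t).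
  split=> /=; first by split=> /=; rewrite normrZ (ger0_norm ri0) mulrC ler_pdivrMr// mul1r.
  by rewrite in_itv /= mulr_ge0//= mulrC ler_pdivrMr// mul1r.
have := hY _ kz i r rp; rewrite /b nz eqxx /= scalerA mulrA divff// mul1r scale1r.
move=> /le_trans; apply.
apply: (@le_trans _ _ (C * expR (- (e / 3 * (phw theta X + t `^ p))))); last first.
  by rewrite ler_wpM2r ?expR_ge0// le_max lexx.
rewrite ler_wpM2l// ler_expR lerN2.
have mono (x : R) : 0 <= x -> x <= r -> x `^ p <= r `^ p.
  by move=> x0 xr; rewrite ge0_ler_powR ?nnegrE ?invr_ge0 ?(ltW t0).
have := mono _ (normr_ge0 _) X1; have := mono _ (normr_ge0 _) X2; have := mono _ t_ge0 X3.
rewrite /phw; move: (`|X.1| `^ p) (`|X.2| `^ p) (t `^ p) (r `^ p) => x y z w h1 h2 h3.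
have : x + y + z <= 3 * w by lra.
move=> h4; have := ler_wpM2l (ltW e0) h4; lra.
Qed.

End Transfer.

(** * Wave front sets in terms of decay near a point *)

Section WaveFront.
Context {R : realType} {N : nat} (theta : R).
Hypothesis htheta : 2^-1 <= theta < 1.
Notation p := (theta^-1).
Implicit Types (u : functional R N) (X Z : phase R N).

Let t0 : 0 < theta. Proof. by case/andP: htheta => h _; apply: lt_le_trans h; rewrite invr_gt0. Qed.
Let p0 : 0 < p. Proof. by rewrite invr_gt0. Qed.

Definition amp I (s : I -> functional R N) (i : I) X : R := cabs (s i (wave_packet X)).

Lemma amp_ge0 I (s : I -> functional R N) i X : 0 <= amp s i X.
Proof. exact: cabs_ge0. Qed.

Lemma enorm_le_norm n (x : 'rV[R]_n) : enorm x <= n%:R * `|x|.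
Proof.
rewrite -(ler_pXn2r (ltn0Sn 1)) ?nnegrE ?enorm_ge0 ?mulr_ge0// enorm_sq exprMn.
apply: (@le_trans _ _ (\sum_(j < n) `|x| ^+ 2)).
  apply: ler_sum => j _; rewrite -real_normK ?num_real// lerXn2r ?nnegrE//.
  exact: coord_le_norm.
rewrite sumr_const card_ord -[leLHS]mulr_natl ler_wpM2r ?sqr_ge0//.
by rewrite -natrX ler_nat; case: n x => // n x; rewrite expnS leq_pmulr// expn_gt0.
Qed.

Lemma enormZ n (x : 'rV[R]_n) s : 0 <= s -> enorm (s *: x) = s * enorm x.
Proof.
move=> s0; apply/eqP; rewrite -(@eqrXn2 _ 2)// ?mulr_ge0 ?enorm_ge0//.
rewrite exprMn !enorm_sq mulr_sumr; apply/eqP; apply: eq_bigr => j _.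
by rewrite !mxE exprMn.
Qed.

Lemma norm_phase_gt0 X : X != 0 -> 0 < `|X.1| + `|X.2|.
Proof.
rewrite lt_neqAle addr_ge0// andbT eq_sym; apply: contra_neq => h.
have [h1 h2] : `|X.1| = 0 /\ `|X.2| = 0.
  by have := normr_ge0 X.1; have := normr_ge0 X.2; lra.
by apply/esym; apply: injective_projections; apply/eqP; rewrite -normr_eq0 ?h1 ?h2.
Qed.

Lemma continuous_phase_sum : continuous (fun X : phase R N => `|X.1| + `|X.2|).
Proof. by apply: continuous_addT; [exact: continuous_phase_norm.1|exact: continuous_phase_norm.2]. Qed.

Lemma decays_at_of_decays I (s : I -> functional R N) X0 L C e : X0 != 0 -> 0 < e -> 0 < C ->
  (forall t Z, 0 < t -> L Z -> L (t *: Z)) -> nbhs X0 L ->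
  (forall i, decays theta (s i) L C e) -> decays_at theta (amp s) X0.
Proof.
move=> X00 e0 C0 Lc nL hd; set r := `|X0.1| + `|X0.2|; have r0 : 0 < r by exact: norm_phase_gt0.
have r2 : r / 2 < r by lra.
have n1 := near_gtT continuous_phase_sum r2.
exists C, (e * (r / 4) `^ p); split; first by rewrite mulr_gt0// powR_gt0// divr_gt0.
apply: filterS2 nL n1 => X LX hX i t t_gt0.
apply: le_trans (hd i _ (Lc _ _ t_gt0 LX)) _; rewrite ler_wpM2l ?(ltW C0)// ler_expR lerN2.
rewrite -!mulrA ler_wpM2l ?(ltW e0)// -powRM; [|by rewrite divr_ge0// ltW|exact: ltW].
have mono (x y : R) : 0 <= x -> x <= y -> x `^ p <= y `^ p.
  by move=> x0 xy; rewrite ge0_ler_powR ?nnegrE ?(ltW p0)// (le_trans x0).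
have rt0 : 0 <= r / 4 * t by rewrite mulr_ge0 ?divr_ge0// ltW.
have sc (x : 'rV[R]_N) : r / 4 <= `|x| -> r / 4 * t <= enorm (t *: x).
  move=> h; rewrite enormZ ?(ltW t_gt0)// mulrC ler_wpM2l ?(ltW t_gt0)//.
  by rewrite (le_trans h)// norm_le_enorm.
have [h1|h1] := leP (r / 4) `|X.1|.
  by apply: le_trans (mono _ _ rt0 (sc _ h1)) _; rewrite lerDl powR_ge0.
have h2 : r / 4 <= `|X.2| by lra.
by apply: le_trans (mono _ _ rt0 (sc _ h2)) _; rewrite lerDr powR_ge0.
Qed.

Lemma continuous_phase_scale (t : R) : continuous (fun X : phase R N => t *: X).
Proof.
exact: (@scaler_continuous R ('rV[R]_N * 'rV[R]_N)%type t).
Qed.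

Definition cone_hull (O : set (phase R N)) : set (phase R N) :=
  [set Z | exists2 t, 0 < t & O (t^-1 *: Z)].

Lemma cone_hull_open O : open O -> open (cone_hull O).
Proof.
move=> oO; have -> : cone_hull O = \bigcup_(t in [set t : R | 0 < t]) ((fun X => t^-1 *: X) @^-1` O).
  by apply/seteqP; split=> Z [t t_gt0 h]; exists t.
apply: bigcup_open => t _; apply: open_comp => // X _.
exact: continuous_phase_scale.
Qed.

(** The cone is the hull of a small open neighbourhood V of X0 on which the norm is positive and
    below r + 1; for Z = t X with X in V the weight of Z is then at most B t^p. *)
Lemma decays_of_decays_at I (s : I -> functional R N) X0 : X0 != 0 -> decays_at theta (amp s) X0 ->
  exists (L : set (phase R N)) (C e : R),
    [/\ open L, conic L, L X0, 0 < C & 0 < e /\ forall i, decays theta (s i) L C e].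
Proof.
move=> X00 [C [e [e0 hX]]].
set r := `|X0.1| + `|X0.2|; have r0 : 0 < r by exact: norm_phase_gt0.
have n1 := near_gtT continuous_phase_sum r0.
have r1 : r < r + 1 by rewrite ltrDl.
have n2 := near_ltT continuous_phase_sum r1.
have : nbhs X0 [set X | [/\ 0 < `|X.1| + `|X.2|, `|X.1| + `|X.2| < r + 1 &
   forall i t, 0 < t -> amp s i (t *: X) <= C * expR (- (e * t `^ p))]].
  by apply: filterS3 n1 n2 hX.
rewrite nbhsE => -[V [oV VX0] hV].
set B := ((N%:R * (r + 1)) `^ p + (N%:R * (r + 1)) `^ p) + 1.
have B0 : 0 < B by rewrite ltr_wpDl// addr_ge0// powR_ge0.
exists (cone_hull V), (Num.max C 1), (e / B); split.
- exact: cone_hull_open.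
- split; last first.
    move=> t Z t_gt0 [s' s0 h]; exists (t * s'); first by rewrite mulr_gt0.
    by rewrite invfM scalerA mulrAC mulVf ?gt_eqF// mul1r.
  by move=> [t t_gt0 /hV /= []]; rewrite !scaler0 /= !normr0 addr0 ltxx.
- by exists 1 => //; rewrite invr1 scale1r.
- by rewrite lt_max ltr01 orbT.
- split=> [|i Z [t t_gt0 /[dup] VZ /hV [h1 h2 h3]]]; first by rewrite divr_gt0.
  have := h3 i t t_gt0; rewrite /amp scalerA divff ?gt_eqF// scale1r => /le_trans; apply.
  apply: (@le_trans _ _ (Num.max C 1 * expR (- (e * t `^ p)))).
    by rewrite ler_wpM2r ?expR_ge0// le_max lexx.
  rewrite ler_wpM2l ?le_max ?ler01 ?orbT// ler_expR lerN2 -mulrA ler_wpM2l ?(ltW e0)//.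
  rewrite mulrC ler_pdivrMr//.
  have bnd (x : 'rV[R]_N) : `|t^-1 *: x| <= r + 1 -> enorm x `^ p <= t `^ p * (N%:R * (r + 1)) `^ p.
    move=> hx; have r10 : 0 <= r + 1 by exact: le_trans hx.
    rewrite -powRM; [|exact: ltW|by rewrite mulr_ge0].
    rewrite ge0_ler_powR ?nnegrE ?(ltW p0) ?enorm_ge0// ?mulr_ge0 ?(ltW t_gt0)//.
    apply: le_trans (enorm_le_norm _) _; rewrite mulrCA ler_wpM2l//.
    by move: hx; rewrite normrZ gtr0_norm ?invr_gt0// mulrC ler_pdivrMr// mulrC.
  have b1 : `|t^-1 *: Z.1| <= r + 1 by apply: ltW; apply: le_lt_trans h2; rewrite lerDl.
  have b2 : `|t^-1 *: Z.2| <= r + 1 by apply: ltW; apply: le_lt_trans h2; rewrite lerDr.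
  have := bnd _ b1; have := bnd _ b2; have : 0 <= t `^ p by exact: powR_ge0.
  rewrite /B; move: (t `^ p) ((N%:R * (r + 1)) `^ p) (enorm _ `^ p) (enorm _ `^ p) => x y z w; lra.
Qed.

Lemma WFP u X : X != 0 -> ~ WF theta u X <-> decays_at theta (amp (fun _ : unit => u)) X.
Proof.
move=> X0; split=> [nW|hd].
  apply: contrapT => nd; apply: nW; split; first exact/eqP.
  move=> [L [C [e [oL [_ Lc] LX C0 [e0 h]]]]]; apply: nd.
  apply: (decays_at_of_decays (L := L) (C := C) (e := e)) => //.
  by rewrite nbhsE; exists L.
move=> [_ nL]; apply: nL.
have [L [C [e [oL cL LX C0 [e0 h]]]]] := decays_of_decays_at X0 hd.
by exists L, C, e; split=> //; split=> //; exact: h tt.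
Qed.

Lemma WF_neq0 u X : WF theta u X -> X != 0. Proof. by case=> /eqP. Qed.

Lemma cvg0_decaysP I (s : I -> functional R N) X : X != 0 ->
  (exists (L : set (phase R N)) (C e : R), [/\ conic L, nbhs X L, 0 < C, 0 < e &
     forall n, decays theta (s n) L C e]) <-> decays_at theta (amp s) X.
Proof.
move=> X0; split=> [[L [C [e [[_ cL] nL C0 e0 h]]]]|hd].
  exact: (decays_at_of_decays X0 e0 C0 cL nL h).
have [L [C [e [oL cL LX C0 [e0 h]]]]] := decays_of_decays_at X0 hd.
by exists L, C, e; split=> //; rewrite nbhsE; exists L.
Qed.

Lemma closed_coneP (A : set (phase R N)) : conic A -> (forall X, X != 0 -> ~ A X ->
  exists2 L : set (phase R N), nbhs X L & forall Z, L Z -> ~ A Z) -> closed_cone A.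
Proof.
move=> cA h; split=> //; exists (A `|` [set 0]).
  rewrite -[X in closed X]setCK; apply: open_closedC; rewrite openE => X /=.
  move=> /not_orP[nA n0]; have X0 : X != 0 by apply/eqP.
  have [L nL LA] := h X X0 nA.
  have r0 := norm_phase_gt0 X0; have n1 := near_gtT continuous_phase_sum r0.
  rewrite /interior; apply: filterS2 nL n1 => Z LZ Z0 [/LA|]; first exact.
  by move=> Z_0; move: Z0; rewrite Z_0 /= !normr0 addr0 ltxx.
apply/seteqP; split=> X; last by case=> -[].
by move=> AX; split; [left|move=> X0; apply: cA.1; rewrite -X0].
Qed.

Lemma closed_cone_nbhs (A : set (phase R N)) X : closed_cone A -> X != 0 -> ~ A X ->
  exists2 L : set (phase R N), nbhs X L & forall Z, L Z -> ~ A Z.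
Proof.
move=> [cA [F cF AF]] X0 nA; exists (~` F).
  have : open (~` F) by exact: closed_openC.
  rewrite openE; apply => FX; apply: nA; rewrite AF; split=> //; exact/eqP.
by move=> Z nF AZ; apply: nF; move: AZ; rewrite AF => -[].
Qed.

Lemma WF_closed_cone u : closed_cone (WF theta u).
Proof.
apply: closed_coneP => [|X X0 nW].
  split; first by case.
  move=> t Z t_gt0 [Z0 nL]; split.
    move/eqP; rewrite scaler_eq0 (gt_eqF t_gt0)/=; exact/negP/eqP.
  move=> [L [C [e [oL [L0 Lc] LZ C0 he]]]]; apply: nL.
  exists L, C, e; split=> //.
  have ti : 0 < t^-1 by rewrite invr_gt0.
  by have := Lc _ _ ti LZ; rewrite scalerA mulVf ?scale1r// (lt0r_neq0 t_gt0).
have [L [C [e [oL cL LX C0 he]]]] : exists (L : set (phase R N)) (C e : R),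
   [/\ open L, conic L, L X, 0 < C & 0 < e /\ decays theta u L C e].
  by apply: contrapT => nL; apply: nW; split=> //; exact/eqP.
exists L; first by rewrite nbhsE; exists L.
by move=> Z LZ [_]; apply; exists L, C, e.
Qed.

End WaveFront.

(** * Pull-back to the diagonal *)

Section GaussianProducts.
Context {R : realType} {N : nat}.
Implicit Types (X Y : phase R N) (y m xi : 'rV[R]_N).

Lemma dotpD y m xi : dotp y (m + xi) = dotp y m + dotp y xi.
Proof. by rewrite /dotp -big_split; apply: eq_bigr => j _; rewrite mxE mulrDr. Qed.

Lemma dotpN y m : dotp y (- m) = - dotp y m.
Proof. by rewrite /dotp -sumrN; apply: eq_bigr => j _; rewrite mxE mulrN. Qed.

Lemma gwin_mul (a b : R) m m' xi xi' y : 0 < a -> 0 < b ->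
  gwin a m xi y * gwin b m' xi' y =
  (expR (- (a * b / (2 * (a + b)) * enorm (m - m') ^+ 2)))%:C *
    gwin (a + b) ((a + b)^-1 *: (a *: m + b *: m')) (xi + xi') y.
Proof.
move=> a0 b0; have ab : a + b != 0 by rewrite gt_eqF// addr_gt0.
rewrite /gwin mulrACA -cisD dotpD opprD [RHS]mulrCA; congr (_ * _).
rewrite -!rmorphM /= -!expRD; congr (expR _)%:C.
rewrite !enorm_sq -!opprD; congr (- _).
rewrite !mulr_sumr !mulr_suml -!big_split /=; apply: eq_bigr => j _.
by rewrite !mxE; field.
Qed.

Lemma cabs_gwt_wave (a : R) Y X : 0 < a -> cabs (gwt a (wave_packet Y) X) =
  expR (- (a / (2 * (1 + a)) * enorm (Y.1 - X.1) ^+ 2)) *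
  (gmass (1 + a) ^+ N * expR (- (enorm (Y.2 + X.2) ^+ 2 / (2 * (1 + a))))).
Proof.
move=> a0; have a10 : 0 < 1 + a by rewrite addr_gt0.
rewrite /gwt (surjective_pairing Y) -gwin1.
have -> : (fun y => gwin 1 Y.1 Y.2 y * gwin a X.1 X.2 y) = fun y =>
   (expR (- (1 * a / (2 * (1 + a)) * enorm (Y.1 - X.1) ^+ 2)))%:C *
    gwin (1 + a) ((1 + a)^-1 *: (1 *: Y.1 + a *: X.1)) (Y.2 + X.2) y.
  by apply/funext => y; rewrite gwin_mul.
rewrite cintZ; last exact: gwin_cnice.
rewrite cint_gwin// !cabsM cabs_cis !cabsR mul1r mul1r !ger0_norm ?expR_ge0//.
by rewrite mulr_ge0 ?expR_ge0// exprn_ge0// ltW// gmass_gt0.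
Qed.

Lemma sum_coord_le (x : 'rV[R]_N) : \sum_(j < N) `|x 0 j| <= N%:R * `|x|.
Proof.
apply: (@le_trans _ _ (\sum_(j < N) `|x|)).
  by apply: ler_sum => j _; exact: coord_le_norm.
by rewrite sumr_const card_ord -[leLHS]mulr_natl.
Qed.

End GaussianProducts.

Section PowerKernel.
Context {R : realType} (theta : R).
Hypothesis htheta : 2^-1 <= theta < 1.
Notation p := (theta^-1).

Let t0 : 0 < theta. Proof. by case/andP: htheta => h _; apply: lt_le_trans h; rewrite invr_gt0. Qed.

Lemma inv_theta : 1 <= p <= 2.
Proof.
case/andP: htheta => h1 h2; rewrite invf_ge1// (ltW h2)/= -[leRHS]invrK lef_pV2//.
by rewrite posrE.
Qed.

(** Merges three decaying factors into one in terms of q. The slots a, b, d hold squares when the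
    factor is Gaussian (enough since p <= 2) and p-th powers when it comes from [gwt_decay]. *)
Lemma kernel_pow (k L : R) : 0 < k -> 0 < L -> exists K c, [/\ 0 <= K, 0 < c &
  forall A B C a b d q : R, 0 <= A -> 0 <= B -> 0 <= C -> 0 <= q ->
   A `^ p <= 1 + a -> B `^ p <= 1 + b -> C `^ p <= 1 + d -> q <= L * (A + B + C) ->
   expR (- (k * (a + b + d))) <= K * expR (- (c * q `^ p))].
Proof.
have /andP[p1 p2] := inv_theta; move=> k0 L0.
have D0 : 0 < (3 * L) `^ p by rewrite powR_gt0// mulr_gt0.
exists (expR (3 * k)), (k / (3 * L) `^ p); split; [exact: expR_ge0|by rewrite divr_gt0|].
move=> A B C a b d q A0 B0 C0 q0 hA hB hC hq; rewrite -expRD ler_expR.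
have h1 : q `^ p <= (3 * L) `^ p * (A `^ p + B `^ p + C `^ p).
  apply: (@le_trans _ _ ((L * (A + B + C)) `^ p)).
    by rewrite ge0_ler_powR ?nnegrE ?(le_trans ler01 p1)// mulr_ge0 ?addr_ge0// ltW.
  rewrite powRM ?(ltW L0) ?addr_ge0// powRM ?(ltW L0)//.
  rewrite -mulrA [leRHS]mulrCA ler_wpM2l ?powR_ge0//.
  exact: powR_triangle3.
have h2 : k / (3 * L) `^ p * q `^ p <= k * (3 + (a + b + d)).
  rewrite mulrAC ler_pdivrMr// -mulrA ler_wpM2l ?(ltW k0)//.
  apply: le_trans h1 _; rewrite mulrC ler_wpM2r ?(ltW D0)//; lra.
lra.
Qed.

Lemma sq_pow (A : R) : 0 <= A -> A `^ p <= 1 + A ^+ 2.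
Proof.
have /andP[p1 p2] := inv_theta.
by move=> A0; apply: powR_le_1Dsqr => //; rewrite p2 (le_trans ler01 p1).
Qed.

Lemma pow_pow (A : R) : A `^ p <= 1 + A `^ p.
Proof. by rewrite lerDr. Qed.

End PowerKernel.

Section SingleKernel.
Context {R : realType} {N : nat} (theta : R).
Hypothesis htheta : 2^-1 <= theta < 1.
Notation p := (theta^-1).

(** A distance that vanishes only for X = Y; the sum over coordinates makes homogeneity and joint
    continuity immediate. *)
Definition qs (X Y : phase R N) : R :=
  \sum_(j < N) (`|X.1 0 j + -1 * Y.1 0 j| + `|X.2 0 j + -1 * Y.2 0 j|).

Lemma qs_le X Y : qs X Y <= N%:R * (`|X.1 - Y.1| + `|X.2 - Y.2|).
Proof.
rewrite /qs big_split /= mulrDr lerD//.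
  by apply: le_trans (sum_coord_le _); apply: ler_sum => j _; rewrite !mxE mulN1r.
by apply: le_trans (sum_coord_le _); apply: ler_sum => j _; rewrite !mxE mulN1r.
Qed.

Lemma qs_ge0 X Y : 0 <= qs X Y.
Proof. by apply: sumr_ge0 => j _; rewrite addr_ge0. Qed.

Lemma wave_kernel : exists K c, [/\ 0 <= K, 0 < c & forall X Y : phase R N,
  cabs (gwt 1 (wave_packet Y) (flip X)) <= K * expR (- (c * qs X Y `^ p))].
Proof.
have k40 : 0 < 4^-1 :> R by rewrite invr_gt0.
have L0 : 0 < N.+1%:R :> R by rewrite ltr0n.
have [K [c [K0 c0 h]]] := kernel_pow htheta k40 L0.
have g0 : 0 <= gmass (1 + 1) ^+ N :> R by rewrite exprn_ge0// ltW// gmass_gt0.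
exists (gmass (1 + 1) ^+ N * K), c; split=> [|//|X Y]; first by rewrite mulr_ge0.
rewrite cabs_gwt_wave//= [leLHS]mulrCA -expRD -[leRHS]mulrA ler_wpM2l//.
apply: le_trans (h `|X.1 - Y.1| `|X.2 - Y.2| 0 (enorm (Y.1 - X.1) ^+ 2) (enorm (Y.2 - X.2) ^+ 2) 0
   (qs X Y) _ _ _ (qs_ge0 _ _) _ _ _ _) => //.
- have e4 : 2 * (1 + 1) = 4 :> R by ring.
  rewrite ler_expR e4; set x := enorm _ ^+ 2; set y := enorm _ ^+ 2; lra.
- apply: le_trans (sq_pow htheta (normr_ge0 _)) _; rewrite lerD2l lerXn2r ?nnegrE ?enorm_ge0//.
  by rewrite distrC norm_le_enorm.
- apply: le_trans (sq_pow htheta (normr_ge0 _)) _; rewrite lerD2l lerXn2r ?nnegrE ?enorm_ge0//.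
  by rewrite distrC norm_le_enorm.
- by rewrite powR0 ?addr0// invr_eq0 gt_eqF//; case/andP: htheta => h1 _; apply: lt_le_trans h1; rewrite invr_gt0.
- by rewrite addr0; apply: le_trans (qs_le _ _) _; rewrite ler_wpM2r ?addr_ge0// ler_nat.
Qed.

End SingleKernel.

Section DiagonalKernel.
Context {R : realType} {d : nat} (theta : R).
Hypothesis htheta : 2^-1 <= theta < 1.
Notation p := (theta^-1).
Implicit Types (X : phase R (d + d)) (Y : phase R d) (f : 'rV[R]_d -> R[i]).

Definition lph X : phase R d := (lsubmx X.1, lsubmx X.2).
Definition rph X : phase R d := (rsubmx X.1, rsubmx X.2).

Lemma wave_row X y z : wave_packet X (row_mx y z) = wave_packet (lph X) y * wave_packet (rph X) z.
Proof.
rewrite /wave_packet mulrACA -cisD -rmorphM /= -expRD; congr (cis _ * (expR _)%:C).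
  rewrite /dotp big_split_ord opprD /=; congr (- _ - _); apply: eq_bigr => j _;
    by rewrite ?row_mxEl ?row_mxEr !mxE.
have -> : row_mx y z - X.1 = row_mx (y - lsubmx X.1) (z - rsubmx X.1).
  by rewrite -{1}[X.1]hsubmxK opp_row_mx add_row_mx.
rewrite !enorm_sq big_split_ord mulrDl opprD /=; congr (- (_ / _) - _ / _); apply: eq_bigr => j _;
    by rewrite ?row_mxEl ?row_mxEr.
Qed.

Definition dgk X f : R[i] := cint (fun y => diag_pull (wave_packet X) y * f y).

(** Centre and frequency of the Gaussian obtained by restricting g_X to the diagonal. *)
Definition dmid X : phase R d := (2^-1 *: ((lph X).1 + (rph X).1), (lph X).2 + (rph X).2).

Lemma diag_wave X y : diag_pull (wave_packet X) y =
  (expR (- (4^-1 * enorm ((lph X).1 - (rph X).1) ^+ 2)))%:C * gwin 2 (dmid X).1 (dmid X).2 y.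
Proof.
rewrite /diag_pull wave_row.
have -> : wave_packet (lph X) = gwin 1 (lph X).1 (lph X).2 by rewrite gwin1.
have -> : wave_packet (rph X) = gwin 1 (rph X).1 (rph X).2 by rewrite gwin1.
rewrite (gwin_mul _ _ _ _ _ ltr01 ltr01) !scale1r.
have e : 1 * 1 / (2 * (1 + 1)) = 4^-1 :> R by field.
by rewrite e.
Qed.

Lemma dgkE X f B : cscont f -> (forall y, cabs (f y) <= B) ->
  dgk X f = (expR (- (4^-1 * enorm ((lph X).1 - (rph X).1) ^+ 2)))%:C * gwt 2 f (dmid X).
Proof.
move=> cf fB; rewrite /dgk /gwt -cintZ.
  by congr cint; apply/funext => y; rewrite diag_wave -mulrA (mulrC (f y)).
by apply: (cnice_bounded cf fB); exact: gwin_cnice.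
Qed.

(** Vanishes exactly when X = (x, x, xi, eta) with (x, xi + eta) = Y. It takes the sum of the two
    positions against 2 Y.1 instead of a midpoint. *)
Definition qd X Y : R := \sum_(j < d)
  (`|X.1 0 (lshift d j) + -1 * X.1 0 (rshift d j)| +
   `|X.1 0 (lshift d j) + X.1 0 (rshift d j) + -2 * Y.1 0 j| +
   `|X.2 0 (lshift d j) + X.2 0 (rshift d j) + -1 * Y.2 0 j|).

Lemma qd_ge0 X Y : 0 <= qd X Y.
Proof. by apply: sumr_ge0 => j _; rewrite !addr_ge0. Qed.

Lemma qd_le X Y : qd X Y <= (2 * d)%:R * (`|(lph X).1 - (rph X).1| +
  `|(dmid X).1 - Y.1| + `|(dmid X).2 - Y.2|).
Proof.
rewrite /qd !big_split /= !mulrDr natrM; apply: lerD; first apply: lerD.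
- apply: (@le_trans _ _ (d%:R * `|(lph X).1 - (rph X).1|)); last first.
    by rewrite -[leRHS]mulrA ler_peMl ?mulr_ge0// ler1n.
  by apply: le_trans (sum_coord_le _); apply: ler_sum => j _; rewrite !mxE mulN1r.
- rewrite -mulrA; apply: (@le_trans _ _ (2 * \sum_(j < d) `|((dmid X).1 - Y.1) 0 j|)).
    rewrite mulr_sumr; apply: ler_sum => j _.
    have -> : X.1 0 (lshift d j) + X.1 0 (rshift d j) + -2 * Y.1 0 j = 2 * ((dmid X).1 - Y.1) 0 j.
      by rewrite !mxE; field.
    by rewrite normrM ger0_norm.
  by rewrite ler_wpM2l// sum_coord_le.
- apply: (@le_trans _ _ (d%:R * `|(dmid X).2 - Y.2|)); last first.
    by rewrite -[leRHS]mulrA ler_peMl ?mulr_ge0// ler1n.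
  by apply: le_trans (sum_coord_le _); apply: ler_sum => j _; rewrite !mxE mulN1r.
Qed.

Lemma lph_flip X : lph (flip X) = flip (lph X).
Proof. by rewrite /lph /flip /=; congr (_, _); apply/matrixP => i j; rewrite !mxE. Qed.

Lemma rph_flip X : rph (flip X) = flip (rph X).
Proof. by rewrite /rph /flip /=; congr (_, _); apply/matrixP => i j; rewrite !mxE. Qed.

Lemma dmid_flip X : dmid (flip X) = flip (dmid X).
Proof. by rewrite /dmid lph_flip rph_flip /flip /= opprD. Qed.

Lemma diag_kernel_wave : exists K c, [/\ 0 <= K, 0 < c & forall X Y,
  cabs (dgk (flip X) (wave_packet Y)) <= K * expR (- (c * qd X Y `^ p))].
Proof.
have k60 : 0 < 6^-1 :> R by rewrite invr_gt0.
have L0 : 0 < (2 * d).+1%:R :> R by rewrite ltr0n.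
have [K [c [K0 c0 h]]] := kernel_pow htheta k60 L0.
have g0 : 0 <= gmass (1 + 2) ^+ d :> R by rewrite exprn_ge0// ltW// gmass_gt0// addr_gt0.
exists (gmass (1 + 2) ^+ d * K), c; split=> [|//|X Y]; first by rewrite mulr_ge0.
have [cw _] := gwin_cnice Y.1 Y.2 (@ltr01 R).
have wE : wave_packet Y = gwin 1 Y.1 Y.2 by rewrite gwin1 -surjective_pairing.
have wB y : cabs (wave_packet Y y) <= 1.
  by rewrite wE cabs_gwin -[leRHS]expR0 ler_expR oppr_le0 mul1r divr_ge0// sqr_ge0.
rewrite (dgkE _ _ wB); last by rewrite wE.
rewrite cabsM cabsR (ger0_norm (expR_ge0 _)) cabs_gwt_wave// dmid_flip lph_flip rph_flip /flip /=.
set x := enorm ((lph X).1 - (rph X).1) ^+ 2.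
set y := enorm (Y.1 - (dmid X).1) ^+ 2; set z := enorm (Y.2 - (dmid X).2) ^+ 2.
rewrite mulrA -expRD mulrCA -expRD -[leRHS]mulrA ler_wpM2l//.
apply: le_trans (h `|(lph X).1 - (rph X).1| `|(dmid X).1 - Y.1| `|(dmid X).2 - Y.2| x y z
   (qd X Y) _ _ _ (qd_ge0 _ _) _ _ _ _) => //.
- rewrite ler_expR; have : 0 <= x by exact: sqr_ge0.
  have : 0 <= y by exact: sqr_ge0. have : 0 <= z by exact: sqr_ge0.
  rewrite (_ : 2 / (2 * (1 + 2)) = 3^-1 :> R); last by field.
  rewrite (_ : 2 * (1 + 2) = 6 :> R); last by ring.
  lra.
- apply: le_trans (sq_pow htheta (normr_ge0 _)) _; rewrite lerD2l lerXn2r ?nnegrE ?enorm_ge0//.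
  by rewrite norm_le_enorm.
- apply: le_trans (sq_pow htheta (normr_ge0 _)) _; rewrite lerD2l lerXn2r ?nnegrE ?enorm_ge0//.
  by rewrite distrC norm_le_enorm.
- apply: le_trans (sq_pow htheta (normr_ge0 _)) _; rewrite lerD2l lerXn2r ?nnegrE ?enorm_ge0//.
  by rewrite distrC norm_le_enorm.
- by apply: le_trans (qd_le _ _) _; rewrite ler_wpM2r ?addr_ge0// ler_nat.
Qed.

(** The Gaussian in lph X - rph X controls the distance to the diagonal and [gwt_decay] controls
    [dmid X], which together measure [qd X 0]. *)
Lemma diag_kernel_fix C : 1 <= C -> exists K c, [/\ 0 <= K, 0 < c & forall M f X, 0 <= M ->
  coordb theta C M f -> cabs (dgk (flip X) f) <= K * M * expR (- (c * qd X 0 `^ p))].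
Proof.
move=> C1; have h12 : 1 <= 2 :> R by rewrite ler1n.
have r0 : 0 < dec_rate theta 2 C by apply: dec_rate_gt0.
set r := dec_rate theta 2 C in r0.
pose k := Num.min 4^-1 r; have k0 : 0 < k by rewrite lt_min r0 invr_gt0 ltr0n.
have k4 : k <= 4^-1 by rewrite ge_min lexx.
have kr : k <= r by rewrite ge_min lexx orbT.
have L0 : 0 < (2 * d).+1%:R :> R by rewrite ltr0n.
have [K [c [K0 c0 h]]] := kernel_pow htheta k0 L0.
have g0 : 0 <= gmass 2 ^+ d :> R by rewrite exprn_ge0// ltW// gmass_gt0.
set H := gmass 2 ^+ d in g0.
exists (2 * (2 * H) * K), c; split=> [|//|M f X M0 hf]; first by rewrite !mulr_ge0.
have [sf fM _] := hf.
rewrite (dgkE _ (smooth_cscont [::] sf) fM) cabsM cabsR (ger0_norm (expR_ge0 _)).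
have := gwt_decay (dmid (flip X)) htheta h12 C1 M0 hf.
rewrite dmid_flip phw_flip -/(dec_rate theta 2 C) -/r -/H lph_flip rph_flip /=.
set x := enorm ((lph X).1 - (rph X).1) ^+ 2.
set F := expR _; set E := expR _; set A := cabs _ => hg.
apply: (@le_trans _ _ (E * (2 * (2 * H * M) * F))).
  by apply: ler_wpM2l => //; exact: expR_ge0.
rewrite (_ : E * _ = 2 * (2 * H) * M * (E * F)); last by ring.
rewrite (_ : 2 * (2 * H) * K * M * _ = 2 * (2 * H) * M * (K * expR (- (c * qd X 0 `^ p)))); last by ring.
apply: ler_wpM2l; first by rewrite !mulr_ge0.
rewrite /E /F -expRD.
apply: le_trans (h `|(lph X).1 - (rph X).1| `|(dmid X).1| `|(dmid X).2|
   x (`|(dmid X).1| `^ p) (`|(dmid X).2| `^ p)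
   (qd X 0) _ _ _ (qd_ge0 _ _) _ _ _ _) => //.
- rewrite ler_expR /phw; have x0 : 0 <= x by exact: sqr_ge0.
  have y0 := powR_ge0 `|(dmid X).1| p; have z0 := powR_ge0 `|(dmid X).2| p.
  set y := `|(dmid X).1| `^ p in y0 *; set z := `|(dmid X).2| `^ p in z0 *.
  have h1 := ler_wpM2r x0 k4; have h2 := ler_wpM2r (addr_ge0 y0 z0) kr; lra.
- apply: le_trans (sq_pow htheta (normr_ge0 _)) _; rewrite lerD2l lerXn2r ?nnegrE ?enorm_ge0//.
  by rewrite norm_le_enorm.
- exact: pow_pow.
- exact: pow_pow.
- by apply: le_trans (qd_le _ _) _; rewrite !subr0 ler_wpM2r ?addr_ge0// ler_nat leqnSn.
Qed.

End DiagonalKernel.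

(** * Limits along an ultrafilter *)

Section UltraLimit.
Context {R : realType}.

(* Limits along an ultrafilter exist for all bounded sequences and are linear,
   so no Cauchy estimate is needed. *)
Definition ultra_nat : set_system nat := sval (cid (@ultraFilterLemma nat \oo _)).

#[local] Instance ultra_natU : UltraFilter ultra_nat.
Proof. by rewrite /ultra_nat; case: cid => G [/= hG _]. Qed.

Lemma ultra_nat_proper : ProperFilter ultra_nat.
Proof. exact: ultra_proper. Qed.

Lemma ultra_nat_infty : \oo `<=` ultra_nat.
Proof. by rewrite /ultra_nat; case: cid => G [/= _ hG]. Qed.

Lemma ultra_nat_real (r : nat -> R) B : (forall n, `|r n| <= B) ->
  exists l : R, r n @[n --> ultra_nat] --> l.
Proof.
move=> hB; have FF := ultra_nat_proper.
have U : UltraFilter (r @ ultra_nat).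
  constructor=> [|G GG le]; first exact: fmap_proper_filter.
  apply/seteqP; split=> // A GA.
  have [//|nA] := in_ultra_setVsetC (r @^-1` A) ultra_natU.
  have : G (~` A) by apply: le.
  by move=> GnA; have [x []] := filter_ex (filterI GA GnA).
have := @segment_compact R (- B) B; rewrite compact_ultra => /(_ _ U).
case=> [|l [_ hl]]; last by exists l.
have hAll n : [set` `[- B, B]] (r n) by rewrite /= in_itv /= -ler_norml.
have : ultra_nat (r @^-1` [set` `[- B, B]]) by apply: filterE; exact: hAll.
by [].
Qed.

Definition ulim (x : nat -> R[i]) : R[i] := xget 0 [set z | ccvg ultra_nat x z].

Lemma ulimP (x : nat -> R[i]) B : (forall n, cabs (x n) <= B) -> ccvg ultra_nat x (ulim x).
Proof.
move=> hB; have FF := ultra_nat_proper.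
have [a ha] := ultra_nat_real (fun n => le_trans (Re_le_cabs (x n)) (hB n)).
have [b hb] := ultra_nat_real (fun n => le_trans (Im_le_cabs (x n)) (hB n)).
have h : exists z, ccvg ultra_nat x z.
  by exists (a +i* b); apply/ccvgReIm.
by rewrite /ulim; case: xgetP => [z -> //|]; case: h => z hz /(_ z).
Qed.

Lemma ulim_eq (x : nat -> R[i]) z : ccvg ultra_nat x z -> ulim x = z.
Proof.
move=> h; have FF := ultra_nat_proper; rewrite /ulim; case: xgetP => [w -> hw|/(_ z)//].
exact: ccvg_unique hw h.
Qed.

Lemma ulim_cvg (x : nat -> R[i]) z : ccvg \oo x z -> ulim x = z.
Proof.
move=> h; apply: ulim_eq; have FF := ultra_nat_proper.
by apply/ccvgP => e e0; have /ccvgP/(_ _ e0) := h; exact: ultra_nat_infty.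
Qed.

Lemma ulim_le (x : nat -> R[i]) B : (forall n, cabs (x n) <= B) -> cabs (ulim x) <= B.
Proof.
move=> h; have FF := ultra_nat_proper.
by apply: (ccvg_le _ (ulimP h)); exact: nearW.
Qed.

Lemma ulim_lin a (x y : nat -> R[i]) B C : (forall n, cabs (x n) <= B) -> (forall n, cabs (y n) <= C) ->
  ulim (fun n => a * x n + y n) = a * ulim x + ulim y.
Proof.
move=> hx hy; have FF := ultra_nat_proper; apply: ulim_eq.
by apply: ccvgD; [apply: ccvgZ; exact: ulimP hx|exact: ulimP hy].
Qed.

End UltraLimit.

Section GridSumBounds.
Context {R : realType} {N : nat} (theta : R).
Hypothesis htheta : 2^-1 <= theta < 1.

Let t01' : 0 < theta <= 1.
Proof. by case/andP: htheta => h /ltW ->; rewrite andbT; apply: lt_le_trans h; rewrite invr_gt0. Qed.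

Lemma grid_sum_bound e : 0 < e -> exists2 W, 0 <= W & forall C (b : phase R N -> R[i]) n,
  (forall X, cabs (b X) <= C * expR (- (e * phw theta X))) ->
  cabs (\sum_(la : glam n) (gwts N n)%:C * b (gpt la)) <= C * W.
Proof.
move=> e0; have [W W0 hW] := gabor_weight (N := N) t01' e0; exists W => // C b n hb.
have C0 : 0 <= C.
  by have := le_trans (cabs_ge0 _) (hb 0); rewrite pmulr_lge0// expR_gt0.
apply: le_trans (cabs_sum _ _ _) _.
apply: (@le_trans _ _ (\sum_(la : glam n) C * (gwts N n * expR (- (e * phw theta (gpt la)))))); last first.
  by rewrite -mulr_sumr; apply: ler_wpM2l => //; exact: hW.
apply: ler_sum => la _; rewrite cabsM cabsR (ger0_norm (gwts_ge0 _)) mulrCA.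
by apply: ler_wpM2l; [exact: gwts_ge0|exact: hb].
Qed.

(** Dominated convergence for grid sums, uniform in the grid: far out half of the rate e is spent on
    smallness, and on the remaining bounded region uniform convergence is available. *)
Lemma grid_sum_small e : 0 < e -> forall C (b : nat -> phase R N -> R[i]), 
  (forall k X, cabs (b k X) <= C * expR (- (e * phw theta X))) ->
  (forall r eta, 0 < eta -> \forall k \near \oo, forall X, `|X.1| <= r -> `|X.2| <= r -> cabs (b k X) <= eta) ->
  forall eta, 0 < eta -> \forall k \near \oo, forall n,
    cabs (\sum_(la : glam n) (gwts N n)%:C * b k (gpt la)) <= eta.
Proof.
move=> e0 C b hb hs eta eta0; have e20 : 0 < e / 2 by rewrite divr_gt0.
have [W W0 hW] := grid_sum_bound e20.
have C0 : 0 <= C.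
  by have := le_trans (cabs_ge0 _) (hb 0%N 0); rewrite pmulr_lge0// expR_gt0.
have t0 : 0 < theta by case/andP: t01'.
have p0 : 0 < theta^-1 by rewrite invr_gt0.
set del := eta / (W + 1); have del0 : 0 < del by rewrite divr_gt0// ltr_wpDl.
(* Chosen so that C exp(- (e / 2) A) <= del, by exp x >= x. *)
pose A := C / (del * (e / 2)).
have A0 : 0 <= A by rewrite divr_ge0// mulr_ge0// ltW.
have hA : C * expR (- (e / 2 * A)) <= del.
  rewrite expRN ler_pdivrMr ?expR_gt0//.
  have h1 := expR_ge1Dx (e / 2 * A).
  have h2 : C = del * (e / 2 * A) by rewrite /A; field; rewrite !gt_eqF.
  by rewrite {1}h2 ler_wpM2l ?(ltW del0)//; lra.
pose r := A `^ theta; have r0 : 0 <= r by exact: powR_ge0.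
have rp : r `^ theta^-1 = A by rewrite /r -powRrM mulfV ?gt_eqF// powRr1.
pose eta' := del * expR (- (e / 2 * (A + A))).
have eta'0 : 0 < eta' by rewrite mulr_gt0// expR_gt0.
apply: filterS (hs r eta' eta'0) => k hk n.
have key X : cabs (b k X) <= del * expR (- (e / 2 * phw theta X)).
  have mono (x y : R) : 0 <= x -> x <= y -> x `^ theta^-1 <= y `^ theta^-1.
    by move=> x0 xy; rewrite ge0_ler_powR ?nnegrE ?(ltW p0)// (le_trans x0).
  have far : A <= phw theta X -> cabs (b k X) <= del * expR (- (e / 2 * phw theta X)).
    move=> hX; apply: le_trans (hb _ _) _.
    rewrite (_ : - (e * phw theta X) = - (e / 2 * phw theta X) + - (e / 2 * phw theta X)); last by field.
    rewrite expRD mulrA ler_wpM2r ?expR_ge0//; apply: le_trans hA.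
    by rewrite ler_wpM2l// ler_expR lerN2 ler_wpM2l// ltW.
  have [h1|h1] := leP `|X.1| r; last first.
    apply: far; rewrite -rp; apply: le_trans (mono _ _ r0 (ltW h1)) _.
    by rewrite lerDl powR_ge0.
  have [h2|h2] := leP `|X.2| r; last first.
    apply: far; rewrite -rp; apply: le_trans (mono _ _ r0 (ltW h2)) _.
    by rewrite lerDr powR_ge0.
  apply: le_trans (hk X h1 h2) _; rewrite /eta' ler_wpM2l ?(ltW del0)// ler_expR lerN2.
  by rewrite ler_wpM2l ?(ltW e20)// -rp lerD// mono.
apply: le_trans (hW _ _ n key) _; rewrite /del mulrAC ler_pdivrMr ?ltr_wpDl//.
by rewrite ler_pM2l//; lra.
Qed.

(** Exchanging the two frequencies of an index negates their difference, so the grid is symmetric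
    under [flip], with multiplicities. *)
Lemma gabor_flip n (F : phase R N -> R[i]) :
  \sum_(la : glam n) F (flip (gpt la)) = \sum_(la : glam n) F (gpt la).
Proof.
pose sw (la : @glam N n) : @glam N n := [ffun j => ((la j).1, ((la j).2.2, (la j).2.1))].
have swK : involutive sw.
  by move=> la; apply/ffunP => j; rewrite !ffunE /=; case: (la j) => a [b c].
rewrite (reindex_inj (inv_inj swK)); apply: eq_bigr => la _; congr F.
rewrite /gpt /flip /=; congr (_, _); apply/matrixP => i j; rewrite !mxE ?ffunE//=.
by rewrite /gxi /= -mulNr opprB.
Qed.

End GridSumBounds.

Section ContinuityTools.
Context {R : realType}.

Lemma cont_fst (A B : topologicalType) (f : A -> R) : continuous f ->
  continuous (fun w : A * B => f w.1).
Proof. by move=> cf -[a b]; apply: (cvg_comp _ f cvg_fst); exact: cf. Qed.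

Lemma cont_snd (A B : topologicalType) (f : B -> R) : continuous f ->
  continuous (fun w : A * B => f w.2).
Proof. by move=> cf -[a b]; apply: (cvg_comp _ f cvg_snd); exact: cf. Qed.

Lemma cont_pairl (A B : topologicalType) (f : A * B -> R) (b : B) : continuous f ->
  continuous (fun a : A => f (a, b)).
Proof.
move=> cf a; apply: (continuous_comp (f := fun a : A => (a, b))); last exact: cf.
by move=> S [[U V] [/= nU nV] UV]; apply: filterS nU => x Ux; apply: UV; split=> //; exact: nbhs_singleton.
Qed.

Lemma cont_abs (A : topologicalType) (f : A -> R) : continuous f -> continuous (fun w => `|f w|).
Proof. by move=> cf a; apply: cvg_norm; exact: cf. Qed.

Lemma cont_id : continuous (fun t : R => t).
Proof. by move=> t; exact: cvg_id. Qed.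

End ContinuityTools.

Section GoodFamilies.
Context {R : realType} {N : nat} (theta : R).
Hypothesis htheta : 2^-1 <= theta < 1.
Notation p := (theta^-1).
Implicit Types (X : phase R N) (G : set (phase R N)) (t : functional R N).

Lemma decays_at_le I (a b : I -> phase R N -> R) X : (forall i Y, a i Y <= b i Y) ->
  decays_at theta b X -> decays_at theta a X.
Proof.
move=> ab [C [e [e0 h]]]; exists C, e; split=> //; apply: filterS h => Y hY i s s0.
exact: le_trans (ab _ _) (hY _ _ s0).
Qed.

Lemma decays_atD I (a b : I -> phase R N -> R) X :
  decays_at theta a X -> decays_at theta b X ->
  decays_at theta (fun i Y => a i Y + b i Y) X.
Proof.
move=> [C [e [e0 h]]] [C' [e' [e'0 h']]].
exists (`|C| + `|C'|), (Num.min e e'); split; first by rewrite lt_min e0.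
apply: filterS2 h h' => Y h h' i s s0; rewrite mulrDl.
have hm c r : Num.min e e' <= c ->
    r * expR (- (c * s `^ p)) <= `|r| * expR (- (Num.min e e' * s `^ p)).
  move=> h1; apply: (@le_trans _ _ (`|r| * expR (- (c * s `^ p)))).
    by rewrite ler_wpM2r ?expR_ge0// ler_norm.
  by rewrite ler_wpM2l// ler_expR lerN2 ler_wpM2r ?powR_ge0.
apply: lerD; [apply: le_trans (h i s s0) _|apply: le_trans (h' i s s0) _]; apply: hm.
  by rewrite ge_min lexx.
by rewrite ge_min lexx orbT.
Qed.

(** What the estimates for the pull-back use about t, with constants uniform in the index. *)
Definition good G I (s : I -> functional R N) :=
  [/\ forall i, gslin theta (s i), forall i, gsbounded theta (s i),
   forall e, 0 < e -> exists2 K, 0 <= K & forall i X, amp s i X <= K * expR (e * phw theta X) &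
   forall X, X != 0 -> ~ G X -> decays_at theta (amp s) X].

Lemma good_sub G (t_ : nat -> functional R N) t : ultradist_in theta G t ->
  (forall n, ultradist_in theta G (t_ n)) -> cvg_in theta G t_ t ->
  good G (fun n F => t_ n F - t F) /\
  (forall F, gs theta F -> ccvg \oo (fun n => t_ n F - t F) 0).
Proof.
move=> [/(ultradistP htheta)[tl tb] _] ht_ [hw hd].
have sl n : gslin theta (fun F => t_ n F - t F).
  have [/(ultradistP htheta)[l _] _] := ht_ n.
  by move=> a f g gf gg; rewrite l// tl//; ring.
have sb n : gsbounded theta (fun F => t_ n F - t F).
  have [/(ultradistP htheta)[_ b] _] := ht_ n.
  move=> C C0; have [K K0 hK] := b C C0; have [L L0 hL] := tb C C0.
  exists (K + L) => [|M f hf]; first by rewrite addr_ge0.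
  by rewrite mulrDl (le_trans (cabsD _ _))// cabsN lerD// ?hK ?hL.
have sw (f : 'rV[R]_N -> R[i]) : gs theta f -> ccvg \oo (fun n => t_ n f - t f) 0 by move=> gf; exact: hw.
split=> //; split=> //.
- by move=> e e0; exact: (weak_growth htheta sl sb sw e0).
- move=> X X0 nG; apply/(cvg0_decaysP htheta _ X0).
  by apply: hd => //; exact/eqP.
Qed.

Lemma good_unit G t : ultradist_in theta G t -> good G (fun _ : unit => t).
Proof.
move=> [/(ultradistP htheta)[tl tb] tW]; split=> //.
- by move=> e e0; have [K K0 hK] := wave_growth htheta tb e0; exists K.
- by move=> X X0 nG; apply/(WFP htheta _ X0) => /tW.
Qed.

Lemma good_ultradist_in G t : good G (fun _ : unit => t) -> ultradist_in theta G t.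
Proof.
move=> [l b _ dec]; split; first by apply/(ultradistP htheta); split; [exact: l tt|exact: b tt].
move=> X WX; have X0 := WF_neq0 WX; apply: contrapT => nG; move: WX.
by apply/(WFP htheta _ X0); exact: dec.
Qed.

Lemma good_of_cvg G (t_ : nat -> functional R N) t : ultradist_in theta G t ->
  (forall n, ultradist_in theta G (t_ n)) -> cvg_in theta G t_ t -> good G t_.
Proof.
move=> ht ht_ hc; have [[_ _ gr dec] _] := good_sub ht ht_ hc.
have [_ _ gr1 dec1] := good_unit ht.
have amp_le n X : amp t_ n X <= amp (fun n F => t_ n F - t F) n X + amp (fun _ : unit => t) tt X.
  by rewrite /amp -{1}[t_ n _](subrK (t (wave_packet X))); exact: cabsD.
split=> [n|n|e e0|X X0 nG].
- by have [/(ultradistP htheta)[]] := ht_ n.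
- by have [/(ultradistP htheta)[]] := ht_ n.
- have [K K0 hK] := gr e e0; have [L L0 hL] := gr1 e e0.
  exists (K + L) => [|n X]; first exact: addr_ge0.
  by apply: le_trans (amp_le n X) _; rewrite mulrDl lerD// ?hK ?(hL tt).
- apply: decays_at_le amp_le _; apply: decays_atD; first exact: dec.
  have [C [e [e0 h]]] := dec1 X X0 nG; exists C, e; split=> //.
  by apply: filterS h => Y hY n s s0; exact: (hY tt).
Qed.

End GoodFamilies.

(** * Balance of growth and decay for the pull-back *)

Section DiagonalTransfer.
Context {R : realType} {d : nat} (theta : R).
Hypothesis htheta : 2^-1 <= theta < 1.
Notation p := (theta^-1).
Implicit Types (X : phase R (d + d)) (Y : phase R d) (G : set (phase R (d + d))).

Lemma continuous_qd : continuous (fun w : (phase R (d + d) * R) * phase R d =>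
  qd w.1.1 (w.1.2 *: w.2)).
Proof.
have c1 j : continuous (fun w : (phase R (d + d) * R) * phase R d => w.1.1.1 0 j).
  apply: (@cont_fst _ _ _ (fun z : phase R (d + d) * R => z.1.1 0 j)).
  apply: (@cont_fst _ _ _ (fun X : phase R (d + d) => X.1 0 j)).
  exact: (continuous_phase_coord j).1.
have c2 j : continuous (fun w : (phase R (d + d) * R) * phase R d => w.1.1.2 0 j).
  apply: (@cont_fst _ _ _ (fun z : phase R (d + d) * R => z.1.2 0 j)).
  apply: (@cont_fst _ _ _ (fun X : phase R (d + d) => X.2 0 j)).
  exact: (continuous_phase_coord j).2.
have c3 : continuous (fun w : (phase R (d + d) * R) * phase R d => w.1.2).
  apply: (@cont_fst _ _ _ (fun z : phase R (d + d) * R => z.2)).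
  apply: (@cont_snd _ _ _ (fun t : R => t)); exact: cont_id.
have c4 j : continuous (fun w : (phase R (d + d) * R) * phase R d => (w.1.2 *: w.2).1 0 j).
  have -> : (fun w : (phase R (d + d) * R) * phase R d => (w.1.2 *: w.2).1 0 j) =
    fun w => w.1.2 * w.2.1 0 j by apply/funext => w; rewrite /= mxE.
  apply: continuous_mulT => //.
  apply: (@cont_snd _ _ _ (fun Y : phase R d => Y.1 0 j)).
  exact: (continuous_phase_coord j).1.
have c5 j : continuous (fun w : (phase R (d + d) * R) * phase R d => (w.1.2 *: w.2).2 0 j).
  have -> : (fun w : (phase R (d + d) * R) * phase R d => (w.1.2 *: w.2).2 0 j) =
    fun w => w.1.2 * w.2.2 0 j by apply/funext => w; rewrite /= mxE.
  apply: continuous_mulT => //.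
  apply: (@cont_snd _ _ _ (fun Y : phase R d => Y.2 0 j)).
  exact: (continuous_phase_coord j).2.
have cz (a : R) (f : (phase R (d + d) * R) * phase R d -> R) : continuous f -> continuous (fun w => a * f w).
  by move=> cf; apply: continuous_mulT => //; exact: continuous_cstT.
rewrite /qd; apply: continuous_sumT => j; apply: continuous_addT; first apply: continuous_addT.
- by apply: cont_abs; apply: continuous_addT => //; exact: cz.
- by apply: cont_abs; apply: continuous_addT; [exact: continuous_addT|exact: cz].
- by apply: cont_abs; apply: continuous_addT; [exact: continuous_addT|exact: cz].
Qed.

Lemma qdZ s X Y : 0 < s -> qd (s *: X) (s *: Y) = s * qd X Y.
Proof.
move=> s0; rewrite /qd mulr_sumr; apply: eq_bigr => j _; rewrite /= !mxE.
have e (a b : R) : s * a + -1 * (s * b) = s * (a + -1 * b) by ring.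
have e2 (a b c : R) : s * a + s * b + -2 * (s * c) = s * (a + b + -2 * c) by ring.
have e3 (a b c : R) : s * a + s * b + -1 * (s * c) = s * (a + b + -1 * c) by ring.
by rewrite e e2 e3 !normrM (gtr0_norm s0) -!mulrDr.
Qed.

Lemma qd_eq0 X Y : qd X Y = 0 -> X.1 = row_mx Y.1 Y.1 /\ lsubmx X.2 + rsubmx X.2 = Y.2.
Proof.
move=> /eqP; rewrite psumr_eq0 => [/allP h|j _]; last by rewrite !addr_ge0.
have {}h j : X.1 0 (lshift d j) = Y.1 0 j /\ X.1 0 (rshift d j) = Y.1 0 j /\
    X.2 0 (lshift d j) + X.2 0 (rshift d j) = Y.2 0 j.
  have := h j (mem_index_enum _) => /=; rewrite paddr_eq0 ?addr_ge0// paddr_eq0//.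
  rewrite !normr_eq0 => /andP[/andP[/eqP h1 /eqP h2] /eqP h3]; split; first lra.
  split; lra.
split.
  rewrite -[LHS]hsubmxK; congr row_mx; apply/rowP => j; rewrite !mxE; have [h1 [h2 h3]] := h j => //.
by apply/rowP => j; rewrite !mxE; have [h1 [h2 h3]] := h j.
Qed.

(* The points [(x, xi + eta)] with [(x, x, xi, eta)] in [G]. *)
Definition pullcone G : set (phase R d) := [set Y | Y != 0 /\ exists X, G X /\
  (X.1 = row_mx Y.1 Y.1 /\ lsubmx X.2 + rsubmx X.2 = Y.2)].

Lemma diag_transfer_fix G I (s : I -> functional R (d + d)) c : 0 < c -> diag_admissible G ->
  good theta G s -> exists C e, [/\ 0 <= C, 0 < e & forall i X,
    amp s i X * expR (- (c * qd X 0 `^ p)) <= C * expR (- (e * phw theta X))].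
Proof.
move=> c0 [cG nG] [_ _ gr dec].
(* An auxiliary one-dimensional parameter: q(X, t Y0) = [qd X 0] + t vanishes only for t = 0 and X =
   (0, 0, xi, - xi), and the result is read off at t = 0. *)
pose q X (Y : phase R 1) := qd X 0 + `|Y.1 0 0|.
pose Y0 : phase R 1 := (const_mx 1, 0).
have [] := @transfer R (d + d) 1 theta htheta I (amp s) q Y0 c c0 (amp_ge0 s) gr.
- by move=> X Y; rewrite addr_ge0// qd_ge0.
- move=> r X Y r0; rewrite /q mulrDr -qdZ// scaler0 /= mxE normrM (gtr0_norm r0)//.
- apply: continuous_addT.
    have -> : (fun w : phase R (d + d) * R * phase R 1 => qd w.1.1 (0 : phase R d)) =
      (fun z : (phase R (d + d) * R) => qd z.1 (0 : phase R d)) \o fst by [].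
    apply: (@cont_fst _ _ _ (fun z : (phase R (d + d) * R) => qd z.1 (0 : phase R d))).
    have := cont_pairl (b := 0 : phase R d) continuous_qd.
    by under eq_fun do rewrite /= scaler0.
  apply: cont_abs.
  have -> : (fun w : phase R (d + d) * R * phase R 1 => (w.1.2 *: w.2).1 0 0) =
    fun w => w.1.2 * w.2.1 0 0 by apply/funext => w; rewrite /= mxE.
  apply: continuous_mulT.
    apply: (@cont_fst _ _ _ (fun z : phase R (d + d) * R => z.2)).
    by apply: (@cont_snd _ _ _ (fun t : R => t)); exact: cont_id.
  apply: (@cont_snd _ _ _ (fun Y : phase R 1 => Y.1 0 0)).
  exact: (continuous_phase_coord 0).1.
- move=> X t t0 Xt0; rewrite /q /= mxE mxE mulr1 => /eqP; rewrite paddr_eq0 ?qd_ge0//.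
  rewrite normr_eq0 => /andP[/eqP q0 /eqP tz].
  have X0 : X != 0 by apply: contraNneq Xt0 => ->; rewrite tz.
  apply: dec => // GX; have [h1 h2] := qd_eq0 q0.
  apply: (nG (lsubmx X.2)); have -> : (0, row_mx (lsubmx X.2) (- lsubmx X.2)) = X => //.
  apply: injective_projections => /=; first by rewrite h1 row_mx0.
  rewrite -[RHS]hsubmxK; congr row_mx; apply/eqP; rewrite eq_sym -subr_eq0 opprK addrC.
  exact/eqP.
move=> C [e [C0 e0 h]]; exists C, e; split=> // i X.
have := nbhs_singleton h i X 0 (lexx 0); rewrite /q scale0r /= mxE normr0 addr0.
by rewrite powR0 ?addr0// invr_eq0 gt_eqF//; case/andP: htheta => h1 _; apply: lt_le_trans h1; rewrite invr_gt0.
Qed.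

(** Stated for an arbitrary amplitude because [pullcone_closed] applies it to the indicator of a
    cone. *)
Lemma diag_transfer_wave G I (a : I -> phase R (d + d) -> R) c Y0 : 0 < c -> diag_admissible G ->
  (forall i X, 0 <= a i X) ->
  (forall e, 0 < e -> exists2 K, 0 <= K & forall i X, a i X <= K * expR (e * phw theta X)) ->
  (forall X, X != 0 -> ~ G X -> decays_at theta a X) ->
  Y0 != 0 -> ~ pullcone G Y0 -> exists C e, [/\ 0 <= C, 0 < e &
  \forall Y \near Y0, forall i X t, 0 <= t -> a i X * expR (- (c * qd X (t *: Y) `^ p)) <=
    C * expR (- (e * (phw theta X + t `^ p)))].
Proof.
move=> c0 [cG nG] a0 gr dec Y00 nY.
apply: (@transfer R (d + d) d theta htheta I a (@qd R d) Y0 c c0 a0 gr).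
- by move=> X Y; exact: qd_ge0.
- by move=> r X Y; exact: qdZ.
- exact: continuous_qd.
move=> X t t_ge0 Xt0 q0; have [h1 h2] := qd_eq0 q0.
(* For t = 0 the zeros of the kernel are the points (0, 0, xi, - xi) excluded by admissibility; for
   t > 0, dividing by t would place Y0 in the pulled back cone. *)
have [tz|tnz] := eqVneq t 0.
  have X0 : X != 0 by apply: contraNneq Xt0 => ->; rewrite tz.
  apply: dec => // GX; rewrite tz scale0r in h1 h2.
  apply: (nG (lsubmx X.2)); have -> : (0, row_mx (lsubmx X.2) (- lsubmx X.2)) = X => //.
  apply: injective_projections => /=; first by rewrite h1 row_mx0.
  rewrite -[RHS]hsubmxK; congr row_mx; apply/eqP; rewrite eq_sym -subr_eq0 opprK addrC.
  exact/eqP.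
have tp : 0 < t by rewrite lt_neqAle eq_sym tnz.
have X0 : X != 0.
  apply: contraNneq Y00 => Xz; rewrite Xz /= in h1 h2.
  have e1 : t *: Y0.1 = 0.
    by have := congr1 lsubmx h1; rewrite row_mxKl => <-; apply/matrixP => i j; rewrite !mxE.
  have e2 : t *: Y0.2 = 0.
    by rewrite -h2; apply/matrixP => i j; rewrite !mxE addr0.
  apply/eqP; apply: injective_projections => /=; apply/eqP.
    by move/eqP: e1; rewrite scaler_eq0 (negPf tnz).
  by move/eqP: e2; rewrite scaler_eq0 (negPf tnz).
apply: dec => // GX; apply: nY; split=> //; exists (t^-1 *: X); split.
  by apply: cG.1.2; rewrite ?invr_gt0.
split=> /=.
  rewrite h1 /= scale_row_mx scalerA mulVf// scale1r//.
have -> : lsubmx (t^-1 *: X.2) + rsubmx (t^-1 *: X.2) = t^-1 *: (lsubmx X.2 + rsubmx X.2).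
  by apply/matrixP => i j; rewrite !mxE mulrDr.
by rewrite h2 /= scalerA mulVf// scale1r.
Qed.

End DiagonalTransfer.

(** * The pull-back as a limit of grid sums *)

Section DiagonalPullback.
Context {R : realType} {d : nat} (theta : R).
Hypothesis htheta : 2^-1 <= theta < 1.
Notation p := (theta^-1).
Implicit Types (X : phase R (d + d)) (Y : phase R d) (G : set (phase R (d + d)))
  (t : functional R (d + d)) (f g phi : 'rV[R]_d -> R[i]).

Let t0 : 0 < theta. Proof. by case/andP: htheta => h _; apply: lt_le_trans h; rewrite invr_gt0. Qed.

Lemma gs_bounded N (f : 'rV[R]_N -> R[i]) : gs theta f -> cscont f /\ exists B, forall y, cabs (f y) <= B.
Proof.
move=> /(gsP htheta)[C [M [C1 M0 hf]]]; have [sf fM _] := gsb_coordb hf.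
by split; [exact: (smooth_cscont [::] sf)|exists M].
Qed.

Lemma gwin_nice N (f : 'rV[R]_N -> R[i]) a m xi : gs theta f -> 0 < a ->
  cnice (fun y => f y * gwin a m xi y).
Proof.
by move=> /gs_bounded[cf [B hB]] a0; apply: (cnice_bounded cf hB); exact: gwin_cnice.
Qed.

Lemma gwt_lin N (X : phase R N) a c (f g : 'rV[R]_N -> R[i]) : 0 < a -> gs theta f -> gs theta g ->
  gwt a (fun x => c * f x + g x) X = c * gwt a f X + gwt a g X.
Proof.
move=> a0 gf gg; rewrite /gwt -cintZ; last exact: gwin_nice.
rewrite -cintD; [|apply: cniceZ; exact: gwin_nice|exact: gwin_nice].
by congr cint; apply/funext => y; ring.
Qed.

Lemma dgk_lin X c f g : gs theta f -> gs theta g ->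
  dgk X (fun x => c * f x + g x) = c * dgk X f + dgk X g.
Proof.
move=> gf gg; have [cf [B hB]] := gs_bounded gf; have [cg [B' hB']] := gs_bounded gg.
have [cfg [B'' hB'']] := gs_bounded (gs_lin htheta c gf gg).
rewrite (dgkE _ cf hB) (dgkE _ cg hB') (dgkE _ cfg hB'') gwt_lin//.
by rewrite mulrDr mulrCA.
Qed.

Definition dsum t f n : R[i] := \sum_(la : @glam (d + d) n)
  (gwts (d + d) n)%:C * (t (wave_packet (gpt la)) * dgk (flip (gpt la)) f).

Definition dstar t : functional R d := fun f => ulim (dsum t f).

Section Family.
Variables (G : set (phase R (d + d))) (I : Type) (s : I -> functional R (d + d)).
Hypotheses (aG : diag_admissible G) (gs_ : good theta G s).

Lemma diag_term_bound C : 1 <= C -> exists K e, [/\ 0 <= K, 0 < e & forall i M f X, 0 <= M ->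
  coordb theta C M f -> cabs (s i (wave_packet X) * dgk (flip X) f) <= K * M * expR (- (e * phw theta X))].
Proof.
move=> C1; have [K [c [K0 c0 hK]]] := diag_kernel_fix (d := d) htheta C1.
have [L [e [L0 e0 hL]]] := diag_transfer_fix htheta c0 aG gs_.
exists (K * L), e; split=> // [|i M f X M0 hf]; first by rewrite mulr_ge0.
rewrite cabsM; apply: (@le_trans _ _ (amp s i X * (K * M * expR (- (c * qd X 0 `^ p))))).
  by apply: ler_wpM2l; [exact: amp_ge0|exact: hK].
rewrite mulrCA (_ : K * L * M * _ = K * M * (L * expR (- (e * phw theta X)))); last by ring.
by rewrite ler_wpM2l// mulr_ge0.
Qed.

Lemma dsum_bound C : 1 <= C -> exists2 K, 0 <= K & forall i M f n, 0 <= M ->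
  coordb theta C M f -> cabs (dsum (s i) f n) <= K * M.
Proof.
move=> C1; have [K [e [K0 e0 hK]]] := diag_term_bound C1.
have [W W0 hW] := grid_sum_bound (N := d + d) htheta e0.
exists (K * W) => [|i M f n M0 hf]; first by rewrite mulr_ge0.
rewrite mulrAC; apply: (hW _ (fun X => s i (wave_packet X) * dgk (flip X) f)) => X.
exact: hK.
Qed.

Lemma gs_coordb f : gs theta f -> exists C M, [/\ 1 <= C, 0 <= M & coordb theta C M f].
Proof. by move=> /(gsP htheta)[C [M [C1 M0 /gsb_coordb hf]]]; exists C, M. Qed.

Lemma dsum_bounded i f : gs theta f -> exists B, forall n, cabs (dsum (s i) f n) <= B.
Proof.
move=> /gs_coordb[C [M [C1 M0 hf]]]; have [K K0 hK] := dsum_bound C1.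
by exists (K * M) => n; exact: hK.
Qed.

Lemma dstar_lin i : gslin theta (dstar (s i)).
Proof.
move=> a f g gf gg; have [B hB] := dsum_bounded i gf; have [B' hB'] := dsum_bounded i gg.
rewrite /dstar -(ulim_lin a hB hB'); congr ulim; apply/funext => n.
rewrite /dsum mulr_sumr -big_split; apply: eq_bigr => la _ /=.
by rewrite dgk_lin//; ring.
Qed.

Lemma dstar_bounded i : gsbounded theta (dstar (s i)).
Proof.
move=> C C0; have m1 : 1 <= Num.max 1 C by rewrite le_max lexx.
have [K K0 hK] := dsum_bound m1; exists K => // M f hf.
have M0 := gsb_ge0 C0 hf.
apply: ulim_le => n; apply: hK => //; apply: gsb_coordb.
by apply: (gsb_leC (C := C)) => //; [exact: ltW|rewrite le_max lexx orbT].
Qed.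

(** The estimate of [diag_transfer_wave] splits: decay in X makes the grid sum bounded and decay in
    t survives as decay along the ray through Y. *)
Lemma dstar_WF Y0 : Y0 != 0 -> ~ pullcone G Y0 ->
  decays_at theta (amp (fun i => dstar (s i))) Y0.
Proof.
move=> Y00 nY; have [K [c [K0 c0 hK]]] := diag_kernel_wave (d := d) htheta.
have [_ _ gr dec] := gs_.
have [L [e [L0 e0 hL]]] := diag_transfer_wave htheta c0 aG (amp_ge0 s) gr dec Y00 nY.
have [W W0 hW] := grid_sum_bound (N := d + d) htheta e0.
exists (K * L * W), e; split=> //; apply: filterS hL => Y hY i r r0.
have b0 X : cabs (s i (wave_packet X) * dgk (flip X) (wave_packet (r *: Y))) <=
    (K * L * expR (- (e * r `^ p))) * expR (- (e * phw theta X)).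
  rewrite cabsM; apply: (@le_trans _ _ (amp s i X * (K * expR (- (c * qd X (r *: Y) `^ p))))).
    by apply: ler_wpM2l; [exact: amp_ge0|exact: hK].
  rewrite mulrCA -!mulrA ler_wpM2l// -expRD.
  by have := hY i X r (ltW r0); rewrite mulrDr opprD addrC.
rewrite /amp mulrAC; apply: ulim_le => n.
by apply: (hW _ (fun X => s i (wave_packet X) * dgk (flip X) (wave_packet (r *: Y)))).
Qed.

End Family.

Lemma dstar_cvg0 G (s : nat -> functional R (d + d)) : diag_admissible G -> good theta G s ->
  (forall F, gs theta F -> ccvg \oo (fun n => s n F) 0) ->
  forall f, gs theta f -> ccvg \oo (fun n => dstar (s n) f) 0.
Proof.
move=> aG gS sw f gf; have [C [M [C1 M0 hf]]] := gs_coordb gf.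
have [K [e [K0 e0 hK]]] := diag_term_bound aG gS C1.
have [sl sb _ _] := gS.
have [Kd [c [Kd0 c0 hKd]]] := diag_kernel_fix (d := d) htheta C1.
apply/ccvgP => eps eps0; have eps20 : 0 < eps / 2 by rewrite divr_gt0.
have := @grid_sum_small R (d + d) theta htheta e e0 (K * M)
  (fun k X => s k (wave_packet X) * dgk (flip X) f) (fun k X => hK k M f X M0 hf) _ _ eps20.
have hs : forall r eta : R, 0 < eta -> \forall k \near \oo, forall X : phase R (d + d),
   `|X.1| <= r -> `|X.2| <= r -> cabs (s k (wave_packet X) * dgk (flip X) f) <= eta.
  move=> r eta eta0; have e1 : 0 < eta / (Kd * M + 1).
    by rewrite divr_gt0// ltr_wpDl// mulr_ge0.
  have := wave_cvg_uniform htheta sl sb sw r e1; apply: filterS => k hk X X1 X2.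
  rewrite cabsM; have h1 := hk X X1 X2; have h2 := hKd M f X M0 hf.
  have h3 : cabs (dgk (flip X) f) <= Kd * M + 1.
    apply: le_trans h2 _; rewrite -[leLHS]addr0 lerD//.
    by rewrite ler_piMr ?mulr_ge0// -expR0 ler_expR oppr_le0 mulr_ge0 ?powR_ge0// ltW.
  apply: le_trans (ler_pM (cabs_ge0 _) (cabs_ge0 _) h1 h3) _.
  by rewrite mulfVK// gt_eqF// ltr_wpDl// mulr_ge0.
move=> /(_ hs); apply: filterS => k hk; rewrite subr0.
apply: le_lt_trans (_ : eps / 2 < eps); last by lra.
by apply: ulim_le => n; exact: hk.
Qed.

Lemma dstar_sub G t t' f : diag_admissible G -> ultradist_in theta G t -> ultradist_in theta G t' ->
  gs theta f -> dstar (fun F => t F - t' F) f = dstar t f - dstar t' f.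
Proof.
move=> aG ht ht' gf.
have [B hB] := dsum_bounded aG (good_unit htheta ht) tt gf.
have [B' hB'] := dsum_bounded aG (good_unit htheta ht') tt gf.
rewrite addrC -mulN1r /dstar -(ulim_lin (-1) hB' hB); congr ulim; apply/funext => n.
by rewrite /dsum mulr_sumr -big_split; apply: eq_bigr => la _ /=; ring.
Qed.

Lemma dstar_weak_cvg G (t_ : nat -> functional R (d + d)) t : diag_admissible G ->
  ultradist_in theta G t -> (forall n, ultradist_in theta G (t_ n)) -> cvg_in theta G t_ t ->
  weak_cvg theta (fun n => dstar (t_ n)) (dstar t).
Proof.
move=> aG ht ht_ hc f gf; have [gS sw] := good_sub htheta ht ht_ hc.
have := dstar_cvg0 aG gS sw gf; rewrite /ccvg.
by under eq_fun do rewrite subr0 (dstar_sub aG)//.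
Qed.

Lemma dstar_ultradist G t : diag_admissible G -> ultradist_in theta G t -> ultradist theta (dstar t).
Proof.
move=> aG ht; apply/(ultradistP htheta); split.
  exact: (dstar_lin aG (good_unit htheta ht) tt).
exact: (dstar_bounded aG (good_unit htheta ht) tt).
Qed.

End DiagonalPullback.

(** * Test functions as functionals, and their density *)

Section RegularFunctionals.
Context {R : realType} (theta : R).
Hypothesis htheta : 2^-1 <= theta < 1.
Notation p := (theta^-1).

Let t0 : 0 < theta. Proof. by case/andP: htheta => h _; apply: lt_le_trans h; rewrite invr_gt0. Qed.
Let p0 : 0 < p. Proof. by rewrite invr_gt0. Qed.

Lemma wgt_ge_norm N (y : 'rV[R]_N) : 1 <= 2 ^+ N * (1 + `|y| ^+ (2 * N)) * wgt y.
Proof.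
have b0 : 0 < 1 + `|y| ^+ 2 by rewrite ltr_wpDr// sqr_ge0.
have h1 : (1 + `|y| ^+ 2) ^- N <= wgt y.
  rewrite -exprVn /wgt.
  have -> : (1 + `|y| ^+ 2)^-1 ^+ N = \prod_(j < N) (1 + `|y| ^+ 2)^-1 by rewrite prodr_const card_ord.
  apply: ler_prod => j _; rewrite invr_ge0 (ltW b0) /= lef_pV2 ?posrE// ?ltr_wpDr ?sqr_ge0//.
  rewrite lerD2l -[leLHS]ger0_norm ?sqr_ge0//.
  by rewrite normrX lerXn2r ?nnegrE// coord_le_norm.
have h2 : (1 + `|y| ^+ 2) ^+ N <= 2 ^+ N * (1 + `|y| ^+ (2 * N)).
  have [y1|y1] := leP `|y| 1.
    apply: (@le_trans _ _ (2 ^+ N)).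
      by rewrite lerXn2r ?nnegrE ?(ltW b0)// -[2]/(1 + 1) lerD2l exprn_ile1.
    by rewrite ler_peMr ?exprn_ge0// lerDl exprn_ge0.
  apply: (@le_trans _ _ ((2 * `|y| ^+ 2) ^+ N)).
    rewrite lerXn2r ?nnegrE ?(ltW b0) ?mulr_ge0 ?sqr_ge0//.
    by rewrite mulr_natl mulr2n lerD2r exprn_ege1// ltW.
  by rewrite exprMn exprM ler_wpM2l ?exprn_ge0// lerDr.
apply: le_trans (ler_wpM2r (wgt_ge0 y) h2); rewrite mulrC -ler_pdivrMr ?exprn_gt0//.
by rewrite mul1r.
Qed.

Lemma gsb_wgt N C M (f : 'rV[R]_N -> R[i]) y : gsb theta C M f ->
  cabs (f y) <= 2 ^+ N * (1 + C ^+ (2 * N) * gbd theta (2 * N)) * M * wgt y.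
Proof.
move=> [_ hf]; have h0 := hf 0%N [::] y; have h1 := hf (2 * N)%N [::] y.
rewrite expr0 mul1r /= /gbd fact0 powR1 mulr1 mulr1 in h0.
rewrite addn0 /= in h1.
apply: le_trans (_ : _ <= 2 ^+ N * (1 + `|y| ^+ (2 * N)) * wgt y * cabs (f y)) _.
  by rewrite ler_peMl ?cabs_ge0// wgt_ge_norm.
rewrite mulrAC ler_wpM2r ?wgt_ge0// -!mulrA ler_wpM2l ?exprn_ge0// !mulrDl !mul1r.
by apply: lerD => //; apply: le_trans h1 _; rewrite mulrC.
Qed.

(** Serves three functionals: pairing with a test function ([A] the identity), integration over the
    diagonal ([A] the map x |-> (x, x)), and evaluation of a Fourier transform ([phi] a
    character). *)
Lemma pairing_gs M N (A : 'rV[R]_N -> 'rV[R]_M) (phi : 'rV[R]_N -> R[i]) B :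
  (forall f, cscont f -> cscont (f \o A)) -> (forall x, wgt (A x) <= wgt x) ->
  cscont phi -> (forall x, cabs (phi x) <= B) ->
  gslin theta (fun F => cint (fun x => phi x * F (A x))) /\
  gsbounded theta (fun F => cint (fun x => phi x * F (A x))).
Proof.
move=> hA wA sphi hB; have B0 : 0 <= B by exact: le_trans (cabs_ge0 _) (hB 0).
pose K C : R := 2 ^+ M * (1 + C ^+ (2 * M) * gbd theta (2 * M)).
have K0 C : 0 < C -> 0 <= K C.
  by move=> C0; rewrite mulr_ge0 ?exprn_ge0// addr_ge0// mulr_ge0 ?exprn_ge0 ?ltW// gbd_gt0.
have bd C L F x : 0 < C -> gsb theta C L F -> cabs (F (A x)) <= K C * L * wgt x.
  move=> C0 hF; apply: le_trans (gsb_wgt _ hF) _; rewrite ler_wpM2l ?wA//.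
  by apply: mulr_ge0; [exact: K0|exact: gsb_ge0 hF].
have nice F : gs theta F -> cnice (fun x => phi x * F (A x)).
  move=> /(gsP htheta)[C [L [C1 L0 hF]]]; apply: cnice_bounded sphi hB _; split.
    by apply: (hA F); exact: (smooth_cscont [::] hF.1).
  by exists (K C * L) => x; apply: bd => //; exact: lt_le_trans C1.
split=> [a f g gf gg|C C0].
  rewrite -cintZ; last exact: nice.
  rewrite -cintD; [|by apply: cniceZ; exact: nice|exact: nice].
  by congr cint; apply/funext => x; ring.
have sw : scont (@wgt R N).
  apply: scont_prod => j; apply: (scont_comp (h := @bump R)); first exact: continuous_bump.
  exact: scont_coord.
have w1 x : `|wgt (x : 'rV[R]_N)| <= 1 * wgt x by rewrite mul1r ger0_norm// wgt_ge0.
have rw0 : 0 <= rint (@wgt R N).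
  rewrite -(@rint0 R N); apply: (@le_rint _ _ _ _ 0 1) => //; first exact: scont_cst.
  - by move=> x; rewrite normr0 mul0r.
  - by move=> x; exact: wgt_ge0.
exists (2 * (B * K C * rint (@wgt R N))) => [|L F hF].
  by rewrite mulr_ge0// mulr_ge0// mulr_ge0// K0.
have cF : cscont (F \o A) by apply: hA; exact: (smooth_cscont [::] hF.1).
apply: le_trans (@cint_le _ _ (fun x => phi x * F (A x)) (fun x => (B * K C * L) * wgt x) (B * K C * L) _ _ _ _) _.
- exact: cscontM.
- by apply: scontM => //; exact: scont_cst.
- by [].
- by move=> x; rewrite cabsM -!mulrA; apply: ler_pM; rewrite ?cabs_ge0// !mulrA; exact: bd.
- by rewrite (rintZ _ sw w1) le_eqVlt; apply/orP; left; apply/eqP; ring.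
Qed.

Lemma of_fun_nice N (h : 'rV[R]_N -> R[i]) : gs theta h ->
  gslin theta (of_fun h) /\ gsbounded theta (of_fun h).
Proof.
by move=> /(gs_bounded htheta)[ch [B hB]]; exact: (pairing_gs (A := id) _ _ ch hB).
Qed.

Lemma of_fun_wave N (h : 'rV[R]_N -> R[i]) X : of_fun h (wave_packet X) = gwt 1 h X.
Proof. by congr cint; apply/funext => x; rewrite gwin1 -surjective_pairing. Qed.

Lemma decays_at_phw N I (a : I -> phase R N -> R) X C e : 0 < e -> X != 0 ->
  (forall i Y, a i Y <= C * expR (- (e * phw theta Y))) -> decays_at theta a X.
Proof.
move=> e0 X0 ha; have n0 := norm_phase_gt0 X0.
set r := (`|X.1| + `|X.2|) / 2; have r0 : 0 < r by rewrite divr_gt0.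
have rX : r < `|X.1| + `|X.2| by rewrite /r ltr_pdivrMr// mulr_natr mulr2n ltrDl.
exists `|C|, (e * (r / 2) `^ p); split; first by rewrite mulr_gt0// powR_gt0// divr_gt0.
have hn := near_gtT (@continuous_phase_sum R N) rX.
apply: filterS hn => Y hY i s s0; apply: le_trans (ha i _) _.
apply: (@le_trans _ _ (`|C| * expR (- (e * phw theta (s *: Y))))).
  by rewrite ler_wpM2r ?expR_ge0// ler_norm.
rewrite ler_wpM2l// ler_expR lerN2 -mulrA ler_wpM2l ?(ltW e0)//.
rewrite (phwZ _ _ (ltW s0)) mulrC ler_wpM2l ?powR_ge0//.
rewrite /phw; have [h|h] := leP (r / 2) `|Y.1|.
  apply: ler_wpDr; first exact: powR_ge0.
  by rewrite ge0_ler_powR ?nnegrE ?(ltW p0)// divr_ge0// ltW.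
apply: ler_wpDl; first exact: powR_ge0.
rewrite ge0_ler_powR ?nnegrE ?(ltW p0)// ?divr_ge0 ?(ltW r0)//.
by apply: ltW; lra.
Qed.

Lemma of_fun_ultradist_in N (h : 'rV[R]_N -> R[i]) (G : set (phase R N)) : gs theta h ->
  ultradist_in theta G (of_fun h).
Proof.
move=> gh; split; first by apply/(ultradistP htheta); exact: of_fun_nice.
move=> X WX; have X0 := WF_neq0 WX; exfalso; move: WX; apply/(WFP htheta _ X0).
have [C [M [C1 M0 hc]]] := gs_coordb htheta gh.
have r0 : 0 < dec_rate theta 1 C by exact: dec_rate_gt0.
apply: (@decays_at_phw _ _ _ _ (2 * (2 * gmass 1 ^+ N * M)) _ r0 X0) => i Y.
by rewrite /amp of_fun_wave; apply: gwt_decay.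
Qed.

Section Density.
Context {N : nat} (G : set (phase R N)) (t : functional R N).
Hypotheses (cG : closed_cone G) (ht : ultradist_in theta G t).

(* The reproducing formula with [t] in place of the test function. *)
Definition regularize n : 'rV[R]_N -> R[i] := fun y =>
  \sum_(la : @glam N n) ((gwts N n)%:C * t (wave_packet (gpt la))) * wave_packet (flip (gpt la)) y.

Lemma regularize_gs n : gs theta (regularize n).
Proof.
have [sl _] := (ultradistP htheta t).1 ht.1.
by have [] := gslin_sum htheta (index_enum (@glam N n)) (fun la => (gwts N n)%:C * t (wave_packet (gpt la)))
  sl (fun la => gs_wave htheta (flip (gpt la))).
Qed.

Lemma regularizeE n f : gs theta f -> of_fun (regularize n) f =
  \sum_(la : @glam N n) (gwts N n)%:C * (t (wave_packet (gpt la)) * gwt 1 f (flip (gpt la))).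
Proof.
move=> gf; have nice X : cnice (fun y => wave_packet X y * f y).
  have [cf [B hB]] := gs_bounded htheta gf.
  have := gwin_nice htheta X.1 X.2 gf ltr01.
  by rewrite gwin1 -surjective_pairing; under eq_fun do rewrite mulrC.
have -> : of_fun (regularize n) f = cint (fun y => \sum_(la : @glam N n)
    ((gwts N n)%:C * t (wave_packet (gpt la))) * (wave_packet (flip (gpt la)) y * f y)).
  by congr cint; apply/funext => y; rewrite mulr_suml; apply: eq_bigr => la _; rewrite mulrA.
have [_ ->] := cint_sum (index_enum (@glam N n)) (F := fun la y =>
    ((gwts N n)%:C * t (wave_packet (gpt la))) * (wave_packet (flip (gpt la)) y * f y))
    (fun la => cniceZ _ (nice _)).
apply: eq_bigr => la _; rewrite cintZ; last exact: nice.
rewrite -mulrA; congr (_ * (_ * cint _)); apply/funext => y.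
by rewrite gwin1 -surjective_pairing mulrC.
Qed.

Lemma regularize_cvg f : gs theta f -> ccvg \oo (fun n => of_fun (regularize n) f) (t f).
Proof.
move=> gf; have [sl sb] := (ultradistP htheta t).1 ht.1.
apply: ccvg_ext (gabor_repr htheta sl sb gf) => n; rewrite regularizeE//.
by apply: eq_bigr => la _; ring.
Qed.

Lemma qsZ s (X Y : phase R N) : 0 < s -> qs (s *: X) (s *: Y) = s * qs X Y.
Proof.
move=> s0; rewrite /qs mulr_sumr; apply: eq_bigr => j _; rewrite !mxE.
rewrite ![-1 * (s * _)]mulrCA -!mulrDr !normrM !(gtr0_norm s0).
by rewrite -mulrDr.
Qed.

Lemma qs_eq0 (X Y : phase R N) : qs X Y = 0 -> X = Y.
Proof.
move=> /eqP; rewrite psumr_eq0; last by move=> j _; rewrite addr_ge0.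
move=> /allP h; have hj j : `|X.1 0 j + -1 * Y.1 0 j| = 0 /\ `|X.2 0 j + -1 * Y.2 0 j| = 0.
  have := h j (mem_index_enum _); rewrite /= paddr_eq0// => /andP[/eqP ? /eqP ?]//.
case: X Y h hj => [x xi] [y eta] _ /= hj; congr (_, _); apply/rowP => j; have [h1 h2] := hj j.
  by apply/eqP; rewrite -subr_eq0 -mulN1r -normr_eq0 h1.
by apply/eqP; rewrite -subr_eq0 -mulN1r -normr_eq0 h2.
Qed.

Lemma continuous_qs : continuous (fun w : (phase R N * R) * phase R N => qs w.1.1 (w.1.2 *: w.2)).
Proof.
have cX j := continuous_phase_coord (R := R) (N := N) j.
have c1 (f : phase R N -> R) : continuous f ->
    continuous (fun w : (phase R N * R) * phase R N => f w.1.1).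
  move=> cf; apply: (@cont_fst _ _ _ (fun z : phase R N * R => f z.1)).
  exact: (@cont_fst _ _ _ f).
have c2 (f : phase R N -> R) : continuous f ->
    continuous (fun w : (phase R N * R) * phase R N => f w.2) by move=> cf; exact: (@cont_snd _ _ _ f).
have ct : continuous (fun w : (phase R N * R) * phase R N => w.1.2).
  apply: (@cont_fst _ _ _ (fun z : phase R N * R => z.2)).
  exact: (@cont_snd _ _ _ (fun t : R => t) (@cont_id R)).
apply: continuous_sumT => j; have [h1 h2] := cX j.
have -> : (fun w : (phase R N * R) * phase R N =>
    `|w.1.1.1 0 j + -1 * (w.1.2 *: w.2).1 0 j| + `|w.1.1.2 0 j + -1 * (w.1.2 *: w.2).2 0 j|) =
  (fun w => `|w.1.1.1 0 j + -1 * (w.1.2 * w.2.1 0 j)| + `|w.1.1.2 0 j + -1 * (w.1.2 * w.2.2 0 j)|).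
  by apply/funext => w; rewrite !mxE.
apply: continuous_addT; apply: cont_abs; apply: continuous_addT.
- exact: (c1 _ h1).
- apply: continuous_mulT; first exact: continuous_cstT.
  by apply: continuous_mulT => //; exact: (c2 _ h1).
- exact: (c1 _ h2).
- apply: continuous_mulT; first exact: continuous_cstT.
  by apply: continuous_mulT => //; exact: (c2 _ h2).
Qed.

(** The kernel between g_X and g_(s Y) vanishes to no order only at X = s Y, and there t itself
    decays; [transfer] with [qs] therefore bounds the regularizations uniformly in n, and t is added
    separately. *)
Lemma regularize_decays X0 : X0 != 0 -> ~ G X0 ->
  decays_at theta (amp (fun n f => of_fun (regularize n) f - t f)) X0.
Proof.
move=> X00 nG; have [sl sb] := (ultradistP htheta t).1 ht.1.
have tdec X : X != 0 -> ~ G X -> decays_at theta (amp (fun _ : unit => t)) X.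
  by move=> Xn0 nGX; apply/(WFP htheta _ Xn0) => /(ht.2 X).
have [K [c [K0 c0 hK]]] := wave_kernel (N := N) htheta.
have hG (s : R) : 0 < s -> ~ G (s *: X0).
  move=> s0 Gs; apply: nG; have [[_ cone] _] := cG.
  have si : 0 < s^-1 by rewrite invr_gt0.
  by have := cone _ _ si Gs; rewrite scalerA mulVf ?gt_eqF// scale1r.
have tg d : 0 < d -> exists2 K, 0 <= K & forall i X, amp (fun _ : unit => t) i X <= K * expR (d * phw theta X).
  by move=> d0; have [K' K'0 hK'] := wave_growth htheta sb d0; exists K'.
have t2 X s : 0 <= s -> (X, s) != 0 -> qs X (s *: X0) = 0 -> decays_at theta (amp (fun _ : unit => t)) X.
  move=> s0 + /qs_eq0 Xs; rewrite Xs => Xn0.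
  have s1 : 0 < s by rewrite lt_neqAle s0 andbT eq_sym; apply: contraNneq Xn0 => ->; rewrite scale0r.
  by apply: tdec; [rewrite scaler_eq0 negb_or gt_eqF|exact: hG].
have [C [e [C0 e0 h]]] := transfer htheta c0 (amp_ge0 (fun _ : unit => t)) tg
  (@qs_ge0 R N) qsZ continuous_qs t2.
have [W W0 hW] := grid_sum_bound (N := N) htheta e0.
apply: (@decays_at_le _ _ _ _ _ (fun n Y => amp (fun n => of_fun (regularize n)) n Y + amp (fun _ : nat => t) n Y)).
  by move=> n Y; rewrite /amp (le_trans (cabsD _ _))// cabsN.
apply: decays_atD; last first.
  have [C' [e' [e'0 h']]] := tdec _ X00 nG; exists C', e'; split=> //.
  by apply: filterS h' => Y hY n s s0; exact: (hY tt).
exists (K * C * W), e; split=> //; apply: filterS h => Y hY n s s0.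
rewrite /amp (regularizeE n (gs_wave htheta _)) mulrAC.
apply: (hW _ (fun X => t (wave_packet X) * gwt 1 (wave_packet (s *: Y)) (flip X))) => X.
rewrite cabsM; apply: (@le_trans _ _ (amp (fun _ : unit => t) tt X * (K * expR (- (c * qs X (s *: Y) `^ p))))).
  by apply: ler_wpM2l; [exact: cabs_ge0|exact: hK].
rewrite mulrCA -!mulrA ler_wpM2l// -expRD.
by have := hY tt X s (ltW s0); rewrite mulrDr opprD addrC.
Qed.

Lemma regularize_cvg_in : cvg_in theta G (fun n => of_fun (regularize n)) t.
Proof.
split=> [f gf|X X0 nG].
  by have := regularize_cvg gf; rewrite /ccvg; under [in X in _ -> X]eq_fun do rewrite subr0.
apply/(cvg0_decaysP htheta _ (X := X)); first exact/eqP.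
by apply: regularize_decays => //; exact/eqP.
Qed.

End Density.

End RegularFunctionals.

Section DeltaStar.
Context {R : realType} {d : nat} (theta : R).
Hypothesis htheta : 2^-1 <= theta < 1.
Implicit Types (G : set (phase R (d + d))) (t : functional R (d + d)).

Lemma cscont_diag (f : 'rV[R]_(d + d) -> R[i]) : cscont f -> cscont (fun x : 'rV[R]_d => f (row_mx x x)).
Proof.
have h u (x : 'rV[R]_d) : cwcvg u x -> cwcvg (fun n => row_mx (u n) (u n)) (row_mx x x).
  by move=> ux j; case: (split_ordP j) => k ->; rewrite ?row_mxEl ?row_mxEr;
    under eq_fun do rewrite ?row_mxEl ?row_mxEr; exact: ux.
by move=> [fr fi]; split=> u x /h ux; [exact: fr|exact: fi].
Qed.

Lemma wgt_diag (x : 'rV[R]_d) : wgt (row_mx x x) <= wgt x.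
Proof.
rewrite /wgt big_split_ord /= (eq_bigr (fun j => bump (x 0 j))) => [|j _]; last by rewrite row_mxEl.
rewrite ler_piMr ?wgt_ge0//; apply: prodr_ile1 => j _.
by rewrite row_mxEr bump_ge0 bump_le1.
Qed.

Lemma flipK N (X : phase R N) : flip (flip X) = X.
Proof. by case: X => x xi; rewrite /flip /= opprK. Qed.

(** The reproducing formula for f, tested on the functional [F |-> cint (phi x * F (x, x))], is the
    sum [dsum] with the two packets flipped; [gabor_flip] identifies them, and here the ultrafilter
    limit is an ordinary one. *)
Lemma dstar_of_fun (f : 'rV[R]_(d + d) -> R[i]) : gs theta f -> agree theta (dstar (of_fun f)) (of_fun (diag_pull f)).
Proof.
move=> gf phi gphi; have [cp [B hB]] := gs_bounded htheta gphi.
have [vl vb] := pairing_gs htheta cscont_diag wgt_diag cp hB.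
have -> : of_fun (diag_pull f) phi = cint (fun x => phi x * f (row_mx x x)).
  by congr cint; apply/funext => x; rewrite mulrC.
apply: ulim_cvg; apply: ccvg_ext (gabor_repr htheta vl vb gf) => n.
pose F X := (gwts (d + d) n)%:C * (of_fun f (wave_packet X) * dgk (flip X) phi).
rewrite /dsum -[RHS](gabor_flip n F); apply: eq_bigr => la _; rewrite /F of_fun_wave mulrA.
by rewrite flipK; congr (_ * _); congr cint; apply/funext => x; rewrite mulrC.
Qed.

Lemma dstar_extension G : diag_admissible G -> diag_extension theta G (@dstar R d).
Proof.
move=> aG; split; [by move=> t; exact: dstar_ultradist| |exact: dstar_of_fun].
by move=> t_ t ht_ ht hc; exact: (dstar_weak_cvg htheta aG ht ht_ hc).
Qed.

Lemma extension_unique G D t : diag_admissible G -> diag_extension theta G D ->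
  ultradist_in theta G t -> agree theta (D t) (dstar t).
Proof.
move=> aG [_ Dc De] ht f gf; have [cG _] := aG.
have hn n := regularize_gs htheta ht n.
have un n := of_fun_ultradist_in htheta G (hn n).
have hc := regularize_cvg_in htheta cG ht.
have c1 := Dc _ _ un ht hc f gf.
have c2 := dstar_weak_cvg htheta aG ht un hc gf.
apply: (ccvg_unique c1); apply: ccvg_ext c2 => n.
by rewrite (De _ (hn n) f gf) (dstar_of_fun (hn n) gf).
Qed.

Lemma dstar_delta_star G : diag_admissible G -> is_delta_star theta G (@dstar R d).
Proof.
move=> aG; split; first exact: dstar_extension.
by move=> D hD t ht f gf; rewrite (extension_unique aG hD ht gf).
Qed.

End DeltaStar.

(** * Tensor products and products *)

Section GridFunctions.
Context {R : realType} {N M : nat} (theta : R).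
Hypothesis htheta : 2^-1 <= theta < 1.

Let t01' : 0 < theta <= 1.
Proof. by case/andP: htheta => h /ltW ->; rewrite andbT; apply: lt_le_trans h; rewrite invr_gt0. Qed.

(** Generalizes [gabor_sum_gsb] to arbitrary decaying coefficients and to packets moved by [P]; it
    is used for the two projections of R^(d+d) and for the rotation of phase space. *)
Lemma grid_gsb r (P : phase R N -> phase R M) : 0 < r -> (forall X, phw theta (P X) <= phw theta X) ->
  exists C K, [/\ 1 <= C, 0 <= K & forall B (c : phase R N -> R[i]) n, 0 <= B ->
    (forall X, cabs (c X) <= B * expR (- (r * phw theta X))) ->
    gsb theta C (K * B) (fun y => \sum_(la : @glam N n) ((gwts N n)%:C * c (gpt la)) * wave_packet (P (gpt la)) y)].
Proof.
move=> r0 hP; pose dl := Num.min 2^-1 (r / 2).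
have dl0 : 0 < dl <= 2^-1 by rewrite lt_min ge_min lexx /= invr_gt0 ltr0n divr_gt0.
have dlr : dl <= r / 2 by rewrite ge_min lexx orbT.
have [K K0 hK] := gabor_weight (N := N) t01' (divr_gt0 r0 (ltr0n _ 2)).
have d0 : 0 < dl by case/andP: dl0.
exists (6 / dl), (expR 1 * K); split.
- by rewrite ler_pdivlMr// mul1r; case/andP: dl0 => _ h; apply: le_trans h _; lra.
- by rewrite mulr_ge0 ?expR_ge0.
move=> B c n B0 hc; have C0 : 0 <= 6 / dl by rewrite divr_ge0// ltW.
apply: (gsb_le C0 _ (gsb_sum (index_enum (@glam N n)) (fun la => (gwts N n)%:C * c (gpt la)) C0
  (fun la => gsb_wave (P (gpt la)) htheta dl0))).
- apply: (@le_trans _ _ (\sum_(la : @glam N n) (expR 1 * B) *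
      (gwts N n * expR (- (r / 2 * phw theta (gpt la)))))); last first.
    rewrite -mulr_sumr (mulrAC _ K); apply: ler_wpM2l; first by rewrite mulr_ge0 ?expR_ge0.
    exact: hK.
  apply: ler_sum => la _; rewrite cabsM cabsR (ger0_norm (gwts_ge0 _)).
  have h := hc (gpt la); have p0 := phw_ge0 theta (gpt la); have h1 := hP (gpt la).
  have w0 := @gwts_ge0 R N n; set w := gwts N n in w0 *; set q := phw theta (gpt la) in h p0 h1 *.
  have hE : expR (- (r * q)) * expR (dl * phw theta (P (gpt la))) <= expR (- (r / 2 * q)).
    rewrite -expRD ler_expR.
    have h2 : dl * phw theta (P (gpt la)) <= r / 2 * q.
      by apply: ler_pM => //; [exact: ltW|exact: phw_ge0].
    by lra.
  apply: (@le_trans _ _ (w * (B * expR (- (r * q))) * (expR 1 * expR (dl * phw theta (P (gpt la)))))).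
    by rewrite ler_wpM2r ?ler_wpM2l// mulr_ge0 ?expR_ge0.
  rewrite (_ : _ * (expR 1 * _) = expR 1 * B * (w * (expR (- (r * q)) * expR (dl * phw theta (P (gpt la)))))).
    by rewrite ler_wpM2l ?mulr_ge0 ?expR_ge0// ler_wpM2l.
  by ring.
Qed.

End GridFunctions.

Section Tensor.
Context {R : realType} {d : nat} (theta : R).
Hypothesis htheta : 2^-1 <= theta < 1.
Notation p := (theta^-1).
Implicit Types (X : phase R (d + d)) (Y : phase R d) (phi : 'rV[R]_(d + d) -> R[i]).

Let t0 : 0 < theta. Proof. by case/andP: htheta => h _; apply: lt_le_trans h; rewrite invr_gt0. Qed.
Let p0 : 0 < p. Proof. by rewrite invr_gt0. Qed.

Lemma norm_lsubmx (x : 'rV[R]_(d + d)) : `|lsubmx x| <= `|x|.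
Proof. by apply: norm_le_coord => // j; rewrite mxE coord_le_norm. Qed.

Lemma norm_rsubmx (x : 'rV[R]_(d + d)) : `|rsubmx x| <= `|x|.
Proof. by apply: norm_le_coord => // j; rewrite mxE coord_le_norm. Qed.

Lemma phw_lph X : phw theta (lph X) <= phw theta X.
Proof. by apply: lerD; rewrite ge0_ler_powR ?nnegrE ?(ltW p0)// norm_lsubmx. Qed.

Lemma phw_rph X : phw theta (rph X) <= phw theta X.
Proof. by apply: lerD; rewrite ge0_ler_powR ?nnegrE ?(ltW p0)// norm_rsubmx. Qed.

Lemma cabs_wave_le1 Y y : cabs (wave_packet Y y) <= 1.
Proof. by case: Y => x xi; rewrite cabs_wave -[leRHS]expR0 ler_expR oppr_le0 divr_ge0// sqr_ge0. Qed.

(** Packets on R^(d+d) are products, so freezing x in the Gabor sum of phi leaves a sum of packets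
    in y whose extra coefficients have modulus at most 1. *)
Lemma slice_gsb C : 1 <= C -> exists C' K, [/\ 1 <= C', 0 <= K & forall M phi x, 0 <= M ->
  coordb theta C M phi -> gsb theta C' (K * M) (fun y => phi (row_mx x y))].
Proof.
move=> C1; have r0 : 0 < dec_rate theta 1 C by exact: dec_rate_gt0.
have [C' [K [C'1 K0 hK]]] := grid_gsb htheta r0 phw_rph.
set g := 2 * (2 * gmass 1 ^+ (d + d)) : R.
have g0 : 0 <= g by rewrite !mulr_ge0// exprn_ge0// ltW// gmass_gt0.
exists C', (K * g); split; [by []|exact: mulr_ge0|move=> M phi x M0 hc].
pose c X := gwt 1 phi (flip X) * wave_packet (lph X) x.
rewrite -mulrA; apply: (gsb_limit (f_ := fun n y =>
  \sum_(la : @glam (d + d) n) ((gwts (d + d) n)%:C * c (gpt la)) * wave_packet (rph (gpt la)) y)).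
  move=> n; apply: hK => [|X]; first exact: mulr_ge0.
  rewrite cabsM; apply: le_trans (ler_piMr (cabs_ge0 _) (cabs_wave_le1 _ _)) _.
  rewrite -(phw_flip theta X); apply: le_trans (gwt_decay _ htheta (lexx 1) C1 M0 hc) _.
  by rewrite /g !mulrA.
move=> y; apply: ccvg_ext (gabor_cvg (row_mx x y) hc) => n.
by apply: eq_bigr => la _; rewrite wave_row /c !mulrA.
Qed.

Lemma slice_gs phi x : gs theta phi -> gs theta (fun y => phi (row_mx x y)).
Proof.
move=> /(gs_coordb htheta)[C [M [C1 M0 hc]]]; have [C' [K [C'1 K0 h]]] := slice_gsb C1.
by apply/(gsP htheta); exists C', (K * M); split=> //; [exact: mulr_ge0|exact: h].
Qed.

(** Here v is applied termwise to the Gabor sum of phi. The values of v on packets grow at rate at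
    most r / 2 against the rate r of decay of the coefficients. *)
Lemma fiber_gsb (v : functional R d) C : gslin theta v -> gsbounded theta v -> 1 <= C ->
  exists C' K, [/\ 1 <= C', 0 <= K & forall M phi, 0 <= M ->
  coordb theta C M phi -> gsb theta C' (K * M) (fun x => v (fun y => phi (row_mx x y)))].
Proof.
move=> vl vb C1; set r := dec_rate theta 1 C.
have r0 : 0 < r by exact: dec_rate_gt0.
have r20 : 0 < r / 2 by rewrite divr_gt0.
have [L L0 hL] := wave_growth htheta vb r20.
have [C' [K [C'1 K0 hK]]] := grid_gsb htheta r20 phw_lph.
have [Cs [Ks [Cs1 Ks0 hs]]] := slice_gsb C1.
have r1 : 0 < r by [].
have [Cg [Kg [Cg1 Kg0 hg]]] := grid_gsb htheta r1 phw_rph.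
set g := 2 * (2 * gmass 1 ^+ (d + d)) : R.
have g0 : 0 <= g by rewrite !mulr_ge0// exprn_ge0// ltW// gmass_gt0.
exists C', (K * (g * L)); split; [by []|by apply: mulr_ge0 => //; exact: mulr_ge0|move=> M phi M0 hc].
have hd X : cabs (gwt 1 phi (flip X)) <= g * M * expR (- (r * phw theta X)).
  rewrite -(phw_flip theta X); apply: le_trans (gwt_decay _ htheta (lexx 1) C1 M0 hc) _.
  by rewrite /g !mulrA.
rewrite -mulrA (mulrAC g); pose c X := gwt 1 phi (flip X) * v (wave_packet (rph X)).
apply: (gsb_limit (f_ := fun n y =>
  \sum_(la : @glam (d + d) n) ((gwts (d + d) n)%:C * c (gpt la)) * wave_packet (lph (gpt la)) y)).
  move=> n; apply: hK => [|X]; first by apply: mulr_ge0 => //; exact: mulr_ge0.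
  rewrite cabsM; apply: (@le_trans _ _ ((g * M * expR (- (r * phw theta X))) * (L * expR (r / 2 * phw theta X)))).
    apply: ler_pM; [exact: cabs_ge0|exact: cabs_ge0|exact: hd|].
    apply: le_trans (hL _) (ler_wpM2l L0 _); rewrite ler_expR.
    exact: (ler_wpM2l (ltW r20) (phw_rph X)).
  rewrite mulrACA -expRD (_ : - (r * phw theta X) + r / 2 * phw theta X = - (r / 2 * phw theta X)) //.
  by field.
move=> x.
pose f n y := \sum_(la : @glam (d + d) n) ((gwts (d + d) n)%:C *
  (gwt 1 phi (flip (gpt la)) * wave_packet (lph (gpt la)) x)) * wave_packet (rph (gpt la)) y.
have fb n : gsb theta Cg (Kg * (g * M)) (f n).
  apply: (hg _ (fun X => gwt 1 phi (flip X) * wave_packet (lph X) x)) => [|X]; first exact: mulr_ge0.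
  rewrite cabsM; apply: le_trans (ler_piMr (cabs_ge0 _) (cabs_wave_le1 _ _)) _; exact: hd.
have fc y : ccvg \oo (f ^~ y) (phi (row_mx x y)).
  apply: ccvg_ext (gabor_cvg (row_mx x y) hc) => n.
  by apply: eq_bigr => la _; rewrite wave_row !mulrA.
have Cg0 : 0 < Cg by exact: lt_le_trans Cg1.
have hv : ccvg \oo (fun n => v (f n)) (v (fun y => phi (row_mx x y))).
  by apply: (gslin_cvg htheta vl vb Cg0 fb (gsb_limit fb fc)).
apply: ccvg_ext hv => n; have [_ ->] := gslin_sum htheta (index_enum (@glam (d + d) n))
  (fun la => (gwts (d + d) n)%:C * (gwt 1 phi (flip (gpt la)) * wave_packet (lph (gpt la)) x)) vl
  (fun la => gs_wave htheta (rph (gpt la))).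
by apply: eq_bigr => la _; rewrite /c; ring.
Qed.

Lemma fiber_gs (v : functional R d) phi : gslin theta v -> gsbounded theta v ->
  gs theta phi -> gs theta (fun x => v (fun y => phi (row_mx x y))).
Proof.
move=> vl vb /(gs_coordb htheta)[C [M [C1 M0 hc]]].
have [C' [K [C'1 K0 h]]] := fiber_gsb vl vb C1.
by apply/(gsP htheta); exists C', (K * M); split=> //; [exact: mulr_ge0|exact: h].
Qed.

Lemma tensor_lin (u v : functional R d) : gslin theta u -> gslin theta v -> gsbounded theta v ->
  gslin theta (tensor u v).
Proof.
move=> ul vl vb a f g gf gg; rewrite /tensor -ul; [|exact: (fiber_gs vl vb gf)|exact: (fiber_gs vl vb gg)].
by congr u; apply/funext => x; rewrite vl//; exact: slice_gs.
Qed.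

Lemma tensor_bounded (u v : functional R d) : gsbounded theta u -> gslin theta v -> gsbounded theta v ->
  gsbounded theta (tensor u v).
Proof.
move=> ub vl vb C C0; have m1 : 1 <= Num.max 1 C by rewrite le_max lexx.
have [C' [K [C'1 K0 h]]] := fiber_gsb vl vb m1.
have C'0 : 0 < C' by exact: lt_le_trans C'1.
have [L L0 hL] := ub C' C'0; exists (L * K) => [|M f hf]; first exact: mulr_ge0.
have M0 := gsb_ge0 C0 hf; rewrite -mulrA; apply: hL; apply: h => //; apply: gsb_coordb.
by apply: (gsb_leC (C := C)) => //; [exact: ltW|rewrite le_max lexx orbT].
Qed.

Lemma tensor_wave (u v : functional R d) X : gslin theta u -> gslin theta v ->
  tensor u v (wave_packet X) = u (wave_packet (lph X)) * v (wave_packet (rph X)).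
Proof.
move=> ul vl; rewrite mulrC -(gslinZ htheta _ ul (gs_wave htheta _)).
congr u; apply/funext => x; rewrite mulrC -(gslinZ htheta _ vl (gs_wave htheta _)).
by congr v; apply/funext => y; rewrite wave_row.
Qed.

Definition tcone (W1 W2 : set (phase R d)) : set (phase R (d + d)) :=
  [set X | [/\ X != 0, lph X = 0 \/ W1 (lph X) & rph X = 0 \/ W2 (rph X)]].

Lemma near_lph X (P : phase R d -> Prop) : (\forall Y \near lph X, P Y) -> \forall Z \near X, P (lph Z).
Proof.
move=> /nbhs_ballP[e e0 h]; apply/nbhs_ballP; exists e => // Z [h1 h2]; apply: h.
by split; split=> // i j; rewrite !mxE; [exact: h1.2|exact: h2.2].
Qed.

Lemma near_rph X (P : phase R d -> Prop) : (\forall Y \near rph X, P Y) -> \forall Z \near X, P (rph Z).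
Proof.
move=> /nbhs_ballP[e e0 h]; apply/nbhs_ballP; exists e => // Z [h1 h2]; apply: h.
by split; split=> // i j; rewrite !mxE; [exact: h1.2|exact: h2.2].
Qed.

Lemma lphZ s X : lph (s *: X) = s *: lph X.
Proof. by rewrite /lph /=; congr (_, _); apply/matrixP => i j; rewrite !mxE. Qed.

Lemma rphZ s X : rph (s *: X) = s *: rph X.
Proof. by rewrite /rph /=; congr (_, _); apply/matrixP => i j; rewrite !mxE. Qed.

Lemma near_phw X : exists2 B, 0 < B & \forall Z \near X, phw theta Z <= B.
Proof.
set r := `|X.1| + `|X.2| + 1; have r0 : 0 < r by rewrite ltr_wpDl ?addr_ge0.
exists (2 * r `^ p); first by rewrite mulr_gt0// powR_gt0.
have hr : `|X.1| + `|X.2| < r by rewrite /r ltrDl.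
have := near_ltT (@continuous_phase_sum R (d + d)) hr; apply: filterS => Z hZ.
rewrite mulr_natl mulr2n; apply: lerD; rewrite ge0_ler_powR ?nnegrE ?(ltW p0) ?(ltW r0)//; apply: ltW;
  apply: le_lt_trans hZ; by rewrite ?lerDl ?lerDr.
Qed.

(* The other factor grows more slowly than every [expR (e * s `^ p)]. *)
Lemma decays_at_mul I (a b : I -> phase R d -> R) (P Q : phase R (d + d) -> phase R d) X0 :
  (forall i Y, 0 <= a i Y) -> (forall i Y, 0 <= b i Y) ->
  (forall X (S : phase R d -> Prop), (\forall Y \near P X, S Y) -> \forall Z \near X, S (P Z)) ->
  (forall s X, P (s *: X) = s *: P X) -> (forall s X, Q (s *: X) = s *: Q X) ->
  (forall X, phw theta (Q X) <= phw theta X) ->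
  (forall e, 0 < e -> exists2 K, 0 <= K & forall i Y, b i Y <= K * expR (e * phw theta Y)) ->
  decays_at theta a (P X0) -> decays_at theta (fun i X => a i (P X) * b i (Q X)) X0.
Proof.
move=> a0 b0 nP PZ QZ hQ gb [C [e [e0 h]]]; have [B B0 hB] := near_phw X0.
have d0 : 0 < e / (2 * B) by rewrite divr_gt0// mulr_gt0.
have [K K0 hK] := gb _ d0; exists (`|C| * K), (e / 2); split; first by rewrite divr_gt0.
apply: filterS2 (nP _ _ h) hB => X h1 h2 i s s0.
rewrite PZ QZ; apply: (@le_trans _ _ ((`|C| * expR (- (e * s `^ p))) * (K * expR (e / 2 * s `^ p)))).
  apply: ler_pM => //.
    by apply: le_trans (h1 i s s0) _; rewrite ler_wpM2r ?expR_ge0// ler_norm.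
  apply: le_trans (hK _ _) _; rewrite ler_wpM2l// ler_expR (phwZ _ _ (ltW s0)) mulrCA [leRHS]mulrC.
  rewrite ler_wpM2l ?powR_ge0//; apply: (@le_trans _ _ (e / (2 * B) * B)).
    by rewrite ler_wpM2l ?(ltW d0)// (le_trans (hQ _)).
  by rewrite invfM mulrA mulfVK// gt_eqF.
rewrite mulrACA -expRD ler_wpM2l ?mulr_ge0// ler_expR le_eqVlt; apply/orP; left; apply/eqP.
by field.
Qed.

Lemma tensor_good I (u v : I -> functional R d) W1 W2 :
  good theta W1 u -> good theta W2 v -> good theta (tcone W1 W2) (fun i => tensor (u i) (v i)).
Proof.
move=> [ul ub ug ud] [vl vb vg vd].
have ampE i X : amp (fun i => tensor (u i) (v i)) i X = amp u i (lph X) * amp v i (rph X).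
  by rewrite /amp tensor_wave// cabsM.
split=> [i|i|e e0|X X0 nX].
- exact: tensor_lin.
- exact: tensor_bounded.
- have e2 : 0 < e / 2 by rewrite divr_gt0.
  have [K K0 hK] := ug _ e2; have [L L0 hL] := vg _ e2.
  exists (K * L) => [|i X]; first exact: mulr_ge0.
  rewrite ampE; apply: (@le_trans _ _ ((K * expR (e / 2 * phw theta X)) * (L * expR (e / 2 * phw theta X)))).
    apply: ler_pM; [exact: amp_ge0|exact: amp_ge0| |].
      apply: le_trans (hK _ _) (ler_wpM2l K0 _); rewrite ler_expR.
      exact: (ler_wpM2l (ltW e2) (phw_lph X)).
    apply: le_trans (hL _ _) (ler_wpM2l L0 _); rewrite ler_expR.
    exact: (ler_wpM2l (ltW e2) (phw_rph X)).
  rewrite mulrACA -expRD ler_wpM2l ?mulr_ge0// ler_expR le_eqVlt; apply/orP; left; apply/eqP.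
  by field.
- have [h1|h1] := pselect (lph X = 0 \/ W1 (lph X)); last first.
    apply: (@decays_at_le _ _ _ _ _ (fun i X => amp u i (lph X) * amp v i (rph X))).
      by move=> i Y; rewrite ampE.
    apply: (@decays_at_mul _ _ _ (@lph R d) (@rph R d)) => //; [exact: amp_ge0|exact: amp_ge0| | | | |].
    + exact: near_lph.
    + exact: lphZ.
    + exact: rphZ.
    + exact: phw_rph.
    + by apply: ud; [apply/eqP => h; apply: h1; left|move=> h; apply: h1; right].
  have [h2|h2] := pselect (rph X = 0 \/ W2 (rph X)); first by exfalso; exact: nX.
  apply: (@decays_at_le _ _ _ _ _ (fun i X => amp v i (rph X) * amp u i (lph X))).
    by move=> i Y; rewrite ampE mulrC.
  apply: (@decays_at_mul _ _ _ (@rph R d) (@lph R d)) => //; [exact: amp_ge0|exact: amp_ge0| | | | |].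
  + exact: near_rph.
  + exact: rphZ.
  + exact: lphZ.
  + exact: phw_lph.
  + by apply: vd; [apply/eqP => h; apply: h2; left|move=> h; apply: h2; right].
Qed.

Lemma tensor_ultradist_in u v W1 W2 : ultradist_in theta W1 u -> ultradist_in theta W2 v ->
  ultradist_in theta (tcone W1 W2) (tensor u v).
Proof.
move=> hu hv; apply: (good_ultradist_in htheta).
exact: (tensor_good (good_unit htheta hu) (good_unit htheta hv)).
Qed.

(** By [wave_cvg_gs] weak convergence is tested on packets, where the tensor product is a product of
    two convergent numerical sequences. *)
Lemma tensor_cvg (u_ v_ : nat -> functional R d) u v W1 W2 :
  (forall n, ultradist_in theta W1 (u_ n)) -> (forall n, ultradist_in theta W2 (v_ n)) ->
  ultradist_in theta W1 u -> ultradist_in theta W2 v ->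
  cvg_in theta W1 u_ u -> cvg_in theta W2 v_ v ->
  cvg_in theta (tcone W1 W2) (fun n => tensor (u_ n) (v_ n)) (tensor u v).
Proof.
move=> hu_ hv_ hu hv cu cv.
have [nl nb ng nd] := tensor_good (good_of_cvg htheta hu hu_ cu) (good_of_cvg htheta hv hv_ cv).
have [l b g dec] := tensor_good (good_unit htheta hu) (good_unit htheta hv).
set s := fun n F => tensor (u_ n) (v_ n) F - tensor u v F.
have amp_le n X : amp s n X <= amp (fun n => tensor (u_ n) (v_ n)) n X + amp (fun _ : unit => tensor u v) tt X.
  by rewrite /amp (le_trans (cabsD _ _))// cabsN.
have sl n : gslin theta (s n).
  by move=> a f h gf gh; rewrite /s nl// (l tt)//; ring.
have sb n : gsbounded theta (s n).
  move=> C C0; have [K K0 hK] := nb n C C0; have [L L0 hL] := b tt C C0.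
  exists (K + L) => [|M f hf]; first by rewrite addr_ge0.
  by rewrite mulrDl (le_trans (cabsD _ _))// cabsN lerD// ?hK ?hL.
have sg e : 0 < e -> exists2 K, 0 <= K & forall n X, amp s n X <= K * expR (e * phw theta X).
  move=> e0; have [K K0 hK] := ng e e0; have [L L0 hL] := g e e0.
  exists (K + L) => [|n X]; first exact: addr_ge0.
  by apply: le_trans (amp_le n X) _; rewrite mulrDl lerD// ?hK ?(hL tt).
have lin w W : ultradist_in theta W w -> gslin theta w by move=> [/(ultradistP htheta)[]].
have wc X : ccvg \oo (fun n => s n (wave_packet X)) 0.
  have c1 : ccvg \oo (fun n => u_ n (wave_packet (lph X))) (u (wave_packet (lph X))).
    have := cu.1 _ (gs_wave htheta (lph X)); rewrite /ccvg.
    by under [in X in X -> _]eq_fun do rewrite subr0.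
  have c2 : ccvg \oo (fun n => v_ n (wave_packet (rph X))) (v (wave_packet (rph X))).
    have := cv.1 _ (gs_wave htheta (rph X)); rewrite /ccvg.
    by under [in X in X -> _]eq_fun do rewrite subr0.
  have c4 : ccvg \oo (fun _ : nat => u (wave_packet (lph X)) * v (wave_packet (rph X)))
    (u (wave_packet (lph X)) * v (wave_packet (rph X))) by exact: ccvg_cst.
  have c3 : ccvg \oo (fun n => u_ n (wave_packet (lph X)) * v_ n (wave_packet (rph X)) -
      u (wave_packet (lph X)) * v (wave_packet (rph X))) 0.
    by rewrite -[X in ccvg _ _ X](subrr (u (wave_packet (lph X)) * v (wave_packet (rph X))));
      apply: ccvgB c4; exact: ccvgM.
  apply: ccvg_ext c3 => n.
  rewrite /s (tensor_wave _ (lin _ _ _ (hu_ n)) (lin _ _ _ (hv_ n))).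
  by rewrite (tensor_wave _ (lin _ _ _ hu) (lin _ _ _ hv)).
split=> [f gf|X X0 nX].
  by apply: (wave_cvg_gs htheta sl sb sg wc gf).
have X0' : X != 0 by exact/eqP.
apply/(cvg0_decaysP htheta _ X0'); apply: decays_at_le amp_le _; apply: decays_atD; first exact: nd.
have [C [e [e0 h]]] := dec X X0' nX; exists C, e; split=> //.
by apply: filterS h => Y hY n r r0; exact: (hY tt).
Qed.

End Tensor.

(** * The cones of the product *)

Section ProductCones.
Context {R : realType} {d : nat} (theta : R).
Hypothesis htheta : 2^-1 <= theta < 1.
Notation p := (theta^-1).
Implicit Types (G : set (phase R (d + d))) (X : phase R (d + d)) (Y : phase R d) (W : set (phase R d)).

Let t0 : 0 < theta. Proof. by case/andP: htheta => h _; apply: lt_le_trans h; rewrite invr_gt0. Qed.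

Lemma qd_pull X Y : X.1 = row_mx Y.1 Y.1 -> lsubmx X.2 + rsubmx X.2 = Y.2 -> qd X Y = 0.
Proof.
move=> h1 h2; rewrite /qd big1// => j _; rewrite h1 row_mxEl row_mxEr -h2 !mxE.
have z1 (a : R) : a + -1 * a = 0 by ring.
have z2 (a : R) : a + a + -2 * a = 0 by ring.
by rewrite !z1 z2 normr0 !addr0.
Qed.

Lemma conic_scale N (A : set (phase R N)) s (X : phase R N) : conic A -> 0 < s -> A (s *: X) <-> A X.
Proof.
move=> [_ cA] s0; split; last exact: cA.
have si : 0 < s^-1 by rewrite invr_gt0.
by move=> /(cA _ _ si); rewrite scalerA mulVf ?gt_eqF// scale1r.
Qed.

(** Instead of extracting limits of points of [G], the transfer estimate is applied to the indicator
    of [G]: it holds uniformly near a point outside [pullcone G], and it fails at every point of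
    [pullcone G]. *)
Lemma pullcone_closed G : diag_admissible G -> closed_cone (pullcone G).
Proof.
move=> aG; have [cG _] := aG; have [kG _] := cG.
apply: closed_coneP.
  split=> [[/eqP//]|s Y s0 [Y0 [X [GX [h1 h2]]]]].
  split; first by rewrite scaler_eq0 negb_or gt_eqF.
  exists (s *: X); split; first by apply/(conic_scale _ kG s0).
  rewrite /= h1 -h2 scale_row_mx; split=> //.
  by apply/matrixP => i j; rewrite !mxE mulrDr.
move=> Y0 Y00 nY; pose a (_ : unit) X : R := (`[< G X >])%:R.
have a0 i X : 0 <= a i X by rewrite ler0n.
have gr e : 0 < e -> exists2 K, 0 <= K & forall i X, a i X <= K * expR (e * phw theta X).
  move=> e0; exists 1 => // i X; rewrite mul1r; apply: (@le_trans _ _ 1).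
    by rewrite /a; case: asboolP.
  by rewrite -expR0 ler_expR mulr_ge0 ?phw_ge0// ltW.
have dec X : X != 0 -> ~ G X -> decays_at theta a X.
  move=> X0 nG; have [L nL hL] := closed_cone_nbhs cG X0 nG.
  exists 0, 1; split=> //; apply: filterS nL => Z LZ i s s0; rewrite mul0r.
  by rewrite /a asboolF// conic_scale//; exact: hL.
have [C [e [C0 e0 h]]] := diag_transfer_wave htheta (@ltr01 R) aG a0 gr dec Y00 nY.
exists [set Y | forall i X t, 0 <= t -> a i X * expR (- (1 * qd X (t *: Y) `^ p)) <=
    C * expR (- (e * (phw theta X + t `^ p)))] => // Y hY [_ [X [GX [h1 h2]]]].
(* Then C exp(- e s^p) = C exp(- (C + e)) < 1, whereas the indicator at s X is 1 and the kernel
   there is 1. *)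
pose s := (C / e + 1) `^ theta.
have c0 : 0 < C / e + 1 by rewrite ltr_wpDl// divr_ge0// ltW.
have s0 : 0 < s by rewrite powR_gt0.
have := hY tt (s *: X) s (ltW s0); rewrite /= qdZ// (qd_pull h1 h2) mulr0.
rewrite powR0 ?invr_eq0 ?gt_eqF// mulr0 oppr0 expR0 mulr1 /a asboolT; last exact/(conic_scale _ kG s0).
apply/negP; rewrite -ltNge /= -powRrM mulfV ?gt_eqF// powRr1 ?ltW//.
rewrite expRN ltr_pdivrMr ?expR_gt0// mul1r.
apply: lt_le_trans (expR_ge1Dx _).
have := mulr_ge0 (ltW e0) (phw_ge0 theta (s *: X)); set q := phw _ _ => q0.
have -> : e * (q + (C / e + 1)) = C + (e * q + e) by field; rewrite gt_eqF.
by lra.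
Qed.

Lemma tcone_closed W1 W2 : closed_cone W1 -> closed_cone W2 -> closed_cone (tcone W1 W2).
Proof.
move=> c1 c2; have [k1 _] := c1; have [k2 _] := c2.
apply: closed_coneP.
  split=> [[/eqP//]|s X s0 [X0 h1 h2]]; split.
  - by rewrite scaler_eq0 negb_or gt_eqF.
  - rewrite lphZ; case: h1 => h; [by left; rewrite h scaler0|right].
    exact/(conic_scale _ k1 s0).
  - rewrite rphZ; case: h2 => h; [by left; rewrite h scaler0|right].
    exact/(conic_scale _ k2 s0).
have key W Y : closed_cone W -> ~ (Y = 0 \/ W Y) -> \forall Z \near Y, ~ (Z = 0 \/ W Z).
  move=> cW h; have Y0 : Y != 0 by apply/eqP => Yz; apply: h; left.
  have [L nL hL] := closed_cone_nbhs cW Y0 (fun w => h (or_intror w)).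
  have n0 := near_gtT (@continuous_phase_sum R d) (norm_phase_gt0 Y0).
  apply: filterS2 nL n0 => Z LZ nZ [Z0|]; last exact: hL.
  by move: nZ; rewrite Z0 !normr0 addr0 ltxx.
move=> X X0 nX; have [h1|h1] := pselect (lph X = 0 \/ W1 (lph X)); last first.
  by exists [set Z | ~ (lph Z = 0 \/ W1 (lph Z))] => [|Z /= nZ []//]; exact: near_lph (key _ _ c1 h1).
have [h2|h2] := pselect (rph X = 0 \/ W2 (rph X)); first by exfalso; exact: nX.
by exists [set Z | ~ (rph Z = 0 \/ W2 (rph Z))] => [|Z /= nZ []//]; exact: near_rph (key _ _ c2 h2).
Qed.

Lemma tcone_pull W1 W2 Y : pullcone (tcone W1 W2) Y -> exists xi eta,
  [/\ (Y.1, xi) = 0 \/ W1 (Y.1, xi), (Y.1, eta) = 0 \/ W2 (Y.1, eta) & Y.2 = xi + eta].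
Proof.
move=> [_ [X [[_ h1 h2] [e1 e2]]]]; exists (lsubmx X.2), (rsubmx X.2); rewrite -e2; split=> //.
  by move: h1; rewrite /lph e1 row_mxKl.
by move: h2; rewrite /rph e1 row_mxKr.
Qed.

Lemma tcone_admissible W1 W2 : closed_cone W1 -> closed_cone W2 ->
  (forall xi, W1 (0, xi) -> ~ W2 (0, - xi)) -> diag_admissible (tcone W1 W2).
Proof.
move=> c1 c2 h; split; first exact: tcone_closed.
move=> xi [X0]; rewrite /lph /rph /= row_mxKl row_mxKr => h1 h2.
have xi0 : xi != 0.
  by apply: contraNneq X0 => ->; rewrite oppr0 row_mx0.
have l0 : lsubmx (0 : 'rV[R]_(d + d)) = 0 by apply/matrixP => i j; rewrite !mxE.
have r0 : rsubmx (0 : 'rV[R]_(d + d)) = 0 by apply/matrixP => i j; rewrite !mxE.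
move: h1 h2; rewrite l0 r0 => -[[/eqP]|w1]; first by rewrite (negPf xi0).
by case=> [[/eqP]|]; [rewrite oppr_eq0 (negPf xi0)|exact: h].
Qed.

Lemma prod_cone_pull W1 W2 : pullcone (tcone W1 W2) `<=` prod_cone W1 W2.
Proof.
move=> Y hY; have Y0 : Y <> 0 by case: hY => /eqP.
have [xi [eta [h1 h2 h3]]] := tcone_pull hY.
case: h1 => [[y0 xi0]|h1].
  case: h2 => [[_ eta0]|h2].
    by exfalso; apply: Y0; case: (Y) y0 h3 => a b /= -> ->; rewrite xi0 eta0 addr0.
  by right; rewrite (surjective_pairing Y) h3 xi0 add0r.
case: h2 => [[_ eta0]|h2].
  by left; right; rewrite (surjective_pairing Y) h3 eta0 addr0.
by left; left; exists Y.1, xi, eta; split=> //; rewrite -h3 -surjective_pairing.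
Qed.

Lemma prod_cone_neq0 W1 W2 : ~ prod_cone W1 W2 0 -> forall xi, W1 (0, xi) -> ~ W2 (0, - xi).
Proof. by move=> h xi h1 h2; apply: h; left; left; exists 0, xi, (- xi); rewrite subrr. Qed.

Lemma closed_coneU N (A B : set (phase R N)) : closed_cone A -> closed_cone B -> closed_cone (A `|` B).
Proof.
move=> [[a0 ac] [F cF eA]] [[b0 bc] [H cH eB]]; split; last first.
  by exists (F `|` H); [exact: closedU|rewrite setDUl -eA -eB].
by split=> [[]//|s z s0 [h|h]]; [left; exact: ac|right; exact: bc].
Qed.

Lemma prod_cone_closed W1 W2 : closed_cone W1 -> closed_cone W2 -> ~ prod_cone W1 W2 0 ->
  closed_cone (prod_cone W1 W2).
Proof.
move=> c1 c2 h0; have aG := tcone_admissible c1 c2 (prod_cone_neq0 h0).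
suff -> : prod_cone W1 W2 = pullcone (tcone W1 W2) `|` W1 `|` W2.
  by apply: closed_coneU => //; apply: closed_coneU => //; exact: pullcone_closed.
apply/seteqP; split=> Y; last first.
  by case=> [[/prod_cone_pull//|]|]; [left; right|right].
case=> [[[x [xi [eta [h1 h2 h3]]]]|]|]; [|by left; right|by right].
left; left; split.
  by apply/eqP => Y0; apply: h0; rewrite -Y0; left; left; exists x, xi, eta.
exists (row_mx x x, row_mx xi eta); split; last by rewrite h3 /= row_mxKl row_mxKr.
split; rewrite /lph /rph /= ?row_mxKl ?row_mxKr; [|by right|by right].
apply/eqP => X0; have [[n1 _] _] := c1; apply: n1.
have := congr1 (@lph R d) X0; rewrite /lph /= !row_mxKl => h.
by rewrite h in h1; move: h1; congr W1; congr (_, _); apply/matrixP => i j; rewrite !mxE.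
Qed.

End ProductCones.

(** * Existence, uniqueness and continuity of the product *)

Section Products.
Context {R : realType} {d : nat} (theta : R).
Hypothesis htheta : 2^-1 <= theta < 1.
Implicit Types (u v w : functional R d) (W : set (phase R d)).

Lemma WF_agree N (u v : functional R N) : agree theta u v -> WF theta u = WF theta v.
Proof.
suff h (s t : functional R N) : agree theta s t -> WF theta s `<=` WF theta t.
  by move=> uv; apply/seteqP; split; apply: h => // f gf; rewrite uv.
move=> st X [X0 nX]; split=> //; apply: contra_not nX => -[L [C [e [oL kL LX C0 [e0 hd]]]]].
exists L, C, e; split=> //; split=> // Z LZ; rewrite st; [exact: hd|exact: gs_wave].
Qed.

(** [dstar] is one map for all cones, so the product does not depend on the cone chosen in
    [is_product]. *)
Lemma is_product_dstar u v w : is_product theta u v w -> agree theta w (dstar (tensor u v)).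
Proof.
move=> [_ [G [D [aG tG [hD _] wD]]]] f gf.
by rewrite wD// (extension_unique htheta aG hD tG gf).
Qed.

Section Admissible.
Variables (W1 W2 : set (phase R d)).
Hypotheses (c1 : closed_cone W1) (c2 : closed_cone W2)
  (hW : forall xi, W1 (0, xi) -> ~ W2 (0, - xi)).

Lemma product_exists u v : ultradist_in theta W1 u -> ultradist_in theta W2 v ->
  is_product theta u v (dstar (tensor u v)).
Proof.
move=> hu hv; have aG := tcone_admissible c1 c2 hW.
have ht := tensor_ultradist_in htheta hu hv.
split; first exact: (dstar_ultradist htheta aG ht).
exists (tcone W1 W2), (@dstar R d); split=> //; exact: dstar_delta_star.
Qed.

Lemma product_well_defined u v : ultradist_in theta W1 u -> ultradist_in theta W2 v ->
  well_defined theta (is_product theta u v).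
Proof.
move=> hu hv; split; first by exists (dstar (tensor u v)); exact: product_exists.
by move=> w w' /is_product_dstar hw /is_product_dstar hw' f gf; rewrite hw// hw'.
Qed.

(** The pulled back cone is kept here instead of [prod_cone]: it retains both frequencies over a
    common position, which is the form required for convolutions. *)
Lemma product_WF u v w : ultradist_in theta W1 u -> ultradist_in theta W2 v ->
  is_product theta u v w -> WF theta w `<=` pullcone (tcone W1 W2).
Proof.
move=> hu hv /is_product_dstar/WF_agree -> X WX; have X0 := WF_neq0 WX.
have aG := tcone_admissible c1 c2 hW.
have ht := tensor_ultradist_in htheta hu hv.
apply: contrapT => nX; move: WX; apply/(WFP htheta _ X0).
exact: (dstar_WF htheta aG (good_unit htheta ht) X0 nX).
Qed.

Lemma product_cvg (u_ v_ w_ : nat -> functional R d) u v w :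
  (forall n, ultradist_in theta W1 (u_ n)) -> (forall n, ultradist_in theta W2 (v_ n)) ->
  ultradist_in theta W1 u -> ultradist_in theta W2 v ->
  (forall n, is_product theta (u_ n) (v_ n) (w_ n)) -> is_product theta u v w ->
  cvg_in theta W1 u_ u -> cvg_in theta W2 v_ v ->
  cvg_in theta (pullcone (tcone W1 W2)) w_ w.
Proof.
move=> hu_ hv_ hu hv hw_ hw cu cv; have aG := tcone_admissible c1 c2 hW.
have ht := tensor_ultradist_in htheta hu hv.
have ht_ n := tensor_ultradist_in htheta (hu_ n) (hv_ n).
have hc := tensor_cvg htheta hu_ hv_ hu hv cu cv.
have [gS sw] := good_sub htheta ht ht_ hc.
have wE n f : gs theta f -> w_ n f - w f = dstar (fun F => tensor (u_ n) (v_ n) F - tensor u v F) f.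
  move=> gf; rewrite (dstar_sub htheta aG (ht_ n) ht gf).
  by rewrite (is_product_dstar (hw_ n))// (is_product_dstar hw).
split=> [f gf|X /eqP X0 nX].
  have := dstar_cvg0 htheta aG gS sw gf; rewrite /ccvg.
  by under eq_fun do rewrite -wE//.
apply/(cvg0_decaysP htheta _ X0).
apply: decays_at_le (dstar_WF htheta aG gS X0 nX) => n Y.
by rewrite /amp wE//; exact: gs_wave.
Qed.

End Admissible.

Lemma cvg0_in_sub N (G H : set (phase R N)) (s : nat -> functional R N) : G `<=` H ->
  cvg0_in theta G s -> cvg0_in theta H s.
Proof. by move=> GH [h1 h2]; split=> // z z0 nH; apply: h2 => // /GH. Qed.

End Products.

(** * Fourier transformation and convolution *)

Section Fourier.
Context {R : realType} {N : nat} (theta : R).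
Hypothesis htheta : 2^-1 <= theta < 1.
Notation p := (theta^-1).
Implicit Types (X Y : phase R N) (f g : 'rV[R]_N -> R[i]) (u v w : functional R N).

Definition rot X : phase R N := (- X.2, X.1).

Definition fmass : R := gmass 1 ^+ N.

Lemma fmass_gt0 : 0 < fmass.
Proof. by rewrite exprn_gt0// gmass_gt0. Qed.

Lemma fmass4_gt0 : 0 < fmass ^+ 4.
Proof. by rewrite exprn_gt0// fmass_gt0. Qed.

Lemma phw_rot X : phw theta (rot X) = phw theta X.
Proof. by rewrite /phw /= normrN addrC. Qed.

Lemma rotZ s X : rot (s *: X) = s *: rot X.
Proof. by rewrite /rot; congr (_, _); exact: esym (scalerN _ _). Qed.

Lemma dotpC (x y : 'rV[R]_N) : dotp x y = dotp y x.
Proof. by rewrite /dotp; apply: eq_bigr => j _; rewrite mulrC. Qed.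

Lemma dotpNl (x y : 'rV[R]_N) : dotp (- x) y = - dotp x y.
Proof. by rewrite dotpC dotpN dotpC. Qed.

Lemma fourier_wave X :
  fourier_fun (wave_packet X) = fun xi => (cis (- dotp X.1 X.2) * fmass%:C) * wave_packet (rot X) xi.
Proof.
apply/funext => xi; have -> : fourier_fun (wave_packet X) xi = cint (gwin 1 X.1 (X.2 + xi)).
  congr cint; apply/funext => x; rewrite /wave_packet /gwin mulrA -cisD mul1r dotpD opprD.
  by rewrite [- dotp x xi + _]addrC.
rewrite cint_gwin// /wave_packet /= opprK mulr1 dotpD opprD cisD.
rewrite rmorphM /= (dotpC xi X.1) [xi + _]addrC.
by rewrite -/fmass; ring.
Qed.

Lemma cabs_fourier_wave u X : gslin theta u ->
  cabs (fourier u (wave_packet X)) = fmass * cabs (u (wave_packet (rot X))).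
Proof.
move=> ul; rewrite /fourier fourier_wave (gslinZ htheta _ ul (gs_wave htheta _)).
by rewrite !cabsM cabs_cis mul1r cabsR ger0_norm// ltW// fmass_gt0.
Qed.

Lemma fourier_point xi : gslin theta (fun f => fourier_fun f xi) /\
  gsbounded theta (fun f => fourier_fun f xi).
Proof.
have h1 : cscont (fun x => cis (- dotp x xi)).
  apply: cscont_cis; apply: (scont_comp (h := fun t => - t)); last exact: scont_dotp.
  by move=> t; exact: opp_continuous.
have h2 (x : 'rV[R]_N) : cabs (cis (- dotp x xi)) <= 1 by rewrite cabs_cis.
exact: (pairing_gs htheta (A := id) _ _ h1 h2).
Qed.

Lemma fourier_gsb C : 1 <= C -> exists C' K, [/\ 1 <= C', 0 <= K & forall M f, 0 <= M ->
  gsb theta C M f -> gsb theta C' (K * M) (fourier_fun f)].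
Proof.
move=> C1; have r0 : 0 < dec_rate theta 1 C by exact: dec_rate_gt0.
have hr X : phw theta (rot X) <= phw theta X by rewrite phw_rot.
have [C' [K [C'1 K0 hK]]] := grid_gsb htheta r0 hr.
set g := 2 * (2 * gmass 1 ^+ N) * fmass : R.
have g0 : 0 <= g.
  by apply: mulr_ge0; [apply: mulr_ge0 => //; apply: mulr_ge0 => //|]; exact: (ltW fmass_gt0).
exists C', (K * g); split; [by []|exact: mulr_ge0|move=> M f M0 hf].
have hc := gsb_coordb hf.
pose c X := gwt 1 f (flip X) * (cis (- dotp X.1 X.2) * fmass%:C).
rewrite -mulrA; apply: (gsb_limit (f_ := fun n xi =>
  \sum_(la : @glam N n) ((gwts N n)%:C * c (gpt la)) * wave_packet (rot (gpt la)) xi)).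
  move=> n; apply: hK => [|X]; first exact: mulr_ge0.
  rewrite !cabsM cabs_cis mul1r cabsR (ger0_norm (ltW fmass_gt0)).
  rewrite (_ : g * M * _ = 2 * (2 * gmass 1 ^+ N * M) * expR (- (dec_rate theta 1 C * phw theta X)) * fmass).
    apply: ler_wpM2r; first exact: (ltW fmass_gt0).
    rewrite -(phw_flip theta X); exact: (gwt_decay _ htheta (lexx 1) C1 M0 hc).
  by rewrite /g; ring.
move=> xi; have [fl fb] := fourier_point xi.
have gf : gs theta f by apply/(gsP htheta); exists C, M.
apply: ccvg_ext (gabor_repr htheta fl fb gf) => n.
by apply: eq_bigr => la _; rewrite fourier_wave /c !mulrA.
Qed.

Lemma fourier_gs f : gs theta f -> gs theta (fourier_fun f).
Proof.
move=> /(gsP htheta)[C [M [C1 M0 hc]]]; have [C' [K [C'1 K0 h]]] := fourier_gsb C1.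
by apply/(gsP htheta); exists C', (K * M); split=> //; [exact: mulr_ge0|exact: h].
Qed.

Lemma fourier_lin u : gslin theta u -> gslin theta (fourier u).
Proof.
move=> ul a f g gf gg; rewrite /fourier -ul; [|exact: fourier_gs|exact: fourier_gs].
by congr u; apply/funext => xi; have [fl _] := fourier_point xi; exact: fl.
Qed.

Lemma fourier_bounded u : gsbounded theta u -> gsbounded theta (fourier u).
Proof.
move=> ub C C0; have m1 : 1 <= Num.max 1 C by rewrite le_max lexx.
have [C' [K [C'1 K0 h]]] := fourier_gsb m1.
have C'0 : 0 < C' by exact: lt_le_trans C'1.
have [L L0 hL] := ub C' C'0; exists (L * K) => [|M f hf]; first exact: mulr_ge0.
have M0 := gsb_ge0 C0 hf; rewrite -mulrA; apply: hL; apply: h => //.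
by apply: (gsb_leC (C := C)) => //; [exact: ltW|rewrite le_max lexx orbT].
Qed.

Lemma fourier_ultradist u : ultradist theta u -> ultradist theta (fourier u).
Proof.
move=> /(ultradistP htheta)[ul ub]; apply/(ultradistP htheta).
by split; [exact: fourier_lin|exact: fourier_bounded].
Qed.

Lemma agree_of_waves u v : gslin theta u -> gsbounded theta u -> gslin theta v -> gsbounded theta v ->
  (forall X, u (wave_packet X) = v (wave_packet X)) -> agree theta u v.
Proof.
move=> ul ub vl vb uv f gf; apply: (ccvg_unique (gabor_repr htheta ul ub gf)).
by apply: ccvg_ext (gabor_repr htheta vl vb gf) => n; apply: eq_bigr => la _; rewrite uv.
Qed.

(** Four rotations by a right angle return every packet to itself and the phases cancel. With the
    factor (2 pi)^(2 N) = [fmass ^+ 4] this inverts the Fourier transformation. *)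
Lemma fourier4 u : ultradist theta u ->
  agree theta (fourier (fourier (fourier (fourier u)))) (fun f => (fmass ^+ 4)%:C * u f).
Proof.
move=> /(ultradistP htheta)[ul ub].
have l1 := fourier_lin ul; have b1 := fourier_bounded ub.
have l2 := fourier_lin l1; have b2 := fourier_bounded b1.
have l3 := fourier_lin l2; have b3 := fourier_bounded b2.
apply: agree_of_waves; [exact: fourier_lin|exact: fourier_bounded| | |].
- by move=> a f g gf gg; rewrite ul//; ring.
- move=> C C0; have [K K0 hK] := ub C C0; exists (fmass ^+ 4 * K).
    by rewrite mulr_ge0// (ltW fmass4_gt0).
  move=> M f hf; rewrite cabsM cabsR (ger0_norm (ltW fmass4_gt0)) -[leRHS]mulrA.
  by rewrite ler_wpM2l ?hK// (ltW fmass4_gt0).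
have step s X : gslin theta s -> fourier s (wave_packet X) =
    (cis (- dotp X.1 X.2) * fmass%:C) * s (wave_packet (rot X)).
  by move=> sl; rewrite /fourier fourier_wave (gslinZ htheta _ sl (gs_wave htheta _)).
move=> X; rewrite !step//= !opprK.
have -> : rot (rot (rot (rot X))) = X by case: X => x xi; rewrite /rot /= !opprK.
rewrite !dotpNl !dotpN !opprK (dotpC X.2 X.1).
have e4 : (fmass ^+ 4)%:C = fmass%:C ^+ 4 :> R[i] by rewrite rmorphXn.
have c1 : cis (dotp X.1 X.2) * cis (- dotp X.1 X.2) = 1 by rewrite -cisD subrr cis0.
transitivity ((cis (dotp X.1 X.2) * cis (- dotp X.1 X.2)) ^+ 2 * fmass%:C ^+ 4 * u (wave_packet X)).
  by ring.
by rewrite c1 expr1n mul1r e4.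
Qed.

Lemma near_rot X (P : phase R N -> Prop) : (\forall Y \near rot X, P Y) -> \forall Z \near X, P (rot Z).
Proof.
move=> /nbhs_ballP[e e0 h]; apply/nbhs_ballP; exists e => // Z [[_ h1] [_ h2]]; apply: h.
split; split=> // i j.
by rewrite !mxE; have := h2 i j; rewrite /ball /= -opprD normrN.
Qed.

Lemma decays_at_rot I (a b : I -> phase R N -> R) c X0 : 0 < c ->
  (forall i X, a i X <= c * b i (rot X)) ->
  decays_at theta b (rot X0) -> decays_at theta a X0.
Proof.
move=> c0 hab [C [e [e0 h]]]; exists (c * C), e; split=> //.
apply: filterS (near_rot h) => X hX i s s0; apply: le_trans (hab _ _) _.
by rewrite rotZ -mulrA ler_wpM2l ?(ltW c0)// hX.
Qed.

Lemma rot_neq0 X : X != 0 -> rot X != 0.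
Proof.
by apply: contraNneq => -[/eqP h1 h2]; rewrite oppr_eq0 in h1; case: X h1 h2 => x xi /= /eqP -> ->.
Qed.

Lemma WF_fourier u X : ultradist theta u -> WF theta (fourier u) X -> WF theta u (rot X).
Proof.
move=> /(ultradistP htheta)[ul ub] WX; have X0 := WF_neq0 WX.
apply: contrapT => /(WFP htheta _ (rot_neq0 X0)) h; move: WX; apply/(WFP htheta _ X0).
by apply: (decays_at_rot fmass_gt0 _ h) => i Y; rewrite /amp cabs_fourier_wave.
Qed.

(** Going round the circle: three further transformations lead from the transform of u back to a
    multiple of u, so [WF_fourier] used three times gives the reverse inclusion. *)
Lemma WF_of_fourier u X : ultradist theta u -> WF theta u (rot X) -> WF theta (fourier u) X.
Proof.
move=> hu WX; have u4 := WF_agree htheta (fourier4 hu).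
have u1 := fourier_ultradist hu; have u2 := fourier_ultradist u1; have u3 := fourier_ultradist u2.
have -> : X = rot (rot (rot (rot X))) by case: X {WX} => x xi; rewrite /rot /= !opprK.
apply: (WF_fourier u1); apply: (WF_fourier u2); apply: (WF_fourier u3); rewrite u4.
have W0 := WF_neq0 WX; have := WX; apply: contraPP => /(WFP htheta _ W0)[C [e [e0 h]]].
apply/(WFP htheta _ W0); exists (fmass ^- 4 * C), e; split=> //.
apply: filterS h => Y hY i s s0.
have := hY tt s s0; rewrite /amp cabsM cabsR (ger0_norm (ltW fmass4_gt0)).
by rewrite -[in X in _ -> X]mulrA ler_pdivlMl// fmass4_gt0.
Qed.

End Fourier.

(** * Convolution through the product of Fourier transforms *)

Section Convolution.
Context {R : realType} {d : nat} (theta : R).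
Hypothesis htheta : 2^-1 <= theta < 1.
Implicit Types (u v w : functional R d).

Lemma is_product_agree u v w w' : ultradist theta w' -> agree theta w' w ->
  is_product theta u v w -> is_product theta u v w'.
Proof.
move=> hw' ww' [_ [G [D [aG tG hD wD]]]]; split=> //; exists G, D; split=> // f gf.
by rewrite ww'// wD.
Qed.

Section Admissible.
Variables u v : functional R d.
Hypotheses (hu : ultradist theta u) (hv : ultradist theta v)
  (huv : forall xi : 'rV[R]_d, WF theta u (xi, 0) -> ~ WF theta v (- xi, 0)).

Let W s := WF theta (fourier s) : set (phase R d).

Let in_W s : ultradist theta s -> ultradist_in theta (W s) (fourier s).
Proof. by move=> hs; split=> //; exact: fourier_ultradist. Qed.

Let cW s : closed_cone (W s). Proof. exact: WF_closed_cone. Qed.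

Let W_admissible xi : W u (0, xi) -> ~ W v (0, - xi).
Proof. by move=> /(WF_fourier htheta hu)/= h1 /(WF_fourier htheta hv) /=; exact: huv. Qed.

Lemma convolution_exists : exists w, is_convolution theta u v w.
Proof.
have k0 := @fmass4_gt0 R d.
have hP := product_exists htheta (cW u) (cW v) W_admissible (in_W hu) (in_W hv).
set P := dstar _ in hP; have [uP _] := hP.
have uF := fourier_ultradist htheta (fourier_ultradist htheta (fourier_ultradist htheta uP)).
(* The inverse Fourier transform of the product P, as three transformations divided by the scalar of
   [fourier4]. *)
pose w : functional R d := fun f => (@fmass R d ^- 4)%:C * fourier (fourier (fourier P)) f.
have hw : ultradist theta w.
  move: uF => /(ultradistP htheta)[l b]; apply/(ultradistP htheta); split=> [a f g gf gg|C C0].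
    by rewrite /w l// mulrDr mulrCA.
  have [K K0 hK] := b C C0; exists (@fmass R d ^- 4 * K) => [|M f hf].
    by rewrite mulr_ge0// invr_ge0 ltW.
  by rewrite cabsM cabsR ger0_norm ?invr_ge0 ?(ltW k0)// -mulrA ler_wpM2l ?invr_ge0 ?(ltW k0)// hK.
exists w; split; first exact: hw.
apply: (is_product_agree (fourier_ultradist htheta hw) _ hP) => f gf.
change ((@fmass R d ^- 4)%:C * fourier (fourier (fourier (fourier P))) f = P f).
rewrite (fourier4 htheta uP gf).
by rewrite mulrA -rmorphM /= mulVf ?gt_eqF// mul1r.
Qed.

Lemma convolution_well_defined : well_defined theta (is_convolution theta u v).
Proof.
split; first exact: convolution_exists.
move=> w w' [uw hw] [uw' hw'] f gf.
have k0 : (@fmass R d ^+ 4)%:C != 0 :> R[i].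
  by apply/eqP => -[]; exact/eqP/lt0r_neq0/fmass4_gt0.
apply: (mulfI k0); rewrite -(fourier4 htheta uw gf) -(fourier4 htheta uw' gf).
have [_ un] := product_well_defined htheta (cW u) (cW v) W_admissible (in_W hu) (in_W hv).
rewrite /fourier; apply: (un _ _ hw hw'); do 3 apply: fourier_gs => //.
Qed.

Lemma convolution_WF w : is_convolution theta u v w ->
  WF theta w `<=` conv_cone (WF theta u) (WF theta v).
Proof.
move=> [uw hw] [y eta] Wy.
(* This is the point that [rot] carries to (y, eta). *)
have W1 : WF theta (fourier w) (eta, - y).
  by apply: (WF_of_fourier htheta uw); rewrite /rot /= opprK.
have := product_WF htheta (cW u) (cW v) W_admissible (in_W hu) (in_W hv) hw W1.
move=> /tcone_pull[x [z [/= h1 h2 h3]]]; exists (- x), (- z), eta; split.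
- case: h1 => [[-> ->]|/(WF_fourier htheta hu)]; [by right; rewrite oppr0|by left].
- case: h2 => [[-> ->]|/(WF_fourier htheta hv)]; [by right; rewrite oppr0|by left].
- by rewrite -opprD -h3 opprK.
Qed.

End Admissible.

End Convolution.

Theorem corollary3p14 (R : realType) (d : nat) (theta : R)
    (htheta : 2^-1 <= theta < 1) :
  (forall G1 G2 : set (phase R d),
     closed_cone G1 -> closed_cone G2 -> ~ prod_cone G1 G2 0 ->
     [/\ closed_cone (prod_cone G1 G2),
         forall u v : functional R d,
           ultradist_in theta G1 u -> ultradist_in theta G2 v ->
           well_defined theta (is_product theta u v) /\
           (forall w, is_product theta u v w ->
              WF theta w `<=` prod_cone G1 G2) &
         forall (u_ v_ w_ : nat -> functional R d) (u v w : functional R d),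
           (forall n, ultradist_in theta G1 (u_ n)) ->
           (forall n, ultradist_in theta G2 (v_ n)) ->
           ultradist_in theta G1 u -> ultradist_in theta G2 v ->
           (forall n, is_product theta (u_ n) (v_ n) (w_ n)) ->
           is_product theta u v w ->
           cvg_in theta G1 u_ u -> cvg_in theta G2 v_ v ->
           cvg_in theta (prod_cone G1 G2) w_ w]) /\
  (forall u v : functional R d,
     ultradist theta u -> ultradist theta v ->
     (forall xi : 'rV[R]_d, WF theta u (xi, 0) -> ~ WF theta v (- xi, 0)) ->
     well_defined theta (is_convolution theta u v) /\
     (forall w, is_convolution theta u v w ->
        WF theta w `<=` conv_cone (WF theta u) (WF theta v))).
Proof.
split=> [G1 G2 c1 c2 h0|u v hu hv huv]; last first.
  by split; [exact: convolution_well_defined|move=> w; exact: convolution_WF].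
have hW := prod_cone_neq0 h0; split; first exact: (prod_cone_closed htheta).
- move=> u v hu hv; split; first exact: (product_well_defined htheta c1 c2 hW).
  move=> w hw; apply: subset_trans (@prod_cone_pull _ _ _ _).
  exact: (product_WF htheta c1 c2 hW hu hv hw).
- move=> u_ v_ w_ u v w hu_ hv_ hu hv hw_ hw cu cv.
  apply: (cvg0_in_sub (@prod_cone_pull _ _ _ _)).
  exact: (product_cvg htheta c1 c2 hW hu_ hv_ hu hv hw_ hw cu cv).
Qed.
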